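(* Assume condition (A1) or (A2). Let $\theta_n$ be the random mobile described below, $\theta^\star_n$ its trimmed mobile and $(M^\star_n,\rho^\star_n)$ the pointed planar map obtained from $\theta^\star_n$ by the BDG construction, with graph distance $d^\star_n$ (given $\Delta_n$, $M^\star_n$ is a planar tree with $\Delta_n$ edges). Then $\big((M^\star_n,\rho^\star_n),(2(1-\kappa)n)^{-1/2}d^\star_n\big)$, viewed as a random element of $\mathbb M^\ast$, converges in distribution to $\big((\mathcal T_\mathbf{e},\rho^\ast),\delta_\mathbf{e}\big)$, where given $\mathcal T_\mathbf{e}$, $\rho^\ast$ is a uniformly chosen point of $\mathcal T_\mathbf{e}$.
   Context: Weights: $(w_i)_{i\ge0}$ nonnegative, $w_0=1$; $g(x)=\sum_iw_ix^i$ with radius of convergence $R$; $\kappa=\lim_{t\nearrow R}tg'(t)/g(t)$ if $R>0$, $\kappa=0$ if $R=0$. Condition (A1): $w_i=L(i)i^{-\beta}$ for $i\ge1$ with $\beta>2$, $L$ slowly varying, and $\kappa<1$. Condition (A2): $w_i=(i!)^\alpha$ for some $\alpha>0$. Mobiles: $\Gamma_n$ = rooted planar (plane, ordered) trees with $n$ edges; vertices at even distance from the root (incl. root) white, others black; $\deg(v)$ = number of neighbours. For black $u$ of degree $k$, $u_0$ its parent, $u_1,\dots,u_{k-1}$ its children clockwise, $u_k=u_0$. Admissible labeling: $\ell:\{\text{white}\}\to\mathbb Z$, $\ell(\text{root})=0$, $\ell(u_{j+1})\ge\ell(u_j)-1$. Random mobile $\theta_n=(\tau_n,\ell_n)$: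 $\tau_n\sim\tilde\nu_n$, $\tilde\nu_n(\tau)\propto\prod_{v\text{ black}}w_{\deg(v)}$; given $\tau_n$, $\ell_n$ uniform admissible. $s$ is the first black vertex (lexicographic order) of maximal degree, $\Delta_n=\deg(s)$, $s_0$ its parent, $s_1,\dots,s_{\Delta_n-1}$ its children clockwise. Trimmed mobile $\theta^\star_n$: the tree consisting of the black vertex $s$ and white vertices $s^\star_0,\dots,s^\star_{\Delta_n-1}$ (copies of $s_0,\dots,s_{\Delta_n-1}$), rooted at $s^\star_0$, with labels $\ell^\star_n(s^\star_i)=\ell_n(s_i)$ (the root label need not be $0$). BDG construction for a labeled tree with $m$ edges: its clockwise contour walk from the root has $2m$ steps alternating white/black; $c_i$ is the white vertex at step $2i$, $0\le i<m$, extended $m$-periodically (for $\theta^\star_n$, $c_i=s^\star_i$); $\sigma(i)=\inf\{j>i:\ell(c_j)=\ell(c_i)-1\}$, $\inf\emptyset=\infty$, $c_\infty$ a new vertex (here $\rho^\star_n$); the map has vertices the white vertices plus the new vertex and an edge $\{c_i,c_{\sigma(i)}\}$ for each $0\le i<m$. $\mathbb M^\ast$ is the set of isometry classes of pointed compact metric spaces with the pointed Gromov–Hausdorff distance; $\mathbf e$ is a standard Brownian excursion on $[0,1]$, $\delta_\mathbf{e}(s,t)=\mathbf e(s)+\mathbf e(t)-2\inf_{[s\wedge t,s\vee t]}\mathbf e$, and $(\mathcal T_\mathbf{e},\delta_\mathbf{e})$ is the quotient metric space $[0,1]/\{\delta_\mathbf{e}=0\}$. *)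

(* Defs.v *)
From HB Require Import structures.
From mathcomp Require Import all_boot all_order all_algebra.
From mathcomp Require Import all_classical all_reals all_analysis.
Set Implicit Arguments. Unset Strict Implicit. Unset Printing Implicit Defensive.
Import Order.TTheory GRing.Theory Num.Theory.
Import numFieldNormedType.Exports.
Local Open Scope classical_set_scope.
Local Open Scope ring_scope.

(* Plane (rooted ordered) trees and labeled trees.  Children are listed
   in clockwise order.  Vertices at even depth are white, odd depth black. *)
Inductive ptree := PNode of seq ptree.
(* A mobile: every vertex carries an integer label; by convention the
   labels of black vertices are required to be 0 (see [adm]). *)
Inductive ltree := LNode of int & seq ltree.

Definition lab (t : ltree) : int := let: LNode l _ := t in l.

Fixpoint shape (t : ltree) : ptree :=
  let: LNode _ cs := t in
  PNode ((fix F cs := match cs with [::] => [::] | c :: cs' => shape c :: F cs' end) cs).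

Fixpoint pnverts (t : ptree) : nat :=
  let: PNode cs := t in
  ((fix F cs := match cs with [::] => 0%N | c :: cs' => (pnverts c + F cs')%N end) cs).+1.

Definition pnedges (t : ptree) : nat := (pnverts t).-1.

(* product over black vertices v of w_{deg v}; deg = #children + 1 (parent) *)
Fixpoint pweight {R : realType} (w : nat -> R) (black : bool) (t : ptree) : R :=
  let: PNode cs := t in
  (if black then w (size cs).+1 else 1) *
  (fix F cs := match cs with [::] => 1 | c :: cs' => pweight w (~~ black) c * F cs' end) cs.

Definition mobile_weight {R : realType} (w : nat -> R) (t : ptree) : R := pweight w false t.

Definition cyc_ok (a : int) (ls : seq int) : bool :=
  path (fun x y => x - 1 <= y) a (rcons ls a).

Fixpoint adm (black : bool) (p : int) (t : ltree) : bool :=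
  let: LNode l cs := t in
  (if black then (l == 0) && cyc_ok p (map lab cs) else true) &&
  (fix F cs := match cs with [::] => true | c :: cs' => adm (~~ black) l c && F cs' end) cs.

Definition admissible (t : ltree) : bool := (lab t == 0) && adm false 0 t.

Fixpoint blacks (black : bool) (p : int) (t : ltree) : seq (int * seq int) :=
  let: LNode l cs := t in
  (if black then [:: (p, map lab cs)] else [::]) ++
  (fix F cs := match cs with [::] => [::] | c :: cs' => blacks (~~ black) l c ++ F cs' end) cs.

(* Labels l(s_0), l(s_1), ..., l(s_{Delta-1}) of the trimmed mobile, where s is
   the first black vertex (lexicographic order) of maximal degree Delta. *)
Definition star_labels (t : ltree) : seq int :=
  let bs := blacks false 0 t in
  let D := (\max_(b <- bs) (size b.2).+1)%N in
  let s := nth (0, [::]) bs (find (fun b : int * seq int => (size b.2).+1 == D) bs) in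
  s.1 :: s.2.

(* BDG construction for the trimmed mobile, whose contour sequence of white
   vertices is c_i = s*_i, i < m := size L, with labels L.  Vertex m is the
   extra vertex rho*.  [bdg_succ L i] is c_{sigma(i)} (taken mod m), or m. *)
Definition bdg_succ (L : seq int) (i : nat) : nat :=
  let m := size L in
  let cand := [seq ((i + k) %% m)%N | k <- iota 1 m.-1] in
  let P := fun j => nth 0 L j == nth 0 L i - 1 in
  if has P cand then nth 0%N cand (find P cand) else m.

Definition bdg_adj (L : seq int) (u v : nat) : bool :=
  has (fun i => ((u == i) && (v == bdg_succ L i)) || ((v == i) && (u == bdg_succ L i)))
      (iota 0 (size L)).

Fixpoint bdg_reach (L : seq int) (k : nat) (u v : nat) : bool :=
  match k with
  | 0 => u == v
  | k'.+1 => has (fun x => bdg_reach L k' u x && bdg_adj L x v) (iota 0 (size L).+1)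
  end.

Definition bdg_dist (L : seq int) (u v : nat) : nat :=
  find (fun k => bdg_reach L k u v) (iota 0 (size L).+1).

Record pms (R : realType) := PMS { pcar : Type; pdist : pcar -> pcar -> R; ppt : pcar }.

Definition is_pseudometric {R : realType} (Z : Type) (d : Z -> Z -> R) : Prop :=
  (forall x, d x x = 0) /\ (forall x y, d x y = d y x) /\
  (forall x y z, d x z <= d x y + d y z).

Definition isometric {R : realType} (X Z : Type) (dX : X -> X -> R) (dZ : Z -> Z -> R)
  (f : X -> Z) : Prop := forall a b, dZ (f a) (f b) = dX a b.

Definition ghd {R : realType} (A B : pms R) : R :=
  inf [set r : R | 0 <= r /\
    exists (Z : Type) (dZ : Z -> Z -> R) (f : pcar A -> Z) (g : pcar B -> Z),
      is_pseudometric dZ /\ isometric (@pdist R A) dZ f /\ isometric (@pdist R B) dZ g /\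
      dZ (f (ppt A)) (g (ppt B)) <= r /\
      (forall a, exists b, dZ (f a) (g b) <= r) /\
      (forall b, exists a, dZ (f a) (g b) <= r)].

Definition compact_pms {R : realType} (A : pms R) : Prop :=
  is_pseudometric (@pdist R A) /\
  forall u : nat -> pcar A, exists (phi : nat -> nat) (a : pcar A),
    (forall n, (phi n < phi n.+1)%N) /\
    (fun n => pdist (u (phi n)) a) @ \oo --> (0 : R).

(* bounded continuous functions on M^* (lifted to representatives) *)
Definition bounded_cont_GH {R : realType} (F : pms R -> R) : Prop :=
  (exists M : R, forall A, compact_pms A -> `|F A| <= M) /\
  (forall A, compact_pms A -> forall eps : R, 0 < eps -> exists2 delta : R, 0 < delta &
     forall B, compact_pms B -> ghd A B < delta -> `|F A - F B| < eps).

Definition bdg_space {R : realType} (c : R) (L : seq int) : pms R :=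
  @PMS R 'I_(size L).+1 (fun u v => c * (bdg_dist L u v)%:R) ord_max.

(* The tree coded by e: [0,1] with the pseudo-distance delta_e (its
   quotient by {delta_e = 0} is T_e), pointed at u in [0,1]. *)
Definition exc_delta {R : realType} (e : R -> R) (s t : R) : R :=
  e s + e t - 2 * inf [set e r | r in `[Num.min s t, Num.max s t]].

Definition unit_itv (R : realType) := {x : R | 0 <= x <= 1}.

Lemma clamp01_proof {R : realType} (u : R) : 0 <= Num.min (Num.max u 0) 1 <= 1.
Proof.
by rewrite le_min ler01 le_max lexx orbT ge_min lexx orbT.
Qed.

Definition clamp01 {R : realType} (u : R) : unit_itv R :=
  exist _ (Num.min (Num.max u 0) 1) (clamp01_proof u).

Definition tree_space {R : realType} (e : R -> R) (u : R) : pms R :=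
  @PMS R (unit_itv R) (fun x y => exc_delta e (sval x) (sval y)) (clamp01 u).

(* Standard Brownian excursion, via continuity and its finite-dimensional
   distributions: for 0 < t_1 < ... < t_k < 1 the vector (e_{t_1},...,e_{t_k})
   has density 2 sqrt(2 pi) q_{t_1}(x_1) prod p*_{t_{i+1}-t_i}(x_i,x_{i+1}) q_{1-t_k}(x_k)
   on (0,oo)^k, with q_t(x) = x/sqrt(2 pi t^3) exp(-x^2/2t) and p*_t the
   transition density of Brownian motion killed at 0. *)
Definition qd {R : realType} (t x : R) : R :=
  x / Num.sqrt (2 * pi * t ^+ 3) * expR (- x ^+ 2 / (2 * t)).

Definition pkill {R : realType} (t x y : R) : R :=
  (Num.sqrt (2 * pi * t))^-1 *
  (expR (- (x - y) ^+ 2 / (2 * t)) - expR (- (x + y) ^+ 2 / (2 * t))).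

Fixpoint exc_tail {R : realType} (s x : R) (l : seq (R * set R)) : \bar R :=
  match l with
  | [::] => (qd (1 - s) x)%:E
  | (t, A) :: l' =>
      (\int[lebesgue_measure]_(y in A `&` [set y : R | (0 < y)%R])
          ((pkill (t - s) x y)%:E * exc_tail t y l'))%E
  end.

Definition exc_fdd {R : realType} (l : seq (R * set R)) : \bar R :=
  match l with
  | [::] => 1%E
  | (t, A) :: l' =>
      ((2 * Num.sqrt (2 * pi))%:E *
       \int[lebesgue_measure]_(y in A `&` [set y : R | (0 < y)%R]) ((qd t y)%:E * exc_tail t y l'))%E
  end.

Definition is_std_excursion {R : realType} {d : measure_display} {T : measurableType d}
  (P : probability T R) (e : T -> R -> R) : Prop :=
  (forall t, measurable_fun setT (fun om => e om t)) /\
  (forall om, e om 0 = 0 /\ e om 1 = 0 /\ {within `[0, 1], continuous (e om)}) /\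
  (forall l : seq (R * set R),
     path (fun a b => a.1 < b.1) (0, setT) l -> (last (0, setT) l).1 < 1 ->
     (forall i, (i < size l)%N -> measurable (nth (0, setT) l i).2) ->
     P [set om | forall i, (i < size l)%N -> (nth (0, setT) l i).2 (e om (nth (0, setT) l i).1)]
       = exc_fdd l).

Definition random_mobile_law {R : realType} {d : measure_display} {T : measurableType d}
  (P : probability T R) (w : nat -> R) (n : nat) (X : T -> ltree) : Prop :=
  (forall t, measurable [set om | X om = t]) /\
  P [set om | admissible (X om) /\ pnedges (shape (X om)) = n] = 1%E /\
  (exists c : R, forall tau, pnedges tau = n ->
     P [set om | shape (X om) = tau] = (c * mobile_weight w tau)%:E) /\
  (forall t1 t2, admissible t1 -> admissible t2 -> shape t1 = shape t2 ->
     P [set om | X om = t1] = P [set om | X om = t2]).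

Definition gen_fun {R : realType} (w : nat -> R) (t : R) : R :=
  limn (series (fun i => w i * t ^+ i)).
Definition gen_fun' {R : realType} (w : nat -> R) (t : R) : R :=
  limn (series (fun i => (i.+1)%:R * w i.+1 * t ^+ i)).

Definition radius {R : realType} (w : nat -> R) : \bar R :=
  ereal_sup [set x%:E | x in [set x : R | 0 <= x /\ cvgn (series (fun i => w i * x ^+ i))]].

Definition is_kappa {R : realType} (w : nat -> R) (k : R) : Prop :=
  let h := fun t => t * gen_fun' w t / gen_fun w t in
  (radius w = 0%E /\ k = 0) \/
  (exists r : R, radius w = r%:E /\ 0 < r /\ h t @[t --> r^'-] --> k) \/
  (radius w = +oo%E /\ h t @[t --> +oo] --> k).

Definition slowly_varying {R : realType} (L : R -> R) : Prop :=
  measurable_fun setT L /\ (\forall x \near +oo, 0 < L x) /\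
  forall c : R, 0 < c -> L (c * x) / L x @[x --> +oo] --> (1 : R).

Definition condA1 {R : realType} (w : nat -> R) (k : R) : Prop :=
  (exists (beta : R) (L : R -> R), 2 < beta /\ slowly_varying L /\
     forall i, (0 < i)%N -> w i = L i%:R * (i%:R `^ (- beta))) /\ k < 1.

Definition condA2 {R : realType} (w : nat -> R) : Prop :=
  exists alpha : R, 0 < alpha /\ forall i, w i = (i`!)%:R `^ alpha.

(* Main.v *)
(* The weight of a mobile depends only on its black degrees, and by Lagrange inversion the total
   weight of the trees with n edges is [x^n] g(x)^(n+1) / (n+1).  Under (A1) a single summand of
   this power carries the excess (1 - kappa) n (Chernoff bounds plus Potter bounds for the slowly
   varying factor); under (A2) a truncated g is negligible against the factorial weight of one
   vertex of degree n.  Hence Delta_n / n tends to 1 - kappa in probability.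

   Given the shape, the increments of the labels around the black vertices are independent uniform
   bridges, so given Delta_n = m the labels around s form a uniform +-1 bridge of length 2m.  Its
   BDG map is the plane tree coded cyclically by the bridge, pointed at the argmin.  Rerooting the
   tree turns a uniform bridge into a uniform Dyck word together with a uniform pointed vertex.

   It remains to show that uniform Dyck paths converge to the Brownian excursion.  The
   finite-dimensional densities come from the reflection principle and a local limit theorem for
   binomial coefficients; tightness comes from a maximal inequality for bridges.  Continuous
   functionals for the Gromov-Hausdorff topology are replaced by their Lipschitz regularizations
   and evaluated on paths discretized in time and space, for which one-sided limits suffice, since
   the bound applies both to F and to - F. *)
From Pilot Require Import Defs.
From HB Require Import structures.
From mathcomp Require Import all_boot all_order all_algebra.
From mathcomp Require Import all_classical all_reals all_analysis.
From mathcomp Require Import measurable_realfun zify ring lra.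
Set Implicit Arguments. Unset Strict Implicit. Unset Printing Implicit Defensive.
Import Order.TTheory GRing.Theory Num.Theory.
Import numFieldNormedType.Exports Pilot.Defs.
Local Open Scope classical_set_scope.
Local Open Scope ring_scope.

(** * Plane trees and Lagrange inversion *)

(** The degree [Delta_n] is random, so the limit for uniform pointed trees with [m] edges has to
    hold uniformly over scaling constants [c] with [c * sqrt (2 m)] close to 1. Condensation then
    only has to place [Delta_n] near [(1 - kappa) n].

    A functional that is continuous for the Gromov-Hausdorff topology need be neither uniformly
    continuous nor evidently measurable along the excursion. Its [K]-Lipschitz regularization, over
    pairs of a coding function and a marked time, cures both: for fixed [K] it tolerates uniform
    errors on paths, and it is a limit of simple functions of the path. The parameters are therefore
    fixed in the order [K], grid size [N], then [m].

    Finite-dimensional convergence enters only through lower bounds on the probabilities of disjoint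
    cells, which Fatou's lemma extracts from pointwise convergence of kernels. Tightness is a bound
    on the number of words with a large oscillation. It is read on the bridge before rerooting,
    where rotation invariance is available; rerooting at most triples the oscillation. *)

HB.instance Definition _ := gen_eqMixin ptree.
HB.instance Definition _ := gen_choiceMixin ptree.
HB.instance Definition _ := gen_eqMixin ltree.
HB.instance Definition _ := gen_choiceMixin ltree.

(** Children sit inside a [seq], so the induction hypothesis on them has to be carried by a second
    predicate, on forests. *)
Lemma ptree_forest_ind (P : ptree -> Prop) (Q : seq ptree -> Prop) :
  (forall cs, Q cs -> P (PNode cs)) -> Q [::] ->
  (forall c cs, P c -> Q cs -> Q (c :: cs)) -> forall t, P t.
Proof.
move=> HP Q0 Q1; fix IH 1 => -[cs]; apply: HP.
by elim: cs => [|c cs IHcs]; [exact: Q0|exact: Q1].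
Qed.

Lemma ltree_forest_ind (P : ltree -> Prop) (Q : seq ltree -> Prop) :
  (forall l cs, Q cs -> P (LNode l cs)) -> Q [::] ->
  (forall c cs, P c -> Q cs -> Q (c :: cs)) -> forall t, P t.
Proof.
move=> HP Q0 Q1; fix IH 1 => -[l cs]; apply: HP.
by elim: cs => [|c cs IHcs]; [exact: Q0|exact: Q1].
Qed.

(** The forest is thought of as hanging from a common root: each of its vertices accounts for the
    edge above it. *)
Definition fedges (cs : seq ptree) : nat := sumn (map pnverts cs).

Lemma pnvertsE cs : pnverts (PNode cs) = (fedges cs).+1.
Proof. by rewrite /fedges /=; congr S; elim: cs => //= c cs ->. Qed.

Lemma pnedgesE cs : pnedges (PNode cs) = fedges cs.
Proof. by rewrite /pnedges pnvertsE. Qed.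

Lemma shapeE l cs : shape (LNode l cs) = PNode (map shape cs).
Proof. by rewrite /=; congr PNode; elim: cs => //= c cs ->. Qed.

Lemma pweightE (R : realType) (w : nat -> R) black cs :
  pweight w black (PNode cs) =
  (if black then w (size cs).+1 else 1) * \prod_(c <- cs) pweight w (~~ black) c.
Proof.
rewrite /=; congr (_ * _); elim: cs => [|c cs IH]; first by rewrite big_nil.
by rewrite big_cons -IH.
Qed.

Lemma admE black p l cs : adm black p (LNode l cs) =
  (if black then (l == 0) && cyc_ok p (map lab cs) else true) &&
  all (adm (~~ black) l) cs.
Proof. by rewrite /=; congr (_ && _); elim: cs => //= c cs ->. Qed.

Lemma blacksE black p l cs : blacks black p (LNode l cs) =
  (if black then [:: (p, map lab cs)] else [::]) ++
  flatten (map (blacks (~~ black) l) cs).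
Proof. by rewrite /=; congr (_ ++ _); elim: cs => //= c cs ->. Qed.

(** A nonempty forest splits into the children of its first tree, with [j] edges, and the remaining
    trees; the edge above the first root takes the missing unit. The fuel makes both recursive calls
    structural. *)
Fixpoint fenum (fuel n : nat) : seq (seq ptree) :=
  if fuel is f.+1 then
    if n is n'.+1 then
      flatten [seq [seq PNode c :: r | c <- fenum f j, r <- fenum f (n' - j)%N]
                 | j <- iota 0 n'.+1]
    else [:: [::]]
  else if n is 0 then [:: [::]] else [::].

Definition forests n := fenum n n.
Definition ptrees n := map PNode (forests n).

Lemma fenumS f n : fenum f.+1 n.+1 =
  flatten [seq [seq PNode c :: r | c <- fenum f j, r <- fenum f (n - j)%N]
             | j <- iota 0 n.+1].
Proof. by []. Qed.

Lemma fenum_fuel f n : (n <= f)%N -> fenum f n = forests n.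
Proof.
rewrite /forests; move: f n; suff H k : forall f n, (n <= f)%N -> (n <= k)%N -> fenum f n = fenum n n.
  by move=> f n /H; apply; exact: leqnn.
elim: k => [|k IH] [|f] [|n] // nf nk.
rewrite !fenumS; congr flatten; apply/eq_in_map => j; rewrite mem_iota add0n => /andP[_ jn].
rewrite (IH f j) ?(IH n j) ?(IH f (n - j)%N) ?(IH n (n - j)%N) //; lia.
Qed.

Lemma forestsS n : forests n.+1 =
  flatten [seq [seq PNode c :: r | c <- forests j, r <- forests (n - j)%N]
             | j <- iota 0 n.+1].
Proof.
rewrite {1}/forests fenumS; congr flatten; apply/eq_in_map => j.
rewrite mem_iota add0n => /andP[_ jn].
by rewrite !fenum_fuel //; lia.
Qed.

Lemma mem_forests n cs : (cs \in forests n) = (fedges cs == n).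
Proof.
move: n cs; suff H k : forall n cs, (n <= k)%N -> (cs \in forests n) = (fedges cs == n).
  by move=> n cs; apply: (H n); exact: leqnn.
elim: k => [|k IH] [|n] cs // nk.
- by case: cs => [|[c] cs] //=; rewrite /fedges /= inE.
- by case: cs => [|[c] cs] //=; rewrite /fedges /= inE.
rewrite forestsS; apply/flatten_mapP/idP => [[j]|].
  rewrite mem_iota add0n => /andP[_ jn] /allpairsP[[c r] /= [+ + ->]].
  rewrite !IH; [|lia..]; move=> /eqP hc /eqP hr.
  by rewrite /fedges /= -/(pnverts (PNode c)) pnvertsE hc -/(fedges r) hr; apply/eqP; lia.
case: cs => [|[c] r]; first by rewrite /fedges.
rewrite /fedges map_cons [sumn _]/= -/(pnverts (PNode c)) -/(fedges r) => /eqP.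
rewrite -[X in (X + _)%N]/(pnverts (PNode c)) pnvertsE => h.
exists (fedges c); first by rewrite mem_iota; lia.
by apply/allpairsP; exists (c, r); split=> //=; rewrite IH; lia.
Qed.

Lemma uniq_forests n : uniq (forests n).
Proof.
move: n; suff H k : forall n, (n <= k)%N -> uniq (forests n).
  by move=> n; apply: (H n); exact: leqnn.
elim: k => [|k IH] [|n] // nk.
rewrite forestsS.
have : {in iota 0 n.+1, forall j, (j <= n)%N} by move=> j; rewrite mem_iota; lia.
elim: (iota 0 n.+1) (iota_uniq 0 n.+1) => //= j s IHs /andP[js us] hs.
rewrite cat_uniq IHs ?andbT => //; last by move=> i ins; apply: hs; rewrite inE ins orbT.
have jn : (j <= n)%N by apply: hs; rewrite inE eqxx.
apply/andP; split.
  apply: allpairs_uniq; [by apply: IH; lia|by apply: IH; lia|].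
  by move=> [c r] [c' r'] _ _ /= [-> ->].
apply/hasPn => x /flatten_mapP[i ins] /allpairsP[[c r] /= [hc _ ->]].
apply/negP => /allpairsP[[c' r'] /= [hc' _ [ecc' _]]].
move: hc hc'; rewrite !mem_forests ecc' => /eqP ei /eqP ej.
by move: js; rewrite -ej ei ins.
Qed.

Lemma mem_ptrees n t : (t \in ptrees n) = (pnedges t == n).
Proof.
case: t => cs; rewrite pnedgesE -mem_forests mem_map // => x y [].
by [].
Qed.

Lemma uniq_ptrees n : uniq (ptrees n).
Proof. by rewrite map_inj_uniq ?uniq_forests // => x y []. Qed.

Lemma big_forestsS (R : realType) n (G : seq ptree -> R) :
  \sum_(fs <- forests n.+1) G fs =
  \sum_(j < n.+1) \sum_(c <- forests j) \sum_(r <- forests (n - j)%N) G (PNode c :: r).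
Proof.
rewrite forestsS big_flatten big_map -[iota 0 n.+1]/(index_iota 0 n.+1) big_mkord.
by apply: eq_bigr => j _; rewrite big_flatten big_map; apply: eq_bigr => c _; rewrite big_map.
Qed.

Section Lagrange.
Variables (R : realType) (w : nat -> R).
Hypothesis w01 : w 0%N = 1.

(** These are the coefficients of [tau], the generating function of weighted mobiles by edges.
    [Ycoef n k] will be the coefficient of [X^n] in [(X tau)^k], the contribution of [k] white
    siblings. *)
Definition Tcoef n := \sum_(fs <- forests n) \prod_(t <- fs) pweight w true t.
Definition Ycoef n k :=
  \sum_(fs <- forests n | size fs == k) \prod_(t <- fs) pweight w false t.

Lemma size_forest n fs : fs \in forests n -> (size fs <= n)%N.
Proof.
rewrite mem_forests => /eqP <-; elim: fs => //= -[c] fs IH.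
rewrite /fedges [X in (_ < X)%N]/= -[X in (_ < X + _)%N]/(pnverts (PNode c)).
rewrite pnvertsE -/(fedges fs); lia.
Qed.

Lemma sum_mobile_weight n : \sum_(t <- ptrees n) mobile_weight w t = Tcoef n.
Proof.
rewrite big_map; apply: eq_bigr => cs _.
by rewrite /mobile_weight pweightE mul1r.
Qed.

Lemma Tcoef0 : Tcoef 0 = 1.
Proof. by rewrite /Tcoef big_seq1 big_nil. Qed.

Lemma Ycoef0 k : Ycoef 0 k = (k == 0%N)%:R.
Proof. by rewrite /Ycoef big_mkcond /= big_seq1 big_nil /=; case: k. Qed.

Lemma YcoefS0 n : Ycoef n.+1 0 = 0.
Proof.
rewrite /Ycoef big_seq_cond big1 // => fs /andP[]; rewrite mem_forests.
by case: fs.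
Qed.

Lemma YcoefSS n k : Ycoef n.+1 k.+1 = \sum_(j < n.+1) Tcoef j * Ycoef (n - j)%N k.
Proof.
rewrite /Ycoef big_mkcond big_forestsS; apply: eq_bigr => j _.
rewrite /Tcoef mulr_suml; apply: eq_bigr => c _.
rewrite mulr_sumr [RHS]big_mkcond; apply: eq_bigr => r _.
by rewrite /= eqSS big_cons pweightE mul1r.
Qed.

Lemma Ycoef_gt n k : (n < k)%N -> Ycoef n k = 0.
Proof.
move=> nk; rewrite /Ycoef big_seq_cond big1 // => fs /andP[/size_forest + /eqP e].
by rewrite e leqNgt nk.
Qed.

Lemma TcoefS n : Tcoef n.+1 =
  \sum_(j < n.+1) (\sum_(k < n.+1) w k.+1 * Ycoef j k) * Tcoef (n - j)%N.
Proof.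
have inner (j : 'I_n.+1) : \sum_(k < n.+1) w k.+1 * Ycoef j k =
    \sum_(c <- forests j) w (size c).+1 * \prod_(t <- c) pweight w false t.
  under eq_bigr do rewrite /Ycoef mulr_sumr big_mkcond.
  rewrite exchange_big /= big_seq [RHS]big_seq; apply: eq_bigr => c /size_forest cj.
  have cn : (size c < n.+1)%N by have := ltn_ord j; move: cj; set a := size c; lia.
  rewrite -big_mkcond (big_pred1 (Ordinal cn)).
    by [].
  by move=> k /=; rewrite -val_eqE /= eq_sym.
rewrite {1}/Tcoef big_forestsS; apply: eq_bigr => j _.
rewrite inner mulr_suml; apply: eq_bigr => c _.
rewrite /Tcoef mulr_sumr; apply: eq_bigr => r _.
by rewrite big_cons pweightE.
Qed.

(** This is the functional equation [tau = g(X tau)]. If the first black vertex has [k] white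
    children, its weight is [w k.+1]; its [k] subtrees and what remains of the root once it is cut
    off are [k + 1] mobiles. *)
Lemma Tcoef_Ycoef n N : (n < N)%N ->
  Tcoef n = \sum_(k < N) w k * Ycoef n k.
Proof.
case: n => [|n]; first case: N => // N _.
  rewrite Tcoef0 big_ord_recl Ycoef0 eqxx w01 mul1r big1 ?addr0 // => i _.
  by rewrite Ycoef0 /= mulr0.
case: N => // N nN.
rewrite big_ord_recl YcoefS0 mulr0 add0r TcoefS.
under [RHS]eq_bigr do rewrite YcoefSS mulr_sumr.
rewrite exchange_big /= (reindex_inj rev_ord_inj) /=; apply: eq_bigr => j _.
have jn : (n - (n.+1 - j.+1) = j)%N by have := ltn_ord j; lia.
rewrite jn mulr_suml.
have -> : (n.+1 - j.+1 = n - j)%N by lia.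
rewrite (big_ord_widen N (fun k => w k.+1 * Ycoef (n - j) k * Tcoef j)) //.
rewrite [RHS](bigID (fun i : 'I_N => (i < n.+1)%N)) /= [X in _ = _ + X]big1 ?addr0.
  by apply: eq_bigr => i _; rewrite mulrCA mulrC.
move=> i ni; rewrite Ycoef_gt ?mulr0 //; lia.
Qed.

Variable N : nat.
Let g : {poly R} := \poly_(i < N.+1) w i.
Let tau : {poly R} := \poly_(i < N.+1) Tcoef i.

Lemma coef_Xtau n k : (n <= N)%N -> (('X * tau) ^+ k)`_n = Ycoef n k.
Proof.
elim: k n => [|k IH] [|n] nN.
- by rewrite expr0 coef1 Ycoef0.
- by rewrite expr0 coef1 YcoefS0.
- by rewrite exprS -mulrA coefXM Ycoef0.
rewrite exprS -mulrA coefXM /= coefM YcoefSS; apply: eq_bigr => j _.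
rewrite IH; last lia.
by rewrite coef_poly ifT //; have := ltn_ord j; lia.
Qed.

Lemma big_ord_narrow0 a b (G : nat -> R) : (a <= b)%N ->
  (forall i, (a <= i)%N -> G i = 0) -> \sum_(i < b) G i = \sum_(i < a) G i.
Proof.
move=> ab G0; rewrite (big_ord_widen b G ab) [RHS]big_mkcond /=.
by apply: eq_bigr => i _; case: ltnP => // /G0.
Qed.

(** The sum may be cut at [M] for either of two reasons: [p] has no further coefficient, or
    [(X tau)^j] starts beyond degree [n]. *)
Lemma coef_comp_Xtau (p : {poly R}) n M : (n <= N)%N -> (size p <= M)%N || (n < M)%N ->
  (p \Po ('X * tau))`_n = \sum_(j < M) p`_j * Ycoef n j.
Proof.
move=> nN sp; rewrite comp_polyE coef_sum.
under eq_bigr do rewrite coefZ coef_Xtau //.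
have z1 i : (size p <= i)%N -> p`_i * Ycoef n i = 0.
  by move=> h; rewrite nth_default // mul0r.
have z2 i : (n < i)%N -> p`_i * Ycoef n i = 0.
  by move=> h; rewrite Ycoef_gt // mulr0.
rewrite -(big_ord_narrow0 (leq_maxr M _) z1).
rewrite (big_ord_narrow0 (a := M) (G := fun i => p`_i * Ycoef n i)) ?leq_maxl //.
move=> i iM; case/orP: sp => h; [apply: z1|apply: z2]; exact: leq_trans iM.
Qed.

Lemma coef_tau_pow n k : (n <= N)%N ->
  (tau ^+ k)`_n = ((g ^+ k) \Po ('X * tau))`_n.
Proof.
(* Both [g] and [tau] are truncated, so [tau = g(X tau)] holds only modulo [X^(N+1)]; that
   divisibility passes to powers. *)
move=> nN; suff : 'X^(N.+1) %| tau ^+ k - ((g ^+ k) \Po ('X * tau)).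
  move=> /dvdpP[q hq]; apply/eqP; rewrite -subr_eq0 -coefB hq coefMXn.
  by rewrite ltnS nN.
rewrite rmorphXn /= subrXX; apply: dvdp_mulr.
apply/eqP/polyP => i.
have h : take_poly N.+1 (tau - (g \Po 'X * tau)) = 0.
  apply/polyP => j; rewrite coef_take_poly coef0; case: ifP => // jN.
  rewrite coefB coef_poly jN (coef_comp_Xtau (M := N.+1)) ; [|by rewrite -ltnS|by rewrite size_poly].
  rewrite (Tcoef_Ycoef jN); apply/eqP; rewrite subr_eq0; apply/eqP.
  by apply: eq_bigr => k' _; rewrite coef_poly ltn_ord.
have := poly_take_drop N.+1 (tau - (g \Po 'X * tau)); rewrite h add0r => <-.
by rewrite modp_mull.
Qed.

(** Induction on [n] replaces residue calculus: after expanding [g^k] at [X tau], the coefficient at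
    [n + 1] involves [tau^(j+1)] only at the smaller index [n - j], and there the factor
    [(n - j) + (j + 1)] is always [n + 1]. *)
Lemma lagrange n k : (n <= N)%N -> (n + k)%:R * (tau ^+ k)`_n = k%:R * (g ^+ (n + k))`_n.
Proof.
move: n k; suff H M : forall n k, (n <= N)%N -> (n <= M)%N ->
    (n + k)%:R * (tau ^+ k)`_n = k%:R * (g ^+ (n + k))`_n.
  by move=> n k nN; apply: (H n).
elim: M => [|M IH] n k nN nM.
  have -> : n = 0%N by lia.
  rewrite add0n coef_tau_pow // -!horner_coef0 horner_comp hornerM hornerX mul0r.
  by [].
case: n nN nM => [|n] nN nM; first by apply: IH.
(* The factor [j + 1] given by the induction hypothesis differentiates [g^k], so the whole sum is
   one product coefficient; [(g^k)' g^(n+1)] is a multiple of the derivative of [g^(n+1+k)]. *)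
have key : n.+1%:R * (tau ^+ k)`_n.+1 = ('X * (g ^+ k)^`() * g ^+ n.+1)`_n.+1.
  rewrite coef_tau_pow // (coef_comp_Xtau (M := n.+2)) ?ltnS ?leqnn ?orbT //.
  rewrite big_ord_recl YcoefS0 mulr0 add0r -mulrA coefXM /= coefM mulr_sumr.
  apply: eq_bigr => -[j /= jn] _; rewrite coef_deriv /bump leq0n add1n.
  rewrite mulrCA -mulr_natl mulrAC -coef_Xtau // exprMn coefXnM ltnS ltnNge.
  rewrite -ltnS jn /= subSS.
  have := IH (n - j)%N j.+1; rewrite (_ : (n - j + j.+1 = n.+1)%N); last lia.
  move=> ->; [|lia|lia].
  by rewrite mulr1 mulrA mulr_natr.
apply: (@mulfI _ n.+1%:R); first by rewrite pnatr_eq0.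
rewrite mulrCA key -mulrA coefXM /=.
case: k {key} => [|k]; first by rewrite expr0 derivC mul0r coef0 mul0r !mulr0.
rewrite deriv_exp /=.
have -> : g^`() * g ^+ k *+ k.+1 * g ^+ n.+1 = g^`() * g ^+ (n.+1 + k) *+ k.+1.
  by rewrite mulrnAl -mulrA -exprD [(k + _)%N]addnC.
have := coef_deriv (g ^+ (n.+1 + k.+1)) n.
rewrite deriv_exp addnS !coefMn [_.-1]/= => e.
by rewrite !mulr_natl mulrnAC e mulrnAC.
Qed.

Lemma Tcoef_lagrange : N.+1%:R * Tcoef N = (g ^+ N.+1)`_N.
Proof.
have := lagrange 1 (leqnn N); rewrite addn1 expr1 mul1r => <-.
by rewrite coef_poly ltnSn.
Qed.
End Lagrange.

(** Listed in the same order as [blacks], so that the position of the first vertex of maximal degree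
    can be read on the shape alone. *)
Fixpoint pdegs (black : bool) (t : ptree) : seq nat :=
  let: PNode cs := t in
  (if black then [:: (size cs).+1] else [::]) ++
  (fix F cs := match cs with [::] => [::] | c :: cs' => pdegs (~~ black) c ++ F cs' end) cs.

Lemma pdegsE black cs : pdegs black (PNode cs) =
  (if black then [:: (size cs).+1] else [::]) ++ flatten (map (pdegs (~~ black)) cs).
Proof. by rewrite /=; congr (_ ++ _); elim: cs => //= c cs ->. Qed.

Definition tdeg (t : ptree) : nat := (\max_(d <- pdegs false t) d)%N.

Lemma pweight_pdegs (R : realType) (w : nat -> R) black t :
  pweight w black t = \prod_(d <- pdegs black t) w d.
Proof.
move: t black; apply: (@ptree_forest_ind _ (fun cs => forall black, \prod_(c <- cs) pweight w black c =
   \prod_(d <- flatten (map (pdegs black) cs)) w d)) => [cs IH black|b|c cs IHc IHcs black].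
- rewrite pweightE pdegsE big_cat IH /=; congr (_ * _).
  by case: black; rewrite ?big_seq1 ?big_nil.
- by rewrite !big_nil.
- by rewrite big_cons /= big_cat IHc IHcs.
Qed.

Lemma blacks_pdegs black p t :
  [seq (size b.2).+1 | b <- blacks black p t] = pdegs black (shape t).
Proof.
move: t black p; apply: (@ltree_forest_ind _ (fun cs => forall black p,
   [seq (size b.2).+1 | b <- flatten (map (blacks black p) cs)] =
   flatten (map (pdegs black) (map shape cs)))) => [l cs IH black p|b p|c cs IHc IHcs black p].
- rewrite blacksE shapeE pdegsE map_cat IH; congr (_ ++ _).
  by case: black => //=; rewrite !size_map.
- by [].
- by rewrite /= map_cat IHc IHcs.
Qed.

Definition wtrunc (R : realType) (w : nat -> R) (K i : nat) : R :=
  if (i <= K)%N then w i else 0.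

(** Truncated weights kill exactly the trees with a degree above [K]; the distribution function of
    the maximal degree becomes a ratio of two Lagrange coefficients. *)
Lemma mobile_weight_trunc (R : realType) (w : nat -> R) K t :
  mobile_weight (wtrunc w K) t = if (tdeg t <= K)%N then mobile_weight w t else 0.
Proof.
rewrite /mobile_weight !pweight_pdegs /tdeg; elim: (pdegs false t) => [|d s IH].
  by rewrite !big_nil.
rewrite !big_cons IH /wtrunc geq_max; case: leqP => //= _; last by rewrite mul0r.
by case: ifP => // _; rewrite mulr0.
Qed.

(** * Gromov-Hausdorff distance between coded trees *)

Section GromovHausdorff.
Variable R : realType.
Implicit Types (f g : R -> R) (u v : R).

Lemma ghd_le_witness (A B : pms R) (r : R) (Z : Type) (dZ : Z -> Z -> R)
    (f : pcar A -> Z) (g : pcar B -> Z) :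
  0 <= r -> is_pseudometric dZ -> isometric (@pdist R A) dZ f ->
  isometric (@pdist R B) dZ g -> dZ (f (ppt A)) (g (ppt B)) <= r ->
  (forall a, exists b, dZ (f a) (g b) <= r) ->
  (forall b, exists a, dZ (f a) (g b) <= r) -> ghd A B <= r.
Proof.
move=> r0 hZ hf hg hp hA hB; apply: ge_inf; first by exists 0 => x [].
by split => //; exists Z, dZ, f, g.
Qed.

Lemma pseudometric_ge0 (Z : Type) (d : Z -> Z -> R) x y :
  is_pseudometric d -> 0 <= d x y.
Proof.
move=> [d0 [dC dT]]; have := dT x y x; rewrite d0 (dC y x).
by rewrite -mulr2n pmulrn_lge0.
Qed.

(* Kuratowski embedding: each point is sent to its distance function. *)
Lemma ghd_same_carrier (X : Type) (d1 d2 : X -> X -> R) (p q : X) (r : R) :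
  is_pseudometric d1 -> is_pseudometric d2 ->
  (exists B, forall x y, d1 x y <= B) -> (exists B, forall x y, d2 x y <= B) ->
  (forall x y, `|d1 x y - d2 x y| <= r) ->
  ghd (@PMS R X d1 p) (@PMS R X d2 q) <= r + d1 p q.
Proof.
move=> h1 h2 [B1 b1] [B2 b2] hr.
have r0 : 0 <= r by exact: le_trans (normr_ge0 _) (hr p p).
pose Z := {h : X -> R | exists B, forall x, `|h x| <= B}.
pose S (h k : Z) := [set `|sval h x - sval k x| | x in [set: X]].
pose dZ (h k : Z) := sup (S h k).
have Sne h k : S h k !=set0 by exists `|sval h p - sval k p|, p.
have Sub h k : has_ubound (S h k).
  case: h k => [h [Bh hB]] [k [Bk kB]]; exists (Bh + Bk) => _ [x _ <-] /=.
  by rewrite (le_trans (ler_normB _ _)) // lerD.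
have dZge h k x : `|sval h x - sval k x| <= dZ h k.
  by apply: ub_le_sup => //; exists x.
have dZle h k c : (forall x, `|sval h x - sval k x| <= c) -> dZ h k <= c.
  by move=> hc; apply: ge_sup => // _ [x _ <-].
have hZ : is_pseudometric dZ.
  split; [|split] => [h|h k|h k l].
  - apply/eqP; rewrite eq_le; apply/andP; split.
      by apply: dZle => x; rewrite subrr normr0.
    by apply: le_trans (dZge h h p).
  - by rewrite /dZ; congr sup; apply/seteqP; split=> _ [x _ <-]; exists x => //;
      rewrite distrC.
  - apply: dZle => x; rewrite (le_trans (ler_distD (sval k x) _ _)) //.
    by apply: lerD; apply: dZge.
have emb (d : X -> X -> R) : is_pseudometric d -> (exists B, forall x y, d x y <= B) ->
    forall a, exists B, forall x, `|d a x| <= B.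
  move=> hd [B hB] a; exists B => x.
  by rewrite ger0_norm // pseudometric_ge0.
have b1' : exists B, forall x y, d1 x y <= B by exists B1.
have b2' : exists B, forall x y, d2 x y <= B by exists B2.
pose i1 a : Z := exist _ (d1 a) (emb d1 h1 b1' a).
pose i2 a : Z := exist _ (d2 a) (emb d2 h2 b2' a).
have iso (d : X -> X -> R) (hd : is_pseudometric d) (hb : exists B, forall x y, d x y <= B) a b :
    dZ (exist _ (d a) (emb d hd hb a)) (exist _ (d b) (emb d hd hb b)) = d a b.
  have [d0 [dC dT]] := hd.
  apply/eqP; rewrite eq_le; apply/andP; split.
    apply: dZle => x /=; rewrite ler_norml; have := dT a b x; have := dT b a x.
    rewrite (dC b a); lra.
  have := dZge (exist _ (d a) (emb d hd hb a)) (exist _ (d b) (emb d hd hb b)) b.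
  by move=> /=; rewrite d0 subr0; apply: le_trans; exact: ler_norm.
have near a b : dZ (i1 a) (i2 b) <= r + d1 a b.
  apply: dZle => x /=; have [_ [dC dT]] := h1.
  have := hr b x; rewrite !ler_norml => /andP[q1 q2].
  have := dT a b x; have := dT b a x; rewrite (dC b a); lra.
apply: (@ghd_le_witness (PMS d1 p) (PMS d2 q) _ Z dZ i1 i2) => //=.
- by rewrite addr_ge0 // pseudometric_ge0.
- by move=> a b; exact: iso.
- by move=> a b; exact: iso.
- move=> a; exists a; apply: le_trans (near a a) _.
  by case: (h1) => -> _; rewrite addr0 lerDl pseudometric_ge0.
- move=> a; exists a; apply: le_trans (near a a) _.
  by case: (h1) => -> _; rewrite addr0 lerDl pseudometric_ge0.
Qed.

(** [Y] itself serves as the common space. This compares a coded tree with its finite graph, or with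
    a rotated copy, when [pi] is onto only up to distance zero. *)
Lemma ghd_pullback (X Y : Type) (dX : X -> X -> R) (dY : Y -> Y -> R) p q (pi : X -> Y) :
  is_pseudometric dY -> (forall a b, dY (pi a) (pi b) = dX a b) ->
  dY (pi p) q = 0 -> (forall b, exists a, dY (pi a) b = 0) ->
  ghd (@PMS R X dX p) (@PMS R Y dY q) <= 0.
Proof.
move=> hY hpi hpq hs; have [d0 _] := hY.
apply: (@ghd_le_witness (PMS dX p) (PMS dY q) _ Y dY pi id) => //=.
- by rewrite hpq.
- by move=> a; exists (pi a); rewrite d0.
- by move=> b; have [a ha] := hs b; exists a; rewrite ha.
Qed.

Lemma GH_invariant (F : pms R -> R) A B : bounded_cont_GH F ->
  compact_pms A -> compact_pms B -> ghd A B <= 0 -> F A = F B.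
Proof.
move=> [_ hF] cA cB hAB; apply/eqP; rewrite -subr_eq0 -normr_le0.
apply/ler_addgt0Pl => e e0; rewrite addr0; have [dl dl0 H] := hF A cA e e0.
by apply/ltW/H => //; exact: le_lt_trans dl0.
Qed.

Lemma increasing_seq_ltS (phi : nat -> nat) : increasing_seq phi ->
  forall n, (phi n < phi n.+1)%N.
Proof. by move=> h n; have := h n.+1 n; rewrite ltnn leEnat => hh; rewrite ltnNge hh. Qed.

(** A sequence visits one of the finitely many fibres of [pi] infinitely often, and all distances
    vanish along that subsequence. *)
Lemma compact_finite (X : Type) (d : X -> X -> R) (p : X) N (pi : X -> 'I_N) :
  is_pseudometric d -> (forall a b, pi a = pi b -> d a b = 0) ->
  compact_pms (@PMS R X d p).
Proof.
move=> hd h0; split => //= u.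
have fin : finite_set (range (pi \o u)) by exact: finite_finset.
have [c [A Aoo Ac]] := finite_range_cst_subsequence fin.
have /= [|f [fincr _ Af]] := infinite_increasing_seq_wf _ Aoo 0.
  by move=> n; apply: sub_finite_set (finite_II n.+1) => m /=.
exists f, (u (f 0%N)); split; first exact: increasing_seq_ltS.
have -> : (fun n => d (u (f n)) (u (f 0%N))) = fun=> 0.
  by apply/funext => n; apply: h0; rewrite -[LHS]/((pi \o u) (f n)) -[RHS]/((pi \o u) (f 0%N)) !(Ac _).1.
exact: cvg_cst.
Qed.

Lemma increasing_seq_ge (phi : nat -> nat) : increasing_seq phi ->
  forall n, (n <= phi n)%N.
Proof.
by move=> h; elim=> // n IH; exact: leq_ltn_trans IH (increasing_seq_ltS h n).
Qed.

Definition cont01 f := forall p : R, 0 <= p <= 1 -> forall e : R, 0 < e -> exists2 h : R, 0 < h &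
  forall x : R, 0 <= x <= 1 -> `|x - p| < h -> `|f x - f p| < e.

Lemma within_cont01 f : {within `[0, 1], continuous f} -> cont01 f.
Proof.
move=> /subspace_continuousP cf p p01 e e0.
have /cf : `[0, 1]%classic p by rewrite /= in_itv.
move=> /cvgrPdist_lt /(_ e e0); rewrite near_withinE => /nbhs_ballP[h /= h0 H].
exists h => // x x01 xp; rewrite distrC; apply: H; last by rewrite /= in_itv.
by rewrite /ball /= distrC.
Qed.

Lemma cvg_eventually_dist (x : nat -> R) (p : R) : x n @[n --> \oo] --> p -> forall e : R, 0 < e ->
  exists N, forall n, (N <= n)%N -> `|x n - p| < e.
Proof.
move=> /cvgrPdist_lt h e /h [N _ H]; exists N => n Nn.
by rewrite distrC; apply: H.
Qed.

Lemma bounded_subsequence (x : nat -> R) : (forall n, 0 <= x n <= 1) ->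
  exists (phi : nat -> nat) (p : R), [/\ increasing_seq phi, 0 <= p <= 1 & x (phi n) @[n --> \oo] --> p].
Proof.
move=> x01; have [|phi hphi /cvg_ex[p hp]] := @bolzano_weierstrass R x.
  exists 1; split; first exact: num_real.
  move=> M M1 n _ /=; rewrite ger0_norm; last by case/andP: (x01 n).
  by apply: (le_trans _ (ltW M1)); case/andP: (x01 n).
have h := cvg_eventually_dist hp.
exists phi, p; split => //; apply/andP; split; rewrite leNgt; apply/negP => hlt.
  have [N /(_ N (leqnn N))] := h (- p) ltac:(lra).
  by have := x01 (phi N); rewrite ltr_norml /=; lra.
have [N /(_ N (leqnn N))] := h (p - 1) ltac:(lra).
by have := x01 (phi N); rewrite ltr_norml /=; lra.
Qed.

Lemma harmonic_small (e : R) : 0 < e -> exists N, forall n, (N <= n)%N -> n.+1%:R^-1 < e.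
Proof.
move=> e0; have [N H] := cvg_eventually_dist (@cvg_harmonic R) e0.
exists N => n /H; rewrite /harmonic subr0 gtr0_norm //.
Qed.

Lemma cont01_unif f : cont01 f -> forall e : R, 0 < e -> exists2 h : R, 0 < h &
  forall x y : R, 0 <= x <= 1 -> 0 <= y <= 1 -> `|x - y| < h -> `|f x - f y| < e.
Proof.
move=> cf e e0; apply: contrapT => hn.
have H n : exists xy : R * R, [/\ 0 <= xy.1 <= 1, 0 <= xy.2 <= 1,
   `|xy.1 - xy.2| < n.+1%:R^-1 & e <= `|f xy.1 - f xy.2|].
  apply: contrapT => hxy; apply: hn; exists n.+1%:R^-1; first by rewrite invr_gt0.
  move=> x y hx hy xy; rewrite ltNge; apply/negP => hf.
  by apply: hxy; exists (x, y).
have [xy hxy] := choice H.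
have [|phi [p [incr p01 cvp]]] := @bounded_subsequence (fun n => (xy n).1).
  by move=> n; case: (hxy n).
have [h h0 hh] := cf p p01 (e / 2) ltac:(lra).
have h20 : 0 < h / 2 by rewrite divr_gt0.
have [N1 HN1] := cvg_eventually_dist cvp h20.
have [N2 HN2] := harmonic_small h20.
pose n := maxn N1 N2.
have [x01 y01 xyn fe] := hxy (phi n).
have d1 := HN1 n (leq_maxl _ _).
have d2 : `|(xy (phi n)).1 - (xy (phi n)).2| < h / 2.
  apply: lt_trans xyn (HN2 _ _); apply: leq_trans (increasing_seq_ge incr n).
  exact: leq_maxr.
have hlt : h / 2 < h by lra.
have e1 := hh _ x01 (lt_trans d1 hlt).
have e2 : `|f (xy (phi n)).2 - f p| < e / 2.
  apply: hh => //; have := ler_distD (xy (phi n)).1 (xy (phi n)).2 p.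
  by rewrite [`|_ - (xy (phi n)).1|]distrC; lra.
have := ler_distD (f p) (f (xy (phi n)).1) (f (xy (phi n)).2).
by rewrite [`|f p - _|]distrC; lra.
Qed.

Lemma cont01_bounded f : cont01 f -> exists B, forall t : R, 0 <= t <= 1 -> `|f t| <= B.
Proof.
move=> cf; have [h h0 hh] := cont01_unif cf ltr01.
have hN : 0 < h^-1 by rewrite invr_gt0.
pose N := (Num.truncn h^-1).+1.
have NE : N%:R^-1 < h.
  by rewrite invf_plt ?posrE ?ltr0n // /N truncnS_gt.
(* The point [t] is reached from 0 in [N] steps of length [t / N < h], each changing [f] by less
   than 1. *)
exists (`|f 0| + N%:R) => t /andP[t0 t1].
have H k : (k <= N)%N -> `|f (t * k%:R / N%:R)| <= `|f 0| + k%:R.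
  elim: k => [_|k IH kN]; first by rewrite mulr0 mul0r addr0.
  have kin j : (j <= N)%N -> 0 <= t * j%:R / N%:R <= 1.
    move=> jN; rewrite !mulr_ge0 ?invr_ge0 ?ler0n //= ler_pdivrMr ?ltr0n // mul1r.
    by rewrite (le_trans (ler_piMl _ t1)) // ler_nat.
  have := hh _ _ (kin _ kN) (kin _ (ltnW kN)).
  rewrite -mulrBl -mulrBr -natrB // subSnn mulr1 ger0_norm ?divr_ge0 //.
  have -> : t / N%:R < h by apply: le_lt_trans NE; rewrite ler_piMl ?invr_ge0.
  move=> /(_ isT) hk; have {}IH := IH (ltnW kN).
  apply: (@le_trans _ _ (`|f 0| + (k%:R + 1))); last by rewrite natr1.
  have := ler_normD (f (t * k.+1%:R / N%:R) - f (t * k%:R / N%:R)) (f (t * k%:R / N%:R)).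
  rewrite subrK; lra.
by have := H N (leqnn N); rewrite mulfK // pnatr_eq0.
Qed.

Definition bnd01 f := exists B, forall t : R, 0 <= t <= 1 -> `|f t| <= B.

Definition imin f s t := inf [set f r | r in `[Num.min s t, Num.max s t]].

Lemma exc_deltaE f s t : exc_delta f s t = f s + f t - 2 * imin f s t.
Proof. by []. Qed.

Lemma iminC f s t : imin f s t = imin f t s.
Proof. by rewrite /imin minC maxC. Qed.

Lemma itv01 (s t r : R) : 0 <= s <= 1 -> 0 <= t <= 1 ->
  Num.min s t <= r <= Num.max s t -> 0 <= r <= 1.
Proof.
move=> /andP[s0 s1] /andP[t0 t1]; rewrite minElt maxElt; case: ifP => _; lra.
Qed.

Lemma imin_le f (s t r : R) : bnd01 f -> 0 <= s <= 1 -> 0 <= t <= 1 ->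
  Num.min s t <= r <= Num.max s t -> imin f s t <= f r.
Proof.
move=> [B hB] hs ht hr; apply: ge_inf; last by exists r => //=; rewrite in_itv.
exists (- B) => _ [x /= hx <-]; rewrite in_itv /= in hx.
by have := hB x (itv01 hs ht hx); rewrite ler_norml => /andP[].
Qed.

Lemma imin_ge f (s t c : R) :
  (forall r : R, Num.min s t <= r <= Num.max s t -> c <= f r) -> c <= imin f s t.
Proof.
move=> h; apply: lb_le_inf.
  by exists (f s), s => //=; rewrite in_itv /= ge_min lexx le_max lexx.
by move=> _ [r /= + <-]; rewrite in_itv => /h.
Qed.

Lemma iminl f (s t : R) : bnd01 f -> 0 <= s <= 1 -> 0 <= t <= 1 -> imin f s t <= f s.
Proof. by move=> *; apply: imin_le => //; rewrite ge_min lexx le_max lexx. Qed.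

Lemma iminr f (s t : R) : bnd01 f -> 0 <= s <= 1 -> 0 <= t <= 1 -> imin f s t <= f t.
Proof. by move=> *; rewrite iminC; apply: iminl. Qed.

(** Every point between [s] and [t] lies between [s] and [x] or between [x] and [t]. This
    ultrametric property is what gives the triangle inequality in the coded tree. *)
Lemma imin_trans f (s x t : R) : bnd01 f -> 0 <= s <= 1 -> 0 <= x <= 1 -> 0 <= t <= 1 ->
  Num.min (imin f s x) (imin f x t) <= imin f s t.
Proof.
move=> bf hs hx ht; apply: imin_ge => r hr; rewrite ge_min.
have [h|h] := boolP (Num.min s x <= r <= Num.max s x).
  by rewrite imin_le.
rewrite (@imin_le f x t r) ?orbT //; move: hr h.
by rewrite !minElt !maxElt; do 3 (case: ltP => ?); lra.
Qed.

Lemma exc_pseudometric f : bnd01 f ->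
  is_pseudometric (fun x y : unit_itv R => exc_delta f (sval x) (sval y)).
Proof.
move=> bf; split; [|split] => [[x hx]|[x hx] [y hy]|[x hx] [y hy] [z hz]];
  rewrite !exc_deltaE /=.
- suff -> : imin f x x = f x by lra.
  apply/eqP; rewrite eq_le iminl //=; apply: imin_ge => r.
  by rewrite minxx maxxx => /le_anti ->.
- by rewrite iminC addrC; lra.
- have := imin_trans bf hx hy hz; have := iminr bf hx hy; have := iminl bf hy hz.
  by rewrite ge_min => a b /orP[] c; lra.
Qed.

Lemma exc_bounded f : bnd01 f -> exists B, forall x y : unit_itv R,
  exc_delta f (sval x) (sval y) <= B.
Proof.
move=> bf; have [B hB] := bf; exists (4 * B) => -[x hx] [y hy]; rewrite exc_deltaE /=.
have : - B <= imin f x y.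
  by apply: imin_ge => r hr; have := hB r (itv01 hx hy hr); rewrite ler_norml => /andP[].
have := hB x hx; have := hB y hy; rewrite !ler_norml; lra.
Qed.

(** The two endpoint values contribute [r] each, the doubled minimum [2 * r]. *)
Lemma exc_delta_near f g (r s t : R) : bnd01 f -> bnd01 g ->
  (forall t : R, 0 <= t <= 1 -> `|f t - g t| <= r) -> 0 <= s <= 1 -> 0 <= t <= 1 ->
  `|exc_delta f s t - exc_delta g s t| <= 4 * r.
Proof.
move=> bf bg fg hs ht; rewrite !exc_deltaE.
have h1 : imin f s t - r <= imin g s t.
  apply: imin_ge => x hx; have := fg x (itv01 hs ht hx); have := imin_le bf hs ht hx.
  by rewrite ler_norml; lra.
have h2 : imin g s t - r <= imin f s t.
  apply: imin_ge => x hx; have := fg x (itv01 hs ht hx); have := imin_le bg hs ht hx.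
  by rewrite ler_norml; lra.
have := fg s hs; have := fg t ht; rewrite !ler_norml; lra.
Qed.

Lemma clamp01K u : 0 <= u <= 1 -> sval (clamp01 u) = u.
Proof.
by move=> /andP[u0 u1] /=; rewrite (max_idPl u0) (min_idPl u1).
Qed.

Lemma tree_ghd_le f g (u v r : R) : bnd01 f -> bnd01 g -> 0 <= u <= 1 -> 0 <= v <= 1 ->
  (forall t : R, 0 <= t <= 1 -> `|f t - g t| <= r) ->
  ghd (tree_space f u) (tree_space g v) <= 4 * r + exc_delta f u v.
Proof.
move=> bf bg hu hv fg; rewrite -{2}(clamp01K hu) -{2}(clamp01K hv).
apply: ghd_same_carrier; try exact: exc_pseudometric; try exact: exc_bounded.
by move=> [x hx] [y hy]; exact: exc_delta_near.
Qed.

Lemma exc_delta_cont f u : cont01 f -> 0 <= u <= 1 -> forall e : R, 0 < e ->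
  exists2 h : R, 0 < h & forall v : R, 0 <= v <= 1 -> `|v - u| < h -> exc_delta f u v < e.
Proof.
move=> cf hu e e0; have e40 : 0 < e / 4 by rewrite divr_gt0.
have [h h0 hh] := cf u hu _ e40; exists h => // v hv vu.
rewrite exc_deltaE.
have : f u - e / 4 <= imin f u v.
  apply: imin_ge => r hr; have : `|r - u| < h.
    apply: le_lt_trans vu; move: hr; rewrite minElt maxElt.
    by case: ltP => huv /andP[? ?]; [rewrite !ger0_norm|rewrite !ler0_norm]; lra.
  by move=> /(hh _ (itv01 hu hv hr)); rewrite ltr_norml; lra.
by have := hh v hv vu; rewrite ltr_norml; lra.
Qed.

(** A class containing both the continuous excursion paths and the rescaled discrete contours, which
    are step functions; the regularization below takes its infimum over it, so the two kinds can be
    compared. *)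
Definition codes f := bnd01 f /\ forall u, compact_pms (tree_space f u).

Lemma cont01_codes f : cont01 f -> codes f.
Proof.
move=> cf; have bf := cont01_bounded cf; split => // u.
split; first exact: exc_pseudometric.
move=> /= x; have [|phi [p [incr hp cvp]]] := @bounded_subsequence (fun n => sval (x n)).
  by move=> n; case: (x n).
exists phi, (exist _ p hp); split; first exact: increasing_seq_ltS.
apply/cvgrPdist_lt => e e0; have [h h0 hh] := exc_delta_cont cf hp e0.
have [N HN] := cvg_eventually_dist cvp h0.
exists N => // n /= /HN xp; rewrite sub0r normrN.
have [_ [dC _]] := exc_pseudometric bf.
have := @pseudometric_ge0 _ _ (x (phi n)) (exist _ p hp) (exc_pseudometric bf).
move=> /= ?; rewrite ger0_norm //.
have := dC (x (phi n)) (exist _ p hp); rewrite /= => ->.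
by apply: hh => //; case: (x (phi n)).
Qed.

Definition stepf N (x : nat -> R) : R -> R := fun t => x (Num.truncn (N%:R * t)).

Lemma truncn01 N (t : R) : 0 <= t <= 1 -> (Num.truncn (N%:R * t) < N.+1)%N.
Proof.
move=> /andP[t0 t1]; rewrite truncn_lt_nat ?mulr_ge0 //.
by rewrite (@le_lt_trans _ _ N%:R) ?ltr_nat // ler_piMr.
Qed.

Lemma stepf_bnd N x : bnd01 (stepf N x).
Proof.
exists (\sum_(i < N.+1) `|x i|) => t /(truncn01 N) ht.
by rewrite (bigD1 (Ordinal ht)) //= lerDl sumr_ge0.
Qed.

Lemma stepf_codes N x : codes (stepf N x).
Proof.
split => [|u]; first exact: stepf_bnd.
pose pi (t : unit_itv R) : 'I_N.+1 := Ordinal (truncn01 N (svalP t)).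
apply: (@compact_finite _ _ _ _ pi); first exact/exc_pseudometric/stepf_bnd.
have main (s t : R) : 0 <= s -> s <= t -> t <= 1 -> Num.truncn (N%:R * s) = Num.truncn (N%:R * t) ->
    exc_delta (stepf N x) s t = 0.
  move=> s0 st t1 e; rewrite exc_deltaE.
  have hc r : s <= r <= t -> stepf N x r = stepf N x s.
    move=> /andP[sr rt]; congr x; apply/eqP; rewrite eqn_leq; apply/andP; split.
      by rewrite e le_truncn // ler_wpM2l.
    by rewrite le_truncn // ler_wpM2l.
  have -> : stepf N x t = stepf N x s by apply: hc; rewrite st lexx.
  have -> : imin (stepf N x) s t = stepf N x s.
    apply/eqP; rewrite eq_le; apply/andP; split; first by apply: iminl; [exact: stepf_bnd|lra|lra].
    by apply: imin_ge => r; rewrite (min_idPl st) (max_idPr st) => /hc ->.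
  lra.
move=> [s hs] [t ht] /(congr1 val) /= e.
have [st|ts] := leP s t; first by apply: main => //; lra.
have [_ [dC _]] := exc_pseudometric (stepf_bnd N x).
by have := dC (exist _ s hs) (exist _ t ht) => /= ->; apply: main => //; lra.
Qed.

(** * Lipschitz regularization of functionals of a coded pointed tree *)

Section Regularization.
Variables (F : pms R -> R) (M : R).
Hypothesis cF : bounded_cont_GH F.
Hypothesis FM : forall A, compact_pms A -> `|F A| <= M.

(* Lipschitz (Pasch-Hausdorff) regularization of (f, u) |-> F (tree_space f u). *)
Definition lipreg_set (k : R) f (u : R) : set R := [set z : R |
  exists (g : R -> R) (v r : R), [/\ codes g, 0 <= v <= 1,
    (forall t : R, 0 <= t <= 1 -> `|f t - g t| <= r) &
    z = F (tree_space g v) + k * (r + `|u - v|)]].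
Definition lipreg (k : R) f (u : R) : R := inf (lipreg_set k f u).

Lemma F_bnd g v : codes g -> - M <= F (tree_space g v) <= M.
Proof. by move=> [_ /(_ v) /FM]; rewrite ler_norml. Qed.

Lemma lipreg_lb k f u z : 0 <= k -> lipreg_set k f u z -> - M <= z.
Proof.
move=> k0 [g [v [r [cg hv hr ->]]]]; have /andP[h _] := F_bnd v cg.
have : 0 <= r by apply: le_trans (hr 0 _); rewrite ?normr_ge0 // lexx ler01.
move=> r0; have : 0 <= k * (r + `|u - v|) by rewrite mulr_ge0 // addr_ge0.
lra.
Qed.

Lemma lipreg_in k f (u : R) : codes f -> 0 <= u <= 1 ->
  lipreg_set k f u (F (tree_space f u)).
Proof.
move=> cf hu; exists f, u, 0; split => // [t _|]; first by rewrite subrr normr0.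
by rewrite subrr normr0 addr0 mulr0 addr0.
Qed.

Lemma lipreg_le k f (u : R) : 0 <= k -> codes f -> 0 <= u <= 1 ->
  lipreg k f u <= F (tree_space f u).
Proof.
move=> k0 cf hu; apply: ge_inf; last exact: lipreg_in.
by exists (- M) => z; exact: lipreg_lb.
Qed.

Lemma lipreg_bnd k f (u : R) : 0 <= k -> codes f -> 0 <= u <= 1 ->
  - M <= lipreg k f u <= M.
Proof.
move=> k0 cf hu; apply/andP; split.
  by apply: lb_le_inf => [|z]; [exists (F (tree_space f u)); exact: lipreg_in|exact: lipreg_lb].
by apply: le_trans (lipreg_le k0 cf hu) _; case/andP: (F_bnd u cf).
Qed.

Lemma lipreg_lip k f f' (u u' r : R) : 0 <= k -> codes f -> 0 <= u <= 1 ->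
  (forall t : R, 0 <= t <= 1 -> `|f' t - f t| <= r) ->
  lipreg k f' u' <= lipreg k f u + k * (r + `|u' - u|).
Proof.
move=> k0 cf hu ff'; rewrite -lerBlDr; apply: lb_le_inf.
  by exists (F (tree_space f u)); exact: lipreg_in.
move=> z [g [v [s [cg hv hs ->]]]]; rewrite lerBlDr.
apply: (@le_trans _ _ (F (tree_space g v) + k * ((r + s) + `|u' - v|))).
  apply: ge_inf; first by exists (- M) => y; exact: lipreg_lb.
  exists g, v, (r + s); split => // t ht.
  by rewrite (le_trans (ler_distD (f t) _ _)) // lerD ?ff' ?hs.
have : k * (r + s + `|u' - v|) <= k * (r + s + `|u' - u| + `|u - v|).
  by rewrite ler_wpM2l //; have := ler_distD u u' v; lra.
rewrite !mulrDr; lra.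
Qed.

Lemma lipreg_cvg f (u : R) : cont01 f -> 0 <= u <= 1 -> forall e : R, 0 < e ->
  exists K : R, forall k, K <= k -> 0 <= k -> F (tree_space f u) - e <= lipreg k f u.
Proof.
move=> cf hu e e0; have cdf := cont01_codes cf; have [bf cpf] := cdf.
have [_ /(_ _ (cpf u) e e0) [dl dl0 H]] := cF.
have dl20 : 0 < dl / 2 by lra.
have [h h0 hh] := exc_delta_cont cf hu dl20.
(* A competitor closer than [m] has [4 * r <= 4 * dl / 10] and marked points within [dl / 2], so its
   Gromov-Hausdorff distance stays below [dl]. *)
pose m := Num.min (dl / 10) h.
have m0 : 0 < m by rewrite lt_min; apply/andP; split; lra.
(* From here on a competitor farther than [m] pays at least [2 * M], the full range of [F]. *)
exists (2 * M / m) => k; rewrite ler_pdivrMr // => km k0.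
apply: lb_le_inf; first by exists (F (tree_space f u)); exact: lipreg_in.
move=> z [g [v [r [cg hv hr ->]]]]; have [bg cpg] := cg.
have r0 : 0 <= r by apply: le_trans (hr 0 _); rewrite ?normr_ge0 // lexx ler01.
have [hlt|hge] := ltP (r + `|u - v|) m.
  have : 0 <= k * (r + `|u - v|) by rewrite mulr_ge0 // addr_ge0.
  move: hlt; rewrite lt_min => /andP[l1 l2].
  have gd : ghd (tree_space f u) (tree_space g v) < dl.
    apply: le_lt_trans (tree_ghd_le bf bg hu hv hr) _.
    have := hh v hv; rewrite distrC; have := normr_ge0 (u - v).
    by move=> ? /(_ ltac:(lra)); lra.
  by have := H _ (cpg v) gd; rewrite ltr_norml; lra.
have : k * m <= k * (r + `|u - v|) by rewrite ler_wpM2l.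
have := F_bnd v cg; have := F_bnd u cdf; lra.
Qed.

End Regularization.
End GromovHausdorff.

(** * The BDG map of a bridge *)

Section WalkMin.
Variable b : nat -> int.

(** The second argument is the length of the window, not its end; windows then concatenate
    additively, as in [mn_add]. *)
Fixpoint mn (i k : nat) : int :=
  if k is k'.+1 then Num.min (mn i k') (b (i + k)%N) else b i.

Lemma mn_le i k r : (r <= k)%N -> mn i k <= b (i + r)%N.
Proof.
elim: k => [|k IH]; first by rewrite leqn0 => /eqP ->; rewrite addn0.
by rewrite leq_eqVlt ltnS ge_min => /orP[/eqP ->|/IH ->]; rewrite ?lexx ?orbT.
Qed.

Lemma mn_ex i k : exists2 r, (r <= k)%N & mn i k = b (i + r)%N.
Proof.
elim: k => [|k [r rk e]]; first by exists 0%N; rewrite ?addn0.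
rewrite [mn _ _]/=; case: (leP (mn i k) (b (i + k.+1)%N)) => _; last by exists k.+1.
by exists r => //; exact: leqW.
Qed.

Lemma mn_recl i k : mn i k.+1 = Num.min (b i) (mn i.+1 k).
Proof.
elim: k => [|k IH]; first by rewrite /= addn1.
by rewrite [LHS]/= -[Num.min (mn i k) _]/(mn i k.+1) IH -minA addnS.
Qed.

Lemma mn_geP i k (c : int) : (c <= mn i k) <-> (forall r, (r <= k)%N -> c <= b (i + r)%N).
Proof.
split=> [h r rk|h]; first exact: le_trans (mn_le i rk).
by have [r rk ->] := mn_ex i k; exact: h.
Qed.

Lemma mn_add i k l : mn i (k + l) = Num.min (mn i k) (mn (i + k) l).
Proof.
apply/eqP; rewrite eq_le; apply/andP; split.
  rewrite le_min; apply/andP; split; apply/mn_geP => r hr; first by apply: mn_le; lia.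
  by rewrite -addnA; apply: mn_le; lia.
apply/mn_geP => r hr; rewrite ge_min; have [rk|kr] := leqP r k.
  by rewrite mn_le.
by rewrite (_ : i + r = i + k + (r - k))%N ?(@mn_le (i + k) l (r - k)) ?orbT //; lia.
Qed.

End WalkMin.

Lemma eq_mn (b b' : nat -> int) i i' k (c : int) :
  (forall r, (r <= k)%N -> b (i + r)%N = b' (i' + r)%N + c) -> mn b i k = mn b' i' k + c.
Proof.
elim: k => [|k IH] h; first by have := h 0%N (leqnn _); rewrite !addn0.
rewrite /= IH => [|r rk]; last by apply: h; lia.
by rewrite h //; lia.
Qed.

(* Distance in the plane tree coded on [0, n] by [b], with [b] viewed cyclically. *)
Definition cdist (b : nat -> int) n (i j : nat) : int :=
  b i + b j - 2 * Num.max (mn b i (j - i)) (Num.min (mn b 0 i) (mn b j (n - j))).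

(* Distance in the plane tree with contour [D]. *)
Definition ldist (D : nat -> int) (i j : nat) : int := D i + D j - 2 * mn D i (j - i).

(* Contour of the tree coded cyclically by the bridge [b], rerooted at time 0. *)
Definition reroot (b : nat -> int) n (i : nat) : int :=
  b i - 2 * Num.max (mn b 0 i) (mn b i (n - i)).

(** * Rerooting the tree coded cyclically by a bridge *)

Section Reroot.
Variables (b : nat -> int) (n : nat).
Hypotheses (b0 : b 0%N = 0) (bn : b n = 0).
Hypothesis bstep : forall i, b i.+1 = b i + 1 \/ b i.+1 = b i - 1.
Let mu := mn b 0 n.
Let D := reroot b n.
Let al i := mn b 0 i.
Let om i := mn b i (n - i).

Definition argmin_first := find (fun k => b k == mu) (iota 0 n.+1).
Let k := argmin_first.

Let al_le i : al i <= b i. Proof. by have := mn_le b 0 (leqnn i). Qed.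
Let om_le i : om i <= b i. Proof. by have := mn_le b i (leq0n (n - i)); rewrite addn0. Qed.

Lemma mu_split i : (i <= n)%N -> mu = Num.min (al i) (om i).
Proof. by move=> ni; rewrite /mu -{1}(subnKC ni) mn_add. Qed.

Lemma argminP : [/\ (k <= n)%N, b k = mu & forall i, (i < k)%N -> mu < b i].
Proof.
have [r rn e] := mn_ex b 0 n; rewrite add0n in e.
have h : has (fun k => b k == mu) (iota 0 n.+1).
  by apply/hasP; exists r; rewrite ?mem_iota; [lia|rewrite -e].
have kn : (k <= n)%N by have := h; rewrite has_find size_iota.
split=> // [|i ik].
  by have := nth_find 0%N h; rewrite nth_iota ?add0n ?ltnS // => /eqP.
have := before_find 0%N ik; rewrite nth_iota ?add0n; last lia.
move=> ne; rewrite lt_neqAle eq_sym ne /=.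
by have := mn_le b 0 (ltnW (leq_trans ik kn)); rewrite add0n.
Qed.

Lemma al_before i : (i < k)%N -> mu < al i.
Proof.
move=> ik; have [_ _ h] := argminP; have [r ri e] := mn_ex b 0 i.
by rewrite /al e add0n; apply: h; lia.
Qed.

Lemma al_after i : (k <= i)%N -> (i <= n)%N -> al i = mu.
Proof.
move=> ki ni; have [_ bk _] := argminP; apply/eqP; rewrite eq_le -{1}bk.
have := mn_le b 0 ki; rewrite add0n => -> /=.
by rewrite (mu_split ni) ge_min lexx.
Qed.

Lemma om_before i : (i <= k)%N -> om i = mu.
Proof.
move=> ki; have [kn bk _] := argminP; apply/eqP; rewrite eq_le -{1}bk.
have := @mn_le b i (n - i) (k - i); rewrite subnKC // => -> /=; last lia.
by rewrite (mu_split (leq_trans ki kn)) ge_min lexx orbT.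
Qed.

Lemma mu_le_al i : (i <= n)%N -> mu <= al i.
Proof. by move=> /mu_split ->; rewrite ge_min lexx. Qed.
Lemma mu_le_om i : (i <= n)%N -> mu <= om i.
Proof. by move=> /mu_split ->; rewrite ge_min lexx orbT. Qed.

(** Up to the argmin the remaining minimum [om i] is the global one, so the maximum defining
    [reroot] is the running minimum [al i]: the contour is Pitman's transform of [b]. After the
    argmin the same holds with time reversed. *)
Lemma D_before i : (i <= k)%N -> D i = b i - 2 * al i.
Proof.
move=> ik; have [kn _ _] := argminP; rewrite /D /reroot -/(al i) -/(om i) om_before //.
by rewrite max_l // mu_le_al //; lia.
Qed.

Lemma D_after i : (k <= i)%N -> (i <= n)%N -> D i = b i - 2 * om i.
Proof.
move=> ki ni; rewrite /D /reroot -/(al i) -/(om i) al_after //.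
by rewrite max_r // mu_le_om.
Qed.

Lemma al_add i j : (i <= j)%N -> al j = Num.min (al i) (mn b i (j - i)).
Proof. by move=> ij; rewrite /al -{1}(subnKC ij) mn_add. Qed.

Lemma om_sub i j : (i <= j)%N -> (j <= n)%N -> om i = Num.min (mn b i (j - i)) (om j).
Proof.
move=> ij jn; rewrite /om (_ : n - i = (j - i) + (n - j))%N; last lia.
by rewrite mn_add subnKC.
Qed.

(** A walk with unit steps cannot jump over a level: this is its first visit to [y], and [ivt_up] is
    the last one. *)
Lemma ivt_down i l (y : int) : y <= b i -> mn b i l <= y ->
  exists2 r, (r <= l)%N & b (i + r)%N = y /\ mn b i r = y.
Proof.
elim: l => [|l IH] yi /=.
  by move=> h; exists 0%N => //; rewrite addn0 /=; split; lia.
case: (leP (mn b i l) y) => h; first by have [r rl hr] := IH yi h; exists r => //; exact: leqW.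
rewrite ge_min leNgt h /= => h2; exists l.+1 => //; have := mn_le b i (leqnn l).
rewrite addnS in h2 *; have [e|e] := bstep (i + l)%N => h3; first lia.
have e2 : b (i + l).+1 = y by lia.
by rewrite /= addnS e2; split=> //; lia.
Qed.

Lemma ivt_up i l (y : int) : y <= b (i + l)%N -> mn b i l <= y ->
  exists2 r, (r <= l)%N & b (i + r)%N = y /\ mn b (i + r) (l - r) = y.
Proof.
elim: l i => [|l IH] i yi /=.
  by move=> h; exists 0%N => //; rewrite addn0 in yi *; rewrite /=; split; lia.
rewrite -[Num.min _ _]/(mn b i l.+1) mn_recl => h.
have [h2|h2] := leP (mn b i.+1 l) y.
  have [|r rl [e1 e2]] := IH i.+1 _ h2; first by rewrite addSnnS.
  by exists r.+1; rewrite // -addSnnS subSS.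
exists 0%N => //; rewrite addn0 subn0 mn_recl.
have h3 := @mn_le b i.+1 l 0 (leq0n _); rewrite addn0 in h3.
by have := bstep i; split; lia.
Qed.

(** If the window gets down to [al i], then [al j] is the window minimum and [D] attains [- al i] at
    the first visit to level [al i]. Otherwise the running minimum is frozen and [D] is a translate
    of [b]. *)
Lemma mn_D_before i j : (i <= j)%N -> (j <= k)%N ->
  mn D i (j - i) = mn b i (j - i) - al i - al j.
Proof.
move=> ij jk; set y := mn b i (j - i).
have alj : al j = Num.min (al i) y by exact: al_add.
have Dr r : (r <= j - i)%N -> D (i + r)%N = b (i + r)%N - 2 * Num.min (al i) (mn b i r).
  move=> rj; rewrite D_before ?(al_add (leq_addr r i)) ?addKn //; lia.
apply/eqP; rewrite eq_le; apply/andP; split; last first.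
  apply/mn_geP => r rj; rewrite Dr //; have := mn_le b i (leqnn r).
  have : y <= mn b i r by apply/mn_geP => q qr; apply: mn_le; lia.
  by rewrite alj; case: (leP (al i) y); case: (leP (al i) (mn b i r)); lia.
have [yai|aiy] := leP y (al i).
  have [r rj [e1 e2]] := ivt_down (al_le i) yai.
  by apply: le_trans (mn_le D i rj) _; rewrite Dr // e1 e2; move: alj; lia.
have [r rj e] := mn_ex b i (j - i).
apply: le_trans (mn_le D i rj) _; rewrite Dr // -e -/y.
have : y <= mn b i r by apply/mn_geP => q qr; apply: mn_le; lia.
by move: alj; lia.
Qed.

Lemma mn_D_after i j : (k <= i)%N -> (i <= j)%N -> (j <= n)%N ->
  mn D i (j - i) = mn b i (j - i) - om i - om j.
Proof.
move=> ki ij jn; set y := mn b i (j - i).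
have omi : om i = Num.min y (om j) by exact: om_sub.
have Dr r : (r <= j - i)%N -> D (i + r)%N = b (i + r)%N - 2 * Num.min (mn b (i + r) (j - (i + r))) (om j).
  move=> rj; rewrite D_after ?(@om_sub (i + r) j) //; lia.
have sub r : (r <= j - i)%N -> y <= mn b (i + r) (j - (i + r)).
  by move=> rj; apply/mn_geP => q qr; rewrite -addnA; apply: mn_le; lia.
have self r : (r <= j - i)%N -> mn b (i + r) (j - (i + r)) <= b (i + r)%N.
  by move=> rj; have := mn_le b (i + r) (leq0n (j - (i + r))); rewrite addn0.
apply/eqP; rewrite eq_le; apply/andP; split; last first.
  apply/mn_geP => r rj; rewrite Dr //; have := sub r rj; have := self r rj.
  by move: omi; do 2 case: leP; lia.
have [yai|aiy] := leP y (om j).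
  have oj : om j <= b (i + (j - i))%N by rewrite subnKC // om_le.
  have [r rj [e1 e2]] := ivt_up oj yai.
  apply: le_trans (mn_le D i rj) _; rewrite Dr // e1 (_ : j - (i + r) = j - i - r)%N; last lia.
  by rewrite e2; move: omi; lia.
have [r rj e] := mn_ex b i (j - i).
apply: le_trans (mn_le D i rj) _; rewrite Dr // -e -/y.
by have := sub r rj; move: omi; lia.
Qed.

Lemma ldist_reroot i j : (i <= j)%N -> (j <= n)%N -> ldist D i j = cdist b n i j.
Proof.
move=> ij jn; have [kn bk _] := argminP; rewrite /ldist /cdist -/(al i) -/(om j).
have [jk|kj] := leqP j k.
  rewrite mn_D_before // !D_before //; [|lia]; rewrite om_before //.
  have : mu <= mn b i (j - i).
    by apply/mn_geP => r rj; have := @mn_le b 0 n (i + r); rewrite add0n; apply; lia.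
  by have := mu_le_al (leq_trans ij jn); move=> h1 h2; rewrite (min_r h1) (max_l h2); lia.
have [ki|ik] := leqP k i.
  rewrite mn_D_after // !D_after //; [|lia..]; rewrite al_after //; last lia.
  have : mu <= mn b i (j - i).
    by apply/mn_geP => r rj; have := @mn_le b 0 n (i + r); rewrite add0n; apply; lia.
  by have := mu_le_om jn; move=> h1 h2; rewrite (min_l h1) (max_l h2); lia.
(* When the argmin lies inside the window, each half has window minimum [mu], which cancels against
   [al k = om k = mu]; the halves leave [- al i] and [- om j]. *)
have e : mn D i (j - i) = - Num.max (al i) (om j).
  rewrite (_ : j - i = (k - i) + (j - k))%N; last lia.
  rewrite mn_add subnKC; last lia.
  rewrite mn_D_before ?(mn_D_after (i := k)) //; [|lia..].
  rewrite (@al_after k) // (@om_before k) //.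
  have e1 : mn b i (k - i) = mu.
    apply/eqP; rewrite eq_le -{1}bk; have := @mn_le b i (k - i) (k - i) (leqnn _).
    rewrite subnKC ?(ltnW ik) // => -> /=; apply/mn_geP => r rj.
    by have := @mn_le b 0 n (i + r); rewrite add0n; apply; lia.
  have e2 : mn b k (j - k) = mu.
    apply/eqP; rewrite eq_le -{1}bk; have := @mn_le b k (j - k) 0 (leq0n _).
    rewrite addn0 => -> /=; apply/mn_geP => r rj.
    by have := @mn_le b 0 n (k + r); rewrite add0n; apply; lia.
  rewrite e1 e2; lia.
rewrite e D_before ?(ltnW ik) // D_after ?(ltnW kj) //.
have e1 : mn b i (j - i) = mu.
  apply/eqP; rewrite eq_le -{1}bk; have := @mn_le b i (j - i) (k - i).
  rewrite subnKC ?(ltnW ik) // => -> /=; last lia.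
  apply/mn_geP => r rj.
  by have := @mn_le b 0 n (i + r); rewrite add0n; apply; lia.
rewrite e1; have := mu_le_al (leq_trans ij jn); have := mu_le_om jn; lia.
Qed.

Lemma reroot0 : D 0%N = 0.
Proof.
rewrite /D /reroot /= subn0 b0; have := mn_le b 0 (leq0n n); rewrite addn0 b0 /=.
by move=> h; rewrite max_l //; lia.
Qed.

Lemma rerootn : D n = 0.
Proof.
rewrite /D /reroot subnn /= bn; have := mn_le b 0 (leqnn n); rewrite add0n bn.
by move=> h; rewrite max_r //; lia.
Qed.

Lemma reroot_ge0 i : (i <= n)%N -> 0 <= D i.
Proof.
move=> ni; rewrite /D /reroot.
have h1 := mn_le b 0 (leq0n i); have h2 := mn_le b 0 (leqnn i).
have h3 := mn_le b i (leq0n (n - i)); have h4 := mn_le b i (leqnn (n - i)).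
rewrite subnKC ?addn0 ?add0n ?b0 ?bn in h1 h2 h3 h4 => //.
by lia.
Qed.

Lemma reroot_step i : (i < n)%N -> D i.+1 = D i + 1 \/ D i.+1 = D i - 1.
Proof.
move=> ni; have [ik|ki] := ltnP i k.
  rewrite !D_before //; last exact: ltnW.
  have a := al_le i; have -> : al i.+1 = Num.min (al i) (b i.+1) by rewrite /al /= add0n.
  by have := bstep i; case: leP; lia.
rewrite !D_after ?(leqW ki) //; last exact: ltnW.
have a := om_le i.+1; have -> : om i = Num.min (b i) (om i.+1).
  by rewrite (@om_sub i i.+1) // subSnn /= addn1; have := bstep i; lia.
by have := bstep i; case: leP; lia.
Qed.

Lemma argmin_lt : (0 < n)%N -> (k < n)%N.
Proof.
move=> n0; have [kn bk h] := argminP; rewrite ltn_neqAle kn andbT; apply/eqP => e.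
by have := h 0%N; rewrite e => /(_ n0); rewrite -bk e bn b0 ltxx.
Qed.

(** Entering the first minimum lowers [b] and its running minimum together by one, so [b - 2 al]
    rises. Hence the marked time follows an up-step, which is how a vertex is named by its first
    visit. *)
Lemma argmin_up : (0 < k)%N -> D k = D k.-1 + 1.
Proof.
case E : k => [//|k'] _ /=; have [kn bk h] := argminP.
rewrite !D_before ?E // al_after -?E //; rewrite -bk E.
have h1 := al_before (i := k'); rewrite E ltnS leqnn in h1.
have := h1 isT; rewrite -bk E; have := al_le k'; have := bstep k'; lia.
Qed.

(** Heights of the bridge above its minimum are distances to the marked vertex; this is what allows
    [b] to be recovered from the rerooted tree. *)
Lemma cdist_argmin i : (i <= n)%N ->
  (if (k <= i)%N then cdist b n k i else cdist b n i k) = b i - mu.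
Proof.
move=> ni; have [kn bk _] := argminP; case: leqP => ki; rewrite /cdist bk.
  have -> : mn b k (i - k) = mu.
    apply/eqP; rewrite eq_le -{1}bk; have := @mn_le b k (i - k) 0 (leq0n _).
    rewrite addn0 => -> /=; apply/mn_geP => r rj.
    by have := @mn_le b 0 n (k + r); rewrite add0n; apply; lia.
  have := al_after (leqnn k) kn; rewrite /al => ->; have := mu_le_om ni; rewrite /om; lia.
have -> : mn b i (k - i) = mu.
  apply/eqP; rewrite eq_le -{1}bk; have := @mn_le b i (k - i) (k - i) (leqnn _).
  rewrite subnKC ?(ltnW ki) // => -> /=; apply/mn_geP => r rj.
  by have := @mn_le b 0 n (i + r); rewrite add0n; apply; lia.
have := om_before (leqnn k); rewrite /om => ->; have := mu_le_al ni; rewrite /al; lia.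
Qed.

End Reroot.

Lemma find_iotaP (p : pred nat) a len k : (k < len)%N -> p (a + k)%N ->
  (forall j, (j < k)%N -> ~~ p (a + j)%N) -> find p (iota a len) = k.
Proof.
move=> kl pk hb.
have h : has p (iota a len) by apply/hasP; exists (a + k)%N; rewrite ?mem_iota //; lia.
have fl : (find p (iota a len) < len)%N by rewrite -{2}(size_iota a len) -has_find.
case: (ltngtP (find p (iota a len)) k) => // hk.
  by have := nth_find 0%N h; rewrite nth_iota // (negbTE (hb _ hk)).
by have := before_find 0%N hk; rewrite nth_iota // pk.
Qed.

Section TreeDist.
Variable D : nat -> int.

Definition md i j := mn D (minn i j) (maxn i j - minn i j).
Definition tdist i j : int := D i + D j - 2 * md i j.

Lemma mdC i j : md i j = md j i. Proof. by rewrite /md minnC maxnC. Qed.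
Lemma tdistC i j : tdist i j = tdist j i. Proof. by rewrite /tdist mdC; lia. Qed.
Lemma tdist_le i j : (i <= j)%N -> tdist i j = ldist D i j.
Proof. by move=> ij; rewrite /tdist /md /ldist (minn_idPl ij) (maxn_idPr ij). Qed.
Lemma tdist0 i : tdist i i = 0.
Proof. by rewrite tdist_le // /ldist subnn /=; lia. Qed.

Lemma md_le i j x : (minn i j <= x <= maxn i j)%N -> md i j <= D x.
Proof.
move=> h; have := @mn_le D (minn i j) (maxn i j - minn i j) (x - minn i j).
by rewrite subnKC; [apply; lia|lia].
Qed.

Lemma md_ex i j : exists2 x, (minn i j <= x <= maxn i j)%N & md i j = D x.
Proof.
have [r hr e] := mn_ex D (minn i j) (maxn i j - minn i j).
by exists (minn i j + r)%N => //; lia.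
Qed.

Lemma tdist_triangle i j k : tdist i k <= tdist i j + tdist j k.
Proof.
rewrite /tdist; have [x hx ->] := md_ex i k.
have h1 : md i j <= D j by apply: md_le; lia.
have h2 : md j k <= D j by apply: md_le; lia.
have : md i j <= D x \/ md j k <= D x.
  have [h|h] := boolP ((minn i j <= x <= maxn i j)%N); first by left; apply: md_le.
  by right; apply: md_le; lia.
lia.
Qed.

End TreeDist.

(** * The BDG map of the labels read on a balanced word *)

Section Contour.
Variables (w : seq bool).
Let n := size w.
Let m := count negb w.
Hypothesis bal : count id w = m.
Hypothesis n0 : (0 < n)%N.

Definition wst i := nth true w (i %% n).
Definition wsg (x : bool) : int := if x then 1 else -1.
Definition wht i : int := \sum_(j < i) wsg (wst j).
Definition wcnt i := count (fun j => ~~ wst j) (iota 0 i).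
(** Each down-step is a white corner, labeled by the height at which the step starts; the up-steps
    in between let labels increase freely, while a label can decrease by at most one. *)
Definition wlabels : seq int := [seq wht t | t <- iota 0 n & ~~ wst t].
Let st := wst. Let b := wht. Let cnt := wcnt.

Lemma size_2m : n = (m + m)%N.
Proof. by rewrite /n -(count_predC id w) bal. Qed.

Lemma m0 : (0 < m)%N. Proof. by have := size_2m; lia. Qed.

Lemma b_0 : b 0%N = 0. Proof. by rewrite /b /wht big_ord0. Qed.
Lemma b_S i : b i.+1 = b i + wsg (st i). Proof. by rewrite /b /wht big_ord_recr. Qed.
Lemma b_step i : b i.+1 = b i + 1 \/ b i.+1 = b i - 1.
Proof. by rewrite b_S; case: (st i); [left|right]. Qed.
Lemma st_per i : st (i + n)%N = st i. Proof. by rewrite /st /wst modnDr. Qed.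

Lemma b_n : b n = 0.
Proof.
have -> : b n = \sum_(x <- w) wsg x.
  rewrite (big_nth true) big_mkord; apply: eq_bigr => i _.
  by rewrite /wst modn_small.
have -> : \sum_(x <- w) wsg x = (count id w)%:Z - (count negb w)%:Z.
  elim: (w) => [|x s IH]; first by rewrite big_nil.
  by rewrite big_cons IH /=; case: x => /=; lia.
by rewrite bal; lia.
Qed.

Lemma b_per i : b (i + n)%N = b i.
Proof. by elim: i => [|i IH]; [rewrite add0n b_n b_0|rewrite addSn !b_S IH st_per]. Qed.

Lemma b_mod i : b (i %% n)%N = b i.
Proof.
rewrite {2}(divn_eq i n); elim: (i %/ n)%N => [|q IH]; first by rewrite mul0n.
by rewrite mulSn -addnA addnC b_per.
Qed.

Lemma cnt_S i : cnt i.+1 = (cnt i + ~~ st i)%N.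
Proof. by rewrite /cnt /wcnt -addn1 iotaD count_cat /= add0n addn0. Qed.
Lemma cnt_n : cnt n = m.
Proof.
rewrite /m -[in RHS](mkseq_nth true w) count_map /cnt /wcnt; apply: eq_in_count => i.
by rewrite mem_iota /= => h; rewrite /wst modn_small.
Qed.
Lemma cnt_per i : cnt (i + n)%N = (cnt i + m)%N.
Proof.
elim: i => [|i IH]; first by rewrite add0n cnt_n.
by rewrite addSn !cnt_S IH st_per; lia.
Qed.
Lemma cnt_le i j : (i <= j)%N -> (cnt i <= cnt j)%N.
Proof.
move=> /subnKC <-; elim: (j - i)%N => [|k IH]; first by rewrite addn0.
by rewrite addnS cnt_S (leq_trans IH) ?leq_addr.
Qed.
Lemma cnt_lt i j : ~~ st i -> (i < j)%N -> (cnt i < cnt j)%N.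
Proof. by move=> si ij; apply: leq_trans (cnt_le ij); rewrite cnt_S si; lia. Qed.

Lemma cnt_surj c : exists2 t, ~~ st t & cnt t = c.
Proof.
have H : exists t, (c < cnt t.+1)%N.
  exists (c.+1 * n)%N; apply: (@leq_trans (c.+1 * m)); first by have := m0; nia.
  apply: leq_trans (cnt_le (leqnSn _)).
  by elim: c.+1 => // q IH; rewrite !mulSn [(n + _)%N]addnC cnt_per; lia.
case: (ex_minnP H) => t ht hmin; exists t.
  apply/negP => s; move: ht; rewrite cnt_S s addn0 => h.
  by case: t h hmin {s} => // t h /(_ t h); rewrite ltnn.
have : (cnt t <= c)%N.
  by case: t hmin {ht} => // t hmin; rewrite leqNgt; apply/negP => /hmin; rewrite ltnn.
by move: ht; rewrite cnt_S; case: (st t) => /=; lia.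
Qed.

Lemma size_labels : size wlabels = m.
Proof. by rewrite size_map size_filter -cnt_n. Qed.

Lemma lab_cnt_lt t : (t < n)%N -> ~~ st t -> nth 0 wlabels (cnt t) = b t.
Proof.
move=> tn ft; have cm : (cnt t < m)%N by rewrite -cnt_n; exact: cnt_lt.
rewrite (nth_map 0%N); last by rewrite size_filter; move: cm; rewrite -cnt_n.
congr b; rewrite (_ : n = t + (n - t))%N; last lia.
rewrite iotaD add0n filter_cat nth_cat size_filter -/(cnt t) ltnn subnn.
by rewrite (_ : n - t = (n - t).-1.+1)%N; [rewrite /= ft|lia].
Qed.

Lemma cnt_mod t : ~~ st t -> (cnt t %% m)%N = cnt (t %% n).
Proof.
move=> ft; have cm : (cnt (t %% n) < m)%N.
  by rewrite -cnt_n; apply: cnt_lt; rewrite ?ltn_mod // /st /wst modn_mod.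
rewrite -(modn_small cm) {1}(divn_eq t n).
elim: (t %/ n)%N => [|q IH]; first by rewrite mul0n.
by rewrite mulSn -addnA [(n + _)%N]addnC cnt_per modnDr.
Qed.

Lemma lab_cnt t : ~~ st t -> nth 0 wlabels (cnt t %% m) = b t.
Proof.
move=> ft; rewrite cnt_mod // lab_cnt_lt ?ltn_mod //; first exact: b_mod.
by rewrite /st /wst modn_mod.
Qed.

(** The vertex of the map occupied by the walk at time [t]: the next white corner at the same
    height, searched over one period, and the extra vertex [m] if there is none. *)
Definition wvert t : nat :=
  let r := find (fun r => ~~ st (t + r)%N && (b (t + r)%N == b t)) (iota 0 n) in
  if (r < n)%N then (cnt (t + r) %% m)%N else m.
Let V := wvert.

Definition firstdrop t t' := [/\ (t <= t')%N, ~~ st t', b t' = b t &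
  forall x, (t <= x)%N -> (x < t')%N -> ~~ st x -> b x <> b t].

Lemma V_some t t' : firstdrop t t' -> V t = (cnt t' %% m)%N.
Proof.
move=> [tt' ft' bt' hmin].
(* By periodicity a drop found later than one period would have occurred already at [t' - n]. *)
have lt : (t' < t + n)%N.
  rewrite ltnNge; apply/negP => h; have e : t' = (t' - n + n)%N by lia.
  apply: (hmin (t' - n)%N); try lia; first by rewrite -st_per -e.
  by rewrite -bt' {2}e b_per.
rewrite /V /wvert (_ : find _ _ = t' - t)%N.
  by rewrite subnKC //; case: ltnP => //; lia.
apply: find_iotaP; first lia.
  by rewrite add0n subnKC // ft' bt' eqxx.
move=> j jt; rewrite add0n; apply/negP => /andP[h /eqP]; apply: hmin => //; lia.
Qed.

Lemma V_none t : (forall t', (t <= t')%N -> ~~ st t' -> b t' <> b t) -> V t = m.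
Proof.
move=> h; rewrite /V /wvert ifN // -{2}(size_iota 0 n) -has_find; apply/hasPn => r _.
by apply/negP => /andP[s /eqP]; apply: h => //; exact: leq_addr.
Qed.

Lemma V_dich t : (exists t', firstdrop t t') \/
  (forall t', (t <= t')%N -> ~~ st t' -> b t' <> b t).
Proof.
have [h|h] := pselect (exists t', [&& (t <= t')%N, ~~ st t' & b t' == b t]); last first.
  right=> t' tt' ft' /eqP e; apply: h; exists t'; by rewrite tt' ft'.
left; case: (ex_minnP h) => t' /and3P[tt' ft' /eqP bt'] hmin; exists t'; split=> // x tx xt' fx /eqP e.
by have := hmin x; rewrite tx fx e => /(_ isT); rewrite leqNgt xt'.
Qed.

Lemma V_le t : (V t <= m)%N.
Proof. by rewrite /V /wvert; case: ifP => // _; rewrite ltnW // ltn_mod m0. Qed.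

Lemma V_self t : ~~ st t -> V t = (cnt t %% m)%N.
Proof. by move=> ft; apply: V_some; split=> // x; lia. Qed.

Lemma V_per t : V (t + n) = V t.
Proof.
rewrite /V /wvert; set p := (fun r => _); set q := (fun r => _).
have -> : p = q by apply/funext => r; rewrite /p /q addnAC st_per !b_per.
by rewrite addnAC cnt_per modnDr.
Qed.

Lemma firstdrop_stay t t' x : firstdrop t t' -> (t <= x <= t')%N -> b t <= b x.
Proof.
move=> [tt' ft' bt' hmin] /andP[/subnKC <-]; elim: (x - t)%N => [|k IH]; first by rewrite addn0.
rewrite addnS => kt; have := IH (ltnW kt); rewrite b_S.
case E : (st (t + k)%N) => /=; first by rewrite /wsg; lia.
have /= := hmin (t + k)%N (leq_addr _ _) kt; rewrite E /wsg; lia.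
Qed.

(** This is the gluing rule of a coded tree: a down-step from level [b s] inside the stretch would
    go below it, so both searches continue from [t]. *)
Lemma V_same s t : (s <= t)%N -> b s = b t -> (forall x, (s <= x <= t)%N -> b s <= b x) ->
  V s = V t.
Proof.
move=> st_ e stay.
have nofalse x : (s <= x)%N -> (x < t)%N -> ~~ st x -> b x <> b s.
  move=> sx xt fx bx; have := stay x.+1; rewrite b_S (negbTE fx) bx /wsg; lia.
have [[t' hd]|hn] := V_dich t.
  rewrite (V_some hd); case: hd => tt' ft' bt' hmin; apply: V_some; split=> //.
  - exact: leq_trans tt'.
  - by rewrite bt' e.
  - move=> x sx xt' fx; have [xt|tx] := ltnP x t; first exact: nofalse.
    by rewrite e; exact: hmin.
rewrite [RHS]V_none //; apply: V_none => x sx fx; have [xt|tx] := ltnP x t; first exact: nofalse.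
by rewrite e; exact: hn.
Qed.

Variable a : int.
Let L := [seq x + a | x <- wlabels].

Lemma size_L : size L = m. Proof. by rewrite size_map size_labels. Qed.

Lemma nth_L t : ~~ st t -> nth 0 L (cnt t %% m) = b t + a.
Proof. by move=> ft; rewrite (nth_map 0) ?size_labels ?ltn_mod ?m0 // lab_cnt. Qed.

(** The successor carries the label lowered by one, which is the height right after the down-step,
    so both sides look for the same next corner. *)
Lemma bdg_succ_V t : ~~ st t -> bdg_succ L (cnt t %% m) = V t.+1.
Proof.
move=> ft; rewrite /bdg_succ size_L.
set cand := map _ _; set P := fun j => _.
have Pk k t' : ~~ st t' -> cnt t' = (cnt t + k)%N ->
    P ((cnt t %% m + k) %% m)%N = (b t' == b t.+1).
  move=> ft' e; rewrite /P modnDml -e nth_L // nth_L // b_S (negbTE ft) /wsg.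
  by apply/eqP/eqP; lia.
have tlt t' k : ~~ st t' -> cnt t' = (cnt t + k)%N -> (0 < k < m)%N -> (t < t' < t + n)%N.
  move=> ft' e /andP[k0 km]; apply/andP; split; rewrite ltnNge; apply/negP => /cnt_le.
    by rewrite e; lia.
  by rewrite cnt_per e; lia.
have [[t' hd]|hn] := V_dich t.+1.
  rewrite (V_some hd); case: (hd) => tt' ft' bt' hmin.
  have lt : (t' < t + n)%N.
    rewrite ltnNge leq_eqVlt; apply/negP => /orP[/eqP e|h].
      by move: bt'; rewrite -e b_per b_S (negbTE ft) /wsg; lia.
    have e : t' = (t' - n + n)%N by lia.
    apply: (hmin (t' - n)%N); try lia; first by rewrite -st_per -e.
    by rewrite -bt' {2}e b_per.
  have k1 : (cnt t < cnt t')%N by apply: cnt_lt.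
  have k2 : (cnt t' < cnt t + m)%N by rewrite -cnt_per; exact: cnt_lt.
  set k := (cnt t' - cnt t)%N.
  have hP : P ((cnt t %% m + k) %% m)%N by rewrite (Pk k t') ?bt' ?eqxx //; lia.
  have F : find P cand = k.-1.
    rewrite /cand find_map; apply: find_iotaP; [lia| |].
      by rewrite /= (_ : 1 + k.-1 = k)%N //; lia.
    move=> j jk /=; have [x fx ex] := cnt_surj (cnt t + (1 + j)).
    rewrite (Pk _ x) //; apply/eqP; apply: hmin => //.
      by have := tlt x (1 + j)%N fx ex; lia.
    rewrite ltnNge; apply/negP => /cnt_le; rewrite ex; lia.
  have hh : has P cand.
    apply/hasP; exists ((cnt t %% m + k) %% m)%N => //; apply/mapP; exists k => //.
    by rewrite mem_iota; lia.
  rewrite hh F (nth_map 0%N) ?size_iota; last lia.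
  rewrite nth_iota; last lia.
  by rewrite (_ : 1 + k.-1 = k)%N ?modnDml ?subnKC //; [exact: ltnW|lia].
rewrite V_none // ifN //; apply/hasPn => _ /mapP[k + ->]; rewrite mem_iota => hk.
have [x fx ex] := cnt_surj (cnt t + k).
rewrite (Pk _ x) //; apply/eqP; apply: hn => //.
by have := tlt x k fx ex; lia.
Qed.

Lemma bdg_adjC u v : bdg_adj L u v = bdg_adj L v u.
Proof. by apply: eq_has => i; rewrite orbC. Qed.

Lemma adj_down t : ~~ st t -> bdg_adj L (V t) (V t.+1).
Proof.
move=> ft; apply/hasP; exists (V t).
  by rewrite mem_iota V_self // size_L add0n ltn_mod m0.
by have -> : bdg_succ L (V t) = V t.+1; rewrite ?eqxx // V_self // bdg_succ_V.
Qed.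

(** A down-step is an edge of the map by definition. An up-step is matched with the down-step that
    first leaves the upper level, after which the walk is back at the vertex of time [t]. *)
Lemma adj_V t : bdg_adj L (V t) (V t.+1).
Proof.
case E : (st t); last by apply: adj_down; rewrite E.
have e1 : b t.+1 = b t + 1 by rewrite b_S E.
have [[t' hd]|hn] := V_dich t.+1; last first.
  exfalso.
  (* Without such a drop the walk would stay above [b t] forever, while periodicity brings it back
     to [b t]. *)
  have : forall k, b t.+1 <= b (t.+1 + k)%N.
    elim=> [|k IH]; first by rewrite addn0.
    rewrite addnS [X in _ <= X]b_S; case F : (st (t.+1 + k)%N); rewrite /wsg; first lia.
    by have := hn (t.+1 + k)%N (leq_addr _ _); rewrite F => /(_ isT); lia.
  move=> /(_ n.-1); rewrite (_ : t.+1 + n.-1 = t + n)%N; last lia.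
  by rewrite b_per; lia.
have stay := firstdrop_stay hd; have -> := V_some hd; case: hd => tt' ft' bt' hmin.
have e2 : b t'.+1 = b t by rewrite b_S bt' (negbTE ft') e1 /wsg; lia.
have -> : V t = V t'.+1.
  apply: V_same; [lia|by []|] => x hx.
  have [->//|] := eqVneq x t; have [->|] := eqVneq x t'.+1; first by rewrite e2.
  by move=> ? ?; have := stay x; rewrite e1; lia.
by rewrite -(V_self ft') bdg_adjC; exact: adj_down.
Qed.

Lemma reach_snoc k u x v : (x <= m)%N -> bdg_reach L k u x -> bdg_adj L x v ->
  bdg_reach L k.+1 u v.
Proof.
move=> xm h1 h2; apply/hasP; exists x; last by apply/andP.
by rewrite mem_iota size_L; lia.
Qed.

Lemma reach_trans k l u x v : bdg_reach L k u x -> bdg_reach L l x v ->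
  bdg_reach L (k + l) u v.
Proof.
move=> h; elim: l v => [|l IH] v; first by rewrite addn0 => /eqP <-.
by rewrite addnS => /hasP[y yi /andP[/IH h1 h2]]; apply/hasP; exists y; last by apply/andP.
Qed.

Lemma reach_sym k u v : (v <= m)%N -> bdg_reach L k u v -> bdg_reach L k v u.
Proof.
elim: k v => [|k IH] v vm; first by rewrite /= eq_sym.
move=> /hasP[y]; rewrite mem_iota size_L => yi /andP[h1 h2].
have ym : (y <= m)%N by lia.
rewrite -add1n; apply: (@reach_trans _ _ _ y); last exact: IH.
by apply: (@reach_snoc 0 v v y) => //=; rewrite bdg_adjC.
Qed.

Definition darc s t : int := b s + b t - 2 * mn b s (t - s).

(** The path follows the walk along the arc: an up-step, or a down-step to a new minimum, adds one
    edge and increases [darc] by one. *)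
Lemma reach_darc s t : (s <= t)%N -> bdg_reach L `|darc s t|%N (V s) (V t).
Proof.
move=> /subnKC; set k := (t - s)%N => <-.
have [l kl] := ubnP k; elim: l k kl => // l IH [|k] kl.
  have e0 : `|darc s s|%N = 0%N by rewrite /darc subnn /=; lia.
  by rewrite addn0 e0 /= eqxx.
rewrite addnS; have IHk := IH k ltac:(lia).
have E x : (s <= x)%N -> darc s x = b s + b x - 2 * mn b s (x - s) by [].
have dk : darc s (s + k) = b s + b (s + k)%N - 2 * mn b s k by rewrite /darc addKn.
have dk1 : darc s (s + k).+1 = b s + b (s + k).+1 - 2 * Num.min (mn b s k) (b (s + k).+1).
  by rewrite /darc subSn ?leq_addr // addKn /= addnS.
have mk : mn b s k <= b (s + k)%N := mn_le b s (leqnn k).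
have mk0 : mn b s k <= b s by have := mn_le b s (leq0n k); rewrite addn0.
have adj := adj_V (s + k).
case: (b_step (s + k)) => e.
  rewrite (_ : `|darc s (s + k).+1|%N = `|darc s (s + k)|.+1); last by rewrite dk dk1; lia.
  by apply: reach_snoc adj => //; exact: V_le.
have [h|h] := ltP (b (s + k).+1) (mn b s k).
  rewrite (_ : `|darc s (s + k).+1|%N = `|darc s (s + k)|.+1); last by rewrite dk dk1; lia.
  by apply: reach_snoc adj => //; exact: V_le.
have yb : b (s + k).+1 <= b (s + k)%N by lia.
(* Any other down-step returns to a vertex already occupied at the last earlier visit to that
   height, where the induction hypothesis applies. *)
have [r rk [e1 e2]] := ivt_up b_0 b_n b_step yb h.
have -> : V (s + k).+1 = V (s + r)%N.
  apply/esym/V_same; [lia|by []|] => x hx; rewrite e1.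
  have [->//|ne] := eqVneq x (s + k).+1.
  have := @mn_le b (s + r) (k - r) (x - (s + r)); rewrite subnKC ?e2; last lia.
  by apply; lia.
rewrite (_ : darc s (s + k).+1 = darc s (s + r)); first by apply: IH; lia.
have mk2 : mn b s k = Num.min (mn b s r) (mn b (s + r) (k - r)) by rewrite -mn_add subnKC.
rewrite dk1 /darc addKn mk2 e2 e1.
by have := mn_le b s (leqnn r); rewrite e1; lia.
Qed.

Let D := reroot b n.
Let dT s t := tdist D (s %% n) (t %% n).

Lemma D_ge0 i : (i <= n)%N -> 0 <= D i. Proof. exact: (reroot_ge0 b_0 b_n). Qed.
Lemma D_0 : D 0%N = 0. Proof. exact: (reroot0 n b_0). Qed.
Lemma D_n : D n = 0. Proof. exact: (rerootn b_n). Qed.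

Lemma dT_cdist i j : (i <= j)%N -> (j < n)%N -> dT i j = cdist b n i j.
Proof.
move=> ij jn; rewrite /dT !modn_small ?(leq_ltn_trans ij) // tdist_le //.
exact: (ldist_reroot b_0 b_n b_step ij (ltnW jn)).
Qed.

Lemma cdist_arcs i j : (i <= j)%N -> (j < n)%N ->
  cdist b n i j = Num.min (darc i j) (darc j (i + n)).
Proof.
move=> ij jn; rewrite /cdist /darc b_per (_ : i + n - j = (n - j) + i)%N; last lia.
rewrite mn_add subnKC; last exact: ltnW.
have -> : mn b n i = mn b 0 i.
  by rewrite (@eq_mn b b n 0 i 0) ?addr0 // => r _; rewrite addr0 addnC b_per.
lia.
Qed.

Lemma dT_le_darc s t : (s <= t)%N -> (t < s + n)%N -> dT s t <= darc s t.
Proof.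
move=> st_ tn.
have es : s = (s %/ n * n + s %% n)%N by exact: divn_eq.
set q := (s %/ n * n)%N in es; set s0 := (s %% n)%N in es.
have sn : (s0 < n)%N by rewrite ltn_mod.
have bq x : b (q + x)%N = b x by rewrite -b_mod /q modnMDl b_mod.
have -> : darc s t = darc s0 (t - q).
  rewrite /darc es bq; have -> : b t = b (t - q)%N by rewrite -(bq (t - q)%N) subnKC //; lia.
  rewrite (_ : t - (q + s0) = t - q - s0)%N; last lia.
  rewrite (@eq_mn b b (q + s0) s0 _ 0) ?addr0 // => r _.
  by rewrite addr0 -addnA bq.
have -> : dT s t = dT s0 (t - q).
  rewrite /dT /s0 modn_mod; congr tdist.
  by rewrite -{1}(@subnKC q t) ?modnMDl //; lia.
have [h|h] := ltnP (t - q) n.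
  by rewrite dT_cdist ?cdist_arcs //; lia.
have -> : dT s0 (t - q) = dT (t - q - n) s0.
  rewrite /dT tdistC; congr tdist.
  by rewrite -{1}(subnK h) modnDr.
rewrite dT_cdist ?cdist_arcs; [|lia..].
by rewrite (_ : t - q - n + n = t - q)%N; lia.
Qed.

Lemma dT_succ t : dT t t.+1 = 1.
Proof.
rewrite /dT; have tn : (t %% n < n)%N by rewrite ltn_mod.
have [h|h] := ltnP (t %% n).+1 n.
  have -> : (t.+1 %% n = (t %% n).+1)%N.
    by rewrite -addn1 -modnDml addn1 modn_small.
  rewrite tdist_le // /ldist subSnn /= addn1.
  by have := reroot_step b_0 b_n b_step tn; rewrite -/D; lia.
have e : (t %% n = n.-1)%N by lia.
have -> : (t.+1 %% n = 0)%N.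
  by rewrite -addn1 -modnDml e addn1 prednK // modnn.
rewrite e tdistC tdist_le // /ldist D_0 subn0.
have -> : mn D 0 n.-1 = 0.
  apply/eqP; rewrite eq_le; apply/andP; split.
    by have := mn_le D 0 (leq0n n.-1); rewrite addn0 D_0.
  by apply/mn_geP => r rn; rewrite add0n D_ge0 //; lia.
have := reroot_step b_0 b_n b_step (i := n.-1); rewrite prednK // -/D D_n.
have := @D_ge0 n.-1; lia.
Qed.

Lemma dT_firstdrop t t' : firstdrop t t' -> dT t t' = 0.
Proof.
move=> hd; have stay := firstdrop_stay hd; case: hd => tt' ft' bt' hmin.
have lt : (t' < t + n)%N.
  rewrite ltnNge; apply/negP => h; have e : t' = (t' - n + n)%N by lia.
  apply: (hmin (t' - n)%N); try lia; first by rewrite -st_per -e.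
  by rewrite -bt' {2}e b_per.
apply/eqP; rewrite eq_le; apply/andP; split.
  apply: le_trans (dT_le_darc tt' lt) _; rewrite /darc bt'.
  have : b t <= mn b t (t' - t) by apply/mn_geP => r hr; apply: stay; lia.
  lia.
have := tdist_triangle D (t %% n) (t' %% n) (t %% n).
by rewrite tdist0 (tdistC _ (t' %% n)%N) /dT; lia.
Qed.

Lemma global_min t : (forall t', (t <= t')%N -> ~~ st t' -> b t' <> b t) ->
  forall x, b t <= b x.
Proof.
move=> hn; have stay : forall k, b t <= b (t + k)%N.
  elim=> [|k IH]; first by rewrite addn0.
  rewrite addnS [X in _ <= X]b_S; case F : (st (t + k)%N); rewrite /wsg; first lia.
  by have := hn (t + k)%N (leq_addr _ _); rewrite F => /(_ isT); lia.
move=> x; have := stay (x + t * n - t)%N; rewrite subnKC; last by nia.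
suff -> : b (x + t * n)%N = b x by [].
by elim: (t) => [|q IH]; rewrite ?mul0n ?addn0 // mulSn addnCA addnC b_per.
Qed.

(** Either both times lead to the same corner, through stretches of length zero in the tree, or
    neither leads to a corner and both sit at the global minimum. *)
Lemma V_inj0 s t : V s = V t -> dT s t = 0.
Proof.
have dge0 x y : 0 <= dT x y.
  have := tdist_triangle D (x %% n) (y %% n) (x %% n).
  by rewrite tdist0 (tdistC _ (y %% n)%N) /dT; lia.
have tri x y z : dT x z <= dT x y + dT y z by exact: tdist_triangle.
have lem x y : (forall z, b x <= b z) -> (forall z, b y <= b z) -> (x <= y)%N ->
    dT (x %% n) (y %% n) = 0.
  move=> h1 h2 xy; apply/eqP; rewrite eq_le dge0 andbT.
  wlog : x y h1 h2 xy / (x %% n <= y %% n)%N => [W|xy'].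
    have [h|h] := leqP (x %% n) (y %% n); first exact: W.
    rewrite {1}/dT tdistC -/(dT _ _) -[(x %% n)%N in X in dT _ X]modn_mod -[(y %% n)%N in X in dT X _]modn_mod.
    by apply: W; rewrite ?modn_mod ?(ltnW h) // => z; rewrite b_mod.
  rewrite dT_cdist ?ltn_mod // /cdist !b_mod.
  have := h1 y; have := h2 x.
  have : b x <= mn b (x %% n) (y %% n - x %% n) by apply/mn_geP.
  lia.
have [[s' hs]|hs] := V_dich s; have [[t' ht]|ht] := V_dich t.
- rewrite (V_some hs) (V_some ht) => e.
  have fs : ~~ st s' by case: hs. have ft : ~~ st t' by case: ht.
  have e2 : (s' %% n = t' %% n)%N.
    move: e; rewrite !cnt_mod // => e.
    have f1 : ~~ st (s' %% n)%N by rewrite /st /wst modn_mod.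
    have f2 : ~~ st (t' %% n)%N by rewrite /st /wst modn_mod.
    by case: (ltngtP (s' %% n) (t' %% n))%N => // h;
      [have := cnt_lt f1 h|have := cnt_lt f2 h]; rewrite e ltnn.
  have := tri s s' t; have := tri s' t' t; have h0 := dT_firstdrop hs.
  have h1 := dT_firstdrop ht; have h2 : dT t' t = dT t t' by rewrite /dT tdistC.
  have h3 : dT s' t' = 0 by rewrite /dT e2 tdist0.
  have := dge0 s t; lia.
- by rewrite (V_some hs) (V_none ht) => e; have := ltn_pmod (cnt s') m0; rewrite e ltnn.
- by rewrite (V_none hs) (V_some ht) => e; have := ltn_pmod (cnt t') m0; rewrite -e ltnn.
move=> _; have g1 := global_min hs; have g2 := global_min ht.
have e : dT (s %% n) (t %% n) = dT s t by rewrite /dT !modn_mod.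
rewrite -e; have [h|h] := leqP s t; first exact: lem.
by rewrite /dT tdistC -/(dT _ _); apply: lem => //; exact: ltnW.
Qed.

Lemma V_surj v : (v <= m)%N -> exists t, V t = v.
Proof.
rewrite leq_eqVlt => /orP[/eqP ->|vm].
  have [r rn e] := mn_ex b 0 n; exists r; apply: V_none => t' rt' ft' e2.
  have := @mn_le b 0 n (t'.+1 %% n); rewrite !add0n b_mod b_S (negbTE ft') e2 e add0n.
  by rewrite ltnW ?ltn_mod // => /(_ isT); rewrite /wsg; lia.
by have [t ft et] := cnt_surj v; exists t; rewrite V_self // et modn_small.
Qed.

(** Every edge of the map joins the vertices of two consecutive times, which are at tree distance
    one; together with [V_inj0] this makes the tree distance a lower bound for path lengths. *)
Lemma reach_ge_dT k s t : bdg_reach L k (V s) (V t) -> dT s t <= k%:Z.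
Proof.
elim: k t => [|k IH] t; first by move=> /= /eqP /V_inj0 ->.
move=> /hasP[x]; rewrite mem_iota size_L => xm /andP[h1 /hasP[i]].
rewrite mem_iota size_L => im hi.
have [t0 ft0 et0] := cnt_surj i.
have Vt0 : V t0 = i by rewrite V_self // et0 modn_small //; lia.
have sc : bdg_succ L i = V t0.+1 by rewrite -bdg_succ_V // et0 modn_small //; lia.
have [x' [v' [ex ev dx]]] : exists x' v', [/\ V x' = x, V v' = V t & dT x' v' = 1].
  move: hi; rewrite sc -Vt0 => /orP[] /andP[/eqP e1 /eqP e2].
    by exists t0, t0.+1; rewrite dT_succ.
  by exists t0.+1, t0; split => //; rewrite /dT tdistC; exact: dT_succ.
have := IH x'; rewrite ex => /(_ h1); have := V_inj0 ev.
have := tdist_triangle D (s %% n) (x' %% n) (t %% n).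
have := tdist_triangle D (x' %% n) (v' %% n) (t %% n).
rewrite -/(dT _ _) -!/(dT _ _) dx; lia.
Qed.

Lemma reach_dT s t : (s < n)%N -> (t < n)%N -> bdg_reach L `|dT s t|%N (V s) (V t).
Proof.
wlog st_ : s t / (s <= t)%N => [W|] sn tn.
  have [h|h] := leqP s t; first exact: W.
  have -> : dT s t = dT t s by rewrite /dT tdistC.
  by apply: reach_sym; [exact: V_le|apply: W => //; exact: ltnW].
rewrite dT_cdist // cdist_arcs //; case: leP => _; first exact: reach_darc.
by apply: reach_sym; [exact: V_le|rewrite -(V_per s); apply: reach_darc; lia].
Qed.

Lemma darc_le s t : (s <= t)%N -> darc s t <= (t - s)%:Z.
Proof.
move=> st_; rewrite /darc; have [r hr ->] := mn_ex b s (t - s).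
have lip x k : `|b (x + k)%N - b x| <= k%:Z.
  elim: k => [|k IH]; first by rewrite addn0 subrr.
  by rewrite addnS; have := b_step (x + k); lia.
have := lip s r; have := lip (s + r)%N (t - s - r)%N.
by rewrite (_ : s + r + (t - s - r) = t)%N; lia.
Qed.

Lemma dT_ge0 s t : 0 <= dT s t.
Proof.
have := tdist_triangle D (s %% n) (t %% n) (s %% n).
by rewrite tdist0 (tdistC _ (t %% n)%N) /dT; lia.
Qed.

Lemma bdg_distE s t : (s < n)%N -> (t < n)%N ->
  (bdg_dist L (V s) (V t))%:Z = tdist D s t.
Proof.
move=> sn tn; have -> : tdist D s t = dT s t by rewrite /dT !modn_small.
have ge0 := dT_ge0 s t.
rewrite /bdg_dist (_ : find _ _ = `|dT s t|%N); first lia.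
apply: find_iotaP.
(* [bdg_dist] tests lengths up to [m] only. The two arcs between the times have total length [2 m],
   so the shorter one stays within that range. *)
- rewrite size_L ltnS; wlog st_ : s t sn tn ge0 / (s <= t)%N => [W|].
    have [h|h] := leqP s t; first exact: W.
    have e : dT s t = dT t s by rewrite /dT tdistC.
    by rewrite e; apply: W; rewrite -?e //; exact: ltnW.
  have := darc_le st_; have := @darc_le t (s + n) ltac:(lia).
  have := size_2m; move: ge0; rewrite (dT_cdist st_ tn) (cdist_arcs st_ tn); lia.
- by rewrite add0n; exact: reach_dT.
- move=> j jd; rewrite add0n; apply/negP => /reach_ge_dT; lia.
Qed.

Lemma V_argmin : V (argmin_first b n) = m.
Proof.
have [kn bk _] := argminP b_0 b_n; apply: V_none => t' rt' ft' e2.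
have := @mn_le b 0 n (t'.+1 %% n); rewrite !add0n b_mod b_S (negbTE ft') e2 bk.
by rewrite ltnW ?ltn_mod // => /(_ isT); rewrite /wsg; lia.
Qed.

End Contour.

(** * Bridges and pointed Dyck words *)

Section SumWords.
Variable V : nmodType.

Lemma big_tupleS n (G : seq bool -> V) :
  \sum_(t : n.+1.-tuple bool) G t =
  \sum_(t : n.-tuple bool) G (true :: t) + \sum_(t : n.-tuple bool) G (false :: t).
Proof.
rewrite (reindex (fun p : bool * n.-tuple bool => [tuple of p.1 :: p.2])) /=; last first.
  exists (fun t : n.+1.-tuple bool => (thead t, [tuple of behead t])) => [[x t] _|t _] /=.
    by congr pair; apply: val_inj.
  by rewrite [RHS]tuple_eta.
rewrite -(pair_bigA _ (fun x (t : n.-tuple bool) => G (x :: t))) /=.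
by rewrite big_bool /=.
Qed.

Lemma big_tuple0 (G : seq bool -> V) : \sum_(t : 0.-tuple bool) G t = G [::].
Proof.
rewrite (big_pred1 [tuple]) //= => t; apply/esym/eqP.
by rewrite [LHS]tuple0.
Qed.

Lemma big_tuple_add n1 n2 (G : seq bool -> V) :
  \sum_(t : (n1 + n2).-tuple bool) G t =
  \sum_(t1 : n1.-tuple bool) \sum_(t2 : n2.-tuple bool) G (t1 ++ t2).
Proof.
elim: n1 G => [|n1 IH] G; first by rewrite (big_tuple0 (fun t1 => \sum_(t2 : n2.-tuple bool) G (t1 ++ t2))).
etransitivity; first exact: (@big_tupleS (n1 + n2) G).
rewrite (IH (fun t => G (true :: t))) (IH (fun t => G (false :: t))).
by rewrite (@big_tupleS n1 (fun t1 => \sum_(t2 : n2.-tuple bool) G (t1 ++ t2))).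
Qed.

End SumWords.

Lemma big_tupleS_nat n (G : seq bool -> nat) :
  (\sum_(t : n.+1.-tuple bool) G t =
  \sum_(t : n.-tuple bool) G (true :: t) + \sum_(t : n.-tuple bool) G (false :: t))%N.
Proof. exact: (@big_tupleS nat). Qed.

Lemma count_idN (s : seq bool) : (count id s + count negb s = size s)%N.
Proof. by elim: s => // -[] s /= <-; lia. Qed.

Fixpoint run (x : nat) (w : seq bool) : option nat :=
  if w is a :: w' then
    if a then run x.+1 w' else if x is x'.+1 then run x' w' else None
  else Some x.

Fixpoint freepaths (n : nat) (z : int) : nat :=
  if n is n'.+1 then (freepaths n' (z - 1) + freepaths n' (z + 1))%N else (z == 0).

Definition npaths n x y := (\sum_(t : n.-tuple bool) (run x t == Some y))%N.

(** The reflection principle at height -1, which sends [x] to [- x - 2]; both sides satisfy the same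
    one-step recursion, and the two free counts cancel at the barrier. *)
Lemma npathsE n x y :
  (npaths n x y)%:Z = (freepaths n (y%:Z - x%:Z))%:Z - (freepaths n (x%:Z + y%:Z + 2))%:Z.
Proof.
elim: n x y => [|n IH] x y.
  rewrite /npaths (@big_tuple0 nat (fun t => (run x t == Some y) : nat)) /=.
  have -> : (x%:Z + y%:Z + 2 == 0) = false by apply/negbTE/eqP; lia.
  have -> : (y%:Z - x%:Z == 0) = (x == y) by apply/eqP/eqP; lia.
  have -> : (Some x == Some y) = (x == y) by apply/eqP/eqP => [[]|->].
  by rewrite subr0.
have -> : npaths n.+1 x y = (npaths n x.+1 y + (if x is x'.+1 then npaths n x' y else 0))%N.
  rewrite /npaths (@big_tupleS nat n (fun t => (run x t == Some y) : nat)) /=.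
  by case: x => [|x] //; congr (_ + _)%N; rewrite big1.
have := IH x.+1 y; rewrite [freepaths n.+1 _]/= [freepaths n.+1 (_ + 2)]/=.
have -> : y%:Z - x.+1%:Z = y%:Z - x%:Z - 1 by lia.
have -> : x.+1%:Z + y%:Z + 2 = x%:Z + y%:Z + 2 + 1 by lia.
case: x => [|x].
  have -> : y%:Z - 0%:Z + 1 = 0%:Z + y%:Z + 2 - 1 by lia.
  by move=> h; rewrite addn0 !PoszD h; ring.
have := IH x y.
have -> : y%:Z - x.+1%:Z + 1 = y%:Z - x%:Z by lia.
have -> : x.+1%:Z + y%:Z + 2 - 1 = x%:Z + y%:Z + 2 by lia.
by move=> h2 h1; rewrite !PoszD h1 h2; ring.
Qed.

Lemma freepaths_bin n k : (k <= n)%N -> freepaths n (k%:Z *+ 2 - n%:Z) = 'C(n, k).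
Proof.
have out : forall n (z : int), n%:Z < `|z| -> freepaths n z = 0%N.
  elim=> [|q IH] z h /=; first by case: eqP => //; lia.
  by rewrite !IH //; lia.
elim: n k => [|n IH] k kn; first by have -> : k = 0%N by lia.
rewrite /=; have -> : k%:Z *+ 2 - n.+1%:Z - 1 = (k%:Z - 1) *+ 2 - n%:Z by lia.
have -> : k%:Z *+ 2 - n.+1%:Z + 1 = k%:Z *+ 2 - n%:Z by lia.
case: k kn => [|k] kn.
  by rewrite out ?add0n; [rewrite IH // !bin0|lia].
have -> : k.+1%:Z - 1 = k%:Z by lia.
rewrite IH // binS addnC; congr (_ + _)%N.
have [h|h] := leqP k.+1 n; first exact: IH.
by rewrite out ?bin_small //; lia.
Qed.

(* [binc j z] counts the words of length 2j with z more up-steps than j. *)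
Definition binc (j : nat) (z : int) : nat := 'C(j + j, j + `|z|).

Lemma freepaths_even j (z : int) : freepaths (j + j) (z *+ 2) = binc j z.
Proof.
have sym : forall n (z : int), freepaths n (- z) = freepaths n z.
  elim=> [|q IH] y /=; first by rewrite oppr_eq0.
  have e1 : - y - 1 = - (y + 1) by lia.
  have e2 : - y + 1 = - (y - 1) by lia.
  by rewrite e1 e2 !IH addnC.
have pos (k : nat) : freepaths (j + j) (k%:Z *+ 2) = 'C(j + j, j + k).
  have [h|h] := leqP k j.
    rewrite -(@freepaths_bin (j + j) (j + k)); last lia.
    by congr freepaths; lia.
  rewrite bin_small; last lia.
  have out : forall n (z : int), n%:Z < `|z| -> freepaths n z = 0%N.
    elim=> [|q IH] y hy /=; first by case: eqP => //; lia.
    by rewrite !IH //; lia.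
  by rewrite out //; lia.
rewrite /binc; case: (lerP 0 z) => hz.
  by rewrite -pos; congr freepaths; lia.
by rewrite -sym -pos; congr freepaths; lia.
Qed.

Lemma npaths_even j x y : (npaths (j + j) (x + x) (y + y))%:Z =
  (binc j (y%:Z - x%:Z))%:Z - (binc j (x%:Z + y%:Z + 1))%:Z.
Proof.
rewrite npathsE -!freepaths_even; congr (Posz (freepaths _ _) - Posz (freepaths _ _)); lia.
Qed.

Lemma run_cat x u v : run x (u ++ v) = if run x u is Some y then run y v else None.
Proof. by elim: u x => [|[] u IH] [|x] //=. Qed.

Definition hts (t : seq bool) (i : nat) : int := \sum_(j < i) wsg (nth true t j).

Lemma hts_cons a t i : hts (a :: t) i.+1 = wsg a + hts t i.
Proof. by rewrite /hts big_ord_recl. Qed.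

Lemma hts0 t : hts t 0 = 0. Proof. by rewrite /hts big_ord0. Qed.
Lemma htsS t i : hts t i.+1 = hts t i + wsg (nth true t i).
Proof. by rewrite /hts big_ord_recr. Qed.

Lemma run_hts x t y : run x t = Some y <->
  (forall i, (i <= size t)%N -> 0 <= x%:Z + hts t i) /\ y%:Z = x%:Z + hts t (size t).
Proof.
elim: t x => [|a t IH] x /=.
  split=> [[<-]|[_]]; last by rewrite hts0 => h; congr Some; lia.
  split=> [i|]; last by rewrite hts0; lia.
  by rewrite leqn0 => /eqP ->; rewrite hts0; lia.
have key x' : x%:Z + wsg a = x'%:Z -> run x' t = Some y <->
  (forall i, (i <= (size t).+1)%N -> 0 <= x%:Z + hts (a :: t) i) /\
     y%:Z = x%:Z + hts (a :: t) (size t).+1.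
  move=> e; rewrite IH hts_cons -e addrA; split=> -[h1 h2]; split=> // i hi.
    by case: i hi => [|i] hi; rewrite ?hts0 ?addr0 // hts_cons addrA; exact: h1.
  by have := h1 i.+1 hi; rewrite hts_cons addrA.
case: a key => key; first by apply: key; rewrite /wsg; lia.
case: x key => [|x] key; last by apply: key; rewrite /wsg; lia.
split=> // -[h _]; have := h 1%N isT; rewrite /hts big_ord_recl big_ord0 /wsg /=; lia.
Qed.

Section Bijection.
Variable m : nat.
Hypothesis m0 : (0 < m)%N.
Let n := m.*2.

Definition balanced : {set n.-tuple bool} :=
  [set w : n.-tuple bool | count id w == m].
Definition dyck (v : seq bool) := run 0 v == Some 0%N.
(** Each vertex of the plane tree is named by its first visit: the root by time 0, any other vertex
    by the time just after its up-step. This leaves [m + 1] marks for each Dyck word. *)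
Definition pointed : {set n.-tuple bool * 'I_n} :=
  [set p : n.-tuple bool * 'I_n | dyck p.1 & (p.2 == 0%N :> nat) || nth false p.1 p.2.-1].

Let n0 : (0 < n)%N. Proof. by rewrite /n; lia. Qed.

Lemma count_balanced (w : n.-tuple bool) : w \in balanced -> count id w = count negb w.
Proof.
rewrite inE => /eqP e; have := count_idN w; rewrite size_tuple.
have : n = (m + m)%N by rewrite /n addnn.
by lia.
Qed.

Definition rootword (w : n.-tuple bool) : n.-tuple bool :=
  [tuple reroot (wht w) n i < reroot (wht w) n i.+1 | i < n].
Definition rootpt (w : n.-tuple bool) : 'I_n :=
  insubd (Ordinal n0) (argmin_first (wht w) n).

Section OneWord.
Variable w : n.-tuple bool.
Hypothesis bw : w \in balanced.
Let b := wht w.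
Let sw : size w = n := size_tuple w.
Let b0 : b 0%N = 0 := b_0 w.
Let bn : b n = 0.
Proof.
have h : wht w (size w) = 0 by apply: b_n; [exact: count_balanced|rewrite sw].
by move: h; rewrite sw.
Qed.
Let bst i : b i.+1 = b i + 1 \/ b i.+1 = b i - 1. Proof. exact: b_step. Qed.

Lemma rootptE : rootpt w = argmin_first b n :> nat.
Proof. by rewrite /rootpt val_insubd (argmin_lt b0 bn n0). Qed.

Lemma hts_rootword i : (i <= n)%N -> hts (rootword w) i = reroot b n i.
Proof.
elim: i => [_|i IH ni]; first by rewrite hts0 reroot0 //.
rewrite htsS IH ?(ltnW ni) // (nth_map (Ordinal n0)) ?size_enum_ord //.
rewrite nth_enum_ord // -/b; have := reroot_step b0 bn bst ni.
by rewrite /wsg; case: ltP; lia.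
Qed.

Lemma rootword_dyck : dyck (rootword w).
Proof.
apply/eqP/run_hts; rewrite size_tuple; split=> [i ni|].
  by have := hts_rootword ni; have := reroot_ge0 b0 bn ni; lia.
by have := hts_rootword (leqnn n); have := rerootn bn; lia.
Qed.

Lemma rootpair_pointed : (rootword w, rootpt w) \in pointed.
Proof.
rewrite inE /= rootword_dyck rootptE /=; case: posnP => //= k0.
have kn : (argmin_first b n < n)%N by exact: argmin_lt.
have kn1 : ((argmin_first b n).-1 < n)%N by lia.
rewrite (nth_map (Ordinal n0)) ?size_enum_ord // nth_enum_ord // prednK // -/b.
by have := argmin_up b0 bn bst k0; lia.
Qed.

Lemma tdist_rootpt i : (i <= n)%N ->
  tdist (hts (rootword w)) (rootpt w) i = b i - mn b 0 n.
Proof.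
move=> ni; rewrite -(cdist_argmin b0 bn ni) rootptE.
have [kn _ _] := argminP b0 bn.
have md_eq x y : (x <= n)%N -> (y <= n)%N -> (x <= y)%N ->
    tdist (hts (rootword w)) x y = cdist b n x y.
  move=> xn yn xy; rewrite -(ldist_reroot b0 bn bst xy yn) tdist_le // /ldist.
  rewrite !hts_rootword // (@eq_mn _ (reroot b n) x x _ 0) ?addr0 // => r hr.
  by rewrite addr0 hts_rootword //; lia.
by case: leqP => h; [|rewrite tdistC]; apply: md_eq => //; exact: ltnW.
Qed.

End OneWord.

(** Distances from the marked vertex give the bridge up to its minimum, and [b 0 = 0] fixes that
    constant. *)
Lemma rootpair_inj : {in balanced &, injective (fun w => (rootword w, rootpt w))}.
Proof.
move=> w w' bw bw' e.
have e1 : rootword w = rootword w' by exact: (f_equal (@fst _ _) e).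
have e2 : rootpt w = rootpt w' by exact: (f_equal (@snd _ _) e).
have H i : (i <= n)%N -> wht w i = wht w' i.
  move=> ni; have h1 := tdist_rootpt bw ni; have h2 := tdist_rootpt bw' ni.
  have h3 := tdist_rootpt bw (leq0n n); have h4 := tdist_rootpt bw' (leq0n n).
  have a1 : wht w i - mn (wht w) 0 n = wht w' i - mn (wht w') 0 n by rewrite -h1 -h2 e1 e2.
  have a2 : wht w 0 - mn (wht w) 0 n = wht w' 0 - mn (wht w') 0 n by rewrite -h3 -h4 e1 e2.
  rewrite !b_0 !sub0r in a2; have /oppr_inj a3 := a2.
  by move: a1; rewrite a3 => /addIr.
apply: eq_from_tnth => i; have hi := ltn_ord i.
have := H i (ltnW hi); have := H i.+1 hi; rewrite !b_S /wst !size_tuple !modn_small //.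
by rewrite !(tnth_nth true) /wsg; case: (nth _ _ _); case: (nth _ _ _); lia.
Qed.

Lemma card_balanced : #|balanced| = 'C(n, m).
Proof.
rewrite -sum1_card /balanced; under eq_bigl do rewrite inE.
rewrite big_mkcond /=; move: n m; elim=> [|q IH] p.
  rewrite (@big_tuple0 nat (fun t => if count id t == p then 1 else 0)%N) /=.
  by case: p.
rewrite (@big_tupleS_nat q (fun t => if count id t == p then 1 else 0)%N) /=.
under [X in (_ + X)%N]eq_bigr do rewrite add0n.
rewrite IH; case: p => [|p]; first by rewrite !bin0 big1.
by under eq_bigr do rewrite add1n eqSS; rewrite IH binS addnC.
Qed.

Definition catalan := npaths n 0 0.

Lemma catalanE : (m.+1 * catalan = 'C(n, m))%N.
Proof.
have := npaths_even m 0 0; rewrite /binc !addn0 /= => h.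
have e : catalan = npaths (m + m) 0 0 by rewrite /catalan /n addnn.
have h2 := mul_bin_left (m + m) m.
rewrite addKn in h2; rewrite e /n -addnn.
have : m.+1%:Z * (npaths (m + m) 0 0)%:Z = 'C(m + m, m)%:Z; last by lia.
by rewrite h; move: h2; rewrite (_ : (m + `|0 + 0 + 1|)%N = m.+1); [nia|lia].
Qed.

Lemma dyck_count v : size v = n -> dyck v -> count id v = m.
Proof.
move=> sv /eqP/run_hts[_]; rewrite sv.
have -> : hts v n = (count id v)%:Z - (count negb v)%:Z.
  rewrite -sv; elim: (v) => [|x s IH]; first by rewrite hts0.
  by rewrite /= hts_cons IH; case: x => /=; rewrite /wsg; lia.
by have := count_idN v; rewrite sv /n -addnn; lia.
Qed.

Lemma card_pointed_fiber (v : n.-tuple bool) : dyck v ->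
  (\sum_(k < n) ((k == 0%N :> nat) || nth false v k.-1) = m.+1)%N.
Proof.
move=> dv; have sv := size_tuple v.
have cv := dyck_count sv dv.
(* A Dyck word ends with a down-step, so every up-step is followed by a time still below [n] and no
   mark is lost. *)
have lastf : nth false v n.-1 = false.
  move/eqP/run_hts: dv => [h1 h2]; rewrite sv in h1 h2.
  have := h1 n.-1 ltac:(lia); have : hts v n.-1.+1 = 0 by rewrite prednK //; lia.
  rewrite htsS (set_nth_default false) ?sv; last lia.
  by case: (nth _ _ _) => //; rewrite /wsg; lia.
have H : (\sum_(k < n) nth false v k = m)%N.
  rewrite -cv -sum1_count (big_nth false) sv big_mkord [RHS]big_mkcond /=.
  by apply: eq_bigr => i _; case: (nth _ _ _).
have key N (f : nat -> bool) : (0 < N)%N -> f N.-1 = false ->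
    (\sum_(k < N) ((k == 0%N :> nat) || f k.-1) = (\sum_(k < N) f k).+1)%N.
  case: N => // q _ /= fq; rewrite big_ord_recl /= add1n; congr S.
  by rewrite [RHS]big_ord_recr /= fq addn0.
by rewrite (key n (nth false v)) // H.
Qed.

Lemma card_pointed : #|pointed| = 'C(n, m).
Proof.
rewrite -catalanE /catalan /npaths mulnC big_distrl /= -sum1_card.
rewrite (eq_bigl (fun p : n.-tuple bool * 'I_n =>
  dyck p.1 && ((p.2 == 0%N :> nat) || nth false p.1 p.2.-1))); last first.
  by move=> p; rewrite inE.
rewrite -(pair_big_dep (fun v : n.-tuple bool => dyck v)
   (fun v (k : 'I_n) => (k == 0%N :> nat) || nth false v k.-1) (fun _ _ => 1%N)) /=.
rewrite big_mkcond /=; apply: eq_bigr => v _; rewrite -/(dyck v).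
case: ifP => dv; last by rewrite mul0n.
rewrite mul1n -(card_pointed_fiber dv) big_mkcond /=.
by apply: eq_bigr => k _; case: ifP.
Qed.

(** Injectivity and equal cardinalities give surjectivity, so that no inverse of the rerooting is
    constructed. *)
Lemma imset_rootpair : (fun w => (rootword w, rootpt w)) @: balanced = pointed.
Proof.
apply/eqP; rewrite eqEcard; apply/andP; split.
  by apply/fintype.subsetP => p /imsetP[w bw ->]; exact: rootpair_pointed.
by rewrite card_in_imset ?card_pointed ?card_balanced //; exact: rootpair_inj.
Qed.

Lemma sum_rootpair (V : nmodType) (G : n.-tuple bool -> 'I_n -> V) :
  \sum_(w in balanced) G (rootword w) (rootpt w) =
  \sum_(v : n.-tuple bool | dyck v)
    \sum_(k < n | (k == 0%N :> nat) || nth false v k.-1) G v k.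
Proof.
rewrite (pair_big_dep (fun v : n.-tuple bool => dyck v)
   (fun v (k : 'I_n) => (k == 0%N :> nat) || nth false v k.-1)) /=.
rewrite (eq_bigl (fun p => p \in pointed)); last by move=> p; rewrite inE.
rewrite -imset_rootpair big_imset //; exact: rootpair_inj.
Qed.

End Bijection.

(** * Rotation invariance, and the tree coded on the unit interval *)

Section CyclicDist.
Variable w : seq bool.
Let n := size w.
Hypothesis bal : count id w = count negb w.
Hypothesis n0 : (0 < n)%N.
Let b := wht w.

Definition ndist s t := tdist (reroot (wht w) (size w)) (s %% size w) (t %% size w).

Lemma darc_per s t : darc w (s + n) (t + n) = darc w s t.
Proof.
rewrite /darc !(b_per bal n0) subnDr (@eq_mn _ (wht w) (s + n) s _ 0) ?addr0 // => r _.
by rewrite addr0 addnAC (b_per bal n0).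
Qed.

Lemma ndist_arcs s t : (s <= t)%N -> (t < s + n)%N ->
  ndist s t = Num.min (darc w s t) (darc w t (s + n)).
Proof.
move=> st tn.
have main s0 t0 : (s0 < n)%N -> (s0 <= t0)%N -> (t0 < s0 + n)%N ->
    ndist s0 t0 = Num.min (darc w s0 t0) (darc w t0 (s0 + n)).
  move=> sn st0 tn0; have [h|h] := ltnP t0 n.
    by rewrite /ndist (dT_cdist bal n0 st0 h) (cdist_arcs bal n0 st0 h).
  have h2 : (t0 - n <= s0)%N by lia.
  have -> : ndist s0 t0 = ndist (t0 - n) s0.
    by rewrite /ndist tdistC -{1}(subnK h) modnDr.
  rewrite /ndist (dT_cdist bal n0 h2 sn) (cdist_arcs bal n0 h2 sn) subnK // minC.
  by rewrite -(darc_per (t0 - n) s0) subnK.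
have [q eq] : exists q, s = (q * n + s %% n)%N by exists (s %/ n)%N; exact: divn_eq.
have sn : (s %% n < n)%N by rewrite ltn_mod.
have red x y : darc w (q * n + x) (q * n + y) = darc w x y.
  by elim: (q) => [|k IH]; rewrite ?mul0n ?add0n // mulSn -2!addnA !(addnC n) darc_per.
have et : t = (q * n + (t - q * n))%N by lia.
rewrite eq et -addnA !red -main //; [|lia..].
by rewrite /ndist !modnMDl.
Qed.

Lemma V_mod t : wvert w (t %% size w) = wvert w t.
Proof.
rewrite [in RHS](divn_eq t (size w)); elim: (t %/ size w)%N => // q IH.
by rewrite mulSn -addnA addnC (V_per bal n0).
Qed.

Lemma ndistC s t : ndist s t = ndist t s. Proof. exact: tdistC. Qed.

End CyclicDist.

Lemma wht_rot1 (w : seq bool) i : (0 < size w)%N ->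
  wht (rot 1 w) i = wht w i.+1 - wht w 1.
Proof.
move=> n0; elim: i => [|i IH]; first by rewrite b_0 subrr.
rewrite [LHS]b_S IH [wht w i.+2]b_S; suff -> : wst (rot 1 w) i = wst w i.+1 by lia.
rewrite /wst size_rot; set j := (i %% size w)%N.
have jn : (j < size w)%N by rewrite ltn_mod.
have -> : (i.+1 %% size w = j.+1 %% size w)%N by rewrite -[in LHS]addn1 -modnDml addn1.
case: (w) n0 jn => // x s _ jn.
rewrite rot1_cons nth_rcons; move: jn; rewrite ltnS /= leq_eqVlt => /orP[/eqP e|h].
  by rewrite e ltnn eqxx modnn.
by rewrite h modn_small.
Qed.

Lemma count_rot1 (p : pred bool) w : count p (rot 1 w) = count p w.
Proof. by rewrite -!size_filter; apply: perm_size; rewrite perm_filter // perm_rot. Qed.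

(** The distance is the minimum over the two arcs of the circle, each computed from height
    differences, hence it does not depend on the starting point of the word. *)
Lemma ndist_rot1 (w : seq bool) s t : count id w = count negb w -> (0 < size w)%N ->
  ndist (rot 1 w) s t = ndist w s.+1 t.+1.
Proof.
move=> bal n0; have bal' : count id (rot 1 w) = count negb (rot 1 w) by rewrite !count_rot1.
have n0' : (0 < size (rot 1 w))%N by rewrite size_rot.
have dr x y : darc (rot 1 w) x y = darc w x.+1 y.+1.
  rewrite /darc subSS !wht_rot1 // (@eq_mn _ (wht w) x x.+1 _ (- wht w 1)); first lia.
  by move=> r _; rewrite wht_rot1.
have red x y : ndist w x.+1 y.+1 = ndist w (x %% size w).+1 (y %% size w).+1.
  have e z : (z.+1 %% size w = (z %% size w).+1 %% size w)%N.
    by rewrite -addn1 -modnDml addn1.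
  by rewrite /ndist (e x) (e y).
have red' x y : ndist (rot 1 w) x y = ndist (rot 1 w) (x %% size w) (y %% size w).
  by rewrite /ndist size_rot !modn_mod.
rewrite red red'; set x := (s %% _)%N; set y := (t %% _)%N.
have xn : (x < size w)%N by rewrite ltn_mod. have yn : (y < size w)%N by rewrite ltn_mod.
wlog xy : x y xn yn / (x <= y)%N => [W|].
  have [h|h] := leqP x y; first exact: W.
  by rewrite ndistC [RHS]ndistC; apply: W => //; exact: ltnW.
rewrite !ndist_arcs // ?size_rot ?dr ?addSn //; lia.
Qed.

Section StepTree.
Variable R : realType.

Lemma exc_delta_stepf n (c : R) (H : nat -> int) (x y : R) : (0 < n)%N -> 0 <= c ->
  0 <= x <= 1 -> 0 <= y <= 1 ->
  exc_delta (stepf n (fun i => c * (H i)%:~R)) x y =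
  c * (tdist H (Num.truncn (n%:R * x)) (Num.truncn (n%:R * y)))%:~R.
Proof.
move=> n0 c0; have nR : 0 < n%:R :> R by rewrite ltr0n.
set f := stepf _ _.
have bf : bnd01 f by exact: stepf_bnd.
have main s t : 0 <= s <= 1 -> 0 <= t <= 1 -> s <= t ->
    imin f s t = c * (md H (Num.truncn (n%:R * s)) (Num.truncn (n%:R * t)))%:~R.
  move=> hs ht st; set i := Num.truncn _; set j := Num.truncn _.
  have ij : (i <= j)%N by rewrite le_truncn // ler_wpM2l // ltW.
  apply/eqP; rewrite eq_le; apply/andP; split; last first.
    apply: imin_ge => r; rewrite (min_idPl st) (max_idPr st) => /andP[sr rt].
    rewrite /f /stepf ler_wpM2l // ler_int; apply: md_le.
    by rewrite (minn_idPl ij) (maxn_idPr ij) !le_truncn // ler_wpM2l // ltW.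
  have [l hl ->] := md_ex H i j.
  (* The two extreme indices are treated apart, because [i / n] may lie to the left of [s]; there
     the endpoints [s] and [t] themselves do. *)
  have [r hr er] : exists2 r, s <= r <= t & Num.truncn (n%:R * r) = l.
    have [->|li] := eqVneq l i; first by exists s; rewrite // lexx.
    have [->|lj] := eqVneq l j; first by exists t; rewrite // lexx andbT.
    exists (l%:R / n%:R); last by rewrite mulrCA divff ?mulr1 ?natrK // gt_eqF.
    rewrite ler_pdivlMr // ler_pdivrMr // mulrC [t * _]mulrC; apply/andP; split.
      rewrite ltW // -truncn_lt_nat; first by rewrite -/i; lia.
      by rewrite mulr_ge0 // ?ler0n; case/andP: hs.
    rewrite -truncn_ge_nat; first by rewrite -/j; lia.
    by rewrite mulr_ge0 // ?ler0n; case/andP: ht.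
  rewrite -er -[c * _]/(f r); apply: imin_le => //.
  by rewrite (min_idPl st) (max_idPr st).
move=> hx hy; rewrite exc_deltaE.
have -> : imin f x y = c * (md H (Num.truncn (n%:R * x)) (Num.truncn (n%:R * y)))%:~R.
  have [h|h] := leP x y; first exact: main.
  by rewrite iminC mdC; apply: main => //; exact: ltW.
rewrite /tdist /f /stepf !(rmorphD, rmorphN, rmorphM) /=; ring.
Qed.

End StepTree.

Section Isometry.
Variables (R : realType) (F : pms R -> R).
Hypothesis cF : bounded_cont_GH F.
Variable m : nat.
Hypothesis m0 : (0 < m)%N.
Let n := m.*2.
Variable c : R.
Hypothesis c0 : 0 <= c.

Definition treeval (v : seq bool) (k : nat) : R :=
  F (tree_space (stepf n (fun i => c * (hts v i)%:~R)) (k%:R / n%:R)).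

Section OneWord.
Variable w : n.-tuple bool.
Hypothesis bw : w \in balanced m.
Let sw : size w = n := size_tuple w.
Let bal : count id w = count negb w := count_balanced m0 bw.
Let n0 : (0 < size w)%N. Proof. by rewrite size_tuple /n double_gt0. Qed.
Let nn0 : (0 < n)%N. Proof. by rewrite /n double_gt0. Qed.
Let cm : count negb w = m.
Proof. by rewrite -bal; move: bw; rewrite inE => /eqP. Qed.

Lemma tdist_rootword i j : (i <= n)%N -> (j <= n)%N ->
  tdist (hts (rootword w)) i j = ndist w i j.
Proof.
move=> hi hj; rewrite /ndist sw.
have mde x y : (x <= n)%N -> (y <= n)%N ->
    tdist (hts (rootword w)) x y = tdist (reroot (wht w) n) x y.
  move=> xn yn; rewrite /tdist /md !hts_rootword //; congr (_ - 2 * _).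
  rewrite (@eq_mn _ (reroot (wht w) n) (minn x y) (minn x y) _ 0) ?addr0 // => r hr.
  by rewrite addr0 hts_rootword //; lia.
have E x y : (x <= n)%N -> (y <= n)%N ->
    tdist (reroot (wht w) n) x y = tdist (reroot (wht w) n) (x %% n) y.
  move=> xn yn; move: xn; rewrite leq_eqVlt => /orP[/eqP ->|/modn_small -> //].
  have D0 := D_0 w; have Dn := D_n bal n0; have Dp := @D_ge0 w bal n0.
  rewrite sw in D0 Dn Dp; rewrite modnn tdistC !tdist_le // /ldist D0 Dn subn0.
  have m1 : mn (reroot (wht w) n) y (n - y) = 0.
    apply/eqP; rewrite eq_le; apply/andP; split.
      by have := mn_le (reroot (wht w) n) y (leqnn (n - y)); rewrite subnKC // Dn.
    by apply/mn_geP => r hr; apply: Dp; lia.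
  have m2 : mn (reroot (wht w) n) 0 y = 0.
    apply/eqP; rewrite eq_le; apply/andP; split.
      by have := mn_le (reroot (wht w) n) 0 (leq0n y); rewrite addn0 D0.
    by apply/mn_geP => r hr; apply: Dp; lia.
  rewrite m1 m2; lia.
rewrite mde // E // tdistC E //; last by rewrite ltnW // ltn_mod.
by rewrite tdistC.
Qed.

(** The point [x] of the interval goes to the vertex occupied at time [floor (n x)] modulo [n]; this
    preserves distances, meets every vertex, and sends the first argmin to the extra vertex. *)
Lemma F_bdg_treeval a :
  F (bdg_space c [seq x + a | x <- wlabels w]) = treeval (rootword w) (rootpt m0 w).
Proof.
set L := map _ _; pose V := wvert w.
have sL : size L = m by rewrite /L size_L cm.
have Vm t : (V t < (size L).+1)%N by rewrite ltnS sL -cm; exact: V_le.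
have dV s t : (s < n)%N -> (t < n)%N -> (bdg_dist L (V s) (V t))%:R = (ndist w s t)%:~R :> R.
  move=> sn tn; rewrite -sw in sn tn.
  by rewrite /ndist !modn_small // -(bdg_distE bal n0 a sn tn).
have surj (u : 'I_(size L).+1) : exists2 t, (t < n)%N & V t = u.
  have [|t et] := V_surj bal n0 (v := u); first by rewrite cm -sL -ltnS.
  exists (t %% n)%N; first by rewrite ltn_mod.
  by have := V_mod bal n0 t; rewrite sw /V et.
have psB : is_pseudometric (fun u v : 'I_(size L).+1 => c * (bdg_dist L u v)%:R).
  split; [|split].
  - by move=> u; have [t tn <-] := surj u; rewrite dV // /ndist tdist0 mulr0.
  - move=> u v; have [t tn <-] := surj u; have [s sn <-] := surj v.
    by rewrite !dV // ndistC.
  - move=> x y z; have [t tn <-] := surj x; have [s sn <-] := surj y.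
    have [r rn <-] := surj z; rewrite !dV // -mulrDr ler_wpM2l // -intrD ler_int.
    exact: tdist_triangle.
have cB : compact_pms (bdg_space c L).
  apply: (@compact_finite _ _ _ _ _ id) => // u v ->; by case: psB.
pose f := stepf n (fun i => c * (hts (rootword w) i)%:~R).
have [_ cT] : codes f by exact: stepf_codes.
apply/esym/(GH_invariant cF) => //.
pose pi (x : unit_itv R) : 'I_(size L).+1 := Ordinal (Vm (Num.truncn (n%:R * sval x) %% n)%N).
apply: (@ghd_pullback _ _ _ _ _ _ _ pi) => //.
- move=> [x hx] [y hy] /=; rewrite dV ?ltn_mod // exc_delta_stepf //.
  have xn := truncn01 n hx; have yn := truncn01 n hy; rewrite !ltnS in xn yn.
  by rewrite tdist_rootword // /ndist sw !modn_mod.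
- rewrite /pi clamp01K /=; last first.
    rewrite divr_ge0 ?ler0n //= ler_pdivrMr ?ltr0n // mul1r ler_nat.
    by rewrite ltnW // ltn_ord.
  rewrite mulrCA divff ?pnatr_eq0 -?lt0n // mulr1 natrK modn_small //.
  have e : V (rootpt m0 w) = size L.
    by have := V_argmin bal n0; rewrite sw -(rootptE m0 bw) sL cm.
  by have := dV _ _ (ltn_ord (rootpt m0 w)) (ltn_ord (rootpt m0 w)); rewrite e /ndist tdist0 => ->; rewrite mulr0.
- move=> u; have [t tn e] := surj u.
  have ht : 0 <= (t%:R / n%:R : R) <= 1.
    by rewrite divr_ge0 ?ler0n //= ler_pdivrMr ?ltr0n // mul1r ler_nat ltnW.
  exists (exist (fun x : R => is_true (0 <= x <= 1)) _ ht); rewrite /= mulrCA divff ?pnatr_eq0 -?lt0n // mulr1 natrK modn_small //.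
  by rewrite -e dV // /ndist tdist0 mulr0.
Qed.

End OneWord.

Let nn0 : (0 < n)%N. Proof. by rewrite /n double_gt0. Qed.

Definition rot1 (w : n.-tuple bool) : n.-tuple bool := [tuple of rot 1 w].

Lemma rot1_balanced w : (rot1 w \in balanced m) = (w \in balanced m).
Proof. by rewrite !inE /= count_rot1. Qed.

(** Shifting time by one is an isometry between the two coded trees, and the vertices marked by the
    two argmins correspond, both being at the global minimum of the heights. *)
Lemma bdg_rot_invariant w : w \in balanced m ->
  treeval (rootword (rot1 w)) (rootpt m0 (rot1 w)) = treeval (rootword w) (rootpt m0 w).
Proof.
move=> bw; have bw' : rot1 w \in balanced m by rewrite rot1_balanced.
have bal := count_balanced m0 bw; have bal' := count_balanced m0 bw'.
have n0 : (0 < size w)%N by rewrite size_tuple.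
have n0' : (0 < size (rot1 w))%N by rewrite size_tuple.
pose f := stepf n (fun i => c * (hts (rootword w) i)%:~R).
pose f' := stepf n (fun i => c * (hts (rootword (rot1 w)) i)%:~R).
have [bf cT] : codes f by exact: stepf_codes.
have [bf' cT'] : codes f' by exact: stepf_codes.
rewrite /treeval -/f -/f'; apply: (GH_invariant cF) => //.
have hk (k : nat) : (k <= n)%N -> 0 <= (k%:R / n%:R : R) <= 1.
  by move=> h; rewrite divr_ge0 ?ler0n //= ler_pdivrMr ?ltr0n // mul1r ler_nat.
have tk (k : nat) : Num.truncn (n%:R * (k%:R / n%:R) : R) = k.
  by rewrite mulrCA divff ?pnatr_eq0 -?lt0n // mulr1 natrK.
pose pi (x : unit_itv R) : unit_itv R :=
  exist (fun x : R => is_true (0 <= x <= 1)) _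
    (hk _ (ltnW (ltn_pmod (Num.truncn (n%:R * sval x)).+1 nn0))).
have dE (u : n.-tuple bool) (bu : u \in balanced m) (x y : R) : 0 <= x <= 1 -> 0 <= y <= 1 ->
   exc_delta (stepf n (fun i => c * (hts (rootword u) i)%:~R)) x y =
   c * (ndist u (Num.truncn (n%:R * x)) (Num.truncn (n%:R * y)))%:~R.
  move=> hx hy; rewrite exc_delta_stepf // tdist_rootword //.
    by have := truncn01 n hx; rewrite ltnS.
  by have := truncn01 n hy; rewrite ltnS.
apply: (@ghd_pullback _ _ _ _ _ _ _ pi); first exact: exc_pseudometric.
- move=> [x hx] [y hy]; rewrite /= dE //; [|exact: (hk _ (ltnW (ltn_pmod _ nn0)))..].
  by rewrite !tk [RHS]dE // ndist_rot1 // /ndist size_tuple !modn_mod.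
- have hr (u : n.-tuple bool) : 0 <= ((rootpt m0 u)%:R / n%:R : R) <= 1.
    by exact: (hk _ (ltnW (ltn_ord _))).
  have pv x : sval (pi x) = ((Num.truncn (n%:R * sval x)).+1 %% n)%:R / n%:R by [].
  have h1 := clamp01K (hr (rot1 w)); have h2 := clamp01K (hr w).
  rewrite pv h1 h2 tk dE //; last by exact: (hk _ (ltnW (ltn_pmod _ nn0))).
  rewrite !tk; suff -> : ndist w ((rootpt m0 (rot1 w)).+1 %% n) (rootpt m0 w) = 0 by rewrite mulr0.
  apply: (V_inj0 bal n0).
  have hV (u : n.-tuple bool) (bu : u \in balanced m) : wvert u (rootpt m0 u) = count negb u.
    have := @V_argmin u (count_balanced m0 bu); rewrite size_tuple -(rootptE m0 bu).
    by apply.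
  rewrite hV //; have e1 : forall t, wvert w (t %% n)%N = wvert w t.
    by move=> t; have := V_mod bal n0 t; rewrite size_tuple.
  rewrite e1; apply: V_none => // t' ht' ft' e.
  have [_ bk _] := argminP (b_0 (rot1 w)) (b_n bal' n0').
  rewrite size_tuple -(rootptE m0 bw') in bk.
  have := @mn_le (wht (rot1 w)) 0 n (t' %% n).
  have := b_mod bal' n0' t'; rewrite size_tuple add0n => -> /(_ (ltnW (ltn_pmod _ nn0))).
  have hb := b_S w t'; rewrite (negbTE ft') /wsg in hb.
  by rewrite -bk !wht_rot1 // hb -e; lia.
- move=> [y hy]; pose j := Num.truncn (n%:R * y).
  have jn : (j <= n)%N by have := truncn01 n hy; rewrite ltnS.
  pose i := ((j + n.-1) %% n)%N.
  have hi := hk i (ltnW (ltn_pmod _ nn0)).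
  exists (exist (fun x : R => is_true (0 <= x <= 1)) _ hi); rewrite /= tk dE //; last by exact: (hk _ (ltnW (ltn_pmod _ nn0))).
  rewrite tk /ndist size_tuple modn_mod -/j /i -addn1 modnDml -addnA addn1 prednK // modnDr.
  by rewrite tdist0 mulr0.
Qed.

Lemma sum_rot1 (G : n.-tuple bool -> R) :
  \sum_(w in balanced m) G (rot1 w) = \sum_(w in balanced m) G w.
Proof.
rewrite [RHS](reindex_inj (h := rot1)) /=; last first.
  by move=> u v /(congr1 val) /= /rot_inj /val_inj.
by apply: eq_bigl => w; rewrite rot1_balanced.
Qed.

(** Labels around a black vertex start at a white corner, that is with a down-step. By rotation
    invariance this conditioning does not change the average: the down-step may be placed at any of
    the [2 m] positions, and each word has [m] of them, whence the factor 2. *)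
Lemma sum_bdg_pointed (a : R) :
  2 * \sum_(w in balanced m | ~~ nth true w 0) F (bdg_space c [seq x + 0 | x <- wlabels w]) =
  \sum_(v : n.-tuple bool | dyck v)
    \sum_(k < n | (k == 0%N :> nat) || nth false v k.-1) treeval v k.
Proof.
pose Q w := treeval (rootword w) (rootpt m0 w).
have e1 : \sum_(w in balanced m | ~~ nth true w 0) F (bdg_space c [seq x + 0 | x <- wlabels w])
   = \sum_(w in balanced m) Q w * (~~ nth true w 0)%:R.
  rewrite [LHS]big_mkcondr /=; apply: eq_bigr => w bw; rewrite F_bdg_treeval // -/(Q w).
  by case: (nth _ _ _); rewrite ?mulr0 ?mulr1.
have e2 j : (j < n)%N -> \sum_(w in balanced m) Q w * (~~ nth true w j)%:R =
    \sum_(w in balanced m) Q w * (~~ nth true w 0)%:R.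
  elim: j => // j IH jn; rewrite -IH; last exact: ltnW.
  rewrite -[RHS]sum_rot1; apply: eq_bigr => w bw; rewrite /Q bdg_rot_invariant //.
  congr (_ * (~~ _)%:R); rewrite /= ; have := size_tuple w; case: (tval w) => [|x s] /= e.
    by move: jn; rewrite /n -e.
  by rewrite rot1_cons nth_rcons ifT //; lia.
have e3 : n%:R * \sum_(w in balanced m) Q w * (~~ nth true w 0)%:R =
    m%:R * \sum_(w in balanced m) Q w.
  rewrite mulr_natl -[n in _ *+ n]card_ord -sumr_const.
  rewrite (eq_bigr (fun j : 'I_n => \sum_(w in balanced m) Q w * (~~ nth true w j)%:R)); last first.
    by move=> j _; rewrite e2.
  rewrite exchange_big mulr_sumr /=; apply: eq_bigr => w bw; rewrite -mulr_sumr mulrC.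
  congr (_ * _); rewrite -natr_sum; congr (_%:R).
  transitivity (count negb w); last by rewrite -(count_balanced m0 bw); move: bw; rewrite inE => /eqP.
  rewrite -sum1_count (big_nth true) size_tuple big_mkord [RHS]big_mkcond /=.
  by apply: eq_bigr => i _; case: (nth _ _ _).
rewrite -(sum_rootpair m0 treeval) -/(Q _) e1.
have mR : m%:R != 0 :> R by rewrite pnatr_eq0 -lt0n.
apply: (mulfI mR); have nE : n%:R = m%:R + m%:R :> R by rewrite -natrD addnn.
by rewrite -[RHS]e3 nE; ring.
Qed.

End Isometry.

(** * Labels around the vertex of maximal degree *)

Definition stepsum (w : seq bool) : int := \sum_(x <- w) wsg x.

Lemma stepsum_cons a w : stepsum (a :: w) = wsg a + stepsum w.
Proof. by rewrite /stepsum big_cons. Qed.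

Lemma stepsum_nil : stepsum [::] = 0.
Proof. by rewrite /stepsum big_nil. Qed.

Fixpoint heightlabels (h : int) (w : seq bool) : seq int :=
  if w is a :: w' then
    if a then heightlabels (h + 1) w' else h :: heightlabels (h - 1) w'
  else [::].

Lemma wlabels_heightlabels w : wlabels w = heightlabels 0 w.
Proof.
have H : forall (s : seq bool) (h : int), heightlabels h s =
    [seq h + hts s t | t <- iota 0 (size s) & ~~ nth true s t].
  elim=> [|a s IH] h //=.
  have e (h' : int) : h' = h + wsg a -> heightlabels h' s =
      [seq h + hts (a :: s) t | t <- iota 1 (size s) & ~~ nth true (a :: s) t].
    move=> ->; rewrite IH -(addn0 1%N) iotaDl filter_map -map_comp.
    by apply: eq_map => t /=; rewrite add1n hts_cons addrA.
  by case: a e => e; [rewrite (e (h + 1))|rewrite /= hts0 addr0 (e (h - 1))].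
rewrite H /wlabels; have -> : [seq t <- iota 0 (size w) | ~~ wst w t] =
    [seq t <- iota 0 (size w) | ~~ nth true w t].
  by apply: eq_in_filter => t; rewrite mem_iota => ht; rewrite /wst modn_small.
apply/eq_in_map => t; rewrite mem_filter mem_iota => /andP[_ ht].
rewrite add0r /wht /hts; apply: eq_bigr => j _; congr wsg.
by rewrite /wst modn_small //; have := ltn_ord j; lia.
Qed.

(** The walk stands at height [h], as if it had just left a corner labeled [h + 1]; the first label
    then obeys the same inequality as the others. *)
Definition oklabels (h : int) (ls : seq int) (e : int) :=
  path (fun x y : int => x - 1 <= y) (h + 1) (rcons ls e).

(** Inverse of [heightlabels]: climb to the next label, take the down-step that records it, and
    finally climb to the end height [e]. *)
Fixpoint wordof (h : int) (ls : seq int) (e : int) : seq bool :=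
  if ls is x :: ls' then nseq `|x - h| true ++ false :: wordof (x - 1) ls' e
  else nseq `|e - h| true.

Lemma heightlabels_ok h w : oklabels h (heightlabels h w) (h + stepsum w).
Proof.
elim: w h => [|[] w IH] h.
- by rewrite /oklabels stepsum_nil /= andbT; lia.
- have := IH (h + 1); rewrite stepsum_cons /oklabels addrA [heightlabels _ (true :: _)]/=.
  case: (heightlabels _ _) => [|x s] /= /andP[h1 h2]; apply/andP; split=> //; move: h1; rewrite /wsg; lia.
- have := IH (h - 1); rewrite stepsum_cons /oklabels addrA subrK /=.
  by move=> h1; apply/andP; split=> //; lia.
Qed.

Lemma wordofK h w : wordof h (heightlabels h w) (h + stepsum w) = w.
Proof.
elim: w h => [|[] w IH] h.
- by rewrite stepsum_nil /= addr0 subrr.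
- have := heightlabels_ok (h + 1) w; have := IH (h + 1).
  rewrite stepsum_cons addrA [wsg true]/= /oklabels [heightlabels _ (true :: _)]/=.
  case: (heightlabels _ _) => [|x s] /= e /andP[h1 _]; rewrite -[in RHS]e.
    by have -> : absz (h + 1 + stepsum w - h)%R = (absz (h + 1 + stepsum w - (h + 1))%R).+1 by lia.
  by have -> : absz (x - h)%R = (absz (x - (h + 1))%R).+1 by lia.
- by rewrite stepsum_cons addrA /= subrr /= IH.
Qed.

Lemma heightlabels_nseq h k w : heightlabels h (nseq k true ++ w) = heightlabels (h + k%:Z) w.
Proof. by elim: k h => [|k IH] h /=; [rewrite addr0|rewrite IH; congr heightlabels; lia]. Qed.

Lemma stepsum_nseq k w : stepsum (nseq k true ++ w) = k%:Z + stepsum w.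
Proof.
elim: k => [|k IH]; first by rewrite add0r.
by rewrite [nseq k.+1 _ ++ _]/= stepsum_cons IH /wsg; lia.
Qed.

Lemma heightlabelsK h ls e : oklabels h ls e -> heightlabels h (wordof h ls e) = ls.
Proof.
elim: ls h => [|x s IH] h; rewrite /oklabels /= => /andP[h1 h2].
  by rewrite -[nseq _ _]cats0 heightlabels_nseq.
rewrite heightlabels_nseq (_ : h + _ = x) /=; last lia.
by rewrite IH // /oklabels subrK.
Qed.

Lemma stepsum_wordof h ls e : oklabels h ls e -> stepsum (wordof h ls e) = e - h.
Proof.
elim: ls h => [|x s IH] h; rewrite /oklabels /= => /andP[h1 h2].
  by rewrite -[nseq _ _]cats0 stepsum_nseq stepsum_nil; lia.
rewrite stepsum_nseq stepsum_cons IH /oklabels ?subrK //.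
by rewrite /wsg; lia.
Qed.

Lemma size_heightlabels h w : size (heightlabels h w) = count negb w.
Proof. by elim: w h => [|[] w IH] h //=; rewrite IH. Qed.

Lemma stepsum_count w : stepsum w = (count id w)%:Z - (count negb w)%:Z.
Proof.
elim: w => [|x s IH]; first by rewrite stepsum_nil.
by rewrite stepsum_cons IH /=; case: x => /=; rewrite /wsg; lia.
Qed.

Lemma count_idN_tuple n (w : n.-tuple bool) : (count id w + count negb w = n)%N.
Proof. by rewrite count_idN size_tuple. Qed.

Definition headfalse d := [seq w : d.*2.-tuple bool <- enum (balanced d) | ~~ nth true w 0].
(** Labels of the children of a black vertex of degree [d], relative to its parent. The parent's own
    label is the leading 0, which [behead] removes. *)
Definition bridges d : seq (seq int) := [seq behead (wlabels w) | w : d.*2.-tuple bool <- headfalse d].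

Lemma mem_headfalse d w : (w \in headfalse d) = ~~ nth true w 0 && (w \in balanced d).
Proof. by rewrite mem_filter mem_enum. Qed.

Lemma wlabels_cons (w : seq bool) : ~~ nth true w 0 -> wlabels w = 0 :: behead (wlabels w).
Proof. by rewrite wlabels_heightlabels; case: w => [|[] w]. Qed.

Lemma uniq_bridges d : uniq (bridges d).
Proof.
rewrite map_inj_in_uniq; first by rewrite filter_uniq // enum_uniq.
move=> u v; rewrite !mem_headfalse => /andP[hu bu] /andP[hv bv] e.
have {}e : wlabels u = wlabels v by rewrite (wlabels_cons hu) (wlabels_cons hv) e.
have s0 (x : d.*2.-tuple bool) : x \in balanced d -> stepsum x = 0.
  rewrite inE stepsum_count => /eqP bx; have := count_idN_tuple x; rewrite bx -[in RHS]addnn; lia.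
apply: val_inj; rewrite /= -(wordofK 0 u) -(wordofK 0 v) (s0 _ bu) (s0 _ bv).
by rewrite -!wlabels_heightlabels e.
Qed.

Lemma mem_bridges d b : (0 < d)%N ->
  (b \in bridges d) = (size b == d.-1) && cyc_ok 0 b.
Proof.
move=> d0; have okc c : oklabels 0 (0 :: c) 0 = cyc_ok 0 c.
  by rewrite -[oklabels _ _ _]/((0 + 1 - 1 <= (0 : int)) && cyc_ok 0 c) addrK lexx.
apply/mapP/andP => [[w]|[/eqP sb]].
  rewrite mem_headfalse => /andP[hw bw] ->.
  have e := wlabels_cons hw; move: bw; rewrite inE => /eqP bw.
  have cn : count negb w = d by apply: (@addnI d); rewrite -{1}bw count_idN_tuple addnn.
  have st : stepsum w = 0 by rewrite stepsum_count bw cn subrr.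
  have := heightlabels_ok 0 w; have := size_heightlabels 0 w.
  rewrite -wlabels_heightlabels st addr0 e okc cn /= => e1 ok.
  by split=> //; apply/eqP; lia.
rewrite -(okc b) => ok; have := stepsum_wordof ok; have := heightlabelsK ok.
move: (wordof 0 _ 0) => w hl; rewrite stepsum_count subrr => e2.
have := size_heightlabels 0 w; rewrite hl /= sb prednK // => e1.
have e3 : count id w = d by lia.
have sw : size w == d.*2 by have := count_idN w; rewrite -addnn; lia.
exists (Tuple sw); last by rewrite wlabels_heightlabels hl.
rewrite mem_headfalse inE /= e3 eqxx andbT.
case: (w) hl => [|[] s] //= hl; have := heightlabels_ok (0 + 1) s.
by rewrite hl.
Qed.

Fixpoint prodlist (T : Type) (As : seq (seq T)) : seq (seq T) :=
  if As is A :: As' then [seq a :: r | a <- A, r <- prodlist As'] else [:: [::]].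

Lemma prodlist_cat (T : Type) (A B : seq (seq T)) :
  prodlist (A ++ B) = [seq u ++ v | u <- prodlist A, v <- prodlist B].
Proof.
elim: A => [|a A IH] /=; first by rewrite cats0 map_id.
rewrite IH; elim: a => //= x a IHa; rewrite IHa map_cat flatten_cat; congr (_ ++ _).
by elim: (prodlist A) => //= u s IHs; rewrite map_cat IHs -map_comp.
Qed.

Lemma uniq_prodlist (T : eqType) (As : seq (seq T)) : all uniq As -> uniq (prodlist As).
Proof.
elim: As => //= A As IH /andP[uA /IH uAs].
by apply: allpairs_uniq => // -[a r] [a' r'] _ _ /= [-> ->].
Qed.

Lemma sum_prodlist_nth (V : nmodType) (T : Type) (x0 : T) (As : seq (seq T)) k (G : T -> V) :
  (k < size As)%N -> exists N : nat,
  \sum_(r <- prodlist As) G (nth x0 r k) = (\sum_(a <- nth [::] As k) G a) *+ N.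
Proof.
elim: As k => // A As IH [|k] /= ks.
  exists (size (prodlist As)); rewrite big_allpairs_dep /=.
  by rewrite -sumrMnl; apply: eq_bigr => a _; rewrite big_const_seq count_predT iter_addr_0.
have [N hN] := IH k ks; exists (N * size A)%N.
rewrite big_allpairs_dep /= hN big_const_seq count_predT iter_addr_0 mulrnA //.
Qed.

(** The argument [l] is the vertex's own label if it is white and the label of its parent if it is
    black. Randomness enters only at black vertices, through one bridge each. *)
Fixpoint labelings (black : bool) (l : int) (t : ptree) : seq ltree :=
  let: PNode cs := t in
  flatten [seq [seq LNode (if black then 0 else l) fs |
     fs <- (fix F cs ls := match cs with
        | [::] => [:: [::]]
        | c :: cs' => [seq x :: r | x <- labelings (~~ black) (head 0 ls) c, r <- F cs' (behead ls)]
        end) cs ls]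
   | ls <- if black then [seq [seq x + l | x <- b] | b <- bridges (size cs).+1] else [:: nseq (size cs) l]].

(** The inner recursion of [labelings] under its own name, so that statements about forests can be
    made. *)
Fixpoint flabelings (black : bool) (ls : seq int) (cs : seq ptree) : seq (seq ltree) :=
  match cs with
  | [::] => [:: [::]]
  | c :: cs' => [seq x :: r | x <- labelings black (head 0 ls) c, r <- flabelings black (behead ls) cs']
  end.

Lemma labelingsE black l cs : labelings black l (PNode cs) =
  flatten [seq [seq LNode (if black then 0 else l) fs | fs <- flabelings (~~ black) ls cs]
   | ls <- if black then [seq [seq x + l | x <- b] | b <- bridges (size cs).+1] else [:: nseq (size cs) l]].
Proof.
rewrite /=; congr flatten; apply: eq_map => ls; congr map.
by elim: cs ls => //= c cs IH ls; rewrite IH.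
Qed.

Lemma map_subrK (l : int) s : [seq x + l | x <- [seq y - l | y <- s]] = s.
Proof. by elim: s => //= x s ->; rewrite subrK. Qed.

Lemma map_addrK (l : int) s : [seq x - l | x <- [seq y + l | y <- s]] = s.
Proof. by elim: s => //= x s ->; rewrite addrK. Qed.

Lemma cyc_ok_shift a (l : int) b : cyc_ok (a + l) [seq x + l | x <- b] = cyc_ok a b.
Proof.
rewrite /cyc_ok -(map_rcons (fun x => x + l)).
elim: (rcons b a) {1 3}a => //= x s IH c; rewrite IH; congr (_ && _); lia.
Qed.

Lemma adm_white p q t : adm false p t = adm false q t.
Proof. by case: t => l cs; rewrite !admE. Qed.

Lemma blacks_white p q t : blacks false p t = blacks false q t.
Proof. by case: t => l cs; rewrite !blacksE. Qed.

Lemma mem_labelings black l t x : (x \in labelings black l t) =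
  [&& shape x == t, adm black l x & black || (lab x == l)].
Proof.
move: t black l x; refine (@ptree_forest_ind (fun t => forall (black : bool) (l : int) x,
    (x \in labelings black l t) =
    [&& shape x == t, adm black l x & black || (lab x == l)]) (fun cs => forall (black : bool) (ls : seq int) (q : int) fs,
    size ls = size cs -> (black -> ls = nseq (size cs) q) ->
    (fs \in flabelings black ls cs) =
    [&& map shape fs == cs, all (adm black q) fs & black || (map lab fs == ls)]) _ _ _).
- move=> cs IH black l [l' fs]; rewrite labelingsE shapeE admE.
  have eqs : (PNode (map shape fs) == PNode cs) = (map shape fs == cs).
    by apply/eqP/eqP => [[]|->].
  rewrite eqs; apply/flatten_mapP/idP.
    case: black => [[ls /mapP[b hb els] /mapP[fs' hfs [-> ->]]]|[ls]].
      move: hb; rewrite mem_bridges //= => /andP[/eqP sb okb].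
      have sl : size ls = size cs by rewrite els size_map.
      move: hfs; rewrite (IH _ _ 0) // => /and3P[/eqP <- -> /eqP ->]; rewrite !eqxx /=.
      by have := cyc_ok_shift 0 l b; rewrite add0r okb -els => ->.
    rewrite inE => /eqP -> /mapP[fs' hfs [-> ->]]; move: hfs.
    by rewrite (IH _ _ l) ?size_nseq // => /and3P[-> -> _]; rewrite /= eqxx.
  move=> /and3P[/eqP es]; case: black => /=.
    move=> /andP[/andP[/eqP -> okc] hadm] _; exists (map lab fs).
      apply/mapP; exists [seq y - l | y <- map lab fs].
        rewrite mem_bridges //= -es !size_map eqxx /= -(cyc_ok_shift 0 l) add0r map_subrK.
        by [].
      by rewrite map_subrK.
    apply/mapP; exists fs => //; rewrite (IH _ _ 0) //; last by rewrite -es !size_map.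
    by rewrite es eqxx hadm /= eqxx.
  move=> hadm /eqP el; rewrite /= in el; rewrite el in hadm *.
  exists (nseq (size cs) l); first by rewrite inE.
  apply/mapP; exists fs => //; rewrite (IH _ _ l) ?size_nseq //.
  by rewrite es eqxx hadm.
- move=> black [|? ?] // q fs _ _ /=; rewrite inE.
  by case: fs => //=; rewrite orbT.
move=> c cs IHc IHcs black [|a ls] // q fs [sl] hq; rewrite [flabelings _ _ _]/=.
have hq' : black -> a = q /\ ls = nseq (size cs) q by move=> /hq [].
apply/allpairsP/idP => [[[x r] /= [+ + ->]]|].
  rewrite IHc (IHcs _ _ q) //; last by move=> /hq' [].
  move=> /and3P[/eqP <- a1 a2] /and3P[/eqP <- b1 b2]; rewrite /= eqxx b1 /=.
  case: black hq' a1 a2 b1 b2 {hq} => hq' a1 a2 b1 b2 /=.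
    by have [<- _] := hq' isT; rewrite a1.
  by rewrite (adm_white q a) a1 /= (eqP a2) (eqP b2).
case: fs => [|x r]; first by [].
move=> /= /and3P[/eqP [e1 e2] /andP[a1 b1] h]; exists (x, r); split=> //=.
  rewrite IHc e1 eqxx /=; case: black hq' a1 b1 h {hq} => hq' a1 b1 h /=.
    by have [-> _] := hq' isT; rewrite a1.
  by rewrite (adm_white a q) a1 /=; case/eqP: h => -> _.
rewrite (IHcs _ _ q) //; last by move=> /hq' [].
by rewrite e2 eqxx b1 /=; case: black h {hq hq' a1 b1} => //= /eqP [_ ->].
Qed.

(** For black children [ls] repeats the label [q] of their common parent; for white children it
    lists their own labels. *)
Lemma mem_flabelings (black : bool) (ls : seq int) (q : int) (cs : seq ptree) (fs : seq ltree) :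
    size ls = size cs -> (black -> ls = nseq (size cs) q) ->
    (fs \in flabelings black ls cs) =
    [&& map shape fs == cs, all (adm black q) fs & black || (map lab fs == ls)].
Proof.
elim: cs ls fs => [|c cs IHcs] [|a ls] // fs.
  by move=> _ _ /=; rewrite inE; case: fs => //=; rewrite orbT.
move=> [sl] hq; rewrite [flabelings _ _ _]/=.
have hq' : black -> a = q /\ ls = nseq (size cs) q by move=> /hq [].
apply/allpairsP/idP => [[[x r] /= [+ + ->]]|].
  rewrite mem_labelings IHcs //; last by move=> /hq' [].
  move=> /and3P[/eqP <- a1 a2] /and3P[/eqP <- b1 b2]; rewrite /= eqxx b1 /=.
  case: black hq' a1 a2 b1 b2 {hq IHcs} => hq' a1 a2 b1 b2 /=.
    by have [<- _] := hq' isT; rewrite a1.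
  by rewrite (adm_white q a) a1 /= (eqP a2) (eqP b2).
case: fs => [|x r]; first by [].
move=> /= /and3P[/eqP [e1 e2] /andP[a1 b1] h]; exists (x, r); split=> //=.
  rewrite mem_labelings e1 eqxx /=; case: black hq' a1 b1 h {hq IHcs} => hq' a1 b1 h /=.
    by have [-> _] := hq' isT; rewrite a1.
  by rewrite (adm_white a q) a1 /=; case/eqP: h => -> _.
rewrite IHcs //; last by move=> /hq' [].
by rewrite e2 eqxx b1 /=; case: black h {hq hq' a1 b1 IHcs} => //= /eqP [_ ->].
Qed.

Definition rels black p t := [seq [seq x - b.1 | x <- b.2] | b <- blacks black p t].

Lemma relsE black p l cs : rels black p (LNode l cs) =
  (if black then [:: [seq x - p | x <- map lab cs]] else [::]) ++
  flatten (map (rels (~~ black) l) cs).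
Proof.
rewrite /rels blacksE map_cat map_flatten -map_comp; congr (_ ++ _).
by case: black.
Qed.

(** An admissible labeling amounts to a free choice of one bridge at each black vertex. This product
    structure is the independence used below. *)
Lemma rels_labelings black l t :
  [seq rels black l x | x <- labelings black l t] = prodlist (map bridges (pdegs black t)).
Proof.
move: t black l; refine (@ptree_forest_ind (fun t => forall (black : bool) (l : int),
    [seq rels black l x | x <- labelings black l t] = prodlist (map bridges (pdegs black t))) (fun cs => forall (black : bool) (ls : seq int) (q : int),
    (black -> ls = nseq (size cs) q) ->
    [seq flatten (map (rels black q) fs) | fs <- flabelings black ls cs] =
    prodlist (map bridges (flatten (map (pdegs black) cs)))) _ _ _).
- move=> cs IH black l; rewrite labelingsE pdegsE map_cat map_flatten -map_comp.
  case: black => /=.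
    congr flatten; rewrite -map_comp; apply/eq_in_map => b; rewrite mem_bridges // => /andP[/eqP sb _].
    have sl : size [seq x + l | x <- b] = size cs by rewrite size_map sb.
    rewrite -(IH false [seq x + l | x <- b] 0) //= -!map_comp; apply/eq_in_map => fs hfs.
    rewrite /= relsE /=; congr cons.
    have /and3P[_ _ /eqP ->] : [&& map shape fs == cs, all (adm false 0) fs & map lab fs == [seq x + l | x <- b]].
      by rewrite -mem_flabelings.
    by rewrite map_addrK.
  rewrite cats0 -(IH true (nseq (size cs) l) l) // -map_comp.
  by apply: eq_map => fs; rewrite /= relsE.
- by [].
move=> c cs IHc IHcs black ls q hq /=; rewrite map_cat prodlist_cat.
rewrite -(IHcs black (behead ls) q); last by move=> /hq ->.
rewrite -(IHc black q).
have e : black -> head 0 ls = q by move=> /hq ->.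
have e2 : [seq rels black q x | x <- labelings black (head 0 ls) c] =
    [seq rels black q x | x <- labelings black q c].
  case: black e {hq IHcs} => [-> //|_]; rewrite (IHc false q) -(IHc false (head 0 ls)).
  by apply: eq_map => x; rewrite /rels (blacks_white q (head 0 ls)).
rewrite -e2; elim: (labelings black (head 0 ls) c) => //= x s IHs.
by rewrite map_cat IHs -!map_comp.
Qed.

Lemma uniq_labelings l t : uniq (labelings false l t).
Proof.
apply: (@map_uniq _ _ (rels false l)); rewrite rels_labelings.
by apply: uniq_prodlist; apply/allP => _ /mapP[d _ ->]; exact: uniq_bridges.
Qed.

Lemma pdegs_gt0 black t d : d \in pdegs black t -> (0 < d)%N.
Proof.
move: t black; refine (@ptree_forest_ind (fun t => forall black : bool, d \in pdegs black t -> (0 < d)%N)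
   (fun cs => forall black : bool, d \in flatten (map (pdegs black) cs) -> (0 < d)%N) _ _ _).
- move=> cs IH black; rewrite pdegsE mem_cat => /orP[|]; last exact: IH.
  by case: black => //; rewrite inE => /eqP ->.
- by [].
- by move=> c cs IHc IHcs black; rewrite /= mem_cat => /orP[/IHc|/IHcs].
Qed.

Lemma tdeg_mem t : (0 < pnedges t)%N -> tdeg t \in pdegs false t.
Proof.
case: t => [[|[ds] cs]] // _; rewrite /tdeg.
have : pdegs false (PNode (PNode ds :: cs)) != [::] by rewrite pdegsE.
elim: (pdegs false _) => // a s IH _; rewrite big_cons inE.
case: s IH => [|b s] IH; first by rewrite big_nil maxn0 eqxx.
have := IH isT; set M := (\big[_/_]_(_ <- _) _)%N => h.
by rewrite /maxn; case: ifP => _; rewrite ?h ?eqxx ?orbT.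
Qed.

(* Given the shape, the labels around the first face of maximal degree form a
   uniform bridge: here for functions [G] that do not see the label of [s_0]. *)
Lemma sum_star_labels (V : nmodType) (G : seq int -> V) t :
  (forall a L, G [seq x + a | x <- L] = G L) -> (0 < pnedges t)%N ->
  exists N : nat, \sum_(x <- labelings false 0 t) G (star_labels x) =
    (\sum_(w : (tdeg t).*2.-tuple bool | (w \in balanced (tdeg t)) && ~~ nth true w 0)
       G (wlabels w)) *+ N.
Proof.
move=> hG t0; set k := index (tdeg t) (pdegs false t).
have kt : (k < size (pdegs false t))%N by rewrite index_mem tdeg_mem.
have ks : (k < size (map bridges (pdegs false t)))%N by rewrite size_map.
(* All coordinates but the [k]-th are summed out and leave only the multiplicity [N]. *)
have [N hN] := sum_prodlist_nth [::] (fun b => G (0 :: b)) ks.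
exists N; rewrite (nth_map 0%N) // nth_index ?tdeg_mem // in hN.
have -> : \sum_(w : (tdeg t).*2.-tuple bool | (w \in balanced (tdeg t)) && ~~ nth true w 0)
    G (wlabels w) = \sum_(b <- bridges (tdeg t)) G (0 :: b).
  rewrite big_map big_filter big_enum_cond /=.
  by apply: eq_bigr => w /andP[_ hw]; rewrite -wlabels_cons.
rewrite -hN -(rels_labelings false 0) big_map big_seq [RHS]big_seq; apply: eq_bigr => x.
rewrite mem_labelings => /and3P[/eqP sx _ _].
rewrite /star_labels; set bs := blacks _ _ _.
have szs : [seq (size b.2).+1 | b <- bs] = pdegs false t by rewrite blacks_pdegs sx.
have -> : (\max_(b <- bs) (size b.2).+1 = tdeg t)%N by rewrite /tdeg -szs big_map.
have -> : find (fun b : int * seq int => (size b.2).+1 == tdeg t) bs = k.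
  by rewrite /k /index -szs find_map; apply: eq_find.
have kbs : (k < size bs)%N by move: kt; rewrite -szs size_map.
rewrite /rels -/bs (nth_map (0, [::])) //.
case: (nth _ bs k) => p ls /=; rewrite -(hG (- p) (p :: ls)) /= subrr.
by [].
Qed.

(** * Local limit theorem *)

Section LocalLimit.
Variable R : realType.

(* [bw j z]: probability that a simple random walk is at 2z at time 2j. *)
Definition bw (j z : nat) : R := (binc j z)%:R / 4 ^+ j.

Lemma bw_ge0 j z : 0 <= bw j z.
Proof. by rewrite divr_ge0 ?ler0n // exprn_ge0. Qed.

Lemma bw_gt j z : (j < z)%N -> bw j z = 0.
Proof. by move=> jz; rewrite /bw /binc bin_small ?mul0r //=; lia. Qed.

Lemma bw00 : bw 0 0 = 1.
Proof. by rewrite /bw /binc /= expr0 divr1. Qed.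

Lemma bwS j z : (z <= j)%N -> bw j z.+1 = bw j z * ((j%:R - z%:R) / (j%:R + z%:R + 1)).
Proof.
move=> zj; have := mul_bin_left (j + j) (j + z).
have -> : (j + j - (j + z) = j - z)%N by lia.
move=> /(congr1 (fun x => x%:R : R)); rewrite !natrM natrB // -natr1 natrD => h.
have p : j%:R + z%:R + 1 != 0 :> R by rewrite -natrD natr1 pnatr_eq0.
rewrite /bw /binc /= addnS.
have -> : ('C(j + j, (j + z).+1))%:R = ('C(j + j, j + z))%:R * ((j%:R - z%:R) / (j%:R + z%:R + 1)) :> R.
  by apply: (mulfI p); rewrite h; field.
by rewrite mulrAC.
Qed.

Lemma bwS0 j : bw j.+1 0 = bw j 0 * ((2 * j%:R + 1) / (2 * j%:R + 2)).
Proof.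
rewrite /bw /binc /= !addn0.
have h1 := mul_bin_down (j + j).+1 j; have h2 := mul_bin_diag (j + j).+2 j.
have e : ((j + j).+1 - j = j.+1)%N by lia.
rewrite e /= in h1 h2.
have {}h1 : (j%:R + j%:R + 1) * ('C(j + j, j))%:R = (j%:R + 1) * ('C((j + j).+1, j))%:R :> R.
  by rewrite -natrD !natr1 -!natrM h1.
have {}h2 : (j%:R + j%:R + 2) * ('C((j + j).+1, j))%:R = (j%:R + 1) * ('C((j + j).+2, j.+1))%:R :> R.
  by rewrite -natrD -natrD natr1 -!natrM -h2 addn2.
have p : 0 <= j%:R :> R by [].
have p1 : (j%:R + 1) != 0 :> R by rewrite natr1 pnatr_eq0.
have -> : (j.+1 + j.+1 = (j + j).+2)%N by lia.
have -> : ('C((j + j).+2, j.+1))%:R = (j%:R + j%:R + 2) * ((j%:R + j%:R + 1) * ('C(j + j, j))%:R / (j%:R + 1)) / (j%:R + 1) :> R.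
  by apply: (mulfI p1); rewrite -h2 h1; field.
rewrite exprS; have p4 : 4 ^+ j != 0 :> R by rewrite expf_neq0 // pnatr_eq0.
have p2 : 2 * j%:R + 2 != 0 :> R by rewrite gt_eqF //; lra.
by field; rewrite p4 p1 p2.
Qed.

(** Each ratio of consecutive binomials is [1 - (2 z + 1) / (j + z + 1)], at most the exponential of
    [- (2 z + 1) / (j + Z)], and the odd numbers add up to [z^2]. [bw_lower] is the same computation
    with [j - Z]. *)
Lemma bw_upper j z Z : (0 < j)%N -> (z <= Z)%N -> (Z <= j)%N ->
  bw j z <= bw j 0 * expR (- (z%:R ^+ 2 / (j%:R + Z%:R))).
Proof.
move=> j0; elim: z => [|z IH] zZ Zj; first by rewrite expr0n /= mul0r oppr0 expR0 mulr1.
have j0R : 0 < j%:R :> R by rewrite ltr0n.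
have zZR : z%:R + 1 <= Z%:R :> R by rewrite natr1 ler_nat.
have z0R : 0 <= z%:R :> R by [].
rewrite bwS; last lia.
have pz : 0 < j%:R + z%:R + 1 :> R by lra.
have pZ : 0 < j%:R + Z%:R :> R by lra.
have e : (z.+1)%:R ^+ 2 / (j%:R + Z%:R) = z%:R ^+ 2 / (j%:R + Z%:R) + (2 * z%:R + 1) / (j%:R + Z%:R) :> R.
  by rewrite -natr1; field; rewrite gt_eqF.
rewrite e opprD expRD mulrA; apply: ler_pM => //; [exact: bw_ge0| | by apply: IH; lia|].
  apply: divr_ge0; last lra.
  by rewrite subr_ge0 ler_nat; lia.
apply: le_trans (expR_ge1Dx _).
have -> : (j%:R - z%:R) / (j%:R + z%:R + 1) = 1 - (2 * z%:R + 1) / (j%:R + z%:R + 1) :> R.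
  by field; rewrite gt_eqF.
rewrite lerD2l lerN2; apply: ler_pM; rewrite ?invr_ge0 ?lef_pV2 ?posrE; lra.
Qed.

Lemma bw_lower j z Z : (z <= Z)%N -> (Z < j)%N ->
  bw j 0 * expR (- (z%:R ^+ 2 / (j%:R - Z%:R))) <= bw j z.
Proof.
elim: z => [|z IH] zZ Zj; first by rewrite expr0n /= mul0r oppr0 expR0 mulr1.
have ZjR : Z%:R < j%:R :> R by rewrite ltr_nat.
have zZR : z%:R + 1 <= Z%:R :> R by rewrite natr1 ler_nat.
have z0R : 0 <= z%:R :> R by [].
rewrite bwS; last lia.
have pz : 0 < j%:R - z%:R :> R by lra.
have pZ : 0 < j%:R - Z%:R :> R by lra.
have e : (z.+1)%:R ^+ 2 / (j%:R - Z%:R) = z%:R ^+ 2 / (j%:R - Z%:R) + (2 * z%:R + 1) / (j%:R - Z%:R) :> R.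
  by rewrite -natr1; field; rewrite gt_eqF.
rewrite e opprD expRD mulrA; apply: ler_pM; [|exact: expR_ge0|by apply: IH; lia|].
  by rewrite mulr_ge0 ?bw_ge0 ?expR_ge0.
rewrite expRN -[leRHS]invrK lef_pV2 ?posrE ?expR_gt0 //; last by rewrite invr_gt0 divr_gt0 //; lra.
rewrite invf_div; apply: (@le_trans _ _ (expR ((2 * z%:R + 1) / (j%:R - z%:R)))).
  apply: le_trans (expR_ge1Dx _).
  rewrite le_eqVlt; apply/orP; left; apply/eqP; field; by rewrite gt_eqF.
have Zz : z%:R <= Z%:R :> R by lra.
rewrite ler_expR; apply: ler_pM; rewrite ?invr_ge0 ?lef_pV2 ?posrE; lra.
Qed.

(** Monotone and bounded, hence convergent: this replaces Stirling's formula. The limit is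
    identified afterwards from the total mass of the walk. *)
Definition cbw (j : nat) : R := bw j 0 * Num.sqrt j%:R.

Lemma cbw_ge0 j : 0 <= cbw j. Proof. by rewrite mulr_ge0 ?bw_ge0 ?sqrtr_ge0. Qed.

Lemma cbw_sqr j : cbw j ^+ 2 = bw j 0 ^+ 2 * j%:R.
Proof. by rewrite exprMn sqr_sqrtr. Qed.

(** The left side is nonincreasing in [j], one half of Wallis's argument; the other half is
    [cbw_nd]. *)
Lemma bw0_sqr_le j : bw j 0 ^+ 2 * (2 * j%:R + 1) <= 1.
Proof.
elim: j => [|j IH]; first by rewrite bw00 expr1n mulr0 add0r mulr1.
apply: le_trans IH; rewrite bwS0; move: (bw j 0) => x; rewrite exprMn -mulrA ler_wpM2l ?sqr_ge0 //.
have p : 0 <= j%:R :> R by [].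
rewrite expr_div_n -natr1 mulrAC ler_pdivrMr; last by rewrite exprn_gt0; lra.
nra.
Qed.

Lemma cbw_nd : nondecreasing_seq cbw.
Proof.
apply/nondecreasing_seqP => j; rewrite -ler_sqr ?nnegrE ?cbw_ge0 // !cbw_sqr bwS0.
move: (bw j 0) => x; rewrite exprMn -[leRHS]mulrA.
rewrite ler_wpM2l ?sqr_ge0 //.
have p : 0 <= j%:R :> R by [].
rewrite expr_div_n -natr1 mulrAC ler_pdivlMr; last by rewrite exprn_gt0; lra.
nra.
Qed.

Lemma cbw_le1 j : cbw j <= 1.
Proof.
rewrite -(@ler_sqr R) ?nnegrE ?cbw_ge0 // cbw_sqr expr1n; apply: le_trans (bw0_sqr_le j).
by rewrite ler_wpM2l ?sqr_ge0 //; have : 0 <= j%:R :> R by []; lra.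
Qed.

Lemma cbw_ge_half j : (0 < j)%N -> 1 / 2 <= cbw j.
Proof.
move=> j0; apply: le_trans (cbw_nd j0); rewrite /cbw bwS0 bw00 sqrtr1 mulr0 !add0r; lra.
Qed.

Lemma cbw_cvg : cbw n @[n --> \oo] --> sup (range cbw).
Proof.
apply: nondecreasing_cvgn; first exact: cbw_nd.
by exists 1 => _ [n _ <-]; exact: cbw_le1.
Qed.

Definition cbwoo : R := sup (range cbw).

Lemma bw_local (j z : nat -> nat) (zeta : R) : j k @[k --> \oo] --> \oo ->
  (z k)%:R / Num.sqrt (j k)%:R @[k --> \oo] --> zeta ->
  Num.sqrt (j k)%:R * bw (j k) (z k) @[k --> \oo] --> cbwoo * expR (- zeta ^+ 2).
Proof.
move=> jo zc.
have j0 : \forall k \near \oo, (0 < j k)%N by exact: (jo _ (nbhs_infty_gt 0)).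
have sjo : (Num.sqrt (j k)%:R)^-1 @[k --> \oo] --> (0 : R).
  apply/cvgrPdist_lt => e e0; near=> k; rewrite sub0r normrN ger0_norm ?invr_ge0 ?sqrtr_ge0 //.
  have jk0 : (0 < j k)%N by near: k.
  rewrite invf_plt ?posrE ?sqrtr_gt0 ?ltr0n // -ltr_sqr ?nnegrE ?sqrtr_ge0 ?invr_ge0 ?(ltW e0) // sqr_sqrtr //.
  have : (Num.truncn (e^-1 ^+ 2) < j k)%N by near: k; exact: (jo _ (nbhs_infty_gt _)).
  by rewrite -(@ler_nat R); apply: lt_le_trans; exact: truncnS_gt.
have zj : (z k)%:R / (j k)%:R @[k --> \oo] --> (0 : R).
  have h : (z k)%:R / Num.sqrt (j k)%:R * (Num.sqrt (j k)%:R)^-1 @[k --> \oo] --> zeta * 0 by apply: cvgM.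
  rewrite mulr0 in h; apply: cvg_trans h; apply: near_eq_cvg; near=> k.
  have jk0 : (0 < j k)%N by near: k.
  by rewrite /= -mulrA -invfM -expr2 sqr_sqrtr.
(* The values [s = 1] and [s = -1] are the upper and lower bounds for the binomial ratio, with
   [Z = z]; they squeeze it. *)
have ex (s : R) : expR (- ((z k)%:R ^+ 2 / ((j k)%:R + s * (z k)%:R))) @[k --> \oo] --> expR (- zeta ^+ 2).
  apply: continuous_cvg; first exact: continuous_expR.
  apply: cvgN; have -> : zeta ^+ 2 = zeta * zeta / (1 + s * 0) by rewrite mulr0 addr0 divr1.
  have h : (z k)%:R / Num.sqrt (j k)%:R * ((z k)%:R / Num.sqrt (j k)%:R) /
      (1 + s * ((z k)%:R / (j k)%:R)) @[k --> \oo] --> zeta * zeta / (1 + s * 0).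
    apply: cvgM; first exact: cvgM.
    apply: cvgV; first by rewrite mulr0 addr0 oner_neq0.
    by apply: cvgD; [exact: cvg_cst|apply: cvgM; [exact: cvg_cst|exact: zj]].
  apply: cvg_trans h.
  apply: near_eq_cvg; near=> k => /=.
  have jk0 : (0 < j k)%N by near: k.
  have jR : (j k)%:R != 0 :> R by rewrite pnatr_eq0 -lt0n.
  rewrite [in RHS](_ : (j k)%:R + s * (z k)%:R = (j k)%:R * (1 + s * ((z k)%:R / (j k)%:R))); last by field.
  rewrite invfM -[X in _ = _ * (X^-1 * _)]sqr_sqrtr //.
  by rewrite mulrACA -expr2 invfM; ring.
have exu := ex 1; have exl := ex (-1).
have ratio : bw (j k) (z k) / bw (j k) 0 @[k --> \oo] --> expR (- zeta ^+ 2).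
  apply: (squeeze_cvgr _ exl exu); near=> k.
  have jk0 : (0 < j k)%N by near: k.
  have zlt : (z k < j k)%N.
    have : `|0 - (z k)%:R / (j k)%:R| < 1 :> R by near: k; apply: cvgr_dist_lt.
    by rewrite sub0r normrN ger0_norm ?divr_ge0 // ltr_pdivrMr ?ltr0n // mul1r ltr_nat.
  have b0 : 0 < bw (j k) 0 by rewrite divr_gt0 ?exprn_gt0 // ltr0n bin_gt0 /=; lia.
  rewrite ler_pdivlMr // ler_pdivrMr // ![expR _ * _]mulrC mulN1r mul1r.
  by rewrite bw_lower ?bw_upper // ltnW.
have cj : cbw (j k) @[k --> \oo] --> cbwoo by apply: cvg_comp jo _; exact: cbw_cvg.
have h : cbw (j k) * (bw (j k) (z k) / bw (j k) 0) @[k --> \oo] --> cbwoo * expR (- zeta ^+ 2) by apply: cvgM.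
 apply: cvg_trans h; apply: near_eq_cvg; near=> k => /=.
have b0 : bw (j k) 0 != 0.
  by rewrite gt_eqF // divr_gt0 ?exprn_gt0 // ltr0n bin_gt0 /=; lia.
by rewrite /cbw; field.
Unshelve. all: by end_near. Qed.

Local Notation mu := (@lebesgue_measure R).

(** Writing a lattice function as a finite sum of indicators gives its measurability and turns
    lattice sums into integrals, so that convergence theorems apply to them. *)
Lemma stepfun_sum (p : nat -> R) K (h y : R) : 0 < h -> 0 <= y ->
  (forall z, (K <= z)%N -> p z = 0) ->
  p (Num.truncn (y / h)) = \sum_(z < K) p z * \1_(`[z%:R * h, z.+1%:R * h[%classic) y.
Proof.
move=> h0 y0 pK; have yh : 0 <= y / h by rewrite divr_ge0 // ltW.
have mem z : (y \in `[z%:R * h, z.+1%:R * h[%classic) = (Num.truncn (y / h) == z).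
  rewrite mem_setE in_itv /= truncn_eq // ler_pdivlMr // ltr_pdivrMr //.
have [tK|tK] := ltnP (Num.truncn (y / h)) K.
  rewrite (bigD1 (Ordinal tK)) //= indicE mem eqxx mulr1 big1 ?addr0 // => i ne.
  by rewrite indicE mem eq_sym -[(_ == _)]/(i == Ordinal tK) (negbTE ne) mulr0.
rewrite pK // big1 // => i _; rewrite indicE mem.
by case: eqP => [e|]; rewrite ?mulr0 //; have := ltn_ord i; rewrite -e ltnNge tK.
Qed.

Lemma measurable_stepfun (p : nat -> R) K (h : R) : 0 < h ->
  (forall z, (K <= z)%N -> p z = 0) ->
  measurable_fun (`[0, +oo[%classic : set R) (fun y : R => p (Num.truncn (y / h))).
Proof.
move=> h0 pK.
apply: (@eq_measurable_fun _ _ _ _ _ (fun y => \sum_(z < K) p z * \1_(`[z%:R * h, z.+1%:R * h[%classic) y)).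
  move=> y; rewrite inE /= in_itv /= andbT => y0.
  by rewrite (stepfun_sum h0 y0 pK).
apply: measurable_sum => z; apply: measurable_funM; first exact: measurable_cst.
by apply: measurable_indic; exact: measurable_itv.
Qed.

Lemma integral_stepfun (p : nat -> R) K (h : R) : 0 < h -> (forall z, 0 <= p z) ->
  (forall z, (K <= z)%N -> p z = 0) ->
  (\int[mu]_(y in `[0%R, +oo[) (p (Num.truncn (y / h)))%:E = (h * \sum_(z < K) p z)%:E)%E.
Proof.
move=> h0 p0 pK.
transitivity (\int[mu]_(y in `[0%R, +oo[) \sum_(z <- index_enum 'I_K)
    ((p z)%:E * (\1_(`[z%:R * h, z.+1%:R * h[%classic) y)%:E))%E.
  apply: eq_integral => y; rewrite inE /= in_itv /= andbT => y0.
  by rewrite (stepfun_sum h0 y0 pK) -sumEFin.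
have mI (z : nat) : measurable_fun (`[0, +oo[%classic : set R) (fun y : R => \1_(`[z%:R * h, z.+1%:R * h[%classic) y : R).
  by apply: measurable_indic; exact: measurable_itv.
rewrite ge0_integral_sum //; last 2 first.
- by move=> z; apply: emeasurable_funM => //; apply/measurable_EFinP.
- by move=> z y _; rewrite mule_ge0 // lee_fin // indicE.
rewrite mulr_sumr -sumEFin; apply: eq_bigr => z _.
rewrite (@ge0_integralZl_EFin _ _ _ mu) //; first last.
- by apply/measurable_EFinP; exact: mI.
rewrite (@integral_indic _ _ _ mu) //.
rewrite (_ : _ `&` _ = `[z%:R * h, z.+1%:R * h[%classic); last first.
  apply/setIidPl => y; rewrite /= !in_itv /= andbT => /andP[+ _]; apply: le_trans.
  by rewrite mulr_ge0 // ltW.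
rewrite [X in (_ * X)%E](_ : _ = h%:E); first by rewrite -EFinM mulrC.
apply: etrans (lebesgue_measure_itv `[z%:R * h, z.+1%:R * h[) _; rewrite /= lte_fin ltr_pM2r // ltr_nat ltnSn -EFinB.
by congr EFin; rewrite -natr1; ring.
Qed.

Lemma sum_bin_half j : (\sum_(z < j.+1) 'C(j + j, j + z) * 2 = 2 ^ (j + j) + 'C(j + j, j))%N.
Proof.
have h : (\sum_(i < (j + j).+1) 'C(j + j, i) = 2 ^ (j + j))%N.
  rewrite -[2%N]/(1 + 1)%N expnDn; apply: eq_bigr => i _.
  by rewrite !exp1n !muln1.
have e : (\sum_(i < (j + j).+1) 'C(j + j, i) =
    \sum_(i < j) 'C(j + j, i) + \sum_(z < j.+1) 'C(j + j, j + z))%N.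
  by rewrite -addnS (big_split_ord) /=.
have e2 : (\sum_(i < j) 'C(j + j, i) = \sum_(i < j) 'C(j + j, j + i.+1))%N.
  rewrite (reindex_inj rev_ord_inj) /=; apply: eq_bigr => i _; have := ltn_ord i => ij.
  rewrite -bin_sub; last lia.
  by congr binomial; lia.
have e3 : (\sum_(z < j.+1) 'C(j + j, j + z) = 'C(j + j, j) + \sum_(i < j) 'C(j + j, j + i.+1))%N.
  by rewrite big_ord_recl /= addn0; congr addn; apply: eq_bigr.
rewrite -big_distrl /= -h e e2 e3; lia.
Qed.

Lemma sum_bw j : \sum_(z < j.+1) bw j z = (1 + bw j 0) / 2.
Proof.
rewrite /bw /binc /= -mulr_suml addn0; apply: (@mulIf _ (2 * 4 ^+ j)).
  by rewrite mulf_neq0 ?expf_neq0 // pnatr_eq0.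
have h := congr1 (fun x => x%:R : R) (sum_bin_half j).
rewrite natrD natrX natr_sum in h.
have p4 : 4 ^+ j != 0 :> R by rewrite expf_neq0 // pnatr_eq0.
rewrite exprD -exprMn -natrM in h.
have -> : \sum_(i < j.+1) ('C(j + j, j + i))%:R = (4 ^+ j + ('C(j + j, j))%:R) / 2 :> R.
  have -> : 4 = (2 * 2)%:R :> R by [].
  rewrite -h mulr_suml; apply: eq_bigr => i _; rewrite natrM; field; split.
by field.
Qed.

Lemma bw0_cvg0 : bw n.+1 0 @[n --> \oo] --> (0 : R).
Proof.
apply/cvgrPdist_lt => e e0; have [N HN] := harmonic_small (exprn_gt0 2 e0).
exists N => // n /= /HN h; rewrite sub0r normrN ger0_norm ?bw_ge0 //.
rewrite -ltr_sqr ?nnegrE ?bw_ge0 ?(ltW e0) //; apply: le_lt_trans h.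
have := bw0_sqr_le n.+1; move: (bw n.+1 0 ^+ 2) (sqr_ge0 (bw n.+1 0)) => x x0 h.
rewrite -[leRHS]mul1r ler_pdivlMr ?ltr0n //; apply: le_trans h.
by rewrite ler_wpM2l // -{1}[n.+1%:R]mul1r -natr1; have : 0 <= n%:R :> R by []; lra.
Qed.

(** The Gaussian bound with [Z = j] yields exponent [(y - 1)^2 / 2], which exceeds [y - 2] because
    [(y - 2)^2 + 1 >= 0]. The outcome is an integrable bound that is uniform in [j]. *)
Lemma bw_dominated j z y : (0 < j)%N -> 0 <= y -> y * Num.sqrt j%:R < z%:R + 1 ->
  Num.sqrt j%:R * bw j z <= expR 2 * expR (- y).
Proof.
move=> j0 y0 hz; have j1 : 1 <= j%:R :> R by rewrite ler1n.
have s1 : 1 <= Num.sqrt j%:R :> R by rewrite -{1}(@sqrtr1 R) ler_sqrt // ltr0n.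
have [jz|zj] := ltnP j z; first by rewrite bw_gt // mulr0 mulr_ge0 ?expR_ge0.
apply: (@le_trans _ _ (expR (- (z%:R ^+ 2 / (j%:R + j%:R))))).
  apply: (@le_trans _ _ (cbw j * expR (- (z%:R ^+ 2 / (j%:R + j%:R))))).
    by rewrite /cbw mulrAC [leLHS]mulrC ler_wpM2r ?sqrtr_ge0 // bw_upper.
  by rewrite ler_piMl ?expR_ge0 // cbw_le1.
rewrite -expRD ler_expR; have [y2|y2] := leP y 2.
  have : 0 <= z%:R ^+ 2 / (j%:R + j%:R) :> R by rewrite divr_ge0 ?sqr_ge0 ?addr_ge0.
  lra.
suff : y - 2 <= z%:R ^+ 2 / (j%:R + j%:R) by lra.
rewrite ler_pdivlMr; last lra.
have sj : Num.sqrt j%:R ^+ 2 = j%:R :> R by rewrite sqr_sqrtr.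
move: (Num.sqrt j%:R) sj s1 hz => s <- s1 hz.
have h1 : (y - 1) * s <= z%:R by nra.
have h2 : ((y - 1) * s) ^+ 2 <= z%:R ^+ 2 by rewrite ler_sqr ?nnegrE // mulr_ge0; lra.
apply: le_trans h2; rewrite exprMn; have : 0 <= ((y - 2) ^+ 2 + 1) * s ^+ 2 by rewrite mulr_ge0 ?addr_ge0 ?sqr_ge0.
by move=> h3; rewrite -subr_ge0; apply: le_trans h3 _; rewrite le_eqVlt; apply/orP; left; apply/eqP; ring.
Qed.

(** The nonnegative half of the law of the walk has mass [(1 + bw j 0) / 2], which tends to [1/2];
    by dominated convergence it also tends to [cbwoo] times the half Gaussian integral
    [sqrt pi / 2]. *)
Lemma cbwooE : cbwoo = (Num.sqrt pi)^-1.
Proof.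
pose D := (`[0, +oo[%classic : set R).
pose f_ (k : nat) (y : R) : \bar R :=
  (Num.sqrt k.+1%:R * bw k.+1 (Num.truncn (y / (Num.sqrt k.+1%:R)^-1)))%:E.
pose f (y : R) : \bar R := (cbwoo * gauss_fun y)%:E.
pose g (y : R) : \bar R := ((expR 2)%:E * (exponential_pdf 1 y)%:E)%E.
have sk0 (k : nat) : 0 < Num.sqrt k.+1%:R :> R by rewrite sqrtr_gt0 ltr0n.
have hk0 (k : nat) : 0 < (Num.sqrt k.+1%:R)^-1 :> R by rewrite invr_gt0.
have supp k z : (k.+2 <= z)%N -> Num.sqrt k.+1%:R * bw k.+1 z = 0 :> R.
  by move=> h; rewrite bw_gt ?mulr0.
have mf_ k : measurable_fun D (f_ k).
  by apply/measurable_EFinP; apply: (measurable_stepfun (hk0 k) (supp k)).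
have mf : measurable_fun D f.
  apply/measurable_EFinP; apply: measurable_funM; first exact: measurable_cst.
  exact: measurable_funTS measurable_gauss_fun.
have mD : measurable D by exact: measurable_itv.
have f_f y : D y -> f_ ^~ y @ \oo --> f y.
  rewrite /D /= in_itv /= andbT => y0; apply: cvg_EFin; first by apply: nearW.
  rewrite /comp /= /gauss_fun; apply: (@bw_local succn (fun k => Num.truncn (y / (Num.sqrt k.+1%:R)^-1))).
    by move=> A [N _ hN]; exists N => // n /= Nn; apply: hN; exact: leqW.
  apply/cvgrPdist_le => e e0; have [N HN] := harmonic_small (exprn_gt0 2 e0).
  exists N => // n /= /HN h; set s := Num.sqrt _; have s0 : 0 < s by exact: sk0.
  have /andP[t1 t2] : (Num.truncn (y / s^-1))%:R <= y / s^-1 < (Num.truncn (y / s^-1)).+1%:R.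
    by rewrite truncn_itv // divr_ge0 // invr_ge0 ltW.
  rewrite invrK in t1 t2; rewrite -natr1 invrK in t2 *.
  have se : s^-1 <= e.
    rewrite -ler_sqr ?nnegrE ?invr_ge0 ?(ltW s0) ?(ltW e0) // exprVn sqr_sqrtr ?ltW //.
  apply: le_trans se; rewrite ler_norml; apply/andP; split.
    have : (Num.truncn (y * s))%:R / s <= y by rewrite ler_pdivrMr.
    have : 0 <= s^-1 by rewrite invr_ge0 ltW.
    lra.
  rewrite lerBlDr (_ : s^-1 + _ = (1 + (Num.truncn (y * s))%:R) / s); last by rewrite mulrDl mul1r.
  rewrite ler_pdivlMr //.
  by rewrite addrC; exact: ltW.
have ig : mu.-integrable D g.
  apply: integrableZl => //; apply: (integrableS measurableT) => //.
  exact: integrable_exponential_pdf.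
have f_g y k : D y -> (`|f_ k y| <= g y)%E.
  rewrite /D /= in_itv /= andbT => y0; rewrite /f_ /g -EFinM lee_fin.
  rewrite ger0_norm; last by rewrite mulr_ge0 ?bw_ge0 // ltW.
  rewrite exponential_pdfE //= mul1r mulN1r.
  apply: bw_dominated => //.
  have : y / (Num.sqrt k.+1%:R)^-1 < (Num.truncn (y / (Num.sqrt k.+1%:R)^-1)).+1%:R by exact: truncnS_gt.
  by rewrite invrK natr1.
have [||_ _ cv] := @dominated_convergence _ (measurableTypeR R) R mu D mD f_ f g mf_ mf _ ig.
- by apply: aeW.
- by apply: aeW => y k; exact: f_g.
have e1 : [sequence (\int[mu]_(x in D) f_ n x)%E]_n = fun n => ((1 + bw n.+1 0) / 2)%:E.
  apply/funext => n /=; rewrite /f_ /D.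
  rewrite (@integral_stepfun (fun z => Num.sqrt n.+1%:R * bw n.+1 z) n.+2) //; first last.
  - exact: supp.
  - by move=> z; rewrite mulr_ge0 ?bw_ge0 // ltW.
  by rewrite -mulr_sumr mulrA mulVf ?mul1r ?sum_bw // gt_eqF.
have e2 : (\int[mu]_(x in D) f x = (cbwoo * (Num.sqrt pi / 2))%:E)%E.
  rewrite /f; under eq_integral do rewrite EFinM.
  rewrite ge0_integralZl_EFin //; first by rewrite integral0y_gauss.
  - by move=> y _; rewrite lee_fin gauss_fun_ge0.
  - by apply/measurable_EFinP; exact: measurable_funTS measurable_gauss_fun.
  - by apply: le_trans (cbw_ge0 0) _; apply: ub_le_sup; [exists 1 => _ [n _ <-]; exact: cbw_le1|exists 0%N].
rewrite e1 e2 in cv.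
have cv2 : (fun n => ((1 + bw n.+1 0) / 2)%:E) @ \oo --> ((1 + 0) / 2)%:E.
  apply: cvg_EFin; first by apply: nearW.
  by apply: cvgMl; apply: cvgD; [exact: cvg_cst|exact: bw0_cvg0].
have e3 : cbwoo * (Num.sqrt pi / 2) = (1 + 0) / 2.
  by apply: EFin_inj; apply: (cvg_unique (@ereal_hausdorff R) cv cv2).
have p0 : 0 < Num.sqrt pi :> R by rewrite sqrtr_gt0 pi_gt0.
apply: (@mulIf _ (Num.sqrt pi)); first by rewrite gt_eqF.
by rewrite mulVf ?gt_eqF //; lra.
Qed.

End LocalLimit.

(** * Tightness *)

Section HitCount.

(** Here [x] is the height still to be climbed. *)
Fixpoint hits (x : nat) (u : seq bool) : bool :=
  (x == 0)%N || (if u is a :: u' then hits (if a then x.-1 else x.+1) u' else false).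

Lemma hits_hts (x s : nat) (u : seq bool) : (s <= size u)%N -> x%:Z <= hts u s -> hits x u.
Proof.
elim: u x s => [|a u IH] x [|s] //=.
- by rewrite hts0; case: x.
- by rewrite hts0; case: x.
case: x => [//|x]; rewrite ltnS hts_cons => su h /=; case: a h => h.
  by apply: (IH _ s) => //; rewrite /= in h *; lia.
by apply: (IH _ s) => //; rewrite /= in h *; lia.
Qed.

Variable R : realType.

(** An exponential maximal inequality by induction on the length: [q^(-x)] is an eigenfunction of
    the step operator with eigenvalue [q + 1/q], which is at least 2, the number of continuations
    once the level is reached. *)
Lemma hits_count (q : R) h x : 1 <= q ->
  (\sum_(u : h.-tuple bool) hits x u)%N%:R <= (q + q^-1) ^+ h * q^-1 ^+ x.
Proof.
move=> q1; have q0 : 0 < q by lra.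
have qi0 : 0 < q^-1 by rewrite invr_gt0.
have qq : 2 <= q + q^-1.
  have : 0 <= (q - 1) ^+ 2 * q^-1 by rewrite mulr_ge0 ?sqr_ge0 // ltW.
  have -> : (q - 1) ^+ 2 * q^-1 = q + q^-1 - 2 by field; rewrite gt_eqF.
  lra.
elim: h x => [|h IH] x.
  rewrite (@big_tuple0 nat (fun u => hits x u : nat)) /= orbF expr0 mul1r.
  by case: x => [|x] /=; rewrite ?expr0 // exprn_ge0 // ltW.
rewrite (@big_tupleS_nat h (fun u => hits x u : nat)).
case: x => [|x] /=.
  rewrite !sum_nat_const card_tuple card_bool muln1 addnn -mul2n -expnS natrX expr0 mulr1.
  by rewrite lerXn2r ?nnegrE //; lra.
rewrite natrD; apply: le_trans (lerD (IH x) (IH x.+2)) _.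
rewrite le_eqVlt; apply/orP; left; apply/eqP; rewrite !exprS.
by field; rewrite gt_eqF.
Qed.

Lemma count_words n p : (\sum_(t : n.-tuple bool) (count id t == p))%N = 'C(n, p).
Proof.
elim: n p => [|q IH] p.
  by rewrite (@big_tuple0 nat (fun t => (count id t == p) : nat)) /=; case: p.
rewrite (@big_tupleS_nat q (fun t => (count id t == p) : nat)) /=.
under [X in (_ + X)%N]eq_bigr do rewrite add0n.
rewrite IH; case: p => [|p]; first by rewrite !bin0 big1.
by under eq_bigr do rewrite add1n eqSS; rewrite IH binS addnC.
Qed.

Lemma bin_le_central j p : ('C(j.*2, p) <= 'C(j.*2, j))%N.
Proof.
wlog jp : p / (j <= p)%N => [W|].
  have [/W //|pj] := leqP j p.
  rewrite -bin_sub; last lia.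
  by apply: W; lia.
have [pj|pj] := leqP p j.*2; last by rewrite bin_small.
have [->|j0] := posnP j; first by move: pj jp; case: p.
rewrite -(ler_nat R) -addnn.
have := @bw_upper R j (p - j) (p - j) j0 (leqnn _).
rewrite /bw /binc /= addn0 => /(_ ltac:(lia)); rewrite subnKC // => h.
have p4 : 0 < 4 ^+ j :> R by rewrite exprn_gt0.
rewrite -(ler_pM2r (x := (4 ^+ j)^-1)) ?invr_gt0 //; apply: le_trans h _.
apply: ler_piMr; first by rewrite divr_ge0 // ltW.
rewrite -[leRHS]expR0 ler_expR oppr_le0 divr_ge0 ?sqr_ge0 ?addr_ge0 //.
Qed.

(** The word is cut after [h] letters. The remaining [2 j] letters have a prescribed number of
    up-steps, so at most a central binomial many completions exist. *)
Lemma hits_balanced_count (q : R) m h j x : 1 <= q -> (m.*2 = h + j.*2)%N ->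
  #|[set w in balanced m | hits x (take h w)]|%:R <=
  (q + q^-1) ^+ h * q^-1 ^+ x * 'C(j.*2, j)%:R.
Proof.
move=> q1 e; rewrite -sum1_card.
have -> : (\sum_(w in [set w in balanced m | hits x (take h w)]) 1 =
    \sum_(w : (m.*2).-tuple bool) (count id w == m) && hits x (take h w))%N.
  by rewrite big_mkcond /=; apply: eq_bigr => w _; rewrite !inE; case: ifP.
rewrite e (@big_tuple_add nat h j.*2 (fun w => ((count id w == m) && hits x (take h w)) : nat)).
apply: (@le_trans _ _ (\sum_(u : h.-tuple bool) hits x u * 'C(j.*2, j))%N%:R); last first.
  by rewrite -big_distrl natrM ler_wpM2r // hits_count.
rewrite ler_nat; apply: leq_sum => u _.
case hu : (hits x u); last first.
  by rewrite big1 // => t _; rewrite take_size_cat ?size_tuple // hu andbF.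
apply: leq_trans (_ : \sum_(t : j.*2.-tuple bool) (count id t == m - count id u)%N <= _)%N.
  apply: leq_sum => t _; rewrite take_size_cat ?size_tuple // hu andbT count_cat.
  by case: eqP => // <-; rewrite addKn eqxx.
by rewrite count_words mul1n bin_le_central.
Qed.

Lemma bernoulli_pow (a : R) s : 0 <= a -> 1 + s%:R * a <= (1 + a) ^+ s.
Proof.
move=> a0; elim: s => [|s IH]; first by rewrite mul0r addr0 expr0.
rewrite exprS; apply: le_trans (_ : (1 + a) * (1 + s%:R * a) <= _); last first.
  by rewrite ler_wpM2l //; lra.
rewrite -natr1; have : 0 <= s%:R * a * a by rewrite !mulr_ge0.
nra.
Qed.

Lemma hits_balanced_prob m g s x l : (0 < g)%N -> (g < m)%N -> (m <= (m - g).*2)%N ->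
  (0 < s)%N -> (g.*2 <= s * s)%N -> (s * l <= x)%N ->
  #|[set w in balanced m | hits x (take g.*2 w)]|%:R <=
  3 * expR 1 * 2^-1 ^+ l * 'C(m.*2, m)%:R :> R.
Proof.
move=> g0 gm mj s0 gs sx; set j := (m - g)%N.
(* With [s^2 >= 2 g], the growth [((q + 1/q) / 2)^(2 g)] stays below [e], while each block of [s]
   levels still halves [q^(-x)]. *)
pose q : R := 1 + s%:R^-1.
have sp : 0 < s%:R :> R by rewrite ltr0n.
have si : 0 < s%:R^-1 :> R by rewrite invr_gt0.
have q1 : 1 <= q by rewrite /q; lra.
have q0 : 0 < q by lra.
apply: le_trans (@hits_balanced_count q m g.*2 j x q1 _) _; first by rewrite /j; lia.
have h1 : q^-1 ^+ x <= 2^-1 ^+ l.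
  have q2 : q^-1 ^+ s <= 2^-1.
    rewrite exprVn lef_pV2 ?posrE ?exprn_gt0 //.
    by have := @bernoulli_pow s%:R^-1 s (ltW si); rewrite mulfV ?gt_eqF.
  apply: le_trans (_ : q^-1 ^+ (s * l) <= _).
    apply: ler_wiXn2l => //; first by rewrite invr_ge0 ltW.
    by rewrite invf_le1.
  by rewrite exprM lerXn2r ?nnegrE ?exprn_ge0 ?invr_ge0 // ltW.
have h2 : ((q + q^-1) / 2) ^+ g.*2 <= expR 1.
  apply: (@le_trans _ _ (expR (s%:R^-1 ^+ 2) ^+ g.*2)).
    rewrite lerXn2r ?nnegrE ?expR_ge0 ?divr_ge0 ?addr_ge0 ?invr_ge0 ?(ltW q0) //.
    apply: le_trans (expR_ge1Dx _); rewrite ler_pdivrMr // -(ler_pM2r q0) mulrDl mulVf ?gt_eqF //.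
    rewrite /q; have : 0 <= s%:R^-1 ^+ 3 :> R by rewrite exprn_ge0 // ltW.
    by nra.
  rewrite -expRM_natl ler_expR exprVn ler_pdivrMr ?exprn_gt0 // mul1r -natrX ler_nat.
  by rewrite -mulnn.
(* From [cbw j <= 1], [cbw m >= 1/2] and [m <= 2 j], the last giving [sqrt m <= (3/2) sqrt j]. *)
have h3 : 'C(j.*2, j)%:R <= 3 * 4 ^+ j * bw R m 0.
  have jp : (0 < j)%N by rewrite /j; lia.
  have mp : (0 < m)%N by lia.
  have -> : 'C(j.*2, j)%:R = 4 ^+ j * bw R j 0.
    by rewrite /bw /binc /= addn0 addnn mulrC divfK // expf_neq0 // pnatr_eq0.
  rewrite mulrAC [leRHS]mulrC ler_wpM2l ?exprn_ge0 //.
  have c1 := cbw_le1 R j; have c2 := @cbw_ge_half R m mp.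
  rewrite /cbw in c1 c2.
  have sj : 0 < Num.sqrt j%:R :> R by rewrite sqrtr_gt0 ltr0n.
  have sm : Num.sqrt m%:R <= 3 / 2 * Num.sqrt j%:R :> R.
    rewrite -ler_sqr ?nnegrE ?sqrtr_ge0 ?mulr_ge0 //.
    rewrite exprMn !sqr_sqrtr //.
    have : m%:R <= j%:R + j%:R :> R by rewrite -natrD ler_nat addnn.
    have : 0 <= j%:R :> R by [].
    by rewrite expr2; lra.
  have b0 := @bw_ge0 R m 0; have b0' := @bw_ge0 R j 0.
  rewrite -(ler_pM2r sj); apply: le_trans c1 _.
  nra.
have p4 : 4 ^+ m = 4 ^+ j * 2 ^+ g.*2 :> R.
  have -> : 4 = 2 ^+ 2 :> R by rewrite expr2 -natrM.
  by rewrite -!exprM -exprD; congr (_ ^+ _); rewrite /j; lia.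
have -> : 'C(m.*2, m)%:R = 4 ^+ j * 2 ^+ g.*2 * bw R m 0.
  by rewrite -p4 /bw /binc /= addn0 addnn mulrC divfK // expf_neq0 // pnatr_eq0.
have -> : (q + q^-1) ^+ g.*2 = 2 ^+ g.*2 * ((q + q^-1) / 2) ^+ g.*2.
  by rewrite -exprMn; congr (_ ^+ _); field; rewrite gt_eqF.
have b0 := @bw_ge0 R m 0.
have e : 3 * expR 1 * 2^-1 ^+ l * (4 ^+ j * 2 ^+ g.*2 * bw R m 0) =
  2 ^+ g.*2 * expR 1 * 2^-1 ^+ l * (3 * 4 ^+ j * bw R m 0) by ring.
rewrite e; apply: ler_pM => //.
- by rewrite !mulr_ge0 ?exprn_ge0 ?divr_ge0 ?addr_ge0 ?invr_ge0 ?(ltW q0).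
- rewrite ler_pM ?mulr_ge0 ?exprn_ge0 ?divr_ge0 ?addr_ge0 ?invr_ge0 ?(ltW q0) //.
  by rewrite ler_wpM2l ?exprn_ge0.
Qed.

End HitCount.

Section Oscillation.
Variables (R : realType) (m : nat).
Hypothesis m0 : (0 < m)%N.
Let n := m.*2.

Lemma card_balanced_rot (p : pred (seq bool)) a :
  #|[set w in balanced m | p (rot a w)]| = #|[set w in balanced m | p w]|.
Proof.
have inj : injective (fun w : n.-tuple bool => [tuple of rot a w]).
  by move=> u v /(congr1 val) /= /rot_inj /val_inj.
rewrite -[RHS](on_card_preimset (onW_bij _ (injF_bij inj))); apply: eq_card => w.
rewrite !inE /=; suff -> : count id (rot a w) = count id w by [].
by rewrite -!size_filter; apply: perm_size; rewrite perm_filter // perm_rot.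
Qed.

Lemma card_balanced_negb (p : pred (seq bool)) :
  #|[set w in balanced m | p (map negb w)]| = #|[set w in balanced m | p w]|.
Proof.
have inj : injective (fun w : n.-tuple bool => [tuple of map negb w]).
  by move=> u v /(congr1 val) /= /(inj_map (can_inj negbK)) /val_inj.
rewrite -[RHS](on_card_preimset (onW_bij _ (injF_bij inj))); apply: eq_card => w.
rewrite !inE /=; suff -> : (count id (map negb w) == m) = (count id w == m) by [].
rewrite count_map (eq_count (a2 := negb)) //.
have := count_idN w; rewrite size_tuple /n; lia.
Qed.

(** Rotation brings the block starting at [a] to the front and negation covers descents; balanced
    words are invariant under both, so every block costs at most twice the first one. *)
Definition block_hits (x h a : nat) (w : seq bool) :=
  hits x (take h (rot a w)) || hits x (map negb (take h (rot a w))).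

Lemma card_block_hits x h a :
  (#|[set w in balanced m | block_hits x h a w]| <=
   (#|[set w in balanced m | hits x (take h w)]|).*2)%N.
Proof.
rewrite (card_balanced_rot (fun v => hits x (take h v) || hits x (map negb (take h v)))).
apply: (@leq_trans (#|[set w in balanced m | hits x (take h w)]| +
    #|[set w in balanced m | hits x (map negb (take h w))]|)%N).
  apply: leq_trans (leq_card_setU _ _); apply: subset_leq_card.
  by apply/fintype.subsetP => w; rewrite !inE -andb_orr.
suff -> : #|[set w in balanced m | hits x (map negb (take h w))]| =
    #|[set w in balanced m | hits x (take h w)]| by rewrite addnn.
rewrite -[RHS](card_balanced_negb (fun v => hits x (take h v))).
by apply: eq_card => w; rewrite !inE map_take.
Qed.

Lemma hts_take u h i : (i <= h)%N -> (i <= size u)%N -> hts (take h u) i = hts u i.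
Proof.
move=> ih iu; apply: eq_bigr => j _; rewrite nth_take //.
exact: leq_trans (ltn_ord j) ih.
Qed.

Lemma hts_negb u i : (i <= size u)%N -> hts (map negb u) i = - hts u i.
Proof.
move=> iu; rewrite /hts -sumrN; apply: eq_bigr => j _.
rewrite (nth_map true) ?(leq_trans (ltn_ord j)) //; by case: (nth _ _ _).
Qed.

Lemma hts_rot (w : n.-tuple bool) a s : (a + s <= n)%N ->
  hts (rot a w) s = wht w (a + s) - wht w a.
Proof.
elim: s => [|s IH] h; first by rewrite addn0 subrr hts0.
rewrite htsS IH; last lia.
rewrite addnS b_S addrAC; congr (_ + wsg _ - _).
rewrite /wst size_tuple modn_small; last by rewrite -/n; lia.
rewrite /rot nth_cat size_drop size_tuple.
by rewrite ifT ?nth_drop // -/n; lia.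
Qed.

(** The rerooted height depends on the whole bridge, but its increments are at most tree distances,
    hence at most [darc], which only sees the block: one oscillation for the end value and two for
    the minimum give the factor 3. *)
Lemma rootword_osc (w : n.-tuple bool) a s h x : w \in balanced m -> (0 < x)%N ->
  (s <= h)%N -> (h < n)%N -> (a + s <= n)%N -> ~~ block_hits x h a w ->
  `|hts (rootword w) (a + s) - hts (rootword w) a| < 3 * x%:Z.
Proof.
move=> bw x0 sh hn asn; rewrite negb_or => /andP[h1 h2].
have sw := size_tuple w.
have bd r : (r <= s)%N -> `|wht w (a + r) - wht w a| < x%:Z.
  move=> rs; have rn : (a + r <= n)%N by lia.
  have rh : (r <= h)%N by lia.
  have rt : (r <= size (rot a w))%N by rewrite size_rot sw -/n; lia.
  rewrite -(hts_rot w rn) ltNge; apply/negP => hx.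
  have rt' : (r <= size (take h (rot a w)))%N.
    by rewrite size_take size_rot sw; case: ifP; lia.
  have [hp|hp] := leP 0 (hts (rot a w) r).
    move: h1; apply/negP/negPn; apply: (@hits_hts x r) => //.
    by rewrite hts_take //; lia.
  move: h2; apply/negP/negPn; apply: (@hits_hts x r); first by rewrite size_map.
  by rewrite hts_negb // hts_take //; lia.
have bal := count_balanced m0 bw; have n0 : (0 < size w)%N by rewrite sw /n; lia.
have := @ndist_arcs w bal n0 a (a + s) (leq_addr _ _); rewrite sw ltn_add2l -/n => /(_ (leq_ltn_trans sh hn)).
rewrite -(@tdist_rootword R m m0 0 (lexx _) w bw) //; last lia.
rewrite tdist_le ?leq_addr // /ldist addKn.
set D := hts _; move=> e.
have l1 := mn_le D a (leq0n s); have l2 := mn_le D a (leqnn s); rewrite addn0 in l1.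
have : D a + D (a + s)%N - 2 * mn D a s <= darc w a (a + s) by rewrite e ge_min lexx.
rewrite /darc addKn; have [r rs ->] := mn_ex (wht w) a s.
have := bd r rs; have := bd s (leqnn s); lia.
Qed.

End Oscillation.

Lemma card_union_bound (T I : finType) (A : {set T}) (B : I -> {set T}) :
  (forall w, w \in A -> exists i, w \in B i) -> (#|A| <= \sum_i #|B i|)%N.
Proof.
move=> h; apply: (@leq_trans (\sum_(w in A) \sum_i (w \in B i))%N).
  rewrite -sum1_card; apply: leq_sum => w /h[i wi].
  by rewrite (bigD1 i) //= wi.
rewrite exchange_big /=; apply: leq_sum => i _; rewrite -[#|B i|]sum1_card big_mkcond [leqRHS]big_mkcond.
by apply: leq_sum => w _; do 2 case: (_ \in _).
Qed.

Section Tightness.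
Variable R : realType.

(** An even time close to the fraction [i / N] of [2 m], so that the height there is even, as the
    kernels below require. *)
Definition gridpt (m N i : nat) : nat := (m * i %/ N).*2.

(** The window extends one step beyond the next grid time, since [truncn (2 m t)] can exceed it by
    one after rounding. *)
Definition osc_good (m N : nat) (r : R) (v : seq bool) : Prop :=
  forall i s, (i < N)%N -> (gridpt m N i <= s)%N -> (s <= (gridpt m N i.+1).+1)%N ->
    (s <= m.*2)%N -> `|hts v s - hts v (gridpt m N i)|%:~R <= r * Num.sqrt m.*2%:R.

Lemma cube_le_exp l : ((l + 4) ^ 3 <= 64 * 2 ^ l)%N.
Proof.
elim: l => // l IH; rewrite (expnS 2 l) mulnCA.
apply: leq_trans (_ : 2 * (l + 4) ^ 3 <= _)%N; last by rewrite leq_mul2l IH orbT.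
by rewrite !expnS !expn0 !muln1; nia.
Qed.

(** A union bound over [N] blocks: the allowed oscillation is about [l] standard deviations of a
    block when [N] grows like [l^2], and the exponential decay in [l] beats this polynomial number
    of blocks. *)
Lemma osc_tight (r eta : R) (N1 : nat) : 0 < r -> 0 < eta ->
  exists2 N : nat, (N1 <= N)%N /\ (0 < N)%N & \forall m \near \oo,
    #|[set w in balanced m | ~~ `[<osc_good m N r (rootword w)>]]|%:R <= eta * 'C(m.*2, m)%:R.
Proof.
move=> r0 eta0.
pose T := (Num.truncn (144 / r ^+ 2)).+1.
have Tr : 144 <= T%:R * r ^+ 2.
  rewrite -ler_pdivrMr ?exprn_gt0 // ltW //; exact: truncnS_gt.
pose C : R := 2 * (3 * expR 1) * T%:R * 64.
have C0 : 0 < C by rewrite !mulr_gt0 ?expR_gt0.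
pose l := (Num.truncn (C / eta) + N1)%N.
have lC : C <= eta * (l + 4)%:R.
  rewrite mulrC -ler_pdivrMr //; apply: le_trans (ltW (truncnS_gt _)) _.
  by rewrite ler_nat /l; move: (Num.truncn _) => t; lia.
pose N := (T * (l + 4) ^ 2)%N.
have N0 : (16 <= N)%N.
  by rewrite /N /T mulSn; apply: leq_trans (leq_addr _ _); rewrite -[16%N]/(4 ^ 2)%N leq_exp2r //; lia.
have sN : 12 * (l + 4)%:R <= r * Num.sqrt N%:R.
  rewrite -ler_sqr ?nnegrE ?mulr_ge0 ?sqrtr_ge0 ?(ltW r0) //.
  rewrite !exprMn sqr_sqrtr // /N natrM natrX.
  rewrite [leRHS](_ : _ = T%:R * r ^+ 2 * (l + 4)%:R ^+ 2); last by ring.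
  by rewrite ler_wpM2r ?sqr_ge0 // (le_trans _ Tr) // expr2 -natrM ler_nat.
have NN : (N1 <= N)%N.
  apply: (@leq_trans (l + 4)%N); first by rewrite /l -addnA addnCA leq_addr.
  rewrite /N /T mulSn; apply: leq_trans (leq_addr _ _).
  by rewrite expnS expn1 leq_pmulr // addn4.
exists N; first by split => //; apply: leq_trans N0.
exists (4 * N)%N => // m /= mN.
(* Half the block length; the two extra units absorb the rounding of the grid times and the extra
   step of [osc_good]. *)
pose h := (m %/ N + 2)%N.
have dv : (m %/ N * N <= m)%N by exact: leq_divM.
have dv4 : (4 <= m %/ N)%N by rewrite leq_divRL //; lia.
have hm : (16 * (m %/ N) <= m)%N by apply: leq_trans dv; rewrite mulnC leq_mul2l N0 orbT.
have m0 : (0 < m)%N by apply: leq_trans mN; rewrite muln_gt0 (leq_trans _ N0).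
pose s := (Num.truncn (Num.sqrt h.*2%:R : R)).+1.
have s_lo : (h.*2 <= s * s)%N.
  rewrite -(ler_nat R) natrM -[leLHS]sqr_sqrtr // -expr2.
  by rewrite lerXn2r ?nnegrE ?sqrtr_ge0 // ltW // truncnS_gt.
have s_hi : s%:R * Num.sqrt N%:R <= 4 * Num.sqrt m%:R :> R.
  have sn0 : 0 < Num.sqrt N%:R :> R by rewrite sqrtr_gt0 ltr0n (leq_trans _ N0).
  have a1 : s%:R <= Num.sqrt h.*2%:R + 1 :> R.
    by rewrite /s -natr1 lerD2r truncn_le // sqrtr_ge0.
  have a2 : Num.sqrt h.*2%:R * Num.sqrt N%:R <= 2 * Num.sqrt m%:R :> R.
    rewrite -ler_sqr ?nnegrE ?mulr_ge0 ?sqrtr_ge0 // !exprMn !sqr_sqrtr //.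
    have hq a q N' : (q * N' <= a -> 4 * N' <= a -> (q + 2).*2 * N' <= 2 * 2 * a)%N by clear; nia.
    by rewrite expr2 -!natrM ler_nat; exact: hq.
  have a3 : Num.sqrt N%:R <= 2 * Num.sqrt m%:R :> R.
    rewrite -ler_sqr ?nnegrE ?mulr_ge0 ?sqrtr_ge0 // !exprMn !sqr_sqrtr //.
    by rewrite expr2 -!natrM ler_nat; apply: (@leq_trans (4 * N)); [rewrite leq_pmull|apply: leq_trans mN _; rewrite leq_pmull].
  clear -a1 a2 a3 sn0; nra.
pose x := (s * l.+1)%N.
have x0 : (0 < x)%N by rewrite /x /s muln_gt0.
have xr : 3 * x%:R <= r * Num.sqrt m.*2%:R :> R.
  have sn0 : 0 < Num.sqrt N%:R :> R by rewrite sqrtr_gt0 ltr0n (leq_trans _ N0).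
  have b1 : Num.sqrt m%:R <= Num.sqrt m.*2%:R :> R.
    by rewrite ler_sqrt // ler_nat -addnn leq_addr.
  apply: (@le_trans _ _ (r * Num.sqrt m%:R)); last by rewrite ler_wpM2l // ltW.
  rewrite /x natrM -(ler_pM2r sn0).
  have b2 : l.+1%:R <= (l + 4)%:R :> R by rewrite ler_nat -addn1 leq_add2l.
  have b3 : 0 <= l.+1%:R :> R by [].
  have b4 : 0 <= Num.sqrt m%:R :> R by exact: sqrtr_ge0.
  apply: (@le_trans _ _ (3 * l.+1%:R * (4 * Num.sqrt m%:R))).
    rewrite [leLHS](_ : _ = 3 * l.+1%:R * (s%:R * Num.sqrt N%:R)); last by ring.
    by rewrite ler_wpM2l // mulr_ge0.
  rewrite [leLHS](_ : _ = Num.sqrt m%:R * (12 * l.+1%:R)); last by ring.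
  rewrite [leRHS](_ : _ = Num.sqrt m%:R * (r * Num.sqrt N%:R)); last by ring.
  by rewrite ler_wpM2l //; lra.
have hlen i : ((gridpt m N i.+1).+1 - gridpt m N i <= h.*2)%N.
  rewrite /gridpt mulnS; have := leq_divDl N m (m * i); rewrite addnC /h.
  by move: (m * i %/ N)%N (m %/ N)%N ((m * i + m) %/ N)%N => a b c; clear; lia.
pose B := 3 * expR 1 * 2^-1 ^+ l.+1 * 'C(m.*2, m)%:R : R.
have bB i : #|[set w in balanced m | block_hits x h.*2 (gridpt m N i) w]|%:R <= 2 * B.
  apply: le_trans (_ : (#|[set w in balanced m | hits x (take h.*2 w)]|).*2%:R <= _).
    by rewrite ler_nat card_block_hits.
  rewrite -mul2n natrM ler_wpM2l //; apply: (@hits_balanced_prob R m h s x l.+1) => //.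
  - by rewrite /h addn2.
  - by rewrite /h; move: (m %/ N)%N dv4 hm => q; clear; lia.
  - by rewrite /h; move: (m %/ N)%N dv4 hm => q; clear; lia.
apply: (@le_trans _ _ (\sum_(i < N) #|[set w in balanced m | block_hits x h.*2 (gridpt m N i) w]|)%N%:R).
  rewrite ler_nat; apply: card_union_bound => w; rewrite inE => /andP[bw].
  move=> /asboolPn; rewrite /osc_good => bad.
  apply: contrapT => noi; apply: bad => i t iN kt tk tm.
  have nb : ~~ block_hits x h.*2 (gridpt m N i) w.
    by apply/negP => hb; apply: noi; exists (Ordinal iN); rewrite inE bw.
  have := @rootword_osc R m m0 w (gridpt m N i) (t - gridpt m N i) h.*2 x bw x0.
  rewrite subnKC // => /(_ _ _ _ nb) hh.
  apply: le_trans xr; have -> : 3 * x%:R = (3 * x%:Z)%:~R :> R by rewrite intrM.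
  rewrite ler_int ltW // hh //; first by apply: leq_trans (hlen i); exact: leq_sub2r.
  by rewrite /h; move: (m %/ N)%N dv4 hm => q; clear; lia.
rewrite natr_sum; apply: (@le_trans _ _ (\sum_(i < N) 2 * B)).
  by apply: ler_sum => i _; exact: bB.
rewrite sumr_const card_ord -[_ *+ N]mulr_natl /B !mulrA ler_wpM2r //.
have p2 : 0 < 2 ^+ l.+1 :> R by rewrite exprn_gt0.
have c3 : (l + 4)%:R ^+ 3 <= 64 * 2 ^+ l :> R.
  by have := cube_le_exp l; rewrite -(ler_nat R) natrM !natrX.
have l4 : 0 < (l + 4)%:R :> R by rewrite ltr0n addn4.
have e0 := expR_gt0 (1 : R).
rewrite exprVn -(ler_pM2r p2) mulfVK ?gt_eqF // -(ler_pM2r l4).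
apply: (@le_trans _ _ (C * 2 ^+ l)); last first.
  rewrite exprS; apply: (@le_trans _ _ (eta * (l + 4)%:R * 2 ^+ l)).
    by rewrite ler_wpM2r // exprn_ge0.
  have : 0 <= eta * (l + 4)%:R * 2 ^+ l by rewrite !mulr_ge0 ?exprn_ge0 // ltW.
  by move: (l + 4)%:R (2 ^+ l) => b c; clear; lra.
rewrite /N natrM natrX /C.
rewrite [leLHS](_ : _ = 2 * (3 * expR 1) * T%:R * (l + 4)%:R ^+ 3); last by rewrite !exprS expr0; ring.
rewrite -[leRHS]mulrA ler_wpM2l // !mulr_ge0 // ltW.
Qed.

End Tightness.

(** * Finite-dimensional distributions *)

Section LowLim.
Variable R : realType.

(* [lowlim b u]: b <= liminf u, for a real sequence u and an extended real b. *)
Definition lowlim (b : \bar R) (u : nat -> R) : Prop :=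
  forall r : R, (r%:E < b)%E -> \forall m \near \oo, r <= u m.

Lemma lowlim_einf b u : lowlim b u -> (b <= limn_einf (fun m => (u m)%:E))%E.
Proof.
move=> h; rewrite leNgt; apply/negP => lt.
have [r r1 r2] : exists2 r : R, (limn_einf (fun m => (u m)%:E) < r%:E)%E & (r%:E < b)%E.
  case: b {h} lt => [b||] //; case: (limn_einf _) => [l||] //.
  - by rewrite lte_fin => lb; exists ((l + b) / 2); rewrite lte_fin midf_lt.
  - by move=> _; exists (b - 1); rewrite ?ltNyr // lte_fin; lra.
  - by move=> _; exists (l + 1); rewrite ?ltry // lte_fin; lra.
  - by move=> _; exists 0; rewrite ?ltNyr ?ltry.
have [N _ hN] := h r r2.
suff : (r%:E <= limn_einf (fun m => (u m)%:E))%E by rewrite leNgt r1.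
rewrite limn_einf_lim (cvg_lim _ (@cvg_einfs_sup R _)) //.
apply: le_trans (ereal_sup_ubound (x := einfs (fun m => (u m)%:E) N) _); last by exists N.
by apply: le_ereal_inf_tmp => _ [k /= Nk <-]; rewrite lee_fin; exact: hN.
Qed.

Lemma einf_near (r : \bar R) (u : nat -> \bar R) : (r < limn_einf u)%E ->
  \forall m \near \oo, (r < u m)%E.
Proof.
rewrite limn_einf_lim (cvg_lim _ (@cvg_einfs_sup R _)) // => /ereal_sup_gt[_ [n _ <-] h].
exists n => // m /= nm; apply: lt_le_trans h _.
by apply: ereal_inf_lbound; exists m.
Qed.

Lemma lowlimM (a : R) (a_ : nat -> R) b u : lowlim b u -> a_ m @[m --> \oo] --> a ->
  (forall m, 0 <= a_ m) -> (forall m, 0 <= u m) -> (0 <= b)%E ->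
  lowlim (a%:E * b)%E (fun m => a_ m * u m).
Proof.
move=> hb ha a0 u0 b0 r hr.
have [r0|r0] := leP r 0; first by apply: nearW => m; apply: le_trans r0 _; rewrite mulr_ge0.
have age : 0 <= a.
  rewrite -(cvg_lim (@Rhausdorff R) ha); apply: limr_ge; last by apply: nearW.
  by apply/cvg_ex; exists a.
have agt : 0 < a.
  by rewrite lt_neqAle age andbT; apply/eqP => a00; move: hr; rewrite -a00 mul0e lte_fin ltNge ltW.
have [be hbe1 hbe2] : exists2 be : R, r / a < be & (be%:E < b)%E.
  case: b hb hr b0 => [b||] //= hb hr b0.
    have rb : r / a < b by rewrite ltr_pdivrMr // mulrC -lte_fin EFinM.
    by exists ((r / a + b) / 2); rewrite ?lte_fin midf_lt.
  by exists (r / a + 1); rewrite ?ltry //; lra.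
have be0 : 0 < be by apply: lt_trans hbe1; rewrite divr_gt0.
have hra : r / be < a by rewrite ltr_pdivrMr // mulrC -ltr_pdivrMr.
near=> m; have h1 : be <= u m by near: m; exact: hb.
have h2 : r / be <= a_ m.
  apply/ltW; near: m; move/cvgrPdist_lt: ha => /(_ (a - r / be)); rewrite subr_gt0 => /(_ hra).
  by apply: filterS => k; rewrite ltr_norml => /andP[_]; lra.
have -> : r = r / be * be by field; rewrite gt_eqF.
by apply: ler_pM => //; rewrite ?divr_ge0 // ltW.
Unshelve. all: by end_near. Qed.

End LowLim.

(** * Scaling limits of the kernel of the killed random walk *)

Section Kernel.
Variable R : realType.
Local Notation mesh m := (Num.sqrt (2 / m%:R) : R).

(** Times and heights are halved to get rid of parity. One unit of [x] is two units of height, so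
    after division by [sqrt (2 m)] the mesh is [2 / sqrt (2 m) = sqrt (2 / m)]. *)
Definition ker (j x y : nat) : R := (npaths (j + j) (x + x) (y + y))%:R / 4 ^+ j.

Lemma ker_ge0 j x y : 0 <= ker j x y.
Proof. by rewrite divr_ge0 ?exprn_ge0. Qed.

Lemma kerE j x y : ker j x y = bw R j `|y%:Z - x%:Z|%N - bw R j (x + y + 1).
Proof.
rewrite /ker /bw -mulrBl; congr (_ / _).
have := npaths_even j x y => /(congr1 (fun z : int => z%:~R : R)).
by rewrite mulrzBr.
Qed.

Lemma ker_sym0 j y : ker j 0 y = ker j y 0.
Proof. by rewrite !kerE subr0 sub0r abszN add0n addn0. Qed.

Lemma ker0E j x : ker j x 0 = bw R j x * ((2 * x%:R + 1) / (j%:R + x%:R + 1)).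
Proof.
rewrite kerE sub0r abszN addn0 addn1.
have [xj|jx] := leqP x j; last by rewrite !bw_gt ?mul0r ?subr0 //; lia.
have p : j%:R + x%:R + 1 != 0 :> R by rewrite -natrD natr1 pnatr_eq0.
by rewrite bwS //=; field.
Qed.

Section Scaling.
Variables (j : nat -> nat) (t : R).
Hypothesis t0 : 0 < t.
Hypothesis jt : (j m)%:R / m%:R @[m --> \oo] --> t.

Lemma scaled_infty : j m @[m --> \oo] --> \oo.
Proof.
move=> A [N _ hN]; rewrite /= /nbhs /=.
have [N1 _ h1] : \forall m \near \oo, t / 2 < (j m)%:R / m%:R.
  move/cvgrPdist_lt: jt => /(_ (t / 2)); rewrite divr_gt0 // => /(_ isT).
  by apply: filterS => m; rewrite ltr_norml => /andP[_]; lra.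
exists (maxn N1.+1 (Num.truncn (2 * N%:R / t)).+1) => // m /=; rewrite geq_max => /andP[m1 m2].
apply: hN => /=; rewrite -(ler_nat R).
have mp : 0 < m%:R :> R by rewrite ltr0n; lia.
have := h1 m (ltnW m1); rewrite ltr_pdivlMr // => /ltW; apply: le_trans.
have : 2 * N%:R / t < m%:R by apply: lt_le_trans (truncnS_gt _) _; rewrite ler_nat.
by rewrite ltr_pdivrMr //; lra.
Qed.

Lemma sqrt_scaled : Num.sqrt (j m)%:R / Num.sqrt m%:R @[m --> \oo] --> Num.sqrt t.
Proof.
have h : Num.sqrt ((j m)%:R / m%:R) @[m --> \oo] --> Num.sqrt t.
  by apply: continuous_cvg => //; exact: sqrt_continuous.
apply: cvg_trans h; apply: near_eq_cvg; near=> m.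
by rewrite sqrtrM // sqrtrV.
Unshelve. all: by end_near. Qed.

Lemma mesh_sqrt m : mesh m = Num.sqrt 2 / Num.sqrt m%:R.
Proof. by rewrite sqrtrM // sqrtrV. Qed.

Lemma bw_scaled (z : nat -> nat) (zeta : R) : (z m)%:R * mesh m @[m --> \oo] --> zeta ->
  Num.sqrt m%:R * bw R (j m) (z m) @[m --> \oo] -->
  (Num.sqrt (pi * t))^-1 * expR (- zeta ^+ 2 / (2 * t)).
Proof.
move=> hz.
have st0 : 0 < Num.sqrt t by rewrite sqrtr_gt0.
have s20 : 0 < Num.sqrt 2 :> R by rewrite sqrtr_gt0.
have hinv : (Num.sqrt (j m)%:R / Num.sqrt m%:R)^-1 @[m --> \oo] --> (Num.sqrt t)^-1.
  by apply: cvgV; [rewrite gt_eqF|exact: sqrt_scaled].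
have jpos : \forall m \near \oo, (0 < j m)%N.
  by move: scaled_infty => /(_ [set n | (0 < n)%N]); apply; exists 1%N.
have hz2 : (z m)%:R / Num.sqrt (j m)%:R @[m --> \oo] --> zeta / Num.sqrt 2 / Num.sqrt t.
  have h : (z m)%:R * mesh m * (Num.sqrt 2)^-1 * (Num.sqrt (j m)%:R / Num.sqrt m%:R)^-1 @[m --> \oo] --> zeta / Num.sqrt 2 / Num.sqrt t.
    by apply: cvgM => //; apply: cvgMl.
  apply: cvg_trans h; apply: near_eq_cvg; near=> m.
  have mp : 0 < Num.sqrt m%:R :> R by rewrite sqrtr_gt0 ltr0n; near: m; exists 1%N.
  have jp : 0 < Num.sqrt (j m)%:R :> R by rewrite sqrtr_gt0 ltr0n; near: m.
  by rewrite mesh_sqrt; field; rewrite !gt_eqF.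
have h := bw_local scaled_infty hz2.
have h2 : Num.sqrt (j m)%:R * bw R (j m) (z m) * (Num.sqrt (j m)%:R / Num.sqrt m%:R)^-1 @[m --> \oo] -->
   cbwoo R * expR (- (zeta / Num.sqrt 2 / Num.sqrt t) ^+ 2) * (Num.sqrt t)^-1 by apply: cvgM.
have -> : (Num.sqrt (pi * t))^-1 * expR (- zeta ^+ 2 / (2 * t)) =
    cbwoo R * expR (- (zeta / Num.sqrt 2 / Num.sqrt t) ^+ 2) * (Num.sqrt t)^-1.
  rewrite cbwooE sqrtrM ?pi_ge0 // invfM mulrAC; congr (_ * expR _ * _).
  by rewrite !exprMn !exprVn !sqr_sqrtr ?(ltW t0) // invfM mulNr mulrA.
apply: cvg_trans h2; apply: near_eq_cvg; near=> m.
have mp : 0 < Num.sqrt m%:R :> R by rewrite sqrtr_gt0 ltr0n; near: m; exists 1%N.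
have jp : 0 < Num.sqrt (j m)%:R :> R by rewrite sqrtr_gt0 ltr0n; near: m.
by field; rewrite !gt_eqF.
Unshelve. all: by end_near. Qed.

Lemma mesh_cvg0 : mesh m @[m --> \oo] --> (0 : R).
Proof.
apply/cvgrPdist_lt => e e0; have e2 : 0 < e ^+ 2 / 2 by rewrite divr_gt0 // exprn_gt0.
have [N hN] := harmonic_small e2.
exists N.+1 => // -[//|m] /= Nm; rewrite sub0r normrN ger0_norm ?sqrtr_ge0 //.
rewrite -ltr_sqr ?nnegrE ?sqrtr_ge0 ?(ltW e0) // sqr_sqrtr ?divr_ge0 //.
by have := hN m Nm; move: (m.+1%:R^-1) => z; lra.
Qed.

Lemma ker_scaled (x y : nat -> nat) (xi eta : R) :
  (x m)%:R * mesh m @[m --> \oo] --> xi -> (y m)%:R * mesh m @[m --> \oo] --> eta ->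
  ker (j m) (x m) (y m) / mesh m @[m --> \oo] --> pkill t xi eta.
Proof.
move=> hx hy.
have s20 : 0 < Num.sqrt 2 :> R by rewrite sqrtr_gt0.
have h1 : `|(y m)%:Z - (x m)%:Z|%N%:R * mesh m @[m --> \oo] --> `|eta - xi|.
  have h : `|(y m)%:R * mesh m - (x m)%:R * mesh m| @[m --> \oo] --> `|eta - xi|.
    by apply: cvg_norm; apply: cvgB.
  apply: cvg_trans h; apply: near_eq_cvg; near=> m.
  rewrite -mulrBl normrM (ger0_norm (sqrtr_ge0 _)); congr (_ * _).
  by rewrite natr_absz intr_norm rmorphB.
have h2 : (x m + y m + 1)%N%:R * mesh m @[m --> \oo] --> xi + eta + 0.
  have h : (x m)%:R * mesh m + (y m)%:R * mesh m + mesh m @[m --> \oo] --> xi + eta + 0.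
    by apply: cvgD; [apply: cvgD|exact: mesh_cvg0].
  apply: cvg_trans h; apply: near_eq_cvg; near=> m.
  by rewrite !natrD; ring.
have h : (Num.sqrt m%:R * bw R (j m) `|(y m)%:Z - (x m)%:Z|%N - Num.sqrt m%:R * bw R (j m) (x m + y m + 1)) * (Num.sqrt 2)^-1 @[m --> \oo] -->
   ((Num.sqrt (pi * t))^-1 * expR (- `|eta - xi| ^+ 2 / (2 * t)) - (Num.sqrt (pi * t))^-1 * expR (- (xi + eta + 0) ^+ 2 / (2 * t))) * (Num.sqrt 2)^-1.
  by apply: cvgMl; apply: cvgB; apply: bw_scaled.
rewrite /pkill.
have -> : (Num.sqrt (2 * pi * t))^-1 * (expR (- (xi - eta) ^+ 2 / (2 * t)) - expR (- (xi + eta) ^+ 2 / (2 * t))) =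
 ((Num.sqrt (pi * t))^-1 * expR (- `|eta - xi| ^+ 2 / (2 * t)) - (Num.sqrt (pi * t))^-1 * expR (- (xi + eta + 0) ^+ 2 / (2 * t))) * (Num.sqrt 2)^-1.
  have -> : 2 * pi * t = pi * t * 2 by ring.
  rewrite sqrtrM ?mulr_ge0 ?pi_ge0 ?(ltW t0) // invfM addr0 real_normK ?num_real //.
  by rewrite -[(eta - xi) ^+ 2]sqrrN opprB; ring.
apply: cvg_trans h; apply: near_eq_cvg; near=> m.
have mp : 0 < Num.sqrt m%:R :> R by rewrite sqrtr_gt0 ltr0n; near: m; exists 1%N.
by rewrite kerE mesh_sqrt; field; rewrite !gt_eqF.
Unshelve. all: by end_near. Qed.

(** At the killing boundary the kernel is of order mesh squared: one power for the density, one for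
    its vanishing at 0. Since [m / 2] is the inverse square of the mesh, a first-passage density
    remains. *)
Lemma ker0_scaled (x : nat -> nat) (xi : R) :
  (x m)%:R * mesh m @[m --> \oo] --> xi ->
  m%:R / 2 * ker (j m) (x m) 0 @[m --> \oo] --> qd t xi.
Proof.
move=> hx.
have s20 : 0 < Num.sqrt 2 :> R by rewrite sqrtr_gt0.
have st0 : 0 < Num.sqrt t by rewrite sqrtr_gt0.
have h1 : (2 * (x m)%:R + 1) / Num.sqrt m%:R @[m --> \oo] --> (2 * xi + 0) / Num.sqrt 2.
  have h : (2 * ((x m)%:R * mesh m) + mesh m) / Num.sqrt 2 @[m --> \oo] --> (2 * xi + 0) / Num.sqrt 2.
    by apply: cvgMl; apply: cvgD; [apply: cvgMr|exact: mesh_cvg0].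
  apply: cvg_trans h; apply: near_eq_cvg; near=> m.
  have mp : 0 < Num.sqrt m%:R :> R by rewrite sqrtr_gt0 ltr0n; near: m; exists 1%N.
  by rewrite mesh_sqrt; field; rewrite !gt_eqF.
have h2 : ((j m)%:R + (x m)%:R + 1) / m%:R @[m --> \oo] --> t + xi * 0 / 2 + 0.
  have h : (j m)%:R / m%:R + (x m)%:R * mesh m * mesh m / 2 + mesh m * mesh m / 2 @[m --> \oo] --> t + xi * 0 / 2 + 0 * 0 / 2.
    apply: cvgD; first by apply: cvgD => //; apply: cvgMl; apply: cvgM => //; exact: mesh_cvg0.
    by apply: cvgMl; apply: cvgM; exact: mesh_cvg0.
  rewrite mul0r mul0r in h; apply: cvg_trans h; apply: near_eq_cvg; near=> m.
  have mp : 0 < m%:R :> R by rewrite ltr0n; near: m; exists 1%N.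
  have s2 : mesh m * mesh m = 2 / m%:R by rewrite -expr2 sqr_sqrtr ?divr_ge0.
  rewrite -[_ * _ * mesh m]mulrA s2.
  by field; rewrite gt_eqF.
rewrite mulr0 mul0r !addr0 in h2; rewrite addr0 in h1.
have h3 : (((j m)%:R + (x m)%:R + 1) / m%:R)^-1 @[m --> \oo] --> t^-1.
  by apply: cvgV => //; rewrite gt_eqF.
have h : 2^-1 * ((Num.sqrt m%:R * bw R (j m) (x m)) * ((2 * (x m)%:R + 1) / Num.sqrt m%:R) * (((j m)%:R + (x m)%:R + 1) / m%:R)^-1) @[m --> \oo] -->
    2^-1 * ((Num.sqrt (pi * t))^-1 * expR (- xi ^+ 2 / (2 * t)) * (2 * xi / Num.sqrt 2) * t^-1).
  by apply: cvgMr; apply: cvgM => //; apply: cvgM => //; apply: bw_scaled.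
have -> : qd t xi = 2^-1 * ((Num.sqrt (pi * t))^-1 * expR (- xi ^+ 2 / (2 * t)) * (2 * xi / Num.sqrt 2) * t^-1).
  rewrite /qd; have -> : Num.sqrt (2 * pi * t ^+ 3) = Num.sqrt 2 * Num.sqrt (pi * t) * t.
    have -> : 2 * pi * t ^+ 3 = 2 * (pi * t) * t ^+ 2 by ring.
    by rewrite sqrtrM ?mulr_ge0 ?pi_ge0 ?(ltW t0) // sqrtr_sqr gtr0_norm // sqrtrM.
  have sp : 0 < Num.sqrt (pi * t) by rewrite sqrtr_gt0 mulr_gt0 ?pi_gt0.
  by field; rewrite !gt_eqF.
apply: cvg_trans h; apply: near_eq_cvg; near=> m.
have mp : 0 < m%:R :> R by rewrite ltr0n; near: m; exists 1%N.
have smp : 0 < Num.sqrt m%:R :> R by rewrite sqrtr_gt0.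
have p : 0 < (j m)%:R + (x m)%:R + 1 :> R by rewrite -natrD natr1 ltr0n.
by rewrite ker0E; field; rewrite !gt_eqF.
Unshelve. all: by end_near. Qed.

End Scaling.
End Kernel.

(** Integrals of nonnegative functions are compared as suprema over simple functions below them. The
    comparison thereby covers [exc_tail], whose measurability is never established. *)
Lemma ge0_integral_le d (T : measurableType d) (R : realType)
  (mu : {measure set T -> \bar R}) (D E : set T) (f g : T -> \bar R) :
  (forall x, D x -> (0 <= f x)%E) -> (forall x, E x -> (0 <= g x)%E) ->
  (forall x, D x -> E x /\ (f x <= g x)%E) ->
  (\int[mu]_(x in D) f x <= \int[mu]_(x in E) g x)%E.
Proof.
move=> f0 g0 fg; rewrite !ge0_integralE //.
apply: le_ereal_sup => _ [h /= hf <-]; exists h => // x /=; apply: le_trans (hf x) _.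
rewrite /patch; case: ifPn => xD; case: ifPn => xE //.
- by case: (fg x) => //; rewrite inE in xD.
- by move: xE; rewrite notin_setE; case: (fg x) => //; rewrite inE in xD.
- by apply: g0; rewrite inE in xE.
Qed.

Section Riemann.
Variable R : realType.
Local Notation mesh m := (Num.sqrt (2 / m%:R) : R).
Local Notation mu := (@lebesgue_measure R).

(** Grid points approximate [y] from below, so membership must pass to slightly smaller points.
    Cells open on the left and closed on the right have this property and still partition the
    line. *)
Definition lopen (A : set R) := forall y, A y -> 0 < y ->
  exists2 d, 0 < d & forall z, y - d < z -> z <= y -> A z.

Lemma mesh_gt0 m : (0 < m)%N -> 0 < mesh m.
Proof. by move=> m0; rewrite sqrtr_gt0 divr_gt0 // ltr0n. Qed.

Lemma floor_mesh (x : R) m : (0 < m)%N -> 0 <= x ->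
  x - mesh m < (Num.truncn (x / mesh m))%:R * mesh m <= x.
Proof.
move=> m0 x0; have h0 := mesh_gt0 m0.
have /andP[t1 t2] : (Num.truncn (x / mesh m))%:R <= x / mesh m < (Num.truncn (x / mesh m)).+1%:R.
  by rewrite truncn_itv // divr_ge0 // ltW.
have {}t2 : x / mesh m < (Num.truncn (x / mesh m))%:R + 1 by rewrite natr1.
apply/andP; split; last by rewrite -ler_pdivlMr.
by rewrite ltrBlDr; move: t2; rewrite ltr_pdivrMr // mulrDl mul1r.
Qed.

Lemma floor_mesh_cvg (x : R) : 0 <= x ->
  (Num.truncn (x / mesh m))%:R * mesh m @[m --> \oo] --> x.
Proof.
move=> x0; apply: (@squeeze_cvgr _ _ _ _ (fun m : nat => x - mesh m) (fun=> x)).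
- near=> m; have m0 : (0 < m)%N by near: m; exists 1%N.
  by have /andP[/ltW -> ->] := floor_mesh m0 x0.
- rewrite -[X in _ --> X]subr0; apply: cvgB; first exact: cvg_cst.
  exact: mesh_cvg0.
- exact: cvg_cst.
Unshelve. all: by end_near. Qed.

Lemma floor_mesh_small (x : R) : 0 <= x ->
  \forall m \near \oo, (Num.truncn (x / mesh m) < m.+1)%N.
Proof.
move=> x0; near=> m.
have m0 : (0 < m)%N by near: m; exists 1%N.
have mp : 0 < m%:R :> R by rewrite ltr0n.
have h0 := mesh_gt0 m0.
have xm : x ^+ 2 <= m%:R.
  near: m; exists (Num.truncn (x ^+ 2)).+1 => // k /= hk.
  by apply: le_trans (ltW (truncnS_gt _)) _; rewrite ler_nat.
rewrite ltnS -(ler_nat R); apply: le_trans (_ : x / mesh m <= _).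
  by rewrite truncn_le // divr_ge0 // ltW.
rewrite ler_pdivrMr // -ler_sqr ?nnegrE //.
have -> : (m%:R * mesh m) ^+ 2 = 2 * m%:R.
  by rewrite exprMn sqr_sqrtr ?divr_ge0 //; field; rewrite gt_eqF.
lra.
Unshelve. all: by end_near. Qed.

(** The lattice sum is the integral of a step function whose pointwise lower limit is controlled at
    the lattice point just below each [x]; Fatou's lemma does the rest. *)
Lemma lowlim_riemann (A : set R) (a : R -> R) (e : R -> \bar R) (w G : nat -> nat -> R) :
  lopen A -> (forall m y, (0 : R) <= w m y) -> (forall m y, 0 <= G m y) ->
  (forall y, 0 < y -> 0 <= a y) -> (forall y, 0 < y -> (0 <= e y)%E) ->
  (forall (eta : R) (y : nat -> nat), 0 < eta -> (y m)%:R * mesh m @[m --> \oo] --> eta ->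
     w m (y m) @[m --> \oo] --> a eta) ->
  (forall (eta : R) (y : nat -> nat), 0 < eta -> (y m)%:R * mesh m @[m --> \oo] --> eta ->
     lowlim (e eta) (fun m => G m (y m))) ->
  lowlim (\int[mu]_(y in A `&` [set y : R | (0 < y)%R]) ((a y)%:E * e y))%E
    (fun m => mesh m * \sum_(y < m.+1) w m y * (`[< A (y%:R * mesh m) >])%:R * G m y).
Proof.
move=> oA w0 G0 a0 e0 wa Ge.
(* The cut at [m] is harmless in the limit: a fixed [x] has lattice index of order [sqrt m] only. *)
pose p m y := if (y < m.+1)%N then w m y * (`[< A (y%:R * mesh m) >])%:R * G m y else 0.
have p0 m y : 0 <= p m y by rewrite /p; case: ifP => // _; rewrite !mulr_ge0.
pose D := (`[0, +oo[%classic : set R).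
pose f (n : nat) (x : R) : \bar R := (p n.+1 (Num.truncn (x / mesh n.+1)))%:E.
have supp n z : (n.+2 <= z)%N -> p n.+1 z = 0 by rewrite /p leqNgt => /negbTE ->.
have mf n : measurable_fun D (f n).
  by apply/measurable_EFinP; apply: (measurable_stepfun (@mesh_gt0 n.+1 isT) (supp n)).
have f0 n x : (0 <= f n x)%E by rewrite lee_fin.
have ei n : (\int[mu]_(x in D) f n x = (mesh n.+1 * \sum_(z < n.+2) p n.+1 z)%:E)%E.
  exact: (integral_stepfun (@mesh_gt0 n.+1 isT) (p0 n.+1) (supp n)).
have mD : measurable D by exact: measurable_itv.
have pt x : A x -> 0 < x -> ((a x)%:E * e x <= limn_einf (f^~ x))%E.
  move=> Ax x0; have cy := floor_mesh_cvg (ltW x0).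
  pose y m := Num.truncn (x / mesh m).
  have hl : lowlim ((a x)%:E * e x)%E (fun m => w m (y m) * G m (y m)).
    apply: lowlimM => //; [exact: Ge|exact: wa|exact: e0].
  apply: lowlim_einf => r /hl [N _ hN]; have [d d0 hd] := oA x Ax x0.
  have [N1 _ h1] := floor_mesh_small (ltW x0).
  have [N2 _ h2] : \forall m \near \oo, mesh m < d.
    have /cvgrPdist_lt := @mesh_cvg0 R; move=> /(_ d d0); apply: filterS => m.
    by rewrite sub0r normrN ger0_norm ?sqrtr_ge0.
  exists (N + N1 + N2)%N => // n /= hn.
  rewrite /p h1 /=; last lia.
  have /andP[z1 z2] := floor_mesh (isT : (0 < n.+1)%N) (ltW x0).
  have -> : `[< A ((Num.truncn (x / mesh n.+1))%:R * mesh n.+1) >] = true.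
    apply/asboolP; apply: hd z2; apply: lt_trans z1; rewrite ltrD2l ltrN2.
    by apply: h2 => /=; lia.
  by rewrite mulr1; apply: hN => /=; lia.
move=> r hr.
have : (r%:E < limn_einf (fun n => \int[mu]_(x in D) f n x))%E.
  apply: lt_le_trans hr _; apply: le_trans (fatou mu mD mf (fun n x _ => f0 n x)).
  apply: ge0_integral_le.
  - by move=> x [Ax /= x0]; rewrite mule_ge0 ?lee_fin; [|exact: a0|exact: e0].
  - move=> x _; rewrite -[0%E]/((0:R)%:E); apply: lowlim_einf => q; rewrite lte_fin => /ltW q0.
    by apply: nearW => n; apply: le_trans q0 _.
  - move=> x [Ax x0]; split; first by rewrite /D /= in_itv /= andbT ltW.
    exact: pt.
move=> /einf_near [N _ hN]; exists N.+1 => // -[//|m] /= Nm.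
have := hN m Nm; rewrite ei lte_fin => /ltW h; apply: le_trans h _.
rewrite le_eqVlt; apply/orP; left; apply/eqP; congr (_ * _).
by apply: eq_bigr => z _; rewrite /p ltn_ord.
Qed.

(** Probability that the killed walk, at height [2 x] at time [2 k], meets all the constraints and
    is at 0 at time [2 m]: the discrete counterpart of [exc_tail]. *)
Fixpoint tailcnt (m k x : nat) (l : seq (R * set R)) : R :=
  match l with
  | [::] => ker R (m - k) x 0
  | (t, A) :: l' =>
      \sum_(y < m.+1) ker R (Num.truncn (m%:R * t) - k) x y *
        (`[< A (y%:R * mesh m) >])%:R * tailcnt m (Num.truncn (m%:R * t)) y l'
  end.

Lemma tailcnt_ge0 m k x l : 0 <= tailcnt m k x l.
Proof.
elim: l k x => [|[t A] l IH] k x /=; first exact: ker_ge0.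
by apply: sumr_ge0 => y _; rewrite !mulr_ge0 // ker_ge0.
Qed.

Lemma qd_ge0 (t x : R) : 0 <= x -> 0 <= qd t x.
Proof. by move=> x0; rewrite /qd mulr_ge0 ?expR_ge0 // divr_ge0 // sqrtr_ge0. Qed.

Lemma pkill_ge0 (t x y : R) : 0 <= t -> 0 <= x -> 0 <= y -> 0 <= pkill t x y.
Proof.
move=> t0 x0 y0; rewrite /pkill mulr_ge0 ?invr_ge0 ?sqrtr_ge0 // subr_ge0 ler_expR.
by apply: ler_wpM2r; [rewrite invr_ge0 mulr_ge0|rewrite lerN2; nra].
Qed.

Definition good_list (s : R) (l : seq (R * set R)) :=
  path (fun a b => a.1 < b.1) (s, setT) l /\ (last (s, setT) l).1 < 1 /\
  forall p, p \in map snd l -> lopen p.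

Lemma good_list_cons s t A l : good_list s ((t, A) :: l) -> [/\ s < t, t < 1, lopen A & good_list t l].
Proof.
move=> [/= /andP[st p] [la h]]; split => //.
- have : forall (l : seq (R * set R)) (a : R * set R), path (fun a b => a.1 < b.1) a l -> a.1 <= (last a l).1.
    by elim=> [|b q IH] a //= /andP[ab /IH]; exact/le_trans/ltW.
  by move=> /(_ l (t, A) p) /le_lt_trans; apply.
- by apply: h; rewrite mem_head.
- split; last split.
  + by case: l p {la h} => [|b q] //= .
  + by case: l p la {h}.
  + by move=> q ql; apply: h; rewrite in_cons ql orbT.
Qed.

Lemma exc_tail_ge0 l (s x : R) : good_list s l -> 0 < x -> (0 <= exc_tail s x l)%E.
Proof.
elim: l s x => [|[t A] l IH] s x /= gl x0; first by rewrite lee_fin qd_ge0 // ltW.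
have [st t1 oA gl'] := good_list_cons gl.
apply: integral_ge0 => y [Ay /= y0]; apply: mule_ge0; last exact: IH.
by rewrite lee_fin pkill_ge0 ?subr_ge0 ?ltW.
Qed.

Lemma lowlim_cvg (b : R) u : u m @[m --> \oo] --> b -> lowlim b%:E u.
Proof.
move=> /cvgrPdist_lt h r; rewrite lte_fin => rb; have := h (b - r); rewrite subr_gt0 => /(_ rb).
by apply: filterS => m; rewrite ltr_norml => /andP[_]; lra.
Qed.

Lemma lowlim_near (b : \bar R) u v : (\forall m \near \oo, u m = v m) -> lowlim b u -> lowlim b v.
Proof.
move=> e h r /h; apply: filterS2 e => m -> //.
Qed.

Lemma sub_scaled (k k' : nat -> nat) (s t : R) : s < t ->
  (k m)%:R / m%:R @[m --> \oo] --> s -> (k' m)%:R / m%:R @[m --> \oo] --> t ->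
  (k' m - k m)%N%:R / m%:R @[m --> \oo] --> t - s.
Proof.
move=> st hk hk'.
have h : (k' m)%:R / m%:R - (k m)%:R / m%:R @[m --> \oo] --> t - s by apply: cvgB.
have d0 : 0 < (t - s) / 2 by rewrite divr_gt0 // subr_gt0.
apply: cvg_trans h; apply: near_eq_cvg; near=> m.
have mp : 0 < m%:R :> R by rewrite ltr0n; near: m; exists 1%N.
have h1 : (k m)%:R / m%:R < (s + t) / 2.
  near: m; move/cvgrPdist_lt: hk => /(_ _ d0); apply: filterS => m.
  by rewrite ltr_norml => /andP[+ _]; lra.
have h2 : (s + t) / 2 < (k' m)%:R / m%:R.
  near: m; move/cvgrPdist_lt: hk' => /(_ _ d0); apply: filterS => m.
  by rewrite ltr_norml => /andP[_]; lra.
have kk : (k m <= k' m)%N.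
  rewrite -(ler_nat R) -(ler_pM2r (_ : 0 < m%:R^-1)) ?invr_gt0 //.
  by apply/ltW; exact: lt_trans h1 h2.
by rewrite natrB // mulrBl.
Unshelve. all: by end_near. Qed.

Lemma truncn_scaled (t : R) : 0 <= t -> (Num.truncn (m%:R * t))%:R / m%:R @[m --> \oo] --> t.
Proof.
move=> t0; apply/cvgrPdist_lt => e e0; have [N hN] := harmonic_small e0.
exists N.+1 => // -[//|m] /= Nm; have := hN m Nm.
have mp : 0 < m.+1%:R :> R by rewrite ltr0n.
have /andP[h1 h2] : (Num.truncn (m.+1%:R * t))%:R <= m.+1%:R * t < (Num.truncn (m.+1%:R * t)).+1%:R.
  by rewrite truncn_itv // mulr_ge0 // ltW.
have {h2} : m.+1%:R * t < (Num.truncn (m.+1%:R * t))%:R + 1 by rewrite natr1.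
move: h1; move: (Num.truncn _) => n; move: (n%:R : R) (m.+1%:R : R) mp => z q q0 h1 h2 h3.
apply: le_lt_trans h3; rewrite ler_norml.
have -> : t - z / q = (q * t - z) / q by field; rewrite gt_eqF.
by apply/andP; split; [rewrite ler_pdivlMr // mulNr|rewrite ler_pdivrMr //]; rewrite mulVf ?gt_eqF //; lra.
Qed.

(** Each intermediate kernel divided by the mesh is a density, and that mesh is consumed by the
    Riemann sum; only the final return to 0 needs the factor [m / 2]. *)
Lemma tailcnt_lowlim l (s xi : R) (k x : nat -> nat) : 0 < xi -> 0 <= s -> s < 1 -> good_list s l ->
  (k m)%:R / m%:R @[m --> \oo] --> s -> (x m)%:R * mesh m @[m --> \oo] --> xi ->
  lowlim (exc_tail s xi l) (fun m => m%:R / 2 * tailcnt m (k m) (x m) l).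
Proof.
elim: l s xi k x => [|[t A] l IH] s xi k x xi0 s0 s1 gl hk hx.
  apply: lowlim_cvg; apply: (@ker0_scaled R (fun m => m - k m)%N) => //; first by rewrite subr_gt0.
  apply: sub_scaled => //; apply: cvg_near_cst; exists 1%N => // m /= m0.
  by rewrite divff // pnatr_eq0 -lt0n.
have [st t1 oA gl'] := good_list_cons gl; have t0 : 0 <= t by apply: le_trans (ltW st).
have hk' := truncn_scaled t0.
have hd := sub_scaled st hk hk'; have ts : 0 < t - s by rewrite subr_gt0.
have := @lowlim_riemann A (pkill (t - s) xi) (fun y => exc_tail t y l)
  (fun m y => ker R (Num.truncn (m%:R * t) - k m) (x m) y / mesh m)
  (fun m y => m%:R / 2 * tailcnt m (Num.truncn (m%:R * t)) y l) oA.
move=> h; apply: lowlim_near (h _ _ _ _ _ _) => {h}.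
- exists 1%N => // m /= m0; have h0 := mesh_gt0 m0.
  rewrite !mulr_sumr; apply: eq_bigr => y _.
  by field; rewrite gt_eqF.
- by move=> m y; rewrite divr_ge0 ?ker_ge0 ?sqrtr_ge0.
- by move=> m y; rewrite mulr_ge0 ?tailcnt_ge0 // divr_ge0.
- by move=> y y0; rewrite pkill_ge0 ?ltW.
- by move=> y y0; exact: exc_tail_ge0.
- by move=> eta y eta0 hy; apply: ker_scaled.
- by move=> eta y eta0 hy; apply: IH.
Qed.

Lemma cvg_sqrt_bw0 : Num.sqrt m%:R * bw R m 0 @[m --> \oo] --> (Num.sqrt pi)^-1.
Proof.
rewrite -cbwooE; have h := @cbw_cvg R.
by apply: cvg_trans h; apply: near_eq_cvg; apply: nearW => m; rewrite /cbw mulrC.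
Qed.

Lemma fdd_lowlim l : good_list 0 l ->
  lowlim (exc_fdd l) (fun m => tailcnt m 0 0 l / ker R m 0 0).
Proof.
have kp m : 0 < ker R m 0 0.
  rewrite ker0E; apply: mulr_gt0.
    by rewrite divr_gt0 ?exprn_gt0 // ltr0n bin_gt0 /=; lia.
  by rewrite mulr0 add0r addr0 natr1 divr_gt0 // ltr0n.
case: l => [|[t A] l] gl.
  apply: lowlim_cvg; apply: cvg_near_cst; apply: nearW => m.
  by rewrite /= subn0 divff // gt_eqF.
have [t0 t1 oA gl'] := good_list_cons gl.
have hk' := truncn_scaled (ltW t0).
have := @lowlim_riemann A (qd t) (fun y => exc_tail t y l)
  (fun m y => m%:R / 2 * ker R (Num.truncn (m%:R * t)) 0 y)
  (fun m y => m%:R / 2 * tailcnt m (Num.truncn (m%:R * t)) y l) oA.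
set I := (\int[mu]_(y in _) _)%E; move=> h.
have {}h : lowlim I (fun m => mesh m * \sum_(y < m.+1) (m%:R / 2 * ker R (Num.truncn (m%:R * t)) 0 y) *
    (`[< A (y%:R * mesh m) >])%:R * (m%:R / 2 * tailcnt m (Num.truncn (m%:R * t)) y l)).
  apply: h.
  - by move=> m y; rewrite mulr_ge0 ?ker_ge0 // divr_ge0.
  - by move=> m y; rewrite mulr_ge0 ?tailcnt_ge0 // divr_ge0.
  - by move=> y y0; rewrite qd_ge0 ?ltW.
  - by move=> y y0; exact: exc_tail_ge0.
  - move=> eta y eta0 hy.
    have h := @ker0_scaled R _ _ t0 hk' _ _ hy.
    by apply: cvg_trans h; apply: near_eq_cvg; apply: nearW => m; rewrite ker_sym0.
  - by move=> eta y eta0 hy; apply: tailcnt_lowlim => //; exact: ltW.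
have I0 : (0 <= I)%E.
  apply: integral_ge0 => y [Ay /= y0]; apply: mule_ge0; last exact: exc_tail_ge0.
  by rewrite lee_fin qd_ge0 // ltW.
have s20 : 0 < Num.sqrt 2 :> R by rewrite sqrtr_gt0.
have spi : 0 < Num.sqrt pi :> R by rewrite sqrtr_gt0 pi_gt0.
(* Exactly what relates [1 / ker m 0 0] to the mesh times [(m / 2)^2]; its limit is the normalizing
   constant [2 sqrt (2 pi)] of [exc_fdd]. *)
pose c (m : nat) : R := 4 / Num.sqrt 2 * (1 + m%:R^-1) * (Num.sqrt m%:R * bw R m 0)^-1.
have hc : c m @[m --> \oo] --> (2 * Num.sqrt (2 * pi) : R).
  have -> : 2 * Num.sqrt (2 * pi) = 4 / Num.sqrt 2 * (1 + 0) * (Num.sqrt pi)^-1^-1 :> R.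
    have ss : Num.sqrt 2 * Num.sqrt 2 = 2 :> R by rewrite -expr2 sqr_sqrtr.
    rewrite addr0 mulr1 invrK sqrtrM //; apply: (mulfI (_ : Num.sqrt 2 != 0)); first by rewrite gt_eqF.
    transitivity (Num.sqrt 2 * Num.sqrt 2 * (2 * Num.sqrt pi) : R); first by ring.
    by rewrite ss; field; rewrite gt_eqF.
  apply: cvgM; last by apply: cvgV; [rewrite invr_eq0 gt_eqF|exact: cvg_sqrt_bw0].
  apply: cvgMr; apply: cvgD; first exact: cvg_cst.
  apply/cvgrPdist_lt => e e0; have [N hN] := harmonic_small e0.
  exists N.+1 => // -[//|m] /= Nm; rewrite sub0r normrN ger0_norm ?invr_ge0 //; exact: hN.
have c0 m : 0 <= c m.
  by rewrite /c !mulr_ge0 ?invr_ge0 ?addr_ge0 ?mulr_ge0 ?sqrtr_ge0 ?bw_ge0 ?invr_ge0 ?ler0n // ltW.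
have := lowlimM h hc c0 _ I0; move=> {}h; apply: lowlim_near (h _); last first.
  move=> m; rewrite mulr_ge0 ?sqrtr_ge0 // sumr_ge0 // => y _.
  by rewrite !mulr_ge0 ?ker_ge0 ?tailcnt_ge0 ?invr_ge0 ?ler0n.
exists 1%N => // m /= m0; rewrite subn0 [in RHS]mulr_suml !mulr_sumr; apply: eq_bigr => y _.
have mp : 0 < m%:R :> R by rewrite ltr0n.
have smp : 0 < Num.sqrt m%:R :> R by rewrite sqrtr_gt0.
have b0 : 0 < bw R m 0 by rewrite divr_gt0 ?exprn_gt0 // ltr0n bin_gt0 /=; lia.
rewrite /c mesh_sqrt ker0E mulr0 addr0 add0r.
have sm2 : Num.sqrt m%:R ^+ 2 = m%:R :> R by rewrite sqr_sqrtr.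
move: (tailcnt _ _ _ _) (ker R _ 0 y) (`[< _ >]%:R) => T K B.
move: smp sm2; move: (Num.sqrt m%:R) => q q0 <-.
have q1 : 0 < q ^+ 2 + 1 by rewrite ltr_wpDl // sqr_ge0.
by field; rewrite !gt_eqF.
Qed.

End Riemann.

(** * Counting Dyck words by their heights on a time grid *)

Section GridCount.
Variable R : realType.
Local Notation mesh m := (Num.sqrt (2 / m%:R) : R).
Local Notation pt m t := (Num.truncn (m%:R * t : R)).

(** A test on words that follows the recursion of [tailcnt] literally, including its cut at height
    [2 m], so that the number of accepted words is exactly [tailcnt] rescaled. *)
Fixpoint gridrun (m k x : nat) (l : seq (R * set R)) (v : seq bool) : bool :=
  match l with
  | [::] => run (x + x) v == Some 0%N
  | (t, A) :: l' =>
      let j := (pt m t - k).*2 in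
      if run (x + x) (take j v) is Some z then
        [&& ~~ odd z, (z./2 < m.+1)%N, `[< A ((z./2)%:R * mesh m) >] &
            gridrun m (pt m t) z./2 l' (drop j v)]
      else false
  end.

Lemma pt_le m (s t : R) : s <= t -> (pt m s <= pt m t)%N.
Proof. by move=> st; apply: le_truncn; rewrite ler_wpM2l. Qed.

Lemma pt_lt1 m (t : R) : t < 1 -> (pt m t <= m)%N.
Proof.
move=> t1; rewrite truncn_le_nat; apply: le_lt_trans (_ : m%:R * 1 < _).
  by rewrite ler_wpM2l // ltW.
by rewrite mulr1 ltr_nat.
Qed.

Lemma sum_run_even n x K (g : nat -> R) :
  \sum_(u : n.-tuple bool) (if run x u is Some z then
      (~~ odd z && (z./2 < K)%N)%:R * g z./2 else 0) =
  \sum_(y < K) (npaths n x (y + y)%N)%:R * g y.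
Proof.
under [RHS]eq_bigr do rewrite /npaths natr_sum mulr_suml.
rewrite exchange_big /=; apply: eq_bigr => u _.
case: (run x u) => [z|]; last by rewrite big1 // => y _; rewrite mul0r.
have [/andP[oz zK]|hz] := boolP (~~ odd z && (z./2 < K)%N).
  rewrite (bigD1 (Ordinal zK)) //= addnn even_halfK // eqxx big1 ?addr0 // => y ne.
  case: eqP => [[e]|]; last by rewrite mul0r.
  by move: ne; rewrite -(inj_eq val_inj) /= e addnn half_double eqxx.
rewrite mul0r big1 // => y _; case: eqP => [[e]|]; last by rewrite mul0r.
by move: hz; rewrite e addnn odd_double half_double ltn_ord.
Qed.

Lemma count_gridrun (l : seq (R * set R)) (s : R) m x : s < 1 -> good_list s l ->
  \sum_(v : (m - pt m s).*2.-tuple bool) (gridrun m (pt m s) x l v)%:R =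
  4 ^+ (m - pt m s) * tailcnt m (pt m s) x l.
Proof.
elim: l s x => [|[t A] l IH] s x s1 gl.
  rewrite /= /ker mulrCA divff ?mulr1 ?expf_neq0 ?pnatr_eq0 //.
  by rewrite -natr_sum /npaths -addnn.
have [st t1 oA gl'] := good_list_cons gl.
set k := pt m s; set k' := pt m t.
have kk : (k <= k')%N by apply: pt_le; exact: ltW.
have km : (k' <= m)%N by apply: pt_lt1.
have -> : ((m - k).*2 = (k' - k).*2 + (m - k').*2)%N by lia.
rewrite (@big_tuple_add R _ _ (fun v => (gridrun m k x ((t, A) :: l) v)%:R)) /= -/k'.
pose g y := (`[< A (y%:R * mesh m) >])%:R * (4 ^+ (m - k') * tailcnt m k' y l).
transitivity (\sum_(u : (k' - k).*2.-tuple bool) (if run (x + x) u is Some z then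
      (~~ odd z && (z./2 < m.+1)%N)%:R * g z./2 else 0)).
  apply: eq_bigr => u _; under eq_bigr do rewrite take_size_cat ?size_tuple // drop_size_cat ?size_tuple //.
  case: (run (x + x) u) => [z|]; last by rewrite big1.
  rewrite /g -IH // !mulr_sumr; apply: eq_bigr => v _.
  by rewrite !mulrA -!natrM !mulnb !andbA.
rewrite sum_run_even mulr_sumr; apply: eq_bigr => y _; rewrite /g /ker.
have -> : (m - k = (k' - k) + (m - k'))%N by lia.
by rewrite exprD -[(k' - k).*2]addnn; field; rewrite expf_neq0 // pnatr_eq0.
Qed.

Lemma hts_cat_ge u v i : hts (u ++ v) (size u + i) = hts u (size u) + hts v i.
Proof.
elim: i => [|i IH]; first rewrite addn0 hts0 addr0.
  by apply: eq_bigr => j _; rewrite nth_cat ltn_ord.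
by rewrite addnS !htsS IH addrA nth_cat ltnNge leq_addr /= addKn.
Qed.

Lemma hts_cat_le u v i : (i <= size u)%N -> hts (u ++ v) i = hts u i.
Proof. by move=> iu; apply: eq_bigr => j _; rewrite nth_cat (leq_trans (ltn_ord j)). Qed.

Definition gridok (m : nat) (l : seq (R * set R)) (v : seq bool) :=
  all (fun p => `[< p.2 ((hts v (pt m p.1).*2)%:~R * mesh m / 2) >]) l.

(** This direction is the one wanted: the accepted words are among those meeting the constraints,
    and only lower bounds on counts are sought. *)
Lemma gridrun_ok (l : seq (R * set R)) (s : R) m x v : s < 1 -> good_list s l ->
  size v = (m - pt m s).*2 -> gridrun m (pt m s) x l v ->
  run (x + x) v = Some 0%N /\
  all (fun p => `[< p.2 ((x%:Z *+ 2 + hts v (pt m p.1 - pt m s).*2)%:~R * mesh m / 2) >]) l.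
Proof.
elim: l s x v => [|[t A] l IH] s x v s1 gl sv; first by move=> /eqP.
have [st t1 oA gl'] := good_list_cons gl.
rewrite /=; set k := pt m s in sv *; set k' := pt m t; set j := (k' - k).*2.
have kk : (k <= k')%N by apply: pt_le; exact: ltW.
have km : (k' <= m)%N by apply: pt_lt1.
have jv : (j <= size v)%N by rewrite sv /j leq_double leq_sub2r.
have st' : size (take j v) = j by rewrite size_takel.
case E : (run (x + x) (take j v)) => [z|//] /and4P[oz zm Az rz].
have sd : size (drop j v) = (m - k').*2 by rewrite size_drop sv /j; lia.
have [r1 r2] := IH t z./2 (drop j v) t1 gl' sd rz.
have zz : (z./2 + z./2 = z)%N by rewrite addnn even_halfK.
have [_ hz] := (run_hts _ _ _).1 E; rewrite st' in hz.
have hj : hts v j = hts (take j v) j by rewrite -{1}(cat_take_drop j v) hts_cat_le // st'.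
split; first by rewrite -(cat_take_drop j v) run_cat E -zz.
apply/andP; split.
  apply/asboolP; move/asboolP: Az; congr A.
  have -> : x%:Z *+ 2 + hts v j = (z./2)%:Z *+ 2 by rewrite hj; lia.
  have -> : ((z./2)%:Z *+ 2)%:~R = (z./2)%:R * 2 :> R by rewrite mulr2n intrD; ring.
  by field.
have mono : {in l, forall p, t <= p.1}.
  case: gl' => [+ _]; have -> : path (fun a b : R * set R => a.1 < b.1) (t, setT) l = path (fun a b : R * set R => a.1 < b.1) (t, setT) l by [].
  move=> /(order_path_min (fun (y x z : R * set R) (h1 : x.1 < y.1) h2 => lt_trans h1 h2)) /allP h p /h /=.
  exact: ltW.
move/allP: r2 => r2; apply/allP => p pl; have := r2 p pl.
have kp : (k' <= pt m p.1)%N by apply/pt_le/mono.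
suff -> : (z./2)%:Z *+ 2 + hts (drop j v) (pt m p.1 - k').*2 =
   x%:Z *+ 2 + hts v (pt m p.1 - k).*2 by [].
have -> : ((pt m p.1 - k).*2 = size (take j v) + (pt m p.1 - k').*2)%N by rewrite st' /j; lia.
have -> i : hts v (size (take j v) + i) = hts (take j v) (size (take j v)) + hts (drop j v) i.
  by rewrite -{1}(cat_take_drop j v) hts_cat_ge.
by rewrite st'; lia.
Qed.

Lemma dyck_fdd_lowlim (l : seq (R * set R)) : good_list 0 l ->
  lowlim (exc_fdd l) (fun m =>
    #|[pred v : m.*2.-tuple bool | dyck v && gridok m l v]|%:R / (catalan m)%:R).
Proof.
move=> gl r hr; have := fdd_lowlim gl hr; apply: filterS => m /le_trans; apply.
have p4 : 0 < 4 ^+ m :> R by rewrite exprn_gt0.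
have -> : tailcnt m 0 0 l / ker R m 0 0 = (4 ^+ m * tailcnt m 0 0 l) / (catalan m)%:R.
  have -> : ker R m 0 0 = (catalan m)%:R / 4 ^+ m by rewrite /ker /catalan -addnn.
  by rewrite invf_div mulrA [_ * 4 ^+ m]mulrC.
have c0 : 0 <= (catalan m)%:R^-1 :> R by rewrite invr_ge0.
rewrite ler_wpM2r //.
have pt0 : pt m 0 = 0%N by rewrite mulr0 truncn0.
have := @count_gridrun l 0 m 0 ltr01 gl; rewrite pt0 subn0 => <-.
rewrite -natr_sum ler_nat -sum1_card big_mkcond [leqRHS]big_mkcond /=.
rewrite [leqRHS]big_mkcond; apply: leq_sum => v _.
case E : (gridrun _ _ _ _ _) => //.
have := @gridrun_ok l 0 m 0 v ltr01 gl; rewrite pt0 subn0 size_tuple => /(_ erefl E)[h1 h2].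
rewrite inE /dyck h1 eqxx /gridok /=; suff -> : all (fun p => `[< p.2 ((hts v (pt m p.1).*2)%:~R * mesh m / 2) >]) l by [].
by apply: etrans h2; apply: eq_all => p; rewrite subn0 mul0rn add0r.
Qed.

Lemma pt_gridpt m N i : (0 < N)%N -> (pt m (i%:R / N%:R)).*2 = (m * i %/ N).*2.
Proof.
move=> N0; congr double; rewrite mulrA -natrM; apply/eqP.
have Np : 0 < N%:R :> R by rewrite ltr0n.
rewrite truncn_eq ?divr_ge0 // ler_pdivlMr // ltr_pdivrMr // -!natrM ler_nat ltr_nat.
by rewrite leq_divM ltn_ceil.
Qed.

End GridCount.

(** * Convergence of uniform pointed trees *)

Section UpSteps.
Variable R : realType.

(** Marked times are enumerated by the number of up-steps made so far. A uniform vertex thus becomes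
    a uniform index [j] up to [m], and [j / m] differs from the time fraction [k / (2 m)] only by a
    height over [2 m]. *)
Lemma sum_upsteps (v : seq bool) (H : nat -> R) :
  \sum_(k < (size v).+1 | (k == 0%N :> nat) || nth false v k.-1) H (count id (take k v)) =
  \sum_(j < (count id v).+1) H j.
Proof.
elim: v H => [|a v IH] H; first by rewrite big_mkcond /= !big_ord_recl !big_ord0.
have := IH (fun j => H (a + j)%N).
rewrite big_mkcond big_ord_recl /= take0 addn0 => h.
rewrite big_mkcond big_ord_recl big_ord_recl /= !take0 /= addn0.
have {}h : \sum_(i < size v) (if nth false v i then H (a + count id (take i.+1 v))%N else 0) =
   \sum_(j < (count id v).+1) H (a + j)%N - H a.
  by rewrite -h [RHS]addrAC subrr add0r; apply: eq_bigr.
rewrite [X in _ + (_ + X) = _](_ : _ = \sum_(j < (count id v).+1) H (a + j)%N - H a); last first.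
  by rewrite -h; apply: eq_bigr.
case: a {h}; last by rewrite add0r addrC subrK.
by rewrite [RHS]big_ord_recl; congr (_ + _); rewrite addrC subrK.
Qed.

Lemma hts_count (v : seq bool) k : (k <= size v)%N ->
  hts v k = (count id (take k v))%:Z *+ 2 - k%:Z.
Proof.
elim: k => [_|k IH kv]; first by rewrite hts0 take0.
rewrite htsS IH ?(ltnW kv) // (take_nth true kv) -cats1 count_cat /= addn0.
by case: (nth _ _ _) => /=; lia.
Qed.

Lemma sum_dyck_upsteps m (v : m.*2.-tuple bool) (H : nat -> R) : (0 < m)%N -> dyck v ->
  \sum_(k < m.*2 | (k == 0%N :> nat) || nth false v k.-1) H (count id (take k v)) =
  \sum_(j < m.+1) H j.
Proof.
move=> m0 dv; have sv := size_tuple v.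
have -> : \sum_(j < m.+1) H j = \sum_(j < (count id v).+1) H j by rewrite (dyck_count m0 sv dv).
rewrite -sum_upsteps sv big_mkcond [RHS]big_mkcond big_ord_recr /=.
suff -> : nth false v m.*2.-1 = false by rewrite orbF ifF ?addr0 //; lia.
have /eqP/run_hts[h1 h2] := dv; rewrite sv add0r in h2.
have e : m.*2 = m.*2.-1.+1 by lia.
have h3 := htsS v m.*2.-1; rewrite -e -h2 in h3.
have := h1 m.*2.-1; rewrite sv => /(_ ltac:(lia)).
rewrite (set_nth_default true) ?sv; last lia.
by move: h3; case: (nth _ _ _) => //=; lia.
Qed.

End UpSteps.

Section Average.
Variable R : realType.
Local Notation mu := (@lebesgue_measure R).

Definition avg (a : R -> R) (m : nat) : R := m.+1%:R^-1 * \sum_(j < m.+1) a (j%:R / m%:R).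

Definition int01 (a : R -> R) : \bar R := (\int[mu]_(u in `[0%R, 1%R]) (a u)%:E)%E.

Lemma avg_le (a b : R -> R) m e : (0 < m)%N ->
  (forall u : R, 0 <= u <= 1 -> a u <= b u + e) -> avg a m <= avg b m + e.
Proof.
move=> m0 h; have mp : 0 < m%:R :> R by rewrite ltr0n.
have m1 : 0 < m.+1%:R :> R by rewrite ltr0n.
have -> : avg b m + e = m.+1%:R^-1 * \sum_(j < m.+1) (b (j%:R / m%:R) + e).
  rewrite big_split /= sumr_const card_ord mulrDr -[e *+ _]mulr_natl mulKf ?gt_eqF //.
rewrite /avg; apply: ler_wpM2l; first by rewrite invr_ge0 ltW.
apply: ler_sum => j _; apply: h.
by rewrite divr_ge0 //= ler_pdivrMr // mul1r ler_nat -ltnS.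
Qed.

Lemma avg_bnd (a : R -> R) m C : (0 < m)%N ->
  (forall u : R, 0 <= u <= 1 -> 0 <= a u <= C) -> 0 <= avg a m <= C.
Proof.
move=> m0 h; apply/andP; split.
  rewrite mulr_ge0 ?invr_ge0 // sumr_ge0 // => j _.
  have mp : 0 < m%:R :> R by rewrite ltr0n.
  suff /h/andP[] : 0 <= (j%:R / m%:R : R) <= 1 by [].
  by rewrite divr_ge0 //= ler_pdivrMr // mul1r ler_nat -ltnS.
have := @avg_le a (fun=> 0) m C m0; rewrite {2}/avg big1 // mulr0 add0r; apply.
by move=> u /h/andP[].
Qed.

(** Measurability of [a] is part of the conclusion: on the half-open interval it is the pointwise
    limit of the sampled step functions. *)
Lemma avg_int01 (a : R -> R) (C K : R) :
  (forall u : R, 0 <= u <= 1 -> 0 <= a u <= C) ->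
  (forall u u' : R, 0 <= u <= 1 -> 0 <= u' <= 1 -> a u' <= a u + K * `|u' - u|) ->
  measurable_fun (`[0, 1]%classic : set R) a /\
  exists2 I : R, int01 a = I%:E & avg a m @[m --> \oo] --> I.
Proof.
move=> ha hK.
have C0 : 0 <= C by have /andP[h1 h2] := ha 0 (ltac:(rewrite lexx ler01 //)); lra.
have K0 : 0 <= K.
  have := hK 0 1; have := hK 1 0; rewrite !subr0 sub0r normrN normr1 mulr1 lexx ler01 /= !lexx.
  by move=> /(_ isT isT) h1 /(_ isT isT) h2; lra.
pose D := (`[0, +oo[%classic : set R).
have mD : measurable D by exact: measurable_itv.
(* Samples are spaced by [1 / (m + 1)] but each fills a cell of length [1 / (m + 2)]: the [m + 2]
   cells tile the unit interval and the integral is exactly [avg a m.+1]. *)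
pose p m z := if (z < m.+2)%N then a (z%:R / m.+1%:R) else 0.
pose f (m : nat) (u : R) : \bar R := (p m (Num.truncn (u / (m.+2%:R)^-1)))%:E.
(* All step functions vanish from 1 on, so the limit does too; the endpoint is a null set and is put
   back at the end. *)
pose g (u : R) : R := if u < 1 then a u else 0.
have hk0 (k : nat) : 0 < (k.+2%:R)^-1 :> R by rewrite invr_gt0.
have in01 m z : (z < m.+2)%N -> 0 <= (z%:R / m.+1%:R : R) <= 1.
  by move=> h; rewrite divr_ge0 //= ler_pdivrMr ?ltr0n // mul1r ler_nat -ltnS.
have supp m z : (m.+2 <= z)%N -> p m z = 0 by rewrite /p leqNgt => /negbTE ->.
have p0 m z : 0 <= p m z <= C.
  by rewrite /p; case: ifP => [/in01/ha //|_]; rewrite lexx.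
have mf m : measurable_fun D (f m).
  by apply/measurable_EFinP; apply: (measurable_stepfun (hk0 m) (supp m)).
have f_g u : D u -> f ^~ u @ \oo --> (g u)%:E.
  rewrite /D /= in_itv /= andbT => u0; apply: cvg_EFin; first by apply: nearW.
  rewrite /comp /= /g; apply/cvgrPdist_le => e e0.
  have e0' : 0 < e / (K + 1) by rewrite divr_gt0 //; lra.
  have [N hN] := harmonic_small e0'; exists N => // m /= /hN h.
  rewrite invrK; have mp : 0 < m.+2%:R :> R by rewrite ltr0n.
  have mp1 : 0 < m.+1%:R :> R by rewrite ltr0n.
  have um : 0 <= u * m.+2%:R by rewrite mulr_ge0.
  have := truncn_itv um; set z := Num.truncn _ => /andP[z1 z2].
  have zlt : (z < m.+2)%N = (u < 1).
    apply/idP/idP => hz.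
      rewrite -(ltr_pM2r mp) mul1r; apply: lt_le_trans z2 _; by rewrite ler_nat.
    by rewrite -(ltr_nat R); apply: le_lt_trans z1 _; rewrite -[ltRHS]mul1r ltr_pM2r.
  rewrite /p zlt; case: ifP => [u1|_]; last by rewrite subrr normr0 ltW.
  have hz := in01 m z; rewrite zlt in hz; have {}hz := hz u1.
  have hu : 0 <= u <= 1 by rewrite u0 ltW.
  have d : `|z%:R / m.+1%:R - u| <= m.+1%:R^-1.
    have z2' : u * m.+2%:R <= z%:R + 1 by rewrite natr1 ltW.
    have e2 : m.+2%:R = m.+1%:R + 1 :> R by rewrite natr1.
    rewrite e2 in z1 z2'; rewrite ler_norml; apply/andP; split.
      rewrite -(ler_pM2r mp1) mulNr mulVf ?gt_eqF // mulrBl divfK ?gt_eqF //; lra.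
    by rewrite -(ler_pM2r mp1) mulVf ?gt_eqF // mulrBl divfK ?gt_eqF //; lra.
  have h1 := hK _ _ hu hz; have h2 := hK _ _ hz hu; rewrite distrC in h2.
  have h3 : K * `|z%:R / m.+1%:R - u| <= e.
    apply: (@le_trans _ _ (K * (e / (K + 1)))).
      by rewrite ler_wpM2l // (le_trans d) // ltW.
    by rewrite mulrA ler_pdivrMr; [nra|lra].
  by rewrite ler_norml; apply/andP; split; lra.
have f_lt1 m (u : R) : 1 <= u -> p m (Num.truncn (u / (m.+2%:R)^-1)) = 0.
  move=> u1; rewrite supp // invrK truncn_ge_nat.
    by rewrite -[leLHS]mul1r ler_wpM2r.
  by rewrite mulr_ge0 //; lra.
have mg : measurable_fun D (fun u => (g u)%:E).
  by apply: (emeasurable_fun_cvg f).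
pose dom (u : R) : \bar R := ((C * expR 1)%:E * (exponential_pdf 1 u)%:E)%E.
have ig : mu.-integrable D dom.
  apply: integrableZl => //; apply: (integrableS measurableT) => //.
  exact: integrable_exponential_pdf.
have f_dom u m : D u -> (`|f m u| <= dom u)%E.
  rewrite /D /= in_itv /= andbT => u0.
  have [/(f_lt1 m) ->|u1] := leP 1 u.
    by rewrite normr0 /dom -EFinM lee_fin exponential_pdfE //= mul1r !mulr_ge0 ?expR_ge0.
  rewrite /dom -EFinM lee_fin exponential_pdfE //= mul1r mulN1r.
  have /andP[p1 p2] := p0 m (Num.truncn (u / (m.+2%:R)^-1)); rewrite ger0_norm //.
  apply: le_trans p2 _; rewrite -mulrA -expRD; apply: ler_peMr => //.
  by rewrite -[leLHS]expR0 ler_expR; lra.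
have [||i1 _ cv] := @dominated_convergence _ (measurableTypeR R) R mu D mD f (fun u => (g u)%:E) dom mf mg _ ig.
- by apply: aeW.
- by apply: aeW => u m; exact: f_dom.
have avgE m : (\int[mu]_(x in D) f m x = (avg a m.+1)%:E)%E.
  rewrite (integral_stepfun (hk0 m) (fun z => proj1 (andP (p0 m z))) (supp m)).
  rewrite /avg; congr (_ * _)%:E; apply: eq_bigr => j _.
  by rewrite /p ltn_ord.
have mga : measurable_fun (`[0, 1[%classic : set R) a.
  apply: (@eq_measurable_fun _ _ _ _ _ g).
    by move=> u; rewrite inE /= in_itv /= /g => /andP[_ ->].
  apply: (measurable_funS (E := D)) => //; last exact/measurable_EFinP.
  by move=> u; rewrite /D /= !in_itv /= andbT => /andP[].
have ma : measurable_fun (`[0, 1]%classic : set R) a.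
  rewrite -(@setUitv1 _ _ (BLeft 0) 1 true) ?bnd_simp // measurable_funU //; split => //.
  exact: measurable_fun_set1.
have e01 : int01 a = (\int[mu]_(x in D) (g x)%:E)%E.
  rewrite /int01 -(@integral_itv_bndo_bndc R (BLeft 0) 1); last exact/measurable_EFinP.
  rewrite integral_mkcond [RHS]integral_mkcond; apply: eq_integral => u _.
  rewrite /patch !mem_setE !in_itv /= andbT /g.
  by have [u0|u0] := leP 0 u; case: (ltP u 1).
split => //; exists (fine (\int[mu]_(x in D) (g x)%:E)).
  by rewrite e01 fineK //; exact: integrable_fin_num i1.
rewrite -cvg_shiftS; have := cv.
rewrite (_ : [sequence _]_n = fun n => (avg a n.+1)%:E); last by apply/funext => n; rewrite /= avgE.
rewrite -{1}[X in _ --> X -> _]fineK; last exact: integrable_fin_num i1.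
by move=> /fine_cvgP[_].
Qed.

End Average.

Section GridTime.
Variable R : realType.

Lemma gridpt0 m N : gridpt m N 0 = 0%N.
Proof. by rewrite /gridpt muln0 div0n. Qed.

Lemma grid_time m N (t : R) : (0 < m)%N -> (0 < N)%N -> 0 <= t < 1 ->
  let j := Num.truncn (N%:R * t) in let q := Num.truncn (m.*2%:R * t) in
  [/\ (j < N)%N, (q < m.*2)%N, (gridpt m N j <= q)%N & (q <= (gridpt m N j.+1).+1)%N].
Proof.
move=> m0 N0 /andP[t0 t1] j q.
have Np : 0 < N%:R :> R by rewrite ltr0n.
have mp : 0 < m.*2%:R :> R by rewrite ltr0n double_gt0.
have Nt : 0 <= N%:R * t by rewrite mulr_ge0.
have mt : 0 <= m.*2%:R * t by rewrite mulr_ge0.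
have /andP[j1 j2] := truncn_itv Nt; have /andP[q1 q2] := truncn_itv mt.
rewrite -/j in j1 j2; rewrite -/q in q1 q2.
split.
- by rewrite -(ltr_nat R); apply: le_lt_trans j1 _; rewrite gtr_pMr.
- by rewrite -(ltr_nat R); apply: le_lt_trans q1 _; rewrite gtr_pMr.
- rewrite -ltnS -(ltr_nat R); apply: le_lt_trans q2.
  rewrite /gridpt -(ler_pM2r Np) -natrM; apply: (@le_trans _ _ (m.*2 * j)%:R).
    by rewrite ler_nat -doubleMl -doubleMl leq_double leq_divM.
  by rewrite natrM -mulrA [t * _]mulrC ler_wpM2l // ltW.
- have h : (m * j.+1 < (gridpt m N j.+1)./2.+1 * N)%N by rewrite /gridpt doubleK ltn_ceil.
  suff : (q < ((m * j.+1 %/ N).+1).*2)%N by rewrite /gridpt; lia.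
  rewrite -(ltr_nat R); apply: le_lt_trans q1 _.
  rewrite -(ltr_pM2r Np); apply: (@lt_le_trans _ _ (m.*2 * j.+1)%:R).
    by rewrite natrM -mulrA [t * _]mulrC ltr_pM2l.
  rewrite -natrM ler_nat -!doubleMl leq_double; move: h; rewrite /gridpt doubleK; exact: ltnW.
Qed.

(** Chaining from time 0 through at most [N] windows. The crude factor [N] does no harm, as [N] is
    fixed before [m] tends to infinity. *)
Lemma osc_good_max m N (r : R) v q : (0 < m)%N -> (0 < N)%N -> 0 <= r -> osc_good m N r v ->
  hts v m.*2 = 0 -> (q <= m.*2)%N ->
  `|hts v q|%:~R <= N%:R * (r * Num.sqrt m.*2%:R).
Proof.
move=> m0 N0 r0 og hn qm.
have rs : 0 <= r * Num.sqrt m.*2%:R by rewrite mulr_ge0 ?sqrtr_ge0.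
have grid j : (j <= N)%N -> `|hts v (gridpt m N j)|%:~R <= j%:R * (r * Num.sqrt m.*2%:R).
  elim: j => [_|j IH jN]; first by rewrite gridpt0 hts0 normr0 mul0r.
  have mono : (gridpt m N j <= gridpt m N j.+1)%N.
    by rewrite /gridpt leq_double leq_div2r // leq_mul2l leqnSn orbT.
  have top : (gridpt m N j.+1 <= m.*2)%N.
    rewrite /gridpt leq_double; apply: (@leq_trans (m * N %/ N)); last by rewrite mulnK.
    by rewrite leq_div2r // leq_mul2l jN orbT.
  have := og j (gridpt m N j.+1) jN mono (leqnSn _) top; have := IH (ltnW jN).
  rewrite -natr1 mulrDl mul1r => h1 h2; apply: le_trans (lerD h1 h2).
  rewrite -intrD ler_int; lia.
have [->|qn] := eqVneq q m.*2; first by rewrite hn normr0 mulr_ge0.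
have q2 : (q < m.*2)%N by rewrite ltn_neqAle qn.
have mp : 0 < m.*2%:R :> R by rewrite ltr0n double_gt0.
have ht : 0 <= (q%:R / m.*2%:R : R) < 1.
  by rewrite divr_ge0 //= ltr_pdivrMr // mul1r ltr_nat.
have [jN _ h1 h2] := grid_time m0 N0 ht; move: jN h1 h2.
rewrite (_ : m.*2%:R * (q%:R / m.*2%:R) = q%:R :> R) ?natrK; last first.
  by rewrite mulrCA divff ?mulr1 // gt_eqF.
set j := Num.truncn _ => jN h1 h2.
have := og j q jN h1 h2 qm; have := grid j (ltnW jN) => h3 h4.
apply: (@le_trans _ _ (j.+1%:R * (r * Num.sqrt m.*2%:R))); last by rewrite ler_wpM2r // ler_nat.
rewrite -natr1 mulrDl mul1r; apply: le_trans (lerD h3 h4).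
rewrite -intrD ler_int; lia.
Qed.

End GridTime.

(** * Discretization of paths in time and space *)

Section Cells.
Variables (R : realType) (p B : nat).
Let N := p.+1.
Implicit Types (z : {ffun 'I_p -> 'I_B.*2}) (y : nat -> R).

(** Cell indices run from [- B] to [B - 1]; the finite type of all [z] makes the sum over
    discretized paths a finite one. *)
Definition zv z (i : nat) : int := (oapp (fun j => nat_of_ord (z j)) 0%N (insub i))%:Z - B%:Z.

Lemma zvE z (i : 'I_p) : zv z i = (z i)%:Z - B%:Z.
Proof. by rewrite /zv valK. Qed.

Definition cell (b : int) : set R := [set x : R | b%:~R / N%:R < x <= (b + 1)%:~R / N%:R].

Definition gz z (j : nat) : R :=
  if (0 < j <= p)%N then (zv z j.-1 + 1)%:~R / N%:R else 0.

Definition gf z : R -> R := stepf N (gz z).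

Definition lz z : seq (R * set R) :=
  [seq (i.+1%:R / N%:R, cell (zv z i)) | i <- iota 0 p].

Definition incell z y := [forall i : 'I_p, `[< cell (zv z i) (y i.+1) >]].

Lemma lopen_cell b : lopen (cell b).
Proof.
move=> y /= /andP[y1 y2] y0; exists (y - b%:~R / N%:R); first by rewrite subr_gt0.
by move=> x; rewrite subKr => h1 h2; rewrite /cell /= h1 (le_trans h2).
Qed.

Lemma measurable_cell b : measurable (cell b).
Proof.
have -> : cell b = `](b%:~R / N%:R), ((b + 1)%:~R / N%:R)]%classic.
  by apply/seteqP; split => x; rewrite /cell /= in_itv.
exact: measurable_itv.
Qed.

Lemma cell_inj b b' x : cell b x -> cell b' x -> b = b'.
Proof.
have Np : 0 < N%:R :> R by rewrite ltr0n.
move=> /= /andP[h1 h2] /andP[h3 h4].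
have l1 : b < b' + 1 by rewrite -(ltr_int R) -(ltr_pM2r (_ : 0 < N%:R^-1)) ?invr_gt0 // (lt_le_trans h1).
have l2 : b' < b + 1 by rewrite -(ltr_int R) -(ltr_pM2r (_ : 0 < N%:R^-1)) ?invr_gt0 // (lt_le_trans h3).
lia.
Qed.

Lemma incell_inj z z' y : incell z y -> incell z' y -> z = z'.
Proof.
move=> /forallP h /forallP h'; apply/ffunP => i; apply/val_inj.
have /asboolP c := h i; have /asboolP c' := h' i.
by have := cell_inj c c'; rewrite !zvE => /addIr [].
Qed.

Lemma size_lz z : size (lz z) = p. Proof. by rewrite size_map size_iota. Qed.

Lemma nth_lz z i : (i < p)%N -> nth (0, setT) (lz z) i = (i.+1%:R / N%:R, cell (zv z i)).
Proof. by move=> ip; rewrite (nth_map 0%N) ?size_iota // nth_iota. Qed.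

Lemma path_lz z : path (fun a b : R * set R => a.1 < b.1) (0, setT) (lz z).
Proof.
apply/(pathP (0, setT)) => i; rewrite size_lz => ip.
have Np : 0 < N%:R :> R by rewrite ltr0n.
rewrite nth_lz //; case: i ip => [|i] ip /=; first by rewrite divr_gt0.
by rewrite nth_lz ?(ltnW ip) //= ltr_pM2r ?invr_gt0 // ltr_nat.
Qed.

Lemma last_lz z : (last (0, setT) (lz z)).1 < 1 :> R.
Proof.
have Np : 0 < N%:R :> R by rewrite ltr0n.
have [e|p0] := posnP p; first by rewrite /lz e /= ltr01.
rewrite -nth_last size_lz nth_lz ?prednK //=.
by rewrite ltr_pdivrMr // mul1r ltr_nat.
Qed.

Lemma good_lz z : good_list 0 (lz z).
Proof.
split; [exact: path_lz|split; first exact: last_lz].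
by move=> A /mapP[q /mapP[i _ ->] ->]; exact: lopen_cell.
Qed.

Lemma gridok_incell m z v : gridok m (lz z) v =
  incell z (fun j => (hts v (gridpt m N j))%:~R * Num.sqrt (2 / m%:R) / 2).
Proof.
apply/allP/forallP => h.
  move=> i; have := h (i.+1%:R / N%:R, cell (zv z i)).
  rewrite /= pt_gridpt //; apply; apply/mapP; exists (val i) => //.
  by rewrite mem_iota /= add0n ltn_ord.
move=> q /mapP[i]; rewrite mem_iota add0n => ip ->.
by have := h (Ordinal ip); rewrite /= pt_gridpt.
Qed.

Lemma gz_incell z y : y 0%N = 0 -> y N = 0 -> incell z y -> forall j, (j <= N)%N ->
  `|gz z j - y j| <= N%:R^-1.
Proof.
move=> y0 yN /forallP h j jN; have Np : 0 < N%:R :> R by rewrite ltr0n.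
have Ni : 0 <= N%:R^-1 :> R by rewrite invr_ge0 ltW.
rewrite /gz; case: ifP => [/andP[j0 jp]|hj].
  have jp' : (j.-1 < p)%N by rewrite prednK.
  have /asboolP /andP[c1 c2] := h (Ordinal jp'); rewrite /= prednK // in c1 c2.
  move: c1 c2; rewrite intrD mulrDl mul1r => c1 c2.
  by rewrite ler_norml; apply/andP; split; lra.
suff -> : y j = 0 by rewrite subrr normr0.
have [->|j0] := posnP j; first exact: y0.
have -> // : j = N by move: hj jN; rewrite j0 /= /N; lia.
Qed.

End Cells.

Section Pathwise.
Variables (R : realType) (F : pms R -> R) (M : R).
Hypothesis cF : bounded_cont_GH F.
Hypothesis FM : forall A, compact_pms A -> `|F A| <= M.
Variables (p B : nat) (K : R).
Hypothesis K0 : 0 <= K.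
Let N := p.+1.

(** The shift by [M] makes everything nonnegative, so that lower limits can be multiplied and
    unaccounted words dropped. *)
Definition Tz (z : {ffun 'I_p -> 'I_B.*2}) (u : R) : R := lipreg F K (gf z) u + M.

Lemma M_ge0 : 0 <= M.
Proof.
apply: le_trans (FM (_ : compact_pms (tree_space (stepf 1 (fun=> 0 : R)) 0))); first exact: normr_ge0.
by have [_] := stepf_codes 1 (fun=> 0 : R); apply.
Qed.

Lemma lipregM_bnd f u : codes f -> 0 <= u <= 1 -> 0 <= lipreg F K f u + M <= 2 * M.
Proof. by move=> cf hu; have /andP[] := lipreg_bnd FM K0 cf hu; lra. Qed.

Lemma lipregM_lip f u u' : codes f -> 0 <= u <= 1 ->
  lipreg F K f u' + M <= lipreg F K f u + M + K * `|u' - u|.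
Proof.
move=> cf hu; have := @lipreg_lip _ F M FM K f f u u' 0 K0 cf hu.
rewrite add0r addrAC lerD2r; apply => t _; by rewrite subrr normr0.
Qed.

Lemma gf_codes z : codes (gf (p := p) (B := B) z : R -> R).
Proof. exact: stepf_codes. Qed.

Lemma Tz_bnd z u : 0 <= u <= 1 -> 0 <= Tz z u <= 2 * M.
Proof. exact: lipregM_bnd (gf_codes z). Qed.

(** The four error terms: replacing [1 / sqrt (2 m)] by [c] on heights of size at most [N * r],
    oscillation between grid times, width of the cells, and displacement of the marked time from
    [k / (2 m)] to [j / m]. *)
Lemma treeval_lower m (c : R) v k z (r de : R) : (0 < m)%N -> 0 <= c -> 0 <= r -> (k <= m.*2)%N ->
  size v = m.*2 -> dyck v -> osc_good m N r v -> gridok m (lz R z) v ->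
  `|c * Num.sqrt m.*2%:R - 1| <= de ->
  Tz z ((count id (take k v))%:R / m%:R) -
    K * (de * (N%:R * r) + r + N%:R^-1 + N%:R * r / Num.sqrt m.*2%:R) <= treeval F m c v k + M.
Proof.
move=> m0 c0 r0 km sv dv og; rewrite gridok_incell => ic hde.
have [h0 hn] := (run_hts _ _ _).1 (eqP dv); rewrite sv add0r in h0 hn.
have mp : 0 < m.*2%:R :> R by rewrite ltr0n double_gt0.
have sp : 0 < Num.sqrt m.*2%:R :> R by rewrite sqrtr_gt0.
set S := Num.sqrt m.*2%:R in hde sp *.
have meshE : Num.sqrt (2 / m%:R) / 2 = S^-1 :> R.
  have m1 : 0 < m%:R :> R by rewrite ltr0n.
  apply: (@pexpIrn _ 2) => //; rewrite ?nnegrE ?divr_ge0 ?invr_ge0 ?sqrtr_ge0 //.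
  rewrite exprMn exprVn sqr_sqrtr ?divr_ge0 // exprVn sqr_sqrtr // -muln2 natrM.
  by field; rewrite gt_eqF.
have hk : 0 <= (k%:R / m.*2%:R : R) <= 1.
  by rewrite divr_ge0 //= ler_pdivrMr // mul1r ler_nat.
have hj : 0 <= ((count id (take k v))%:R / m%:R : R) <= 1.
  rewrite divr_ge0 //= ler_pdivrMr ?ltr0n // mul1r ler_nat -[X in (_ <= X)%N](dyck_count m0 sv dv).
  by rewrite -[in X in (_ <= X)%N](cat_take_drop k v) count_cat leq_addr.
pose f := stepf m.*2 (fun i => c * (hts v i)%:~R : R).
have cf : codes f by exact: stepf_codes.
have mx q : (q <= m.*2)%N -> `|hts v q|%:~R <= N%:R * (r * S).
  by move=> qm; apply: osc_good_max => //; rewrite -hn.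
have h1 := lipreg_le FM K0 cf hk.
have fg t : 0 <= t <= 1 -> `|gf z t - f t| <= de * (N%:R * r) + r + N%:R^-1.
  move=> /andP[t0 t1]; have Ni : 0 <= N%:R^-1 :> R by rewrite invr_ge0.
  have de0 : 0 <= de by apply: le_trans hde.
  rewrite /gf /f /stepf.
  have [t1'|t1'] := ltP t 1; last first.
    have -> : t = 1 by apply: le_anti; rewrite t1 t1'.
    by rewrite !mulr1 !natrK -hn mulr0 subr0 /gz ltnn andbF normr0 !addr_ge0 // !mulr_ge0.
  have [jN qm g1 g2] := grid_time m0 (isT : (0 < N)%N) (introT andP (conj t0 t1')).
  set j := Num.truncn _ in jN g1 g2 *; set q := Num.truncn _ in qm g1 g2 *.
  have o := og j q jN g1 g2 (ltnW qm).
  have g := @gz_incell R p B z _ _ _ ic j (ltnW jN).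
  rewrite gridpt0 hts0 !mul0r in g.
  have gN : gridpt m N N = m.*2 by rewrite /gridpt mulnK.
  rewrite gN -hn !mul0r in g; have {}g := g erefl erefl.
  rewrite -mulrA meshE in g.
  have a1 : `|(hts v q)%:~R / S - (hts v (gridpt m N j))%:~R / S : R| <= r.
    rewrite -mulrBl normrM normfV (gtr0_norm sp) ler_pdivrMr //.
    by rewrite -intrB -intr_norm.
  have a2 : `|c * (hts v q)%:~R - (hts v q)%:~R / S| <= de * (N%:R * r).
    have -> : c * (hts v q)%:~R - (hts v q)%:~R / S = (c * S - 1) * ((hts v q)%:~R / S).
      by field; rewrite gt_eqF.
    rewrite normrM ler_pM // normrM normfV (gtr0_norm sp) ler_pdivrMr // -mulrA -intr_norm.
    exact: mx (ltnW qm).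
  rewrite -/N in g.
  have b1 := ler_distD ((hts v (gridpt m N j))%:~R / S) (gz R z j) ((hts v q)%:~R / S).
  have b2 := ler_distD ((hts v q)%:~R / S) (gz R z j) (c * (hts v q)%:~R).
  rewrite distrC in a1; rewrite distrC in a2; lra.
have := lipreg_lip FM ((count id (take k v))%:R / m%:R) K0 cf hk fg.
have ud : `|(count id (take k v))%:R / m%:R - k%:R / m.*2%:R : R| <= N%:R * r / S.
  have -> : (count id (take k v))%:R / m%:R - k%:R / m.*2%:R = (hts v k)%:~R / m.*2%:R :> R.
    rewrite hts_count ?sv // intrB -muln2 natrM mulr2n intrD.
    by field; rewrite pnatr_eq0 -lt0n.
  have S2 : S * S = m.*2%:R by rewrite -expr2 sqr_sqrtr // ltW.
  rewrite normrM normfV (gtr0_norm mp) -intr_norm ler_pdivrMr // -S2.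
  have -> : N%:R * r / S * (S * S) = N%:R * (r * S) by field; rewrite gt_eqF.
  exact: mx.
move=> h2; rewrite /Tz /treeval -/f.
have h3 : K * `|(count id (take k v))%:R / m%:R - k%:R / m.*2%:R| <= K * (N%:R * r / S) by rewrite ler_wpM2l.
move: h1 h2 h3; rewrite !mulrDr; lra.
Qed.

Let n0 (m : nat) (m0 : (0 < m)%N) : (0 < m.*2)%N. Proof. by rewrite double_gt0. Qed.

Definition pavg (m : nat) (c : R) : R :=
  (\sum_(v : m.*2.-tuple bool | dyck v)
     \sum_(k < m.*2 | (k == 0%N :> nat) || nth false v k.-1) treeval F m c v k) / 'C(m.*2, m)%:R.

Definition pcell (m : nat) (z : {ffun 'I_p -> 'I_B.*2}) : R :=
  #|[pred v : m.*2.-tuple bool | dyck v && gridok m (lz R z) v]|%:R / (catalan m)%:R.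

Lemma gridok_inj m v (z z' : {ffun 'I_p -> 'I_B.*2}) :
  gridok m (lz R z) v -> gridok m (lz R z') v -> z = z'.
Proof. by rewrite !gridok_incell; exact: incell_inj. Qed.

Lemma count_upsteps m (v : m.*2.-tuple bool) : (0 < m)%N -> dyck v ->
  \sum_(k < m.*2 | (k == 0%N :> nat) || nth false v k.-1) (1 : R) = m.+1%:R.
Proof.
move=> m0 dv; rewrite (@sum_dyck_upsteps R m v (fun=> 1) m0 dv).
by rewrite sumr_const card_ord.
Qed.

(** The bound is checked word by word. Words with bad oscillation lose at most [2 * M]; their number
    is measured on bridges and carried over to pointed Dyck words by [sum_rootpair]. *)
Lemma pavg_lower m c (r de : R) : (0 < m)%N -> 0 <= c -> 0 <= r ->
  `|c * Num.sqrt m.*2%:R - 1| <= de ->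
  \sum_z pcell m z * avg (Tz z) m -
    K * (de * (N%:R * r) + r + N%:R^-1 + N%:R * r / Num.sqrt m.*2%:R) -
    2 * M * (#|[set w in balanced m | ~~ `[<osc_good m N r (rootword w)>]]|%:R / 'C(m.*2, m)%:R)
  <= pavg m c + M.
Proof.
move=> m0 c0 r0 hde; set rho := K * _; set bad := #|_|.
have rho0 : 0 <= rho.
  have de0 : 0 <= de by apply: le_trans hde.
  by rewrite /rho mulr_ge0 // !addr_ge0 ?divr_ge0 ?invr_ge0 ?mulr_ge0 ?sqrtr_ge0.
have M0 := M_ge0.
have Bp : 0 < 'C(m.*2, m)%:R :> R by rewrite ltr0n bin_gt0; lia.
have Cp : (m.+1%:R * (catalan m)%:R = 'C(m.*2, m)%:R :> R) by rewrite -natrM catalanE.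
have cat0 : (catalan m)%:R != 0 :> R.
  by apply/eqP => e; move: Cp Bp; rewrite e mulr0 => <-; rewrite ltxx.
have e0 : 2 * M * (bad%:R / 'C(m.*2, m)%:R) * 'C(m.*2, m)%:R = 2 * M * bad%:R :> R.
  by rewrite -mulrA divfK // gt_eqF.
rewrite -(ler_pM2r Bp) [leRHS]mulrDl /pavg divfK ?gt_eqF //.
set PA := \sum_z _.
rewrite (_ : (PA - _ - _) * _ = PA * 'C(m.*2, m)%:R - rho * 'C(m.*2, m)%:R - 2 * M * bad%:R); last first.
  by rewrite -e0; ring.
rewrite {}/PA.
pose ok (v : m.*2.-tuple bool) (k : 'I_m.*2) := (k == 0%N :> nat) || nth false v k.-1.
pose bd (v : m.*2.-tuple bool) : R := (~~ `[<osc_good m N r v>])%:R.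
have badE : bad%:R = \sum_(v : m.*2.-tuple bool | dyck v) bd v * m.+1%:R.
  have := @sum_rootpair m m0 R (fun v _ => bd v); rewrite -/n0.
  rewrite /bad -sum1_card natr_sum => h.
  transitivity (\sum_(w in balanced m) bd (rootword w)).
    rewrite big_mkcond [RHS]big_mkcond; apply: eq_bigr => w _; rewrite !inE /bd.
    by case: (_ == _); case: (`[< _ >]).
  rewrite h; apply: eq_bigr => v dv.
  by rewrite -(count_upsteps m0 dv) mulr_sumr; apply: eq_bigr => k _; rewrite mulr1.
have pE : (\sum_z pcell m z * avg (Tz z) m) * 'C(m.*2, m)%:R =
    \sum_(v : m.*2.-tuple bool | dyck v) \sum_z (gridok m (lz R z) v)%:R *
       \sum_(j < m.+1) Tz z (j%:R / m%:R).
  rewrite exchange_big mulr_suml; apply: eq_bigr => z _.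
  rewrite -mulr_suml -Cp /pcell /avg.
  have -> : \sum_(v : m.*2.-tuple bool | dyck v) (gridok m (lz R z) v)%:R =
     #|[pred v : m.*2.-tuple bool | dyck v && gridok m (lz R z) v]|%:R :> R.
    rewrite -sum1_card natr_sum big_mkcond [RHS]big_mkcond; apply: eq_bigr => v _.
    by rewrite inE /=; case: (dyck v); case: (gridok _ _ _).
  by field; rewrite cat0 addrC natr1 pnatr_eq0.
rewrite pE badE -Cp.
have catE : (catalan m)%:R = \sum_(v : m.*2.-tuple bool | dyck v) (1 : R).
  rewrite /catalan /npaths natr_sum [RHS]big_mkcond; apply: eq_bigr => v _.
  by rewrite /dyck; case: eqP.
rewrite [rho * _]mulrC [m.+1%:R * _]mulrC [M * _]mulrC catE !mulr_suml mulr_sumr -!sumrB -big_split /=.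
apply: ler_sum => v dv.
have -> : 1 * m.+1%:R * M = \sum_(k < m.*2 | ok v k) M.
  by rewrite mul1r -(count_upsteps m0 dv) mulr_suml; apply: eq_bigr => k _; rewrite mul1r.
rewrite -big_split /=.
have low k : 0 <= treeval F m c v k + M.
  have := @FM (tree_space (stepf m.*2 (fun i => c * (hts v i)%:~R)) (k%:R / m.*2%:R)).
  have [_ /(_ (k%:R / m.*2%:R)) h] := stepf_codes m.*2 (fun i => c * (hts v i)%:~R : R).
  by move=> /(_ h); rewrite /treeval ler_norml => /andP[]; lra.
have rm0 : 0 <= 1 * m.+1%:R * rho by rewrite mul1r mulr_ge0.
have bm0 : 0 <= 2 * M * (bd v * m.+1%:R) by rewrite !mulr_ge0 // ler0n.
(* A word lying in no cell adds nothing on the left and a nonnegative amount on the right. *)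
have [|noz] := EM (exists z : {ffun 'I_p -> 'I_B.*2}, gridok m (lz R z) v); last first.
  rewrite big1 ?sub0r; last by move=> z _; case E : (gridok _ _ _); [case: noz; exists z|rewrite mul0r].
  apply: (@le_trans _ _ 0); first lra.
  by apply: sumr_ge0 => k _; exact: low.
case=> z hz; rewrite (bigD1 z) //= hz mul1r [X in _ + X - _ - _]big1 ?addr0; last first.
  move=> z' ne; case E : (gridok _ _ _); last by rewrite mul0r.
  by move: ne; rewrite (gridok_inj E hz) eqxx.
rewrite -(@sum_dyck_upsteps R m v (fun j => Tz z (j%:R / m%:R)) m0 dv).
have e1 : 1 * m.+1%:R * rho = \sum_(k < m.*2 | ok v k) rho.
  by rewrite mul1r -(count_upsteps m0 dv) mulr_suml; apply: eq_bigr => k _; rewrite mul1r.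
have e2 : 2 * M * (bd v * m.+1%:R) = \sum_(k < m.*2 | ok v k) 2 * M * bd v.
  by rewrite -(count_upsteps m0 dv) !mulr_sumr; apply: eq_bigr => k _; rewrite mulr1.
rewrite e1 e2 -!sumrB; apply: ler_sum => k _.
rewrite /bd; case: asboolP => og /=.
  rewrite mulr0 subr0; apply: treeval_lower => //; [exact: ltnW|exact: size_tuple].
apply: le_trans (low k).
have hj : 0 <= ((count id (take k v))%:R / m%:R : R) <= 1.
  rewrite divr_ge0 //= ler_pdivrMr ?ltr0n // mul1r ler_nat.
  rewrite -[X in (_ <= X)%N](dyck_count m0 (size_tuple v) dv).
  by rewrite -[in X in (_ <= X)%N](cat_take_drop k v) count_cat leq_addr.
by have /andP[_ t2] := Tz_bnd z hj; lra.
Qed.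

End Pathwise.

Section BoundedConvergence.
Context d (T : measurableType d) (R : realType) (mu : {measure set T -> \bar R}) (D : set T).
Hypotheses (mD : measurable D) (muD : (mu D < +oo)%E).

Lemma bounded_integrable (f : T -> R) (C : R) : measurable_fun D f ->
  (forall x, D x -> `|f x| <= C) -> mu.-integrable D (fun x => (f x)%:E).
Proof.
move=> mf hf; apply: (measurable_bounded_integrable mD muD mf).
by exists C; split; [exact: num_real|move=> y Cy x Dx; apply: le_trans (hf x Dx) (ltW Cy)].
Qed.

Lemma fine_integral_cstB (f : T -> R) (C c : R) : mu D = 1%E -> measurable_fun D f ->
  (forall x, D x -> `|f x| <= C) ->
  fine (\int[mu]_(x in D) (c - f x)%:E) = c - fine (\int[mu]_(x in D) (f x)%:E).
Proof.
move=> D1 mf hf; have if_ := bounded_integrable mf hf.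
have ic := @bounded_integrable (fun=> c) `|c| (measurable_cst _) (fun x _ => lexx _).
under eq_integral do rewrite EFinB.
rewrite integralB // integral_cst // [X in (_ * X - _)%E](_ : _ = 1%E) // mule1.
by rewrite fineB //; exact: integrable_fin_num.
Qed.

Lemma bounded_cvg (f_ : nat -> T -> R) (f : T -> R) (C : R) :
  (forall n, measurable_fun D (f_ n)) -> (forall n x, D x -> `|f_ n x| <= C) ->
  (forall x, D x -> f_ n x @[n --> \oo] --> f x) ->
  [/\ measurable_fun D f, (forall x, D x -> `|f x| <= C) &
    fine (\int[mu]_(x in D) (f_ n x)%:E) @[n --> \oo] --> fine (\int[mu]_(x in D) (f x)%:E)].
Proof.
move=> mf_ hf_ cf; have mf : measurable_fun D f by exact: measurable_fun_cvg cf.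
have hf x : D x -> `|f x| <= C.
  move=> Dx; apply: (@closed_cvg _ _ \oo _ (fun n => `|f_ n x|) (fun y => y <= C)).
  - exact: closed_le.
  - by apply: nearW => n; exact: hf_.
  - by apply: cvg_norm; exact: cf.
split => //.
have [|||||_ _] := @dominated_convergence _ T R mu D mD (fun n x => (f_ n x)%:E)
   (fun x => (f x)%:E) (fun=> C%:E).
- by move=> n; apply/measurable_EFinP.
- exact/measurable_EFinP.
- by apply: aeW => x Dx; apply: cvg_EFin; [exact: nearW|exact: cf].
- exact: (@bounded_integrable (fun=> C) `|C| (measurable_cst _)).
- by apply: aeW => x n Dx; rewrite lee_fin; exact: hf_.
move=> cv; apply: fine_cvg; rewrite fineK //.
by apply: integrable_fin_num => //; exact: bounded_integrable hf.
Qed.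

End BoundedConvergence.

Section Int01.
Variable R : realType.
Local Notation mu := (@lebesgue_measure R).

Definition rint01 (a : R -> R) : R := fine (int01 a).

Definition lip01 (C K : R) (a : R -> R) :=
  (forall u : R, 0 <= u <= 1 -> 0 <= a u <= C) /\
  (forall u u' : R, 0 <= u <= 1 -> 0 <= u' <= 1 -> a u' <= a u + K * `|u' - u|).

Lemma lip01_avg C K a : lip01 C K a ->
  [/\ measurable_fun (`[0, 1]%classic : set R) a, int01 a = (rint01 a)%:E &
      avg a m @[m --> \oo] --> rint01 a].
Proof. by case=> h1 h2; have [ma [I eI cI]] := avg_int01 h1 h2; rewrite /rint01 eI. Qed.

Lemma rint01_le C K K' a b eps : lip01 C K a -> lip01 C K' b ->
  (forall u : R, 0 <= u <= 1 -> a u <= b u + eps) -> rint01 a <= rint01 b + eps.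
Proof.
move=> /lip01_avg[_ _ ca] /lip01_avg[_ _ cb] h.
apply: (ler_cvg_to ca (_ : avg b m + eps @[m --> \oo] --> rint01 b + eps)).
  by apply: cvgD => //; exact: cvg_cst.
by exists 1%N => // m /= m0; exact: avg_le.
Qed.

Lemma rint01_bnd C K a : lip01 C K a -> 0 <= rint01 a <= C.
Proof.
move=> la; have [_ _ ca] := lip01_avg la; case: la => hb _.
apply/andP; split.
  apply: (ler_cvg_to (cvg_cst 0) ca); exists 1%N => // m /= m0.
  by have /andP[] := avg_bnd m0 hb.
apply: (ler_cvg_to ca (cvg_cst C)); exists 1%N => // m /= m0.
by have /andP[] := avg_bnd m0 hb.
Qed.

Lemma lebesgue01 : (mu (`[0%R, 1%R]%classic : set R) < +oo)%E.
Proof. by rewrite lebesgue_measure_itv /= lte_fin ltr01 -EFinB ltry. Qed.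

Lemma lebesgue01E : mu (`[0%R, 1%R]%classic : set R) = 1%E.
Proof. by rewrite lebesgue_measure_itv /= lte_fin ltr01 -EFinB subr0. Qed.

End Int01.

(** * Functionals of the Brownian excursion and the lower limit *)

Section Excursion.
Variables (R : realType) (d : measure_display) (T : measurableType d).
Variables (P : probability T R) (e : T -> R -> R).
Hypothesis he : is_std_excursion P e.
Variables (F : pms R -> R) (M : R).
Hypothesis cF : bounded_cont_GH F.
Hypothesis FM : forall A, compact_pms A -> `|F A| <= M.

Let me t : measurable_fun setT (fun om => e om t). Proof. by case: he. Qed.
Let e0 om : e om 0 = 0. Proof. by case: he => _ [/(_ om)[]]. Qed.
Let e1 om : e om 1 = 0. Proof. by case: he => _ [/(_ om)[_ []]]. Qed.
Let ce om : cont01 (e om). Proof. by apply: within_cont01; case: he => _ [/(_ om)[_ []]]. Qed.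
Let cc om : codes (e om). Proof. exact: cont01_codes. Qed.

Section FixK.
Variable K : R.
Hypothesis K0 : 0 <= K.

Lemma lip01_lipreg f : codes f -> lip01 (2 * M) K (fun u => lipreg F K f u + M).
Proof.
move=> cf; split => [u|u u' hu _]; first exact: lipregM_bnd.
exact: lipregM_lip.
Qed.

Lemma lip01_Tz p B (z : {ffun 'I_p -> 'I_B.*2}) : lip01 (2 * M) K (Tz F M K z).
Proof. exact: (lip01_lipreg (gf_codes R z)). Qed.

Definition HK (om : T) : R := rint01 (fun u => lipreg F K (e om) u + M).

Definition cells_event p B (z : {ffun 'I_p -> 'I_B.*2}) : set T :=
  [set om | incell z (fun j => e om (j%:R / p.+1%:R))].

Lemma cells_eventE p B (z : {ffun 'I_p -> 'I_B.*2}) :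
  cells_event z = [set om | forall i, (i < size (lz R z))%N ->
     (nth (0, setT) (lz R z) i).2 (e om (nth (0, setT) (lz R z) i).1)].
Proof.
apply/seteqP; split => om /=.
  move=> /forallP h i; rewrite size_lz => ip; rewrite nth_lz //=.
  by have /asboolP := h (Ordinal ip).
by move=> h; apply/forallP => i; apply/asboolP; have := h i; rewrite size_lz nth_lz //; apply.
Qed.

Lemma measurable_cells p B (z : {ffun 'I_p -> 'I_B.*2}) : measurable (cells_event z).
Proof.
have -> : cells_event z = \bigcap_(i in [set: 'I_p]) ((fun om => e om (i.+1%:R / p.+1%:R)) @^-1` @cell R p (zv z i)).
  apply/seteqP; split => om /=.
    by move=> /forallP h i _; have /asboolP := h i.
  by move=> h; apply/forallP => i; apply/asboolP; exact: h.
apply: fin_bigcap_measurable; first exact: finite_finset.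
by move=> i _; rewrite -[X in measurable X]setTI; apply: me => //; exact: measurable_cell.
Qed.

Lemma prob_cells p B (z : {ffun 'I_p -> 'I_B.*2}) : P (cells_event z) = exc_fdd (lz R z).
Proof.
case: he => _ [_ h]; rewrite cells_eventE h //.
- exact: path_lz.
- exact: last_lz.
- by move=> i; rewrite size_lz => ip; rewrite nth_lz //; exact: measurable_cell.
Qed.

(** Cells of width [1 / (p + 1)] and [(p + 1)^2] of them on each side of 0 cover heights up to
    [p + 1], so every continuous path is eventually inside some cell. *)
Definition SK (p : nat) (om : T) : R :=
  \sum_(z : {ffun 'I_p -> 'I_(p.+1 * p.+1).*2}) \1_(cells_event z) om * rint01 (Tz F M K z).

Lemma measurable_SK p : measurable_fun setT (SK p).
Proof.
apply: measurable_sum => z; apply: measurable_funM; last exact: measurable_cst.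
by apply: measurable_indic; exact: measurable_cells.
Qed.

Lemma SK_cell p (z : {ffun 'I_p -> 'I_(p.+1 * p.+1).*2}) om : cells_event z om -> SK p om = rint01 (Tz F M K z).
Proof.
move=> hz; rewrite /SK (bigD1 z) //= indicE mem_set // mul1r big1 ?addr0 // => z' ne.
rewrite indicE memNset ?mul0r // => hz'.
by move: ne; rewrite (incell_inj hz' hz) eqxx.
Qed.

Lemma SK_bnd p om : 0 <= SK p om <= 2 * M.
Proof.
have M0 := M_ge0 FM.
have [[z hz]|no] := EM (exists z, @cells_event p (p.+1 * p.+1) z om).
  by rewrite (SK_cell hz); exact: rint01_bnd (lip01_Tz z).
rewrite /SK big1 ?lexx ?mulr_ge0 // => z _; rewrite indicE memNset ?mul0r // => h.
by apply: no; exists z.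
Qed.

Lemma SK_cvg om : SK p om @[p --> \oo] --> HK om.
Proof.
apply/cvgrPdist_le => /= eps eps0.
have del0 : 0 < eps / (K + 1) / 2 by rewrite divr_gt0 // divr_gt0 // ltr_wpDl.
have [h h0 hh] := cont01_unif (ce om) del0.
have [Bd hB] := cont01_bounded (ce om).
have [N1 hN1] := harmonic_small h0; have [N2 hN2] := harmonic_small del0.
exists (N1 + N2 + (Num.truncn Bd).+2)%N => // p /= hp.
have hp1 : (N1 <= p)%N by move: hp; clear; lia.
have hp2 : (N2 <= p)%N by move: hp; clear; lia.
have hp3 : ((Num.truncn Bd).+2 <= p.+1)%N by move: hp; clear; lia.
have Np : 0 < p.+1%:R :> R by rewrite ltr0n.
have in01 (j : nat) : (j <= p.+1)%N -> 0 <= (j%:R / p.+1%:R : R) <= 1.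
  by move=> jp; rewrite divr_ge0 //= ler_pdivrMr // mul1r ler_nat.
have BN : Bd + 1 <= p.+1%:R.
  have := truncnS_gt Bd; have : (Num.truncn Bd).+2%:R <= p.+1%:R :> R by rewrite ler_nat.
  by rewrite -[(Num.truncn Bd).+2%:R]natr1; lra.
(* Cells are open on the left, whence the ceiling minus one rather than the floor. *)
pose zi (i : nat) : int := Num.ceil (e om (i.+1%:R / p.+1%:R) * p.+1%:R) - 1.
have hzi i : (i < p)%N -> - (p.+1 * p.+1)%:Z <= zi i < (p.+1 * p.+1)%:Z /\
    @cell R p (zi i) (e om (i.+1%:R / p.+1%:R)).
  move=> ip; have := hB _ (in01 i.+1 (leqW ip)); rewrite ler_norml.
  have := ceil_itv (e om (i.+1%:R / p.+1%:R) * p.+1%:R); rewrite /cell /= /zi subrK.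
  set x := e om _; set cx := Num.ceil _ => /andP[c1 c2] /andP[b1 b2].
  rewrite ltr_pdivrMr // ler_pdivlMr // c1 c2; split => //.
  have xl : - (p.+1 * p.+1)%:R <= x * p.+1%:R - 1 + 1 - p.+1%:R :> R.
    rewrite natrM; nra.
  have p1 : 1 <= p.+1%:R :> R by rewrite ler1n.
  apply/andP; split.
    rewrite lerBrDr -(ler_int R) intrD; apply: le_trans c2; rewrite intrN /=; lra.
  rewrite ltrBlDr -(ltr_int R) intrD /=.
  have : x * p.+1%:R <= (p.+1 * p.+1)%:R :> R by rewrite natrM; nra.
  by move: c1; rewrite intrB; lra.
pose z : {ffun 'I_p -> 'I_(p.+1 * p.+1).*2} := [ffun i : 'I_p => insubd (Ordinal (isT : (0 < (p.+1 * p.+1).*2)%N)) `|(zi i + (p.+1 * p.+1)%:Z)%R|%N].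
have zE (i : 'I_p) : zv z i = zi i.
  have [/andP[l1 l2] _] := hzi i (ltn_ord i).
  have aux (q : nat) (x : int) : - q%:Z <= x -> x < q%:Z ->
      (`|(x + q%:Z)%R|%N < q.*2)%N /\ `|(x + q%:Z)%R|%N%:Z - q%:Z = x by clear; lia.
  by have [a1 a2] := aux _ _ l1 l2; rewrite zvE ffunE val_insubd a1.
have hz : cells_event z om.
  apply/forallP => i; apply/asboolP; rewrite zE.
  by have [_] := hzi i (ltn_ord i).
rewrite (SK_cell hz).
have fg t : 0 <= t <= 1 -> `|gf z t - e om t| <= eps / (K + 1).
  move=> /andP[t0 t1]; rewrite /gf /stepf.
  have [t1'|t1'] := ltP t 1; last first.
    have -> : t = 1 by apply: le_anti; rewrite t1 t1'.
    rewrite mulr1 natrK /gz ltnn andbF e1 subrr normr0 ltW // divr_gt0 // ltr_wpDl //.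
  have Nt : 0 <= p.+1%:R * t by rewrite mulr_ge0 // ltW.
  have := truncn_itv Nt; set j := Num.truncn _ => /andP[j1 j2].
  have jN : (j < p.+1)%N.
    by rewrite -(ltr_nat R); apply: le_lt_trans j1 _; rewrite gtr_pMr.
  have g := @gz_incell R p _ z _ _ _ hz j (ltnW jN).
  rewrite mul0r e0 divff ?gt_eqF // e1 in g; have {}g := g erefl erefl.
  have g2 : p.+1%:R^-1 <= eps / (K + 1) / 2 by apply/ltW/hN2.
  have g3 : `|e om (j%:R / p.+1%:R) - e om t| < eps / (K + 1) / 2.
    apply: hh; [exact: in01 (ltnW jN)|by rewrite t0 t1|].
    have h1 : p.+1%:R^-1 < h by apply: hN1.
    apply: le_lt_trans h1; rewrite ler_norml; apply/andP; split.
      rewrite lerBrDr; apply: (@le_trans _ _ ((j%:R + 1) / p.+1%:R - p.+1%:R^-1)); last first.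
        by rewrite mulrDl mul1r addrK.
      by rewrite addrC lerD2r ler_pdivlMr // mulrC natr1 ltW.
    rewrite lerBlDr; apply: (@le_trans _ _ t); first by rewrite ler_pdivrMr // mulrC.
    by rewrite lerDr invr_ge0 ltW.
  have := ler_distD (e om (j%:R / p.+1%:R)) (gz R z j) (e om t).
  move=> h3; apply: le_trans h3 _; apply: le_trans (lerD (le_trans g g2) (ltW g3)) _.
  by rewrite -splitr.
have Kp : K * (eps / (K + 1)) <= eps.
  rewrite mulrA ler_pdivrMr ?ltr_wpDl //.
  have : 0 <= eps by exact: ltW.
  nra.
have le1 u : 0 <= u <= 1 -> Tz F M K z u <= lipreg F K (e om) u + M + eps.
  move=> hu; have := lipreg_lip FM u K0 (cc om) hu fg; rewrite subrr normr0 addr0 /Tz.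
  by move: Kp; lra.
have le2 u : 0 <= u <= 1 -> lipreg F K (e om) u + M <= Tz F M K z u + eps.
  move=> hu; have fg' t : 0 <= t <= 1 -> `|e om t - gf z t| <= eps / (K + 1).
    by move=> ht; rewrite distrC; exact: fg.
  have := lipreg_lip FM u K0 (gf_codes R z) hu fg'; rewrite subrr normr0 addr0 /Tz.
  by move: Kp; lra.
have q1 := rint01_le (lip01_Tz z) (lip01_lipreg (cc om)) le1.
have q2 := rint01_le (lip01_lipreg (cc om)) (lip01_Tz z) le2.
rewrite ler_norml; apply/andP; split; rewrite /HK; lra.
Qed.

Let PT : (P setT < +oo)%E. Proof. by rewrite probability_setT ltry. Qed.

Definition pc p B (z : {ffun 'I_p -> 'I_B.*2}) : R := fine (exc_fdd (lz R z)).

Lemma pcE p B (z : {ffun 'I_p -> 'I_B.*2}) : exc_fdd (lz R z) = (pc z)%:E.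
Proof. by rewrite /pc fineK // -prob_cells fin_num_measure //; exact: measurable_cells. Qed.

Lemma integral_SK p : (\int[P]_om (SK p om)%:E)%E =
  (\sum_(z : {ffun 'I_p -> 'I_(p.+1 * p.+1).*2}) pc z * rint01 (Tz F M K z))%:E.
Proof.
rewrite /SK; under eq_integral do rewrite -sumEFin.
rewrite ge0_integral_sum //; last 2 first.
- move=> z; apply/measurable_EFinP; apply: measurable_funM; last exact: measurable_cst.
  by apply: measurable_indic; exact: measurable_cells.
- move=> z om _; rewrite lee_fin mulr_ge0 // ?indicE //.
  by have /andP[] := rint01_bnd (lip01_Tz z).
rewrite -sumEFin; apply: eq_bigr => z _; rewrite [in RHS]mulrC.
under eq_integral do rewrite mulrC EFinM.
rewrite ge0_integralZl_EFin //; first last.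
- by have /andP[] := rint01_bnd (lip01_Tz z).
- by apply/measurable_EFinP; apply: measurable_indic; exact: measurable_cells.
rewrite (@integral_indic _ _ _ P) //; last exact: measurable_cells.
by rewrite setIT EFinM; congr (_ * _)%E; apply: etrans (prob_cells z) (pcE z).
Qed.

(** [SK] is a simple function of finitely many coordinates of the path; its limit [HK] is
    measurable, and its expectation is a limit of sums of finite-dimensional probabilities. *)
Lemma HK_cvg : [/\ measurable_fun setT HK, (forall om, `|HK om| <= 2 * M) &
  \sum_(z : {ffun 'I_p -> 'I_(p.+1 * p.+1).*2}) pc z * rint01 (Tz F M K z) @[p --> \oo]
    --> fine (\int[P]_om (HK om)%:E)%E].
Proof.
have hb p om : setT om -> `|SK p om| <= 2 * M.
  by move=> _; have /andP[s1 s2] := SK_bnd p om; rewrite ger0_norm.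
have hc om : setT om -> SK p om @[p --> \oo] --> HK om by move=> _; exact: SK_cvg.
have [m1 m2 m3] := bounded_cvg measurableT PT measurable_SK hb hc.
split => //; first by move=> om; exact: m2.
by apply: cvg_trans m3; apply: near_eq_cvg; apply: nearW => p; rewrite integral_SK.
Qed.

End FixK.

Definition Fu (om : T) (u : R) : R := F (tree_space (e om) u) + M.

Definition HF (om : T) : R := rint01 (Fu om).

Lemma Fu_bnd om u : 0 <= Fu om u <= 2 * M.
Proof.
have := FM (_ : compact_pms (tree_space (e om) u)); have [_ h] := cc om.
by move=> /(_ (h u)); rewrite ler_norml /Fu; lra.
Qed.

Lemma Fu_cvg om u : 0 <= u <= 1 -> lipreg F n%:R (e om) u + M @[n --> \oo] --> Fu om u.
Proof.
move=> hu; apply: cvgD; last exact: cvg_cst.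
apply/cvgrPdist_le => /= eps eps0; have [k0 hk] := lipreg_cvg cF FM (ce om) hu eps0.
exists (Num.truncn k0).+1 => // n /= hn; have n0 : 0 <= n%:R :> R by [].
have h1 := lipreg_le FM n0 (cc om) hu.
have h2 : F (tree_space (e om) u) - eps <= lipreg F n%:R (e om) u.
  by apply: hk => //; apply: le_trans (ltW (truncnS_gt _)) _; rewrite ler_nat.
by rewrite ger0_norm ?subr_ge0 //; lra.
Qed.

Let L01 : measurable (`[0%R, 1%R]%classic : set R). Proof. exact: measurable_itv. Qed.

(** Bounded convergence as the Lipschitz constant grows; measurability in the marked time is
    inherited from the regularizations, which are Lipschitz in it. *)
Lemma HF_spec om : [/\ measurable_fun (`[0, 1]%classic : set R) (Fu om),
   int01 (Fu om) = (HF om)%:E & HK n%:R om @[n --> \oo] --> HF om].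
Proof.
have n0 (n : nat) : 0 <= n%:R :> R by [].
have [|||m1 m2 m3] := @bounded_cvg _ (measurableTypeR R) R (@lebesgue_measure R) _ L01 (lebesgue01 R)
  (fun n u => lipreg F n%:R (e om) u + M) (Fu om) (2 * M).
- by move=> n; have [] := lip01_avg (lip01_lipreg (n0 n) (cc om)).
- move=> n u; rewrite /= in_itv /= => hu.
  by have /andP[h1 h2] := lipregM_bnd FM (n0 n) (cc om) hu; rewrite ger0_norm.
- by move=> u; rewrite /= in_itv /=; exact: Fu_cvg.
- split => //; rewrite /HF /rint01 fineK //.
  by apply: integrable_fin_num => //; exact: (@bounded_integrable _ (measurableTypeR R) R (@lebesgue_measure R) _ L01 (lebesgue01 R) _ _ m1 m2).
Qed.

Let PT : (P setT < +oo)%E. Proof. by rewrite probability_setT ltry. Qed.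

Lemma HF_cvg : [/\ measurable_fun setT HF, (forall om, `|HF om| <= 2 * M) &
  fine (\int[P]_om (HK n%:R om)%:E)%E @[n --> \oo] --> fine (\int[P]_om (HF om)%:E)%E].
Proof.
have n0 (n : nat) : 0 <= n%:R :> R by [].
have h1 (n : nat) : measurable_fun setT (HK n%:R) by have [] := HK_cvg (n0 n).
have h2 (n : nat) om : setT om -> `|HK n%:R om| <= 2 * M by move=> _; have [_ h _] := HK_cvg (n0 n); exact: h.
have h3 om : setT om -> HK n%:R om @[n --> \oo] --> HF om by move=> _; have [] := HF_spec om.
by have [m1 m2 m3] := bounded_cvg measurableT PT h1 h2 h3; split => // om; exact: m2.
Qed.

Lemma integral_tree :
  (\int[P]_om \int[@lebesgue_measure R]_(u in `[0%R, 1%R]) (F (tree_space (e om) u))%:E =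
   (fine (\int[P]_om (HF om)%:E) - M)%:E)%E.
Proof.
have [m1 m2 _] := HF_cvg.
transitivity (\int[P]_om ((HF om)%:E - M%:E))%E.
  apply: eq_integral => om _; have [q1 q2 _] := HF_spec om.
  rewrite -q2 /int01.
  have i1 : (@lebesgue_measure R).-integrable (`[0%R, 1%R]%classic : set R) (fun u => (Fu om u)%:E).
    apply: (@bounded_integrable _ (measurableTypeR R) R (@lebesgue_measure R) _ L01 (lebesgue01 R) (Fu om) (2 * M) q1) => u _.
    by have /andP[f1 f2] := Fu_bnd om u; rewrite ger0_norm.
  have i2 : (@lebesgue_measure R).-integrable (`[0%R, 1%R]%classic : set R) (fun u => M%:E).
    exact: (@bounded_integrable _ (measurableTypeR R) R (@lebesgue_measure R) _ L01 (lebesgue01 R) (fun=> M) `|M| (measurable_cst _)).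
  rewrite (_ : M%:E = \int[@lebesgue_measure R]_(u in `[0%R, 1%R]) M%:E)%E; last first.
    by rewrite integral_cst //= lebesgue_measure_itv /= lte_fin ltr01 -EFinB subr0 mule1.
  rewrite -integralB //; apply: eq_integral => u _.
  by rewrite -EFinB /Fu addrK.
have iH : P.-integrable setT (fun om => (HF om)%:E).
  by apply: (bounded_integrable measurableT PT m1 (fun om _ => m2 om)).
have iM : P.-integrable setT (fun om => M%:E).
  by apply: (@bounded_integrable _ _ _ _ _ measurableT PT (fun=> M) `|M|); first exact: measurable_cst.
rewrite integralB // integral_cst // [X in (_ - _ * X)%E](@probability_setT _ _ _ P) mule1.
by rewrite EFinB fineK //; exact: integrable_fin_num.
Qed.

Lemma sum_lowlim_near (I : finType) (b : I -> \bar R) (q : I -> R) (u : I -> nat -> R)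
  (eps : R) : 0 < eps -> (forall i, b i = (q i)%:E) -> (forall i, lowlim (b i) (u i)) ->
  \forall m \near \oo, \sum_i q i - eps <= \sum_i u i m.
Proof.
move=> eps0 bE hl.
have c0 : 0 < #|I|%:R + 1 :> R by rewrite ltr_wpDl.
have : \forall m \near \oo, forall i, q i - eps / (#|I|%:R + 1) <= u i m.
  apply: filter_forall => i; apply: hl; rewrite bE lte_fin ltrBlDr ltrDl divr_gt0 //.
apply: filterS => m h.
apply: (@le_trans _ _ (\sum_i (q i - eps / (#|I|%:R + 1)))); last by apply: ler_sum => i _.
rewrite sumrB sumr_const lerD2l lerN2 -[_ *+ #|_|]mulr_natr mulrAC ler_pdivrMr //.
have : 0 <= #|I|%:R :> R by [].
nra.
Qed.

(** Every approximation costs a share of [eps / 10]: regularization, discretization of the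
    excursion, finite-dimensional limit, bad oscillation, and four more for the pathwise error. *)
Lemma pavg_liminf (eps : R) : 0 < eps ->
  exists2 de, 0 < de & \forall m \near \oo, forall c : R, 0 <= c ->
    `|c * Num.sqrt m.*2%:R - 1| <= de ->
    fine (\int[P]_om (HF om)%:E)%E - M - eps <= pavg F m c.
Proof.
move=> eps0; have M0 := M_ge0 FM.
have e5 : 0 < eps / 10 by rewrite divr_gt0.
have [n1 _ hn1] : \forall n \near \oo, fine (\int[P]_om (HF om)%:E)%E - eps / 10 <= fine (\int[P]_om (HK n%:R om)%:E)%E.
  have [_ _ /cvgrPdist_le /(_ _ e5)] := HF_cvg.
  by apply: filterS => n; rewrite ler_norml => /andP[_]; lra.
(* [K] comes first, since the oscillation threshold [r] and then the grid size both depend on it. *)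
pose K : R := n1%:R; have K0 : 0 <= K by [].
have hK := hn1 n1 (leqnn _); rewrite -/K in hK.
have [_ _ cK] := HK_cvg K0.
have [p1 _ hp1] : \forall p \near \oo, fine (\int[P]_om (HK K om)%:E)%E - eps / 10 <=
   \sum_(z : {ffun 'I_p -> 'I_(p.+1 * p.+1).*2}) pc z * rint01 (Tz F M K z).
  move: cK => /cvgrPdist_le /(_ _ e5).
  by apply: filterS => n; rewrite ler_norml => /andP[_]; lra.
have r0 : 0 < eps / 10 / (K + 1) by rewrite divr_gt0 // ltr_wpDl.
set r := eps / 10 / (K + 1) in r0.
have Kr : K * r <= eps / 10.
  by rewrite /r mulrA ler_pdivrMr ?ltr_wpDl //; move: e5; move: (eps / 10) => w; nra.
have eta0 : 0 < eps / 10 / (2 * M + 1) by rewrite divr_gt0 // ltr_wpDl // mulr_ge0.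
set eta := eps / 10 / (2 * M + 1) in eta0.
have Meta : 2 * M * eta <= eps / 10.
  by rewrite /eta mulrA ler_pdivrMr ?ltr_wpDl ?mulr_ge0 //; move: e5; move: (eps / 10) => w; nra.
have [N3 hN3] := harmonic_small r0.
have [N [N1 Np] hN] := osc_tight (p1 + N3).+1 r0 eta0.
case: N N1 Np hN => [//|p] N1 _ hN; have pp1 : (p1 <= p)%N by move: N1; clear; lia.
have pN3 : (N3 <= p)%N by move: N1; clear; lia.
have invN : p.+1%:R^-1 <= r by apply/ltW/hN3.
pose B := (p.+1 * p.+1)%N.
have Nr : 0 < p.+1%:R :> R by rewrite ltr0n.
(* With this tolerance the rescaling error [de * (N * r)] equals [r]. *)
exists p.+1%:R^-1; first by rewrite invr_gt0.
have hs : \forall m \near \oo, \sum_(z : {ffun 'I_p -> 'I_B.*2}) pc z * rint01 (Tz F M K z) - eps / 10 <=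
    \sum_(z : {ffun 'I_p -> 'I_B.*2}) avg (Tz F M K z) m.+1 * pcell R m.+1 z.
  have := @sum_lowlim_near _ (fun z : {ffun 'I_p -> 'I_B.*2} => (rint01 (Tz F M K z))%:E * exc_fdd (lz R z))%E
    (fun z => pc z * rint01 (Tz F M K z)) (fun z m => avg (Tz F M K z) m.+1 * pcell R m.+1 z) _ e5.
  apply.
    by move=> z; rewrite pcE mulrC.
  move=> z; have lz1 := lip01_Tz K0 z; have [_ _ ca] := lip01_avg lz1.
  apply: (@lowlimM R _ (fun m => avg (Tz F M K z) m.+1) _ (fun m => pcell R m.+1 z)).
  - move=> q hq; have [N0 _ h] := dyck_fdd_lowlim (good_lz R z) hq.
    by exists N0 => // m /= hm; apply: h; exact: leqW.
  - by rewrite cvg_shiftS.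
  - by move=> m; have /andP[] := avg_bnd (isT : (0 < m.+1)%N) (proj1 lz1).
  - by move=> m; rewrite /pcell divr_ge0.
  - by rewrite -prob_cells.
case: hs => N4 _ hN4; case: hN => N5 _ hN5.
exists (N4 + N5 + (p.+1 * p.+1) + 2)%N => // m /= hm c c0 hc.
have m4 : (N4 <= m.-1)%N by move: hm; clear; lia.
have m5 : (N5 <= m)%N by move: hm; clear; lia.
have m6 : (p.+1 * p.+1 <= m)%N by move: hm; clear; lia.
have m0 : (0 < m)%N by apply: leq_trans m6.
have := hN4 m.-1 m4; rewrite /= prednK // => h4.
have h1 := hp1 p pp1; rewrite -/B in h1.
have hB : #|[set w in balanced m | ~~ `[<osc_good m p.+1 r (rootword w)>]]|%:R / 'C(m.*2, m)%:R <= eta.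
  by rewrite ler_pdivrMr ?(hN5 m m5) // ltr0n bin_gt0; clear; lia.
have := @pavg_lower R F M FM p B K K0 m c r p.+1%:R^-1 m0 c0 (ltW r0) hc.
have sm : p.+1%:R <= Num.sqrt m.*2%:R :> R.
  rewrite -ler_sqr ?nnegrE ?sqrtr_ge0 // sqr_sqrtr // expr2 -natrM ler_nat.
  by apply: leq_trans m6 _; rewrite -addnn leq_addr.
have rho : K * (p.+1%:R^-1 * (p.+1%:R * r) + r + p.+1%:R^-1 + p.+1%:R * r / Num.sqrt m.*2%:R) <= eps / 10 * 4.
  apply: (@le_trans _ _ (K * (r * 4))); last by move: Kr; move: (eps / 10) => w; nra.
  rewrite ler_wpM2l // mulKf ?gt_eqF //.
  have : p.+1%:R * r / Num.sqrt m.*2%:R <= r.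
    by rewrite ler_pdivrMr ?(lt_le_trans Nr) // mulrC ler_wpM2l // ltW.
  move: invN; move: (p.+1%:R^-1) (p.+1%:R * r / _) => x y; lra.
have bb : 2 * M * (#|[set w in balanced m | ~~ `[<osc_good m p.+1 r (rootword w)>]]|%:R / 'C(m.*2, m)%:R) <= eps / 10.
  by apply: le_trans Meta; rewrite ler_wpM2l // mulr_ge0.
have e6 : \sum_(z : {ffun 'I_p -> 'I_B.*2}) pcell R m z * avg (Tz F M K z) m =
  \sum_(z : {ffun 'I_p -> 'I_B.*2}) avg (Tz F M K z) m * pcell R m z.
  by apply: eq_bigr => z _; rewrite mulrC.
rewrite e6; move: h4 h1 hK rho bb.
move: (\sum_z _) (\sum_z _) (K * _) (2 * M * _) (fine _) (fine _) (pavg _ _ _) => x1 x2 x3 x4 x5 x6 x7.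
lra.
Qed.

End Excursion.

Lemma pavgN (R : realType) (F : pms R -> R) m c : pavg (fun A => - F A) m c = - pavg F m c.
Proof.
rewrite /pavg -mulNr -sumrN; congr (_ / _); apply: eq_bigr => v _.
by rewrite -sumrN; apply: eq_bigr.
Qed.

Lemma bounded_cont_GHN (R : realType) (F : pms R -> R) :
  bounded_cont_GH F -> bounded_cont_GH (fun A => - F A).
Proof.
move=> [[M hM] hc]; split; first by exists M => A /hM; rewrite normrN.
move=> A cA eps eps0; have [de de0 h] := hc A cA eps eps0; exists de => // B cB hB.
by rewrite -opprD normrN; exact: h.
Qed.

(** The one-sided bound is applied to [F] and to [- F]. The two bounds meet because the
    corresponding excursion expectations are opposite, which rests on the linearity of both
    integrals. *)
Lemma pavg_cvg (R : realType) d (T : measurableType d) (P : probability T R)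
  (e : T -> R -> R) (F : pms R -> R) : is_std_excursion P e -> bounded_cont_GH F ->
  exists2 E : R,
  (\int[P]_om \int[@lebesgue_measure R]_(u in `[0%R, 1%R]) (F (tree_space (e om) u))%:E = E%:E)%E &
  forall eps : R, 0 < eps ->
  exists2 de, 0 < de & \forall m \near \oo, forall c : R, 0 <= c ->
    `|c * Num.sqrt m.*2%:R - 1| <= de -> `|pavg F m c - E| <= eps.
Proof.
move=> he cF; have [[M FM] _] := cF; have cF' := bounded_cont_GHN cF.
have FM' A : compact_pms A -> `|- F A| <= M by move=> /FM; rewrite normrN.
have i1 := integral_tree he cF FM; have i2 := integral_tree he cF' FM'.
set E := _ - M in i1; set E' := _ - M in i2.
have L01 : measurable (`[0%R, 1%R]%classic : set R) by exact: measurable_itv.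
have hH om : HF e (fun A => - F A) M om = 2 * M - HF e F M om.
  have [q1 q2 _] := HF_spec he cF FM om.
  rewrite /HF /rint01 -(@fine_integral_cstB _ (measurableTypeR R) R (@lebesgue_measure R) _ L01 (lebesgue01 R)
    (Fu e F M om) (2 * M) (2 * M) (lebesgue01E R) q1); last first.
    by move=> u _; have /andP[f1 f2] := Fu_bnd he FM om u; rewrite ger0_norm.
  by congr fine; apply: eq_integral => u _; congr EFin; rewrite /Fu; ring.
have [m1 m2 _] := HF_cvg he cF FM.
have EE : E' = - E.
  have PT : (P setT < +oo)%E by rewrite probability_setT ltry.
  have := @fine_integral_cstB _ T R P setT measurableT PT _ (2 * M) (2 * M)
    (probability_setT P) m1 (fun om _ => m2 om).
  have -> : (\int[P]_om (2 * M - HF e F M om)%:E = \int[P]_om (HF e (fun A => - F A) M om)%:E)%E.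
    by apply: eq_integral => om _; rewrite hH.
  by rewrite /E /E' => ->; ring.
exists E => // eps eps0.
have [d1 d10 [n1 _ h1]] := pavg_liminf he cF FM eps0.
have [d2 d20 [n2 _ h2]] := pavg_liminf he cF' FM' eps0.
exists (Num.min d1 d2); first by rewrite lt_min d10 d20.
exists (n1 + n2)%N => // m /= hm c c0; rewrite le_min => /andP[a1 a2].
have := h1 m (leq_trans (leq_addr _ _) hm) c c0 a1.
have := h2 m (leq_trans (leq_addl _ _) hm) c c0 a2.
rewrite pavgN -/E -/E' EE ler_norml => q1 q2; apply/andP; split; lra.
Qed.

(** * Condensation *)

Section CoefficientOrder.
Variable R : realType.
Implicit Types p q a b : {poly R}.

(** Polynomials with nonnegative coefficients stand for finite measures on the integers, products
    for convolutions, and [cle] for domination; probabilistic estimates become coefficientwise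
    inequalities. *)
Definition cge0 p := forall i, 0 <= p`_i.
Definition cle p q := forall i, p`_i <= q`_i.

Lemma cge0M p q : cge0 p -> cge0 q -> cge0 (p * q).
Proof. by move=> hp hq i; rewrite coefM sumr_ge0 // => j _; rewrite mulr_ge0. Qed.

Lemma cge0D p q : cge0 p -> cge0 q -> cge0 (p + q).
Proof. by move=> hp hq i; rewrite coefD addr_ge0. Qed.

Lemma cge01 : cge0 1. Proof. by move=> i; rewrite coef1; case: eqP. Qed.

Lemma cge0X p n : cge0 p -> cge0 (p ^+ n).
Proof. by move=> hp; elim: n => [|n IH]; [exact: cge01|rewrite exprS; exact: cge0M]. Qed.

Lemma cge0_mulrn p n : cge0 p -> cge0 (p *+ n).
Proof. by move=> hp i; rewrite coefMn mulrn_wge0. Qed.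

Lemma cle_trans q p a : cle p q -> cle q a -> cle p a.
Proof. by move=> h1 h2 i; exact: le_trans (h1 i) (h2 i). Qed.

Lemma cleM p q a b : cge0 p -> cge0 a -> cle p q -> cle a b -> cle (p * a) (q * b).
Proof. by move=> hp ha pq ab i; rewrite !coefM; apply: ler_sum => j _; exact: ler_pM. Qed.

Lemma cleD p q a b : cle p q -> cle a b -> cle (p + a) (q + b).
Proof. by move=> pq ab i; rewrite !coefD lerD. Qed.

Lemma cle_refl p : cle p p. Proof. by move=> i. Qed.

Lemma cleX p q n : cge0 p -> cle p q -> cle (p ^+ n) (q ^+ n).
Proof.
move=> hp pq; elim: n => [|n IH]; first exact: cle_refl.
by rewrite !exprS; apply: cleM => //; exact: cge0X.
Qed.

(** A union bound: either every factor comes from [a], or one of the [N + 1] factors comes from [b]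
    and the others are arbitrary. *)
Lemma cle_expD a b N : cge0 a -> cge0 b ->
  cle ((a + b) ^+ N.+1) (a ^+ N.+1 + (b * (a + b) ^+ N) *+ N.+1).
Proof.
move=> ha hb; elim: N => [|N IH]; first by rewrite !expr1 expr0 mulr1; exact: cle_refl.
have hab := cge0D ha hb.
rewrite exprS; set s := a + b in IH hab *.
apply: (@cle_trans (s * (a ^+ N.+1 + (b * s ^+ N) *+ N.+1))).
  by apply: cleM; [exact: hab|exact: cge0X|exact: cle_refl|exact: IH].
rewrite mulrDr [s * (_ *+ _)]mulrnAr mulrCA -exprS {1}/s mulrDl -exprS -addrA [in X in cle _ X]mulrS.
apply: cleD; first exact: cle_refl.
apply: cleD; last exact: cle_refl.
apply: cleM; [exact: hb|exact: cge0X|exact: cle_refl|apply: cleX => // i].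
by rewrite coefD lerDl.
Qed.

(** The terms with exactly one factor from [b], of which there are [N + 1]. Together with [cle_expD]
    this is the one-big-jump estimate. *)
Lemma cle_expD_lower a b N : cge0 a -> cge0 b ->
  cle ((b * a ^+ N) *+ N.+1) ((a + b) ^+ N.+1).
Proof.
move=> ha hb.
suff h : cle (a ^+ N.+1 + (b * a ^+ N) *+ N.+1) ((a + b) ^+ N.+1).
  by apply: cle_trans h => i; rewrite [leRHS]coefD lerDr; exact: cge0X.
elim: N => [|N IH]; first by rewrite !expr1 expr0 mulr1; exact: cle_refl.
rewrite [(a + b) ^+ _]exprS; set s := a + b.
apply: (@cle_trans (s * (a ^+ N.+1 + (b * a ^+ N) *+ N.+1))); last first.
  apply: cleM; [exact: cge0D| |exact: cle_refl|exact: IH].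
  by apply: cge0D; [exact: cge0X|apply: cge0_mulrn; apply: cge0M => //; exact: cge0X].
rewrite /s mulrDl mulrDr -exprS [a * (_ *+ _)]mulrnAr mulrCA -exprS mulrDr.
rewrite -addrA; apply: cleD; first exact: cle_refl.
rewrite mulrSr addrA => i; rewrite [leRHS]coefD [leRHS]addrC lerDr.
by apply: cge0M => //; apply: cge0_mulrn; apply: cge0M => //; exact: cge0X.
Qed.

Lemma coef_chernoff p t n : cge0 p -> 0 <= t -> p`_n * t ^+ n <= p.[t].
Proof.
move=> hp t0; have [sn|sn] := leqP (size p) n.
  by rewrite nth_default // mul0r horner_coef sumr_ge0 // => i _; rewrite mulr_ge0 ?exprn_ge0.
rewrite horner_coef (bigD1 (Ordinal sn)) //= lerDl sumr_ge0 // => i _.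
by rewrite mulr_ge0 ?exprn_ge0.
Qed.

Lemma sum_coef_chernoff p (t d : R) k (Q : pred nat) : cge0 p -> 0 <= t -> 0 < d ->
  (forall i, Q i -> d <= t ^+ i) -> \sum_(i < k | Q i) p`_i <= p.[t] / d.
Proof.
move=> hp t0 d0 hQ; rewrite ler_pdivlMr // mulr_suml.
apply: (@le_trans _ _ (\sum_(i < k) p`_i * t ^+ i)).
  rewrite big_mkcond /=; apply: ler_sum => i _; case: ifP => [/hQ h|_].
    by rewrite ler_wpM2l.
  by rewrite mulr_ge0 // exprn_ge0.
rewrite (@horner_coef_wide _ (maxn k (size p))) ?leq_maxr //.
rewrite (big_ord_widen (maxn k (size p)) (fun i => p`_i * t ^+ i)) ?leq_maxl //.
rewrite big_mkcond /=; apply: ler_sum => i _; case: ifP => // _.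
by rewrite mulr_ge0 // exprn_ge0.
Qed.

Lemma coef_conv_le p q (c : R) n (Q : pred nat) : cge0 q ->
  (forall j, p`_j <= if Q j then c else 0) ->
  (p * q)`_n <= c * \sum_(l < n.+1 | Q (n - l)%N) q`_l.
Proof.
move=> hq hp; rewrite coefM (reindex_inj rev_ord_inj) /= mulr_sumr big_mkcond [leRHS]big_mkcond /=.
apply: ler_sum => l _; rewrite subSS subKn; last by rewrite -ltnS.
have := hp (n - l)%N; case: ifP => _ h; first exact: ler_wpM2r.
by apply: le_trans (ler_wpM2r (hq l) h) _; rewrite mul0r.
Qed.

Lemma coef_conv_ge p q (c : R) n (Q : pred nat) : cge0 p -> cge0 q ->
  (forall j, (j <= n)%N -> Q j -> c <= p`_j) ->
  c * \sum_(l < n.+1 | Q (n - l)%N) q`_l <= (p * q)`_n.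
Proof.
move=> hp0 hq hp; rewrite coefM [leRHS](reindex_inj rev_ord_inj) /= mulr_sumr big_mkcond /=.
apply: ler_sum => l _; rewrite subSS subKn; last by rewrite -ltnS.
case: ifP => [/(hp _ (leq_subr _ _)) h|_]; first exact: ler_wpM2r.
by rewrite mulr_ge0.
Qed.
End CoefficientOrder.

Section Condensed.
Variables (R : realType).
Implicit Types (w : nat -> R) (k : R).

(* Under P(tau) proportional to the weight, [condensed] says that the maximal black degree of
   a tree with n edges is (1 - k) n up to o(n), with high probability. *)
Definition condensed w k := forall de eps : R, 0 < de -> de < 1 - k -> 0 < eps ->
  \forall n \near \oo, [/\ 0 < Tcoef w n,
    Tcoef (wtrunc w (Num.truncn ((1 - k - de) * n%:R))) n <= eps * Tcoef w n &
    Tcoef w n - Tcoef (wtrunc w (Num.truncn ((1 - k + de) * n%:R))) n <= eps * Tcoef w n].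

Definition wcoef w n := ((\poly_(i < n.+1) w i) ^+ n.+1)`_n.

Lemma condensedP w k : w 0%N = 1 -> (forall de eps : R, 0 < de -> de < 1 - k -> 0 < eps ->
  \forall n \near \oo, [/\ 0 < wcoef w n,
    wcoef (wtrunc w (Num.truncn ((1 - k - de) * n%:R))) n <= eps * wcoef w n &
    wcoef w n - wcoef (wtrunc w (Num.truncn ((1 - k + de) * n%:R))) n <= eps * wcoef w n]) ->
  condensed w k.
Proof.
move=> w0 h de eps d0 d1 e0; near=> n.
have wK K : wtrunc w K 0 = 1 by rewrite /wtrunc leq0n.
have : [/\ 0 < wcoef w n,
    wcoef (wtrunc w (Num.truncn ((1 - k - de) * n%:R))) n <= eps * wcoef w n &
    wcoef w n - wcoef (wtrunc w (Num.truncn ((1 - k + de) * n%:R))) n <= eps * wcoef w n].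
  by near: n; exact: h.
rewrite /wcoef -!Tcoef_lagrange // -mulrBr ![eps * (_ * _)]mulrCA !ler_pM2l //.
by rewrite pmulr_rgt0.
Unshelve. all: by end_near. Qed.

Lemma cge0_poly w n : (forall i, 0 <= w i) -> cge0 (\poly_(i < n) w i).
Proof. by move=> h i; rewrite coef_poly; case: ifP. Qed.

Lemma eq_wcoef w1 w2 n : (forall i, (i <= n)%N -> w1 i = w2 i) -> wcoef w1 n = wcoef w2 n.
Proof. by move=> h; rewrite /wcoef (@eq_poly _ n.+1 _ w2). Qed.

Lemma wcoef_lower w n : (forall i, 0 <= w i) -> w 0%N = 1 -> (0 < n)%N ->
  n.+1%:R * w n <= wcoef w n.
Proof.
move=> wge0 w0 n0; set p := \poly_(i < n.+1) w i.
have hb : cge0 (p - 1).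
  move=> i; rewrite coefB coef1 coef_poly; case: i => [|i] /=; first by rewrite w0 subrr.
  by rewrite subr0; case: ifP.
have := @cle_expD_lower R 1 (p - 1) n (@cge01 R) hb n.
rewrite addrCA subrr addr0 expr1n mulr1 coefMn coefB coef1 coef_poly ltnSn (gtn_eqF n0) subr0.
by rewrite mulr_natl.
Qed.

Lemma truncn_ltMn (c : R) n : 0 <= c -> c < 1 -> (0 < n)%N -> (Num.truncn (c * n%:R) < n)%N.
Proof.
move=> c0 c1 n0; have cn : 0 <= c * n%:R by rewrite mulr_ge0.
by rewrite truncn_lt_nat // -[ltRHS]mul1r ltr_pM2r ?ltr0n.
Qed.

Lemma near_truncn_ge (c : R) M : 0 < c -> \forall n \near \oo, (M <= Num.truncn (c * n%:R))%N.
Proof.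
move=> c0; exists (Num.truncn (M%:R / c)).+1 => // n /= hn.
rewrite truncn_ge_nat; last by rewrite mulr_ge0 // ltW.
rewrite mulrC -ler_pdivrMr //; apply: ltW; apply: lt_le_trans (truncnS_gt _) _.
by rewrite ler_nat.
Qed.
End Condensed.

Lemma powRX (R : realType) (a x : R) n : 0 <= a -> (a `^ x) ^+ n = (a ^+ n) `^ x.
Proof.
by move=> a0; elim: n => [|n IH]; rewrite ?expr0 ?powR1 // !exprS IH powRM ?exprn_ge0.
Qed.

Lemma powR_ge1 (R : realType) (a x : R) : 1 <= x -> 0 <= a -> 1 <= x `^ a.
Proof.
move=> x1 a0; have -> : 1 = 1 `^ a :> R by rewrite powR1.
by apply: ge0_ler_powR; rewrite ?nnegrE // (le_trans _ x1).
Qed.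

Lemma powR_le1 (R : realType) (a x : R) : 0 <= x -> x <= 1 -> 0 <= a -> x `^ a <= 1.
Proof.
move=> x0 x1 a0; have -> : 1 = 1 `^ a :> R by rewrite powR1.
by apply: ge0_ler_powR; rewrite ?nnegrE.
Qed.

(** * Condensation for factorial weights *)

Section FactorialWeights.
Variables (R : realType) (alpha : R) (w : nat -> R).
Hypotheses (al0 : 0 < alpha) (hw : forall i, w i = (i`!)%:R `^ alpha).

Lemma factw0 : w 0%N = 1.
Proof. by rewrite hw fact0 powR1. Qed.

Lemma factw_ge0 i : 0 <= w i. Proof. by rewrite hw powR_ge0. Qed.

Lemma fact_dominates (x : R) : 0 < x -> \forall n \near \oo, x ^+ n <= n`!%:R.
Proof.
move=> x0; have /cvgr0_norm_lt /(_ 1 ltr01) := cvg_exp_coeff x.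
apply: filterS => n; rewrite exp_coeffE /= ger0_norm => [h|]; last first.
  by rewrite mulr_ge0 ?exprn_ge0 // ltW.
move: h => /ltW.
by rewrite mulrC ler_pdivrMr ?ltr0n ?fact_gt0 // mul1r.
Qed.

(** With [y = x^(1 / alpha)] the general term is [(n! y^n)^alpha], which does not tend to 0 for any
    positive [x]. *)
Lemma factw_radius : (radius w <= 0)%E.
Proof.
apply: ge_ereal_sup => _ [x [x0 cv] <-]; rewrite lee_fin leNgt; apply/negP => xp.
have /cvgr0_norm_lt /(_ 1 ltr01) h := cvg_series_cvg_0 cv.
have z0 : 0 < (x `^ alpha^-1)^-1 by rewrite invr_gt0 powR_gt0.
near \oo => n.
have : `|w n * x ^+ n| < 1 by near: n.
have : (x `^ alpha^-1)^-1 ^+ n <= n`!%:R by near: n; exact: fact_dominates.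
move=> le1; rewrite ltNge => /negP; apply; rewrite ger0_norm; last first.
  by rewrite mulr_ge0 ?exprn_ge0 ?factw_ge0.
have -> : x ^+ n = ((x `^ alpha^-1) ^+ n) `^ alpha.
  by rewrite -powRX ?powR_ge0 // -powRrM mulVf ?gt_eqF // powRr1.
rewrite hw -powRM ?exprn_ge0 ?powR_ge0 // //.
have h1 : 1 <= n`!%:R * (x `^ alpha^-1) ^+ n.
  by move: le1; rewrite exprVn -[_^-1]mul1r ler_pdivrMr ?exprn_gt0 ?powR_gt0.
by apply: powR_ge1 => //; exact: ltW.
Unshelve. all: by end_near. Qed.

Lemma factw_kappa k : is_kappa w k -> k = 0.
Proof.
by case=> [[_ ->]//|[[r [e [r0 _]]]|[e _]]]; have := factw_radius; rewrite e // lee_fin leNgt r0.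
Qed.

Lemma fact_exp_le i K : (i <= K)%N -> (i`! ^ K <= K`! ^ i)%N.
Proof.
elim: K => [|K IH]; first by case: i.
rewrite leq_eqVlt => /predU1P[->//|iK].
have le : (i`! <= K.+1 ^ i)%N.
  elim: i iK {IH} => // i IH iK; rewrite factS expnS leq_mul //; first exact: ltnW.
  by apply: IH; exact: ltnW.
by rewrite expnS factS expnMn mulnC [leqRHS]mulnC leq_mul // IH.
Qed.

(** The factors of [K!] are paired as [i (K + 1 - i)], and the arithmetic-geometric inequality is
    applied to each pair. *)
Lemma fact_amgm K : (K`! * 2 ^ K <= K.+1 ^ K)%N.
Proof.
rewrite -leq_sqr !expnMn.
have -> : (K`! ^ 2 = \prod_(i < K) (i.+1 * (K - i)))%N.
  rewrite big_split /= expnS expn1 fact_prod big_add1 big_mkord /=; congr (_ * _)%N.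
  by rewrite (reindex_inj rev_ord_inj) /=; apply: eq_bigr => i _; rewrite subnSK.
have h m c : (c ^ m = \prod_(i < m) c)%N by rewrite prod_nat_const card_ord.
rewrite -!expnM ![(K * 2)%N]mulnC !expnM (h _ (2 ^ 2)%N) (h _ (K.+1 ^ 2)%N) -big_split /=.
apply: leq_prod => i _; have := ltn_ord i; move: (i : nat) => j jK.
have -> : K.+1 = (j.+1 + (K - j))%N by rewrite addSn subnKC // ltnW.
by rewrite mulnC; exact: (nat_AGM2 _ _).
Qed.

(** The geometric mean of the integers from 1 to [K]. Its power [- alpha] is the natural scale for
    evaluating the series truncated at [K]. *)
Definition fgm K : R := (K`!)%:R `^ (K%:R^-1).

Lemma fgm_gt0 K : 0 < fgm K. Proof. by rewrite powR_gt0 // ltr0n fact_gt0. Qed.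

Lemma fgmX K : (0 < K)%N -> fgm K ^+ K = (K`!)%:R.
Proof.
by move=> K0; rewrite -powR_mulrn ?powR_ge0 // -powRrM mulVf ?powRr1 // pnatr_eq0 -lt0n.
Qed.

Lemma fact_le_fgm i K : (0 < K)%N -> (i <= K)%N -> (i`!)%:R <= fgm K ^+ i.
Proof.
move=> K0 iK; rewrite -(@ler_pXn2r _ K) ?nnegrE ?exprn_ge0 ?(ltW (fgm_gt0 K)) //.
by rewrite -exprM mulnC exprM fgmX // -!natrX ler_nat fact_exp_le.
Qed.

(** Each factor of [n!] beyond the first [K] is at least [K + 1], twice the geometric mean by
    [fact_amgm]. This is the gain of one vertex of degree [n] over degrees capped at [K]. *)
Lemma fgm_fact n K : (0 < K)%N -> (K <= n)%N -> fgm K ^+ n * 2 ^+ (n - K) <= (n`!)%:R.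
Proof.
move=> K0 Kn; have le : fgm K * 2 <= K.+1%:R.
  rewrite -(@ler_pXn2r _ K) ?nnegrE ?mulr_ge0 ?(ltW (fgm_gt0 K)) //.
  by rewrite exprMn fgmX // -natrX -natrM -natrX ler_nat fact_amgm.
rewrite -{1 3}(subnKC Kn); elim: (n - K)%N => [|m IH].
  by rewrite addn0 mulr1 fgmX.
rewrite addnS !exprS mulrACA factS natrM ler_pM ?mulr_ge0 ?exprn_ge0 ?(ltW (fgm_gt0 K)) //.
by apply: le_trans le _; rewrite ler_nat ltnS leq_addr.
Qed.

Lemma fgm_dvg (M : R) : 0 < M -> \forall K \near \oo, M <= fgm K.
Proof.
move=> M0; near=> K; have K0 : (0 < K)%N by near: K; exists 1%N.
rewrite -(@ler_pXn2r _ K) ?nnegrE ?(ltW M0) ?(ltW (fgm_gt0 K)) // fgmX //.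
by near: K; exact: fact_dominates.
Unshelve. all: by end_near. Qed.

Definition ftrunc n K : {poly R} := \poly_(i < n.+1) wtrunc w K i.

Lemma ftrunc_eval n K (la : R) : (0 < K)%N -> (K <= n)%N -> 0 <= la ->
  (ftrunc n K).[la * fgm K `^ (- alpha)] =
  \sum_(i < K.+1) la ^+ i * ((i`!)%:R / fgm K ^+ i) `^ alpha.
Proof.
move=> K0 Kn la0; rewrite /ftrunc horner_poly.
rewrite (big_ord_widen n.+1 (fun i => la ^+ i * ((i`!)%:R / fgm K ^+ i) `^ alpha)) //.
rewrite [RHS]big_mkcond /=; apply: eq_bigr => i _; rewrite /wtrunc ltnS.
case: ifP => _; last by rewrite mul0r.
rewrite hw exprMn mulrCA; congr (_ * _).
rewrite powRM ?invr_ge0 ?exprn_ge0 ?(ltW (fgm_gt0 K)) //; congr (_ * _).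
by rewrite powRX ?(ltW (fgm_gt0 K)) // powRN -powR_inv1 ?powR_ge0 // powRAC powR_inv1 // exprn_ge0 // ltW // fgm_gt0.
Qed.

Lemma geom_tail (x : R) m n : 0 < x -> x < 1 -> \sum_(m <= i < n) x ^+ i <= x ^+ m / (1 - x).
Proof.
move=> x0 x1; rewrite ler_pdivlMr ?subr_gt0 // mulr_suml.
under eq_bigr do rewrite mulrBr mulr1 -exprSr.
have [mn|nm] := leqP m n; last first.
  by rewrite big_geq ?exprn_ge0 ?(ltW x0) // ltnW.
under eq_bigr do rewrite -opprB.
by rewrite sumrN telescope_sumr // opprB lerBlDr lerDl exprn_ge0 // ltW.
Qed.

(** The [i]-th term is [la^i (i! / fgm K ^ i)^alpha], at most [la^i]. A geometric tail takes care of
    large [i], and the divergence of [fgm K] of the finitely many others. *)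
Lemma ftrunc_eval_le (la eps : R) : 0 < la -> la < 1 -> 0 < eps ->
  \forall K \near \oo, forall n, (K <= n)%N -> (ftrunc n K).[la * fgm K `^ (- alpha)] <= 1 + eps.
Proof.
move=> la0 la1 e0.
have [J _ hJ] : \forall J \near \oo, la ^+ J / (1 - la) <= eps / 2.
  have c0 : 0 < eps / 2 * (1 - la) by rewrite !mulr_gt0 ?invr_gt0 ?subr_gt0.
  have la1' : `|la| < 1 by rewrite ger0_norm ?ltW.
  have /cvgr0_norm_lt /(_ _ c0) := cvg_expr la1'.
  apply: filterS => J; rewrite ger0_norm ?exprn_ge0 ?(ltW la0) // => /ltW.
  by rewrite ler_pdivrMr ?subr_gt0.
have {}hJ := hJ J (leqnn J).
pose eta := eps / 2 / J.+1%:R.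
have eta0 : 0 < eta by rewrite !mulr_gt0 ?invr_gt0.
near=> K => n Kn; have JK : (J.+1 <= K)%N by near: K; exists J.+1.
have K0 : (0 < K)%N by exact: leq_trans JK.
have g0 := fgm_gt0 K.
have g1 : 1 <= fgm K by near: K; exact: fgm_dvg.
rewrite ftrunc_eval ?(ltW la0) // big_ord_recl expr0 fact0 divr1 powR1 mulr1 lerD2l.
have hB : ((J`!)%:R / fgm K) `^ alpha <= eta.
  have h : (J`!)%:R / eta `^ alpha^-1 <= fgm K.
    by near: K; apply: fgm_dvg; rewrite divr_gt0 ?powR_gt0 ?ltr0n ?fact_gt0.
  have -> : eta = (eta `^ alpha^-1) `^ alpha.
    by rewrite -powRrM mulVf ?gt_eqF // powRr1 // ltW.
  apply: ge0_ler_powR; rewrite ?nnegrE ?(ltW al0) ?powR_ge0 //.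
    by rewrite divr_ge0 ?(ltW g0).
  by move: h; rewrite !ler_pdivrMr ?powR_gt0 // mulrC.
pose G i := if (i < J)%N then eta else la ^+ i.
apply: (@le_trans _ _ (\sum_(i < K) G i)).
  apply: ler_sum => i _; rewrite lift0 /G.
  have r0 : 0 <= (i.+1`!)%:R / fgm K ^+ i.+1 by rewrite divr_ge0 // exprn_ge0 // ltW.
  have r1 : (i.+1`!)%:R / fgm K ^+ i.+1 <= 1.
    by rewrite ler_pdivrMr ?exprn_gt0 // mul1r fact_le_fgm.
  case: ifP => iJ; last first.
    apply: (@le_trans _ _ (la ^+ i.+1)); last by rewrite exprS ler_piMl ?exprn_ge0 // ltW.
    rewrite ler_piMr ?exprn_ge0 ?(ltW la0) //.
    exact: powR_le1 r0 r1 (ltW al0).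
  apply: le_trans hB; apply: (@le_trans _ _ (((i.+1)`!%:R / fgm K ^+ i.+1) `^ alpha)).
    by rewrite ler_piMl ?powR_ge0 // exprn_ile1 // ltW.
  have hf : (i.+1`!)%:R <= (J`!)%:R :> R by rewrite ler_nat leq_fact.
  apply: ge0_ler_powR; rewrite ?nnegrE ?(ltW al0) //; first by rewrite divr_ge0 ?(ltW g0).
  rewrite ler_pM ?invr_ge0 ?exprn_ge0 ?(ltW g0) // lef_pV2 ?posrE ?exprn_gt0 //.
  by rewrite ler_eXnr.
rewrite -(big_mkord xpredT G) (@big_cat_nat _ _ _ J) ?(ltnW JK) //=.
rewrite [leRHS]splitr lerD //.
  rewrite big_nat (eq_bigr (fun=> eta)); last by move=> i /andP[_ h]; rewrite /G h.
  rewrite -big_nat sumr_const_nat subn0 -[_ *+ J]mulr_natl /eta mulrCA ler_piMr //.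
    by rewrite divr_ge0 // ltW.
  by rewrite ler_pdivrMr // mul1r ler_nat.
rewrite big_nat (eq_bigr (fun i => la ^+ i)); last by move=> i /andP[h _]; rewrite /G ltnNge h.
by rewrite -big_nat; apply: le_trans (geom_tail _ _ la0 la1) hJ.
Unshelve. all: by end_near. Qed.

Lemma factw_trunc_le (la eps : R) : 0 < la -> la < 1 -> 0 < eps ->
  \forall K \near \oo, forall n, (K <= n)%N ->
  wcoef (wtrunc w K) n <=
    la ^- n * (1 + eps) ^+ n.+1 * (2 `^ (- alpha)) ^+ (n - K) * (n`!)%:R `^ alpha.
Proof.
move=> la0 la1 e0; near=> K => n Kn.
have K0 : (0 < K)%N by near: K; exists 1%N.
have g0 := fgm_gt0 K.
have ge : cge0 (ftrunc n K) by apply: cge0_poly => i; rewrite /wtrunc; case: ifP => // _; exact: factw_ge0.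
have t0 : 0 < la * fgm K `^ (- alpha) by rewrite mulr_gt0 ?powR_gt0.
have := @coef_chernoff R (ftrunc n K ^+ n.+1) _ n (cge0X _ ge) (ltW t0).
rewrite horner_exp -[X in X * _ <= _]/(wcoef (wtrunc w K) n) => h1.
have h2 : (ftrunc n K).[la * fgm K `^ (- alpha)] ^+ n.+1 <= (1 + eps) ^+ n.+1.
  rewrite lerXn2r ?nnegrE ?addr_ge0 ?(ltW e0) //.
    by rewrite horner_coef sumr_ge0 // => i _; rewrite mulr_ge0 ?ge ?exprn_ge0 ?ltW.
  by move: n Kn {ge h1}; near: K; exact: ftrunc_eval_le.
have h3 : 1 <= (fgm K `^ (- alpha)) ^+ n * ((2 `^ (- alpha)) ^+ (n - K) * (n`!)%:R `^ alpha).
  rewrite (powRX (- alpha) n (ltW g0)) (powRX (- alpha) (n - K) (ler0n _ 2)).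
  rewrite !powRN mulrA -invfM mulrC -powRM ?exprn_ge0 ?(ltW g0) //.
  rewrite ler_pdivlMr ?powR_gt0 ?mulr_gt0 ?exprn_gt0 // mul1r.
  apply: ge0_ler_powR; rewrite ?nnegrE ?(ltW al0) ?mulr_ge0 ?exprn_ge0 ?(ltW g0) //.
  exact: fgm_fact.
have w_ge0 : 0 <= wcoef (wtrunc w K) n by exact: (cge0X _ ge).
rewrite -!mulrA mulrC ler_pdivlMr ?exprn_gt0 //.
apply: le_trans (_ : (1 + eps) ^+ n.+1 * (fgm K `^ (- alpha)) ^- n <= _); last first.
  rewrite ler_wpM2l ?exprn_ge0 ?addr_ge0 ?(ltW e0) // -[leLHS]mul1r ler_pdivrMr ?exprn_gt0 ?powR_gt0 //.
  by rewrite mulrC.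
rewrite ler_pdivlMr ?exprn_gt0 ?powR_gt0 // -mulrA -exprMn; exact: le_trans h1 h2.
Unshelve. all: by end_near. Qed.

Lemma factw_condensed : condensed w 0.
Proof.
apply: condensedP factw0 _ => de eps d0; rewrite subr0 => d1 e0.
pose q : R := 2 `^ (- alpha * de).
have q0 : 0 < q by rewrite powR_gt0.
have q1 : q < 1.
  rewrite /q mulNr powRN invf_lt1 ?powR_gt0 // -{1}(powRr0 (2 : R)).
  rewrite powRr0 lt_neqAle eq_sym powR_eq1 -[X in _ && (X <= _)](powRr0 2) ler_powR ?ler1n ?mulr_ge0 ?ltW //.
  by rewrite andbT !negb_or -leNgt ler0n mulf_neq0 ?gt_eqF // ltr1n.
(* Chernoff's bound costs a factor [1 + ep] per edge twice, from [la] and from the evaluation; [ep]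
   is small enough for the gain [q] per edge to win. *)
pose ep := (1 - q) / 6.
have ep0 : 0 < ep by rewrite divr_gt0 ?subr_gt0.
have ep1 : (1 + ep) ^+ 2 * q < 1.
  rewrite /ep; move: q0 q1; move: (q : R) => x; clear => x0 x1; nra.
have cK : 0 < 1 - de by rewrite subr_gt0.
pose rr := (1 + ep) ^+ 2 * q.
have rr0 : 0 < rr by rewrite mulr_gt0 ?exprn_gt0 ?addr_gt0.
have la0 : 0 < (1 + ep)^-1 by rewrite invr_gt0 addr_gt0.
have la1 : (1 + ep)^-1 < 1 by rewrite invf_lt1 ?addr_gt0 // ltrDl.
have [K1 _ hK1] := factw_trunc_le la0 la1 ep0.
near=> n; pose K := Num.truncn ((1 - de) * n%:R).
have n0 : (0 < n)%N by near: n; exists 1%N.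
have Kn : (K < n)%N by apply: truncn_ltMn => //; [exact: ltW|rewrite ltrBlDr ltrDl].
have fac0 : 0 < w n by rewrite hw powR_gt0 // ltr0n fact_gt0.
have low := wcoef_lower factw_ge0 factw0 n0.
have lown : w n <= wcoef w n by apply: le_trans low; rewrite ler_peMl ?(ltW fac0) // ler1n.
split; first exact: lt_le_trans lown.
- have : wcoef (wtrunc w K) n <= ((1 + ep)^-1) ^- n * (1 + ep) ^+ n.+1 *
      (2 `^ (- alpha)) ^+ (n - K) * (n`!)%:R `^ alpha.
    apply: (hK1 K _ n (ltnW Kn)); rewrite /K; near: n; exact: near_truncn_ge.
  rewrite -hw => /le_trans; apply.
  apply: (@le_trans _ _ ((1 + ep) * rr ^+ n * w n)); last first.
    apply: ler_pM; rewrite ?mulr_ge0 ?exprn_ge0 ?(ltW rr0) ?addr_ge0 ?(ltW ep0) ?(ltW fac0) //.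
    rewrite -ler_pdivlMl ?addr_gt0 //; near: n.
    have rr1 : `|rr| < 1 by rewrite ger0_norm ?ltW.
    have c0 : 0 < (1 + ep)^-1 * eps by rewrite mulr_gt0.
    have /cvgr0_norm_lt /(_ _ c0) := cvg_expr rr1.
    by apply: filterS => n; rewrite ger0_norm ?exprn_ge0 ?(ltW rr0) // => /ltW.
  rewrite ler_wpM2r ?(ltW fac0) // exprVn invrK exprS [(1 + ep) ^+ n * _]mulrCA -mulrA.
  rewrite ler_wpM2l ?addr_ge0 ?(ltW ep0) // /rr exprMn -exprM mulSn mul1n exprD.
  rewrite ler_wpM2l ?mulr_ge0 ?exprn_ge0 ?addr_ge0 ?(ltW ep0) //.
  rewrite -!powR_mulrn ?powR_ge0 // /q -!powRrM -mulrA !mulNr !powRN lef_pV2 ?posrE ?powR_gt0 //.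
  apply: ler_powR; rewrite ?ler1n // ler_wpM2l ?(ltW al0) // natrB ?(ltnW Kn) //.
  rewrite lerBrDr -lerBrDl; have : 0 <= (1 - de) * n%:R by rewrite mulr_ge0 // ltW.
  by rewrite -truncn_le -/K mulrBl mul1r.
(* As [kappa = 0], the upper threshold [(1 + de) n] exceeds every index that matters and the
   truncation changes nothing. *)
rewrite (_ : wcoef (wtrunc w _) n = wcoef w n).
  by rewrite subrr mulr_ge0 ?(ltW e0) // (le_trans (ltW fac0)).
apply: eq_wcoef => i iN; rewrite /wtrunc truncn_ge_nat ?mulr_ge0 ?addr_ge0 ?(ltW d0) //.
case: ifPn => // /negP[]; apply: (@le_trans _ _ n%:R); first by rewrite ler_nat.
by rewrite ler_peMl // lerDl ltW.
Unshelve. all: by end_near. Qed.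
End FactorialWeights.

Section Analysis.
Variable R : realType.
Implicit Types (x y s : R) (n : nat).

(** Up to [ep / 2] the linear term suffices; beyond, [2 y / ep] exceeds 1 and a moment of order
    [1 + e0] can be inserted. No second moment is then required of the weights. *)
Lemma expR_le_mgf (e0 ep y : R) : 0 <= e0 -> 0 < ep <= 1 -> 0 <= y ->
  expR y <= 1 + (1 + ep) * y + (2 / ep) `^ (1 + e0) * (y `^ (1 + e0) * expR y).
Proof.
move=> e00 /andP[ep0 ep1] y0; have [h|h] := leP y (ep / 2).
  apply: (@le_trans _ _ (1 + (1 + ep) * y)); last first.
    by rewrite lerDl !mulr_ge0 ?powR_ge0 ?expR_ge0.
  have y1 : 0 < 1 - y by move: h ep1; clear; lra.
  have le1 : 1 - y <= expR (- y) by exact: expR_ge1Dx.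
  have : expR y <= (1 - y)^-1.
    by rewrite -[expR y]invrK -expRN lef_pV2 ?posrE ?expR_gt0.
  move=> /le_trans; apply; rewrite -[_^-1]mul1r ler_pdivrMr //.
  by move: h ep1 ep0 y0; clear; nra.
apply: (@le_trans _ _ ((2 / ep) `^ (1 + e0) * (y `^ (1 + e0) * expR y))); last first.
  by rewrite lerDr addr_ge0 ?mulr_ge0 ?addr_ge0 // ltW.
rewrite mulrA ler_peMl ?expR_ge0 // -powRM ?divr_ge0 ?(ltW ep0) //.
apply: powR_ge1; last by rewrite addr_ge0.
by move: h; rewrite mulrAC ler_pdivlMr // mul1r; lra.
Qed.

Lemma expRN_le_mgf (e0 y : R) : 0 <= e0 <= 1 -> 0 <= y ->
  expR (- y) <= 1 - y + y `^ (1 + e0).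
Proof.
move=> /andP[e00 e01]; rewrite le_eqVlt => /predU1P[<-|y0].
  by rewrite oppr0 expR0 addr0 lerDl powR_ge0.
have [h|h] := leP y 1.
  apply: (@le_trans _ _ (1 - y + y ^+ 2)); last first.
    rewrite lerD2l -powR_mulrn ?(ltW y0) //; apply: ger_powR; first by rewrite y0.
    by move: e01; clear; lra.
  have : expR (- y) <= (1 + y)^-1.
    by rewrite expRN lef_pV2 ?posrE ?expR_gt0 ?addr_gt0 // expR_ge1Dx.
  move=> /le_trans; apply; rewrite -[_^-1]mul1r ler_pdivrMr ?addr_gt0 //.
  by move: y0; clear; nra.
apply: (@le_trans _ _ 1); first by rewrite expRN invf_le1 ?expR_gt0 // -expR0 ler_expR ltW.
rewrite -addrA lerDl addrC subr_ge0 -{1}[y]powRr1 ?(ltW y0) //.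
by apply: ler_powR; [exact: ltW|rewrite lerDl].
Qed.

Lemma near_powRN (r ep : R) : 0 < r -> 0 < ep -> \forall n \near \oo, n%:R `^ (- r) <= ep.
Proof.
move=> r0 ep0; have h : 0 < ep^-1 `^ r^-1 by rewrite powR_gt0 // invr_gt0.
near=> n; have hn : ep^-1 `^ r^-1 <= n%:R.
  by near: n; exact: nbhs_infty_ger.
have n0 : 0 < n%:R :> R by exact: lt_le_trans hn.
rewrite powRN -[leRHS]invrK lef_pV2 ?posrE ?powR_gt0 ?invr_gt0 //.
have -> : ep^-1 = (ep^-1 `^ r^-1) `^ r by rewrite -powRrM mulVf ?gt_eqF // powRr1 // invr_ge0 ltW.
by apply: ge0_ler_powR; rewrite ?nnegrE ?(ltW r0) ?(ltW h) ?(ltW n0).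
Unshelve. all: by end_near. Qed.

Lemma near_expRN (x ep : R) : 0 < x -> 0 < ep -> \forall n \near \oo, expR (- (x * n%:R)) <= ep.
Proof.
move=> x0 ep0; near=> n; have hn : ep^-1 / x <= n%:R by near: n; exact: nbhs_infty_ger.
rewrite expRN -[leRHS]invrK lef_pV2 ?posrE ?expR_gt0 ?invr_gt0 //.
move: hn; rewrite ler_pdivrMr // mulrC => /le_trans; apply.
by apply: le_trans (expR_ge1Dx _); rewrite lerDr.
Unshelve. all: by end_near. Qed.

Lemma ln_le_powR (r x : R) : 0 < r -> 0 < x -> ln x <= x `^ r / r.
Proof.
move=> r0 x0; rewrite ler_pdivlMr // mulrC -ln_powR.
by apply/ltW; apply: ln_sublinear; rewrite powR_gt0.
Qed.

Lemma expR_pow_le (x r z : R) n : 0 <= x -> 0 <= r -> x <= r * (1 + z) ->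
  x ^+ n <= r ^+ n * expR (n%:R * z).
Proof.
move=> x0 r0 h; have h1 : x <= r * expR z.
  by apply: le_trans h _; rewrite ler_wpM2l // expR_ge1Dx.
by rewrite mulrC expRM_natl -exprMn mulrC lerXn2r // nnegrE mulr_ge0 // expR_ge0.
Qed.
End Analysis.

(** * The principle of one big jump for summable weights with a finite moment of order above one *)

Section BigJump.
Variables (R : realType) (w : nat -> R) (rho kap e0 S B c : R).
Hypotheses (wge0 : forall i, 0 <= w i) (w0 : w 0%N = 1).
Hypotheses (e00 : 0 < e0) (e01 : e0 <= 1) (kap0 : 0 <= kap) (kap1 : kap < 1) (S0 : 0 < S) (rho0 : 0 < rho).
Hypothesis mass_le : forall n, \sum_(i < n) w i <= rho.
Hypothesis mass_near : forall ep : R, 0 < ep -> \forall n \near \oo, rho - ep <= \sum_(i < n) w i.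
Hypothesis mean_le : forall n, \sum_(i < n) i%:R * w i <= kap * rho.
Hypothesis mean_near : forall ep : R, 0 < ep ->
  \forall n \near \oo, kap * rho - ep <= \sum_(i < n) i%:R * w i.
Hypothesis mom_le : forall n, \sum_(i < n) i%:R `^ (1 + e0) * w i <= S.
Hypothesis w_ratio : forall eta : R, 0 < eta -> exists2 C : R, 0 < C &
  \forall n \near \oo, forall j, eta * n%:R <= j%:R -> (j <= n)%N -> w j <= C * w n /\ w n <= C * w j.
Hypotheses (c0 : 0 < c) (B0 : 0 < B).
Hypothesis w_lower : \forall n \near \oo, c * n%:R `^ (- B) <= w n.

Local Notation tr K n := (ftrunc w n K).

Lemma tr_ge0 K n : cge0 (tr K n).
Proof. by apply: cge0_poly => i; rewrite /wtrunc; case: ifP. Qed.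

Lemma coef_tr K n i : (tr K n)`_i = if ((i <= K) && (i <= n))%N then w i else 0.
Proof. by rewrite coef_poly /wtrunc ltnS andbC; case: ifP => //= _; case: ifP. Qed.

Lemma wcoef_tr n : wcoef w n = (tr n n ^+ n.+1)`_n.
Proof. by apply: eq_wcoef => i iN; rewrite /wtrunc iN. Qed.

Lemma tr_eval_sum K n (t : R) : (tr K n).[t] = \sum_(i < n.+1) wtrunc w K i * t ^+ i.
Proof. by rewrite horner_poly. Qed.

Lemma tr1_le K n : (tr K n).[1] <= rho.
Proof.
rewrite tr_eval_sum; apply: le_trans (mass_le n.+1); apply: ler_sum => i _.
by rewrite expr1n mulr1 /wtrunc; case: ifP.
Qed.

(** [expR_le_mgf] is summed against the weights; the truncation at [K] bounds the remaining
    exponential by [expR (s * K)]. *)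
Lemma tr_mgf K n (ep s : R) : 0 < ep <= 1 -> 0 <= s ->
  (tr K n).[expR s] <= rho * (1 + ((1 + ep) * s * kap +
    (2 / ep) `^ (1 + e0) * S / rho * (s `^ (1 + e0) * expR (s * K%:R)))).
Proof.
move=> hep s0; rewrite tr_eval_sum; set Ce := (2 / ep) `^ _; set E := s `^ _ * expR _.
have E0 : 0 <= E by rewrite mulr_ge0 ?powR_ge0 ?expR_ge0.
have Ce0 : 0 <= Ce by exact: powR_ge0.
have ep0 : 0 < ep by case/andP: hep.
apply: (@le_trans _ _ (\sum_(i < n.+1) (w i + (1 + ep) * s * (i%:R * w i) +
    Ce * E * (i%:R `^ (1 + e0) * w i)))); last first.
  rewrite !big_split /= -!mulr_sumr.
  have -> : rho * (1 + ((1 + ep) * s * kap + Ce * S / rho * E)) =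
     rho + (1 + ep) * s * (kap * rho) + Ce * E * S.
    by move: (E) (Ce) => E' C'; field; rewrite gt_eqF.
  apply: lerD; last exact: (ler_wpM2l (mulr_ge0 Ce0 E0) (mom_le _)).
  apply: lerD; first exact: mass_le.
  by apply: (ler_wpM2l _ (mean_le _)); rewrite mulr_ge0 // addr_ge0 // ltW.
apply: ler_sum => i _; rewrite /wtrunc; case: ifP => iK; last first.
  by rewrite mul0r !addr_ge0 // !mulr_ge0 ?powR_ge0 ?addr_ge0 // ltW.
rewrite -expRM_natr mulrC.
have y0 : 0 <= s * i%:R by rewrite mulr_ge0.
have := ler_wpM2r (wge0 i) (expR_le_mgf (ltW e00) hep y0).
move=> /le_trans; apply; rewrite -/Ce 2!mulrDl mul1r lerD //.
  by rewrite lerD2l !mulrA.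
have hE : (s * i%:R) `^ (1 + e0) * expR (s * i%:R) <= E * i%:R `^ (1 + e0).
  rewrite powRM // /E [leRHS]mulrAC ler_wpM2l ?mulr_ge0 ?powR_ge0 //.
  by rewrite ler_expR ler_wpM2l // ler_nat.
by rewrite [leRHS]mulrA ler_wpM2r // -[leRHS]mulrA ler_wpM2l.
Qed.

(** Markov's inequality with the moment of order [1 + e0]: the tail mass is [o(1/n)], so among [n]
    summands a large one is unlikely. *)
Lemma tail_mass_le (eta : R) n m : 0 < eta -> (0 < n)%N ->
  n%:R * \sum_(i < m | (Num.truncn (eta * n%:R) < i)%N) w i <=
  S * eta `^ (- (1 + e0)) * n%:R `^ (- e0).
Proof.
move=> eta0 n0; have nR : 0 < n%:R :> R by rewrite ltr0n.
have en : 0 < eta * n%:R by rewrite mulr_gt0.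
have e1 : 0 <= 1 + e0 by rewrite addr_ge0 // ltW.
have -> : S * eta `^ (- (1 + e0)) * n%:R `^ (- e0) = n%:R * (S * (eta * n%:R) `^ (- (1 + e0))).
  rewrite powRM ?(ltW eta0) // mulrCA -mulrA; congr (_ * _).
  rewrite [RHS]mulrCA; congr (_ * _).
  rewrite -{2}[n%:R]powRr1 // -powRD; last by rewrite (gt_eqF nR) implybT.
  by congr (_ `^ _); ring.
rewrite ler_wpM2l // powRN ler_pdivlMr ?powR_gt0 // mulr_suml.
apply: le_trans (mom_le m); rewrite big_mkcond /=; apply: ler_sum => i _.
case: ifP => [h|_]; last by rewrite mulr_ge0 ?powR_ge0.
rewrite mulrC ler_wpM2r //; apply: ge0_ler_powR; rewrite ?nnegrE ?(ltW en) //.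
by apply: le_trans (ltW (truncnS_gt _)) _; rewrite ler_nat.
Qed.

Lemma near_tail_mass (eta ep : R) : 0 < eta -> 0 < ep -> \forall n \near \oo, forall m,
  n%:R * \sum_(i < m | (Num.truncn (eta * n%:R) < i)%N) w i <= ep.
Proof.
move=> eta0 ep0; pose X := S * eta `^ (- (1 + e0)).
have X0 : 0 < X by rewrite mulr_gt0 ?powR_gt0.
near=> n => m; have n0 : (0 < n)%N by near: n; exists 1%N.
apply: le_trans (tail_mass_le m eta0 n0) _; rewrite -/X mulrC -ler_pdivlMr //.
by near: n; apply: near_powRN => //; rewrite divr_gt0.
Unshelve. all: by end_near. Qed.

Lemma tail_pow (de A eta : R) : 0 < de -> 0 < A -> 0 <= eta -> eta <= 1 ->
  \forall n \near \oo, forall k,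
  \sum_(l < k | (kap + de) * n%:R <= l%:R) ((tr (Num.truncn (eta * n%:R)) n) ^+ n)`_l <=
    rho ^+ n * expR (- (A * de / 2)).
Proof.
move=> de0 A0 eta0 eta1; pose ep := Num.min 1 (de / 4).
have ep0 : 0 < ep by rewrite lt_min ltr01 divr_gt0.
have ep1 : ep <= 1 by rewrite ge_min lexx.
have epd : ep <= de / 4 by rewrite ge_min lexx orbT.
pose X := (2 / ep) `^ (1 + e0) * S / rho.
have X0 : 0 < X by rewrite !mulr_gt0 ?powR_gt0 ?invr_gt0 // divr_gt0.
pose Y := X * A `^ (1 + e0) * expR A.
have Y0 : 0 < Y by rewrite /Y mulr_gt0 ?expR_gt0 // mulr_gt0 ?powR_gt0.
near=> n => k; have n0 : (0 < n)%N by near: n; exists 1%N.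
have nR : 0 < n%:R :> R by rewrite ltr0n.
(* At scale [1 / n] the truncation costs only the constant [expR A], multiplied by a power of [n]
   tending to 0, while a deviation [de * n] gains [A * de]; half of that gain absorbs the errors. *)
set K := Num.truncn _; pose s := A / n%:R; have s0 : 0 < s by rewrite divr_gt0.
have sn : s * n%:R = A by rewrite /s divfK ?gt_eqF.
have KnR : K%:R <= n%:R :> R.
  by apply: (@le_trans _ _ (eta * n%:R)); [rewrite truncn_le mulr_ge0|rewrite ler_piMl].
have hE : n%:R * (X * (s `^ (1 + e0) * expR (s * K%:R))) <= A * (de / 4).
  apply: (@le_trans _ _ (Y * n%:R `^ (- e0))); last first.
    rewrite mulrC -ler_pdivlMr //; near: n; apply: near_powRN => //.
    by rewrite !mulr_gt0 ?invr_gt0.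
  have -> : Y * n%:R `^ (- e0) = n%:R * (X * (s `^ (1 + e0) * expR A)).
    rewrite /s powRM ?invr_ge0 ?(ltW A0) // /Y.
    have -> : n%:R `^ (- e0) = n%:R * (n%:R^-1) `^ (1 + e0) :> R.
      rewrite -powR_inv1 // -powRrM -{2}[n%:R]powRr1 // -powRD; last by rewrite (gt_eqF nR) implybT.
      by congr (_ `^ _); ring.
    by move: (_ `^ _) (expR _) (_ `^ _) => x y z; ring.
  rewrite ler_wpM2l // ler_wpM2l ?(ltW X0) // ler_wpM2l ?powR_ge0 // ler_expR -sn.
  by rewrite ler_wpM2l // ltW.
have t0 : 0 <= expR s by exact: expR_ge0.
have d0 : 0 < expR (A * (kap + de)) by exact: expR_gt0.
have := @sum_coef_chernoff R _ _ _ k (fun l => (kap + de) * n%:R <= l%:R)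
  (cge0X n (@tr_ge0 K n)) t0 d0.
move=> h; apply: (le_trans (h _)) => {h} [l hl|].
  rewrite -expRM_natr ler_expR -sn mulrAC -mulrA ler_wpM2l ?(ltW s0) //.
rewrite horner_exp ler_pdivrMr // -[leRHS]mulrA -expRD.
have h0 : 0 <= (tr K n).[expR s].
  by rewrite horner_coef sumr_ge0 // => i _; rewrite mulr_ge0 ?tr_ge0 ?exprn_ge0.
have hep : 0 < ep <= 1 by rewrite ep0.
apply: le_trans (expR_pow_le n h0 (ltW rho0) (tr_mgf K n hep (ltW s0))) _.
rewrite ler_wpM2l ?exprn_ge0 ?(ltW rho0) // ler_expR mulrDr -/X.
have -> : n%:R * ((1 + ep) * s * kap) = A * (1 + ep) * kap.
  by rewrite -sn; ring.
have h2 : A * (ep * kap) <= A * (de / 4).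
  rewrite ler_wpM2l ?(ltW A0) //; apply: le_trans epd; rewrite ler_piMr ?(ltW ep0) //; exact: ltW.
move: hE h2; set E := n%:R * _; move: (E) => E' h1 h2.
have -> : A * (1 + ep) * kap = A * kap + A * (ep * kap) by ring.
by move: h1 h2; move: (A * (ep * kap)) => Z; lra.
Unshelve. all: by end_near. Qed.

Lemma tr_full K n : tr n n = tr K n + (tr n n - tr K n).
Proof. by rewrite addrC subrK. Qed.

Lemma tr_diff_ge0 K L n : (K <= L)%N -> cge0 (tr L n - tr K n).
Proof.
move=> KL i; rewrite coefB !coef_tr; case: (leqP i K) => iK /=.
  by rewrite (leq_trans iK KL) subrr.
by rewrite subr0; case: ifP.
Qed.

Lemma tr_diff_coef K L n i :
  (tr L n - tr K n)`_i <= if [&& K < i, i <= L & i <= n]%N then w i else 0.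
Proof.
rewrite coefB !coef_tr; case: (leqP i K) => iK /=; last by rewrite subr0.
by case: ifP => [/andP[_ ->]|_]; rewrite ?subrr // sub0r oppr_le0; case: ifP.
Qed.

Lemma tr_diff1 K n : (tr n n - tr K n).[1] <= \sum_(i < n.+1 | (K < i)%N) w i.
Proof.
rewrite (@horner_coef_wide _ n.+1); last first.
  by rewrite (leq_trans (size_polyD _ _)) // size_polyN geq_max !size_poly.
rewrite [leRHS]big_mkcond; apply: ler_sum => i _; rewrite expr1n mulr1.
apply: le_trans (tr_diff_coef _ _ _ _) _; case: (leqP i K) => //= _.
by case: ifP.
Qed.

Lemma full_tail (de ep : R) : 0 < de -> 0 < ep -> \forall n \near \oo,
  \sum_(l < n.+1 | (kap + de) * n%:R <= l%:R) ((tr n n) ^+ n)`_l <= ep * rho ^+ n.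
Proof.
(* So that [A * de / 2 = 2 / ep], whose negative exponential is below [ep / 2]; the other half of
   [ep] pays for one summand above [n / 2]. *)
move=> de0 ep0; pose A := 2 / de * (2 / ep).
have A0 : 0 < A by rewrite !mulr_gt0 ?invr_gt0.
have eh : 0 <= 2^-1 :> R by [].
have eh1 : 2^-1 <= 1 :> R by rewrite invf_le1 // ler1n.
near=> n.
have H1 : forall k, \sum_(l < k | (kap + de) * n%:R <= l%:R)
    ((tr (Num.truncn (2^-1 * n%:R : R)) n) ^+ n)`_l <= rho ^+ n * expR (- (A * de / 2)).
  by near: n; exact: tail_pow.
have H2 : forall m, n%:R * \sum_(i < m | (Num.truncn (2^-1 * n%:R : R) < i)%N) w i <= ep / 2 * rho.
  by near: n; apply: near_tail_mass => //; rewrite mulr_gt0 // divr_gt0.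
pose K := Num.truncn (2^-1 * n%:R : R).
have n0 : (0 < n)%N by near: n; exists 1%N.
have Kn : (K <= n)%N by rewrite ltnW // truncn_ltMn // invf_lt1 // ltr1n.
have h1 : \sum_(l < n.+1 | (kap + de) * n%:R <= l%:R) ((tr K n) ^+ n)`_l <= ep / 2 * rho ^+ n.
  apply: le_trans (H1 _) _; rewrite mulrC ler_wpM2r ?exprn_ge0 ?(ltW rho0) //.
  have -> : A * de / 2 = 2 / ep.
    by rewrite /A; field; rewrite !gt_eqF.
  rewrite expRN -[leRHS]invrK lef_pV2 ?posrE ?expR_gt0 ?invr_gt0 ?divr_gt0 // invf_div.
  by apply: le_trans (expR_ge1Dx _); rewrite lerDr.
have h2 : n%:R * \sum_(i < n.+1 | (K < i)%N) w i <= ep / 2 * rho by exact: H2.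
have n1 : n = n.-1.+1 by rewrite prednK.
have hb := @tr_diff_ge0 K n n Kn.
have := cle_expD n.-1 (tr_ge0 K n) hb; rewrite -tr_full prednK // => h.
apply: (@le_trans _ _ (\sum_(l < n.+1 | (kap + de) * n%:R <= l%:R)
   (tr K n ^+ n + ((tr n n - tr K n) * tr n n ^+ n.-1) *+ n)`_l)).
  by apply: ler_sum.
under eq_bigr do rewrite coefD coefMn; rewrite big_split /= sumrMnl.
have -> : ep * rho ^+ n = ep / 2 * rho ^+ n + ep / 2 * rho ^+ n by rewrite -mulrDl -splitr.
rewrite lerD //.
have p0 L : 0 <= (tr L n).[1].
  by rewrite horner_coef sumr_ge0 // => i _; rewrite mulr_ge0 ?tr_ge0 ?exprn_ge0.
apply: (@le_trans _ _ ((\sum_(i < n.+1 | (K < i)%N) w i * rho ^+ n.-1) *+ n)); last first.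
  have -> : rho ^+ n = rho * rho ^+ n.-1 by rewrite -exprS prednK.
  by rewrite -mulr_suml -mulrnAl -mulr_natl mulrA ler_wpM2r // exprn_ge0 // ltW.
rewrite lerMn2r -mulr_suml; apply/orP; right.
have := @sum_coef_chernoff R _ 1 1 n.+1 (fun l => (kap + de) * n%:R <= l%:R)
  (cge0M hb (cge0X n.-1 (tr_ge0 n n))) ler01 ltr01.
move=> hc; apply: le_trans (hc _) _ => [i _|]; first by rewrite expr1n.
rewrite divr1 hornerM horner_exp; apply: ler_pM; rewrite ?tr_diff1 ?exprn_ge0 //.
- by rewrite horner_coef sumr_ge0 // => i _; rewrite mulr_ge0 ?hb ?exprn_ge0.
- by rewrite lerXn2r ?nnegrE ?(ltW rho0) ?tr1_le.
Unshelve. all: by end_near. Qed.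

(* One coefficient above eta n carries the excess, the others follow the law of large numbers. *)
Lemma wcoef_ge (de eta : R) : 0 < de -> 0 < eta -> kap + de + eta <= 1 ->
  exists2 c1 : R, 0 < c1 & \forall n \near \oo, c1 * (n.+1%:R * w n * rho ^+ n) <= wcoef w n.
Proof.
move=> de0 eta0 hde; have [C C0 hC] := w_ratio eta0.
have eta1 : eta <= 1 by have := kap0; lra.
(* The tail is then at most [exp (-4) <= 1/4] of [rho^n], against a truncated mass of at least
   [3/4]. *)
pose A := 8 / de; have A0 : 0 < A by rewrite divr_gt0.
exists (C^-1 / 2); first by rewrite divr_gt0 ?invr_gt0.
near=> n.
have H1 : forall k, \sum_(l < k | (kap + de) * n%:R <= l%:R)
    ((tr (Num.truncn (eta * n%:R)) n) ^+ n)`_l <= rho ^+ n * expR (- (A * de / 2)).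
  by near: n; apply: tail_pow => //; exact: ltW.
have H2 : forall m, n%:R * \sum_(i < m | (Num.truncn (eta * n%:R) < i)%N) w i <= rho / 4.
  by near: n; apply: near_tail_mass => //; rewrite divr_gt0.
have H3 : forall j, eta * n%:R <= j%:R -> (j <= n)%N -> w j <= C * w n /\ w n <= C * w j.
  by near: n.
have n0 : (0 < n)%N by near: n; exists 1%N.
pose K := Num.truncn (eta * n%:R : R).
have en : 0 <= eta * n%:R by rewrite mulr_ge0 // ltW.
have KR : K%:R <= eta * n%:R by rewrite truncn_le.
have Kn : (K <= n)%N by rewrite -(ler_nat R) (le_trans KR) // ler_piMl.
have hb := @tr_diff_ge0 K n n Kn.
have := cle_expD_lower n (tr_ge0 K n) hb n; rewrite -tr_full coefMn => hlow.
have hw0 : 0 <= C^-1 * w n by rewrite mulr_ge0 // invr_ge0 ltW.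
have := @coef_conv_ge R _ _ (C^-1 * w n) n (fun j => K < j)%N hb (cge0X n (tr_ge0 K n)).
have hj : forall j, (j <= n)%N -> (K < j)%N -> C^-1 * w n <= (tr n n - tr K n)`_j.
  move=> j jn Kj; rewrite coefB !coef_tr jn (leqNgt j K) Kj /= subr0 ler_pdivrMl //.
  apply: (proj2 (H3 j _ jn)); apply: le_trans (ltW (truncnS_gt _)) _; rewrite ler_nat //.
move=> /(_ hj) hconv.
suff hs : rho ^+ n / 2 <= \sum_(l < n.+1 | (K < n - l)%N) (tr K n ^+ n)`_l.
  rewrite wcoef_tr; apply: le_trans hlow; rewrite -[leRHS]mulr_natl; apply: le_trans (ler_wpM2l (ler0n _ _) hconv).
  have -> : C^-1 / 2 * (n.+1%:R * w n * rho ^+ n) = n.+1%:R * (C^-1 * w n * (rho ^+ n / 2)) by ring.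
  by rewrite ler_wpM2l // ler_wpM2l.
(* Truncation removes only a fraction [1 / (4 n)] of the mass, so by Bernoulli's inequality its
   [n]-th power keeps three quarters. *)
have mass : rho <= (tr K n).[1] + rho / 4 / n%:R.
  apply/ler_addgt0Pr => ep ep0.
  have [m _ hm] := mass_near ep0; have {}hm := hm _ (leqnn m).
  rewrite -lerBlDr; apply: (le_trans hm); rewrite (bigID (fun i : 'I_m => (K < i)%N)) /= addrC.
  apply: lerD; last by rewrite ler_pdivlMr ?ltr0n // mulrC; exact: H2.
  rewrite tr_eval_sum.
  apply: (@le_trans _ _ (\sum_(i < maxn m n.+1 | (i <= K)%N) w i)).
    rewrite (big_ord_widen_cond (maxn m n.+1) (fun i => ~~ (K < i)%N) w) ?leq_maxl //.
    rewrite big_mkcond [leRHS]big_mkcond; apply: ler_sum => i _; rewrite -leqNgt.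
    by case: (leqP i K) => //= _; case: ifP.
  rewrite (big_ord_widen (maxn m n.+1) (fun i => wtrunc w K i * 1 ^+ i)) ?leq_maxr //.
  rewrite big_mkcond [leRHS]big_mkcond; apply: ler_sum => i _; rewrite /wtrunc expr1n mulr1.
  by case: (leqP i K) => [iK|_]; rewrite ?if_same // ltnS (leq_trans iK Kn).
have p0 : 0 <= (tr K n).[1].
  by rewrite horner_coef sumr_ge0 // => i _; rewrite mulr_ge0 ?tr_ge0 ?exprn_ge0.
have nR : 0 < n%:R :> R by rewrite ltr0n.
have pown : rho ^+ n * (3 / 4) <= (tr K n).[1] ^+ n.
  have h : rho * (1 - (4 * n%:R)^-1) <= (tr K n).[1].
    have -> : rho * (1 - (4 * n%:R)^-1) = rho - rho / 4 / n%:R by rewrite invfM mulrBr mulr1 mulrA.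
    by rewrite lerBlDr.
  have x1 : (4 * n%:R)^-1 <= 1 :> R by rewrite invf_le1 ?mulr_gt0 // -natrM ler1n muln_gt0.
  have x0 : 0 <= (4 * n%:R)^-1 :> R by rewrite invr_ge0 mulr_ge0.
  apply: (@le_trans _ _ ((rho * (1 - (4 * n%:R)^-1)) ^+ n)); last first.
    by rewrite lerXn2r // nnegrE mulr_ge0 ?(ltW rho0) // subr_ge0.
  rewrite exprMn ler_wpM2l ?exprn_ge0 ?(ltW rho0) //.
  have -> : 3 / 4 = 1 - n%:R * (4 * n%:R)^-1 :> R.
    by field; rewrite gt_eqF.
  move: (_^-1) x0 x1 => x x0 x1; elim: (n) => [|m IH]; first by rewrite mul0r subr0.
  rewrite exprS; apply: le_trans (ler_wpM2l _ IH); rewrite ?subr_ge0 // -natr1.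
  have : 0 <= m%:R * x * x by rewrite !mulr_ge0.
  by move: (m%:R) => y; nra.
set k := maxn n.+1 (size (tr K n ^+ n)).
have tot : (tr K n).[1] ^+ n = \sum_(l < k) (tr K n ^+ n)`_l.
  rewrite -horner_exp (@horner_coef_wide _ k) ?leq_maxr //.
  by under eq_bigr do rewrite expr1n mulr1.
have tail : \sum_(l < k | (kap + de) * n%:R <= l%:R) (tr K n ^+ n)`_l <= rho ^+ n / 4.
  apply: le_trans (H1 k) _; rewrite ler_wpM2l ?exprn_ge0 ?(ltW rho0) //.
  have -> : A * de / 2 = 4 by rewrite /A; field; rewrite gt_eqF.
  rewrite expRN lef_pV2 ?posrE ?expR_gt0 //; apply: le_trans (expR_ge1Dx _); rewrite lerDr //.
have split : \sum_(l < k) (tr K n ^+ n)`_l <=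
    \sum_(l < k | (kap + de) * n%:R <= l%:R) (tr K n ^+ n)`_l +
    \sum_(l < n.+1 | (K < n - l)%N) (tr K n ^+ n)`_l.
  rewrite (bigID (fun l : 'I_k => (kap + de) * n%:R <= l%:R)) /= lerD2l.
  rewrite (big_ord_widen_cond k (fun l => (K < n - l)%N) (fun l => (tr K n ^+ n)`_l)) ?leq_maxl //.
  rewrite big_mkcond [leRHS]big_mkcond; apply: ler_sum => l _.
  case: ifP => [|_]; last by case: ifP => // _; exact: cge0X (tr_ge0 _ _) _.
  rewrite -ltNge => hl; rewrite ifT //.
  have hln : l%:R + eta * n%:R < n%:R.
    apply: lt_le_trans (_ : (kap + de + eta) * n%:R <= _); first by rewrite [ltRHS]mulrDl ltrD2r.
    by rewrite ler_piMl.
  have : (l + K < n)%N.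
    by rewrite -(ltr_nat R) natrD; apply: le_lt_trans hln; rewrite lerD2l.
  move=> lK; by rewrite ltn_subRL lK ltnS ltnW // (leq_ltn_trans _ lK) // leq_addr.
rewrite tot in pown; move: (le_trans pown split) tail.
by move: (rho ^+ n) => r; lra.
Unshelve. all: by end_near. Qed.

(* Chernoff bound at exp s with s = A ln n / n: the truncation at eta n keeps the moment
   generating function under control, at the price of a power of n that A compensates. *)
Lemma wcoef_small (eta ep : R) : 0 < eta -> eta <= 1 -> eta * (2 * B / (1 - kap)) <= e0 / 2 -> 0 < ep ->
  \forall n \near \oo, (tr (Num.truncn (eta * n%:R)) n ^+ n.+1)`_n <= ep * (n.+1%:R * w n * rho ^+ n).
Proof.
move=> eta0 eta1 hA ep0; have k1 : 0 < 1 - kap by rewrite subr_gt0.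
(* With [eps = (1 - kap) / 2] the net exponent is at least [A * eps * ln n = B * ln n], which
   matches the polynomial lower bound on [w n]; the factor [n + 1] on the right leaves room for
   [ep]. *)
pose A := 2 * B / (1 - kap); have A0 : 0 < A by rewrite divr_gt0 // mulr_gt0.
pose eps := (1 - kap) / 2.
have eps0 : 0 < eps by rewrite divr_gt0.
have heps : 0 < eps <= 1 by rewrite eps0 /= ler_pdivrMr // mul1r; have := kap0; lra.
pose X := (2 / eps) `^ (1 + e0) * S / rho.
have X0 : 0 < X by rewrite !mulr_gt0 ?powR_gt0 ?invr_gt0 // divr_gt0.
(* The logarithm in [s] is traded for [n^tau]. After raising to [1 + e0] this costs [n^(e0/4)], and
   with the [n^(e0/2)] of the truncation a decay [n^(-e0/4)] is left. *)
pose tau := e0 / (4 * (1 + e0)).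
have e1 : 0 < 1 + e0 by rewrite addr_gt0.
have tau0 : 0 < tau by rewrite divr_gt0 // mulr_gt0.
pose Y := 2 * X * (A / tau) `^ (1 + e0).
have Y0 : 0 < Y.
  by rewrite /Y mulr_gt0 ?powR_gt0 ?divr_gt0 // mulr_gt0.
pose Z := rho * expR (A + 1) / (c * ep).
have Z0 : 0 <= Z by rewrite !mulr_ge0 ?invr_ge0 ?mulr_ge0 ?expR_ge0 ?ltW.
near=> n; have n0 : (0 < n)%N by near: n; exists 1%N.
have nR : 0 < n%:R :> R by rewrite ltr0n.
have nR1 : 1 <= n%:R :> R by rewrite ler1n.
have hY : n%:R `^ (- (e0 / 4)) <= Y^-1 by near: n; apply: near_powRN; rewrite ?invr_gt0 ?divr_gt0.
have hw : c * n%:R `^ (- B) <= w n by near: n.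
have hZ : Z <= n%:R by near: n; exact: nbhs_infty_ger.
set K := Num.truncn _.
have KR : K%:R <= eta * n%:R by rewrite truncn_le mulr_ge0 // ltW.
pose ll := ln n%:R : R; have ll0 : 0 <= ll by exact: ln_ge0.
pose s := A * ll / n%:R; have s0 : 0 <= s by rewrite divr_ge0 // mulr_ge0 // ltW.
have sn : s * n%:R = A * ll by rewrite /s divfK ?gt_eqF.
have pw (x : R) : n%:R `^ x = expR (x * ll) by rewrite /powR (gt_eqF nR).
have hE : n.+1%:R * (X * (s `^ (1 + e0) * expR (s * K%:R))) <= 1.
  have b1 : expR (s * K%:R) <= n%:R `^ (e0 / 2).
    rewrite pw ler_expR; apply: (@le_trans _ _ (s * (eta * n%:R))); first by rewrite ler_wpM2l.
    by rewrite mulrCA sn mulrA ler_wpM2r.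
  have b2 : s `^ (1 + e0) <= (A / tau) `^ (1 + e0) * (n%:R `^ (e0 / 4) * n%:R `^ (- (1 + e0))).
    have -> : n%:R `^ (e0 / 4) * n%:R `^ (- (1 + e0)) = (n%:R `^ tau / n%:R) `^ (1 + e0) :> R.
      rewrite powRM ?powR_ge0 ?invr_ge0 // -powRrM; congr (_ * _).
        by congr (_ `^ _); rewrite /tau; field; rewrite gt_eqF.
      by rewrite powRN -[n%:R^-1]powR_inv1 // powRAC powR_inv1 // powR_ge0.
    have At0 : 0 <= A / tau by exact: divr_ge0 (ltW A0) (ltW tau0).
    have nt0 : 0 <= n%:R `^ tau / n%:R :> R by exact: divr_ge0 (powR_ge0 _ _) (ltW nR).
    rewrite -(powRM _ At0 nt0); apply: (ge0_ler_powR (ltW e1)).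
    - by rewrite nnegrE.
    - by rewrite nnegrE; exact: mulr_ge0.
    rewrite /s mulrA; apply: (ler_wpM2r); first by rewrite invr_ge0.
    rewrite -mulrA; apply: (ler_wpM2l (ltW A0)); rewrite mulrC.
    exact: ln_le_powR.
  apply: (@le_trans _ _ ((2 * n%:R) * (X * ((A / tau) `^ (1 + e0) *
      (n%:R `^ (e0 / 4) * n%:R `^ (- (1 + e0))) * n%:R `^ (e0 / 2))))).
    apply: ler_pM; first exact: ler0n.
    - apply: mulr_ge0; first exact: ltW.
      by apply: mulr_ge0; [exact: powR_ge0|exact: expR_ge0].
     - by rewrite -natr1 mulr_natl mulr2n lerD2l.
    apply: (ler_wpM2l (ltW X0)).
    exact: (ler_pM (powR_ge0 _ _) (expR_ge0 _) b2 b1).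
  have -> : 2 * n%:R * (X * ((A / tau) `^ (1 + e0) *
      (n%:R `^ (e0 / 4) * n%:R `^ (- (1 + e0))) * n%:R `^ (e0 / 2))) =
      Y * (n%:R `^ 1 * n%:R `^ (e0 / 4) * n%:R `^ (- (1 + e0)) * n%:R `^ (e0 / 2)).
    rewrite powRr1 // /Y; move: (_ `^ _) (_ `^ _) (_ `^ _) (_ `^ _) => x1 x2 x3 x4; ring.
  rewrite -!powRD; try by rewrite (gt_eqF nR) implybT.
  rewrite (_ : 1 + e0 / 4 + - (1 + e0) + e0 / 2 = - (e0 / 4)); last by field.
  by rewrite mulrC -ler_pdivlMr // mul1r.
have h0 : 0 <= (tr K n).[expR s].
  by rewrite horner_coef sumr_ge0 // => i _; rewrite mulr_ge0 ?tr_ge0 ?exprn_ge0 ?expR_ge0.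
have := coef_chernoff n (cge0X n.+1 (tr_ge0 K n)) (expR_ge0 s).
rewrite horner_exp -expRM_natr sn => hc.
have hp := expR_pow_le n.+1 h0 (ltW rho0) (tr_mgf K n heps s0).
have hexp : n.+1%:R * ((1 + eps) * s * kap + X * (s `^ (1 + e0) * expR (s * K%:R))) <=
    A * ll - B * ll + A + 1.
  rewrite mulrDr lerD //.
  have k2 : (1 + eps) * kap <= 1 - eps by rewrite /eps; have := kap0; have := kap1; nra.
  have k3 : (1 + eps) * kap <= 1 by apply: le_trans k2 _; rewrite gerBl ltW.
  have -> : n.+1%:R * ((1 + eps) * s * kap) = (1 + eps) * kap * (A * ll) + (1 + eps) * kap * s.
    by rewrite -natr1 -sn; ring.
  have sA : s <= A.
    rewrite /s ler_pdivrMr // ler_wpM2l ?(ltW A0) //.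
    by apply: ltW; exact: ln_sublinear.
  have -> : A * ll - B * ll = (1 - eps) * (A * ll).
    by rewrite /eps /A; field; rewrite gt_eqF.
  apply: lerD; first by rewrite ler_wpM2r // mulr_ge0 // ltW.
  by apply: le_trans sA; rewrite ler_piMl.
have {}hc : (tr K n ^+ n.+1)`_n <= rho ^+ n.+1 * expR (- B * ll + A + 1).
  rewrite -(ler_pM2r (expR_gt0 (A * ll))); apply: le_trans hc _; apply: le_trans hp _.
  rewrite -[leRHS]mulrA -expRD ler_wpM2l ?exprn_ge0 ?(ltW rho0) // ler_expR.
  by apply: le_trans hexp _; rewrite le_eqVlt; apply/orP; left; apply/eqP; ring.
apply: (le_trans hc); rewrite -addrA expRD -pw exprS.
have -> : ep * (n.+1%:R * w n * rho ^+ n) = rho ^+ n * (ep * n.+1%:R * w n) by ring.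
have -> : rho * rho ^+ n * (n%:R `^ (- B) * expR (A + 1)) = rho ^+ n * (rho * expR (A + 1) * n%:R `^ (- B)) by ring.
rewrite ler_wpM2l ?exprn_ge0 ?(ltW rho0) //.
apply: (@le_trans _ _ (ep * n.+1%:R * (c * n%:R `^ (- B)))); last first.
  by rewrite ler_wpM2l // mulr_ge0 // ltW.
rewrite mulrA ler_wpM2r ?powR_ge0 //.
have : Z <= n.+1%:R by apply: le_trans hZ _; rewrite ler_nat.
by rewrite /Z ler_pdivrMr ?mulr_gt0 // => /le_trans; apply; rewrite mulrA mulrAC [ep * _]mulrC mulrAC.
Unshelve. all: by end_near. Qed.

Lemma wcoef_lower_dev (de ep : R) : 0 < de -> de < 1 - kap -> 0 < ep -> \forall n \near \oo,
  wcoef (wtrunc w (Num.truncn ((1 - kap - de) * n%:R))) n <= ep * (n.+1%:R * w n * rho ^+ n).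
Proof.
move=> de0 de1 ep0; have k1 : 0 < 1 - kap by rewrite subr_gt0.
have kd : 0 < 1 - kap - de by rewrite subr_gt0.
(* The first bound puts the truncation at [eta n] below the one studied, the second is the condition
   of [wcoef_small]. A summand between the two truncations forces the others to exceed
   [(kap + de) n]. *)
pose eta := Num.min (1 - kap - de) ((1 - kap) * e0 / (4 * B)).
have eta0 : 0 < eta by rewrite lt_min kd divr_gt0 ?mulr_gt0.
have eta1 : eta <= 1 - kap - de by rewrite ge_min lexx.
have eta2 : eta <= 1 by apply: le_trans eta1 _; have := kap0; lra.
have eta3 : eta * (2 * B / (1 - kap)) <= e0 / 2.
  apply: (@le_trans _ _ ((1 - kap) * e0 / (4 * B) * (2 * B / (1 - kap)))).
    by rewrite ler_wpM2r ?divr_ge0 ?mulr_ge0 ?(ltW k1) ?(ltW B0) // ge_min lexx orbT.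
  by rewrite le_eqVlt; apply/orP; left; apply/eqP; field; rewrite !gt_eqF.
have [C C0 hC] := w_ratio eta0.
have ep20 : 0 < ep / 2 by rewrite divr_gt0.
have ep2C : 0 < ep / 2 / C by rewrite divr_gt0.
near=> n.
have H1 : \sum_(l < n.+1 | (kap + de) * n%:R <= l%:R) ((tr n n) ^+ n)`_l <= ep / 2 / C * rho ^+ n.
  by near: n; exact: full_tail.
have H2 : (tr (Num.truncn (eta * n%:R)) n ^+ n.+1)`_n <= ep / 2 * (n.+1%:R * w n * rho ^+ n).
  by near: n; exact: wcoef_small.
have H3 : forall j, eta * n%:R <= j%:R -> (j <= n)%N -> w j <= C * w n /\ w n <= C * w j.
  by near: n.
set K1 := Num.truncn _; pose K := Num.truncn (eta * n%:R : R).
have K1R : K1%:R <= (1 - kap - de) * n%:R by rewrite truncn_le mulr_ge0 // ltW.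
have KK : (K <= K1)%N by apply: le_truncn; rewrite ler_wpM2r.
have hb := @tr_diff_ge0 K K1 n KK.
have := cle_expD n (tr_ge0 K n) hb n; rewrite addrC subrK coefD coefMn => hup.
rewrite -[X in X <= _]/((tr K1 n ^+ n.+1)`_n); apply: (le_trans hup).
rewrite (_ : ep * _ = ep / 2 * (n.+1%:R * w n * rho ^+ n) + (ep / 2 * (w n * rho ^+ n)) *+ n.+1); last first.
  by rewrite -mulr_natl; field.
rewrite lerD // lerMn2r /=.
have hj : forall j, (tr K1 n - tr K n)`_j <= if ((K < j) && (j <= K1))%N then C * w n else 0.
  move=> j; apply: le_trans (tr_diff_coef _ _ _ _) _; rewrite andbA; case: (_ && (j <= K1)%N) / andP => //= -[Kj _].
  case: ifP => [jn|_]; last by rewrite mulr_ge0 // ltW.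
  apply: (proj1 (H3 j _ jn)); apply: le_trans (ltW (truncnS_gt _)) _; by rewrite ler_nat.
apply: le_trans (coef_conv_le _ (cge0X n (tr_ge0 K1 n)) hj) _.
have -> : ep / 2 * (w n * rho ^+ n) = C * w n * (ep / 2 / C * rho ^+ n) by field; rewrite gt_eqF.
rewrite ler_wpM2l ?mulr_ge0 ?(ltW C0) //; apply: le_trans H1.
rewrite big_mkcond [leRHS]big_mkcond; apply: ler_sum => l _; case: ifP => [/andP[_ hl]|_]; last first.
  by case: ifP => // _; exact: cge0X (tr_ge0 _ _) _.
have ln : (l <= n)%N by rewrite -ltnS.
rewrite ifT.
  apply: (cleX n (tr_ge0 K1 n)) => i; rewrite !coef_tr; case: (leqP i n); rewrite ?andbF ?andbT // => _.
  by case: ifP.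
have : n%:R - l%:R <= K1%:R :> R by rewrite -natrB // ler_nat.
by move: K1R; move: (K1%:R) (l%:R) (n%:R) => x y z; nra.
Unshelve. all: by end_near. Qed.

(** Chernoff's bound on the other side, with a fixed negative exponent: for sums of nonnegative
    terms that are too small no truncation is involved. *)
Lemma tr_eval_le (de : R) : 0 < de -> exists2 s : R, 0 < s & \forall n \near \oo,
  (tr n n).[expR (- s)] <= rho * (1 + s * (de / 2 - kap)).
Proof.
(* Chosen so that the moment term [s^(1 + e0) * S] is exactly [s * rho * de / 4]. *)
move=> de0; pose x := rho * de / (4 * S).
have x0 : 0 < x by rewrite divr_gt0 ?mulr_gt0.
pose s := x `^ e0^-1; have s0 : 0 < s by rewrite powR_gt0.
exists s => //; near=> n.
have hm : kap * rho - rho * de / 4 <= \sum_(i < n.+1) i%:R * w i.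
  have : kap * rho - rho * de / 4 <= \sum_(i < n) i%:R * w i.
    by near: n; apply: mean_near; rewrite divr_gt0 ?mulr_gt0.
  by move=> /le_trans; apply; rewrite big_ord_recr /= lerDl mulr_ge0.
have he : 0 <= e0 <= 1 by rewrite (ltW e00).
rewrite tr_eval_sum; apply: (@le_trans _ _ (\sum_(i < n.+1)
   (w i - s * (i%:R * w i) + s `^ (1 + e0) * (i%:R `^ (1 + e0) * w i)))).
  apply: ler_sum => i _; rewrite /wtrunc -ltnS ltn_ord -expRM_natr mulNr mulrC.
  have y0 : 0 <= s * i%:R by rewrite mulr_ge0 // ltW.
  have := ler_wpM2r (wge0 i) (expRN_le_mgf he y0).
  move=> /le_trans; apply; rewrite powRM ?(ltW s0) // le_eqVlt; apply/orP; left; apply/eqP.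
  by move: (_ `^ _) (_ `^ _) => y z; ring.
rewrite !big_split /= sumrN -!mulr_sumr.
have hs : s `^ (1 + e0) * S = s * (rho * de / 4).
  rewrite powRD; last by rewrite (gt_eqF s0) implybT.
  rewrite powRr1 ?(ltW s0) // /s -powRrM mulVf ?gt_eqF // powRr1 ?(ltW x0) // -mulrA; congr (_ * _).
  by rewrite /x; field; rewrite gt_eqF.
apply: (@le_trans _ _ (rho - s * (kap * rho - rho * de / 4) + s `^ (1 + e0) * S)).
  apply: lerD; last exact: (ler_wpM2l (powR_ge0 _ _) (mom_le _)).
  by apply: lerB; [exact: mass_le|rewrite ler_wpM2l // ltW].
by rewrite hs le_eqVlt; apply/orP; left; apply/eqP; field.
Unshelve. all: by end_near. Qed.

(** A summand above [(1 - kap + de) n] leaves at most [(kap - de) n] to the other [n] summands, an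
    exponentially unlikely event. *)
Lemma wcoef_upper_dev (de ep : R) : 0 < de -> de < 1 - kap -> 0 < ep -> \forall n \near \oo,
  wcoef w n - wcoef (wtrunc w (Num.truncn ((1 - kap + de) * n%:R))) n <=
  ep * (n.+1%:R * w n * rho ^+ n).
Proof.
move=> de0 de1 ep0; have k1 : 0 < 1 - kap by rewrite subr_gt0.
have [C C0 hC] := w_ratio k1; have [s s0 hs] := tr_eval_le de0.
have sd0 : 0 < s * de / 2 by rewrite divr_gt0 // mulr_gt0.
have epC : 0 < ep / C by rewrite divr_gt0.
near=> n.
have H1 : (tr n n).[expR (- s)] <= rho * (1 + s * (de / 2 - kap)) by near: n.
have H2 : expR (- (s * de / 2 * n%:R)) <= ep / C by near: n; exact: near_expRN.
have H3 : forall j, (1 - kap) * n%:R <= j%:R -> (j <= n)%N -> w j <= C * w n /\ w n <= C * w j.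
  by near: n.
set K := Num.truncn _.
have [nK|Kn] := leqP n K.
  rewrite (@eq_wcoef _ (wtrunc w K) w) ?subrr; last by move=> i iN; rewrite /wtrunc (leq_trans iN).
  by rewrite !mulr_ge0 ?exprn_ge0 ?(ltW ep0) ?(ltW rho0).
have hb := @tr_diff_ge0 K n n (ltnW Kn).
have := cle_expD n (tr_ge0 K n) hb n; rewrite -tr_full coefD coefMn => hup.
rewrite -[wcoef (wtrunc w K) n]/((tr K n ^+ n.+1)`_n).
rewrite wcoef_tr lerBlDl; apply: (le_trans hup); rewrite lerD2l.
have -> : ep * (n.+1%:R * w n * rho ^+ n) = (ep * (w n * rho ^+ n)) *+ n.+1.
  by rewrite -mulr_natl; ring.
rewrite lerMn2r /=.
have en : 0 <= (1 - kap + de) * n%:R by rewrite mulr_ge0 // addr_ge0 // ltW.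
have KR (j : nat) : (K < j)%N -> (1 - kap + de) * n%:R <= j%:R.
  by move=> Kj; apply: le_trans (ltW (truncnS_gt _)) _; rewrite ler_nat.
have hj : forall j, (tr n n - tr K n)`_j <= if (K < j)%N then C * w n else 0.
  move=> j; apply: le_trans (tr_diff_coef _ _ _ _) _; case: (leqP j K) => //= Kj.
  rewrite andbb; case: ifP => [jn|_]; last by rewrite mulr_ge0 // ltW.
  apply: (proj1 (H3 j _ jn)); apply: le_trans (KR _ Kj); rewrite ler_wpM2r // lerDl ltW //.
apply: le_trans (coef_conv_le _ (cge0X n (tr_ge0 n n)) hj) _.
have -> : ep * (w n * rho ^+ n) = C * w n * (ep / C * rho ^+ n) by field; rewrite gt_eqF.
rewrite ler_wpM2l ?mulr_ge0 ?(ltW C0) //.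
have d0 : 0 < expR (- (s * ((kap - de) * n%:R))) by exact: expR_gt0.
have := @sum_coef_chernoff R _ (expR (- s)) _ n.+1 (fun l => (K < n - l)%N)
  (cge0X n (tr_ge0 n n)) (expR_ge0 _) d0.
move=> h; apply: le_trans (h _) _ => {h} [l hl|].
  rewrite -expRM_natr ler_expR mulNr lerN2 ler_wpM2l ?(ltW s0) //.
  have ln : (l <= n)%N by rewrite ltnW // -subn_gt0 (leq_ltn_trans _ hl).
  have := KR _ hl; rewrite natrB //.
  by move: (l%:R) (n%:R) => y z; nra.
rewrite horner_exp ler_pdivrMr //.
have h0 : 0 <= (tr n n).[expR (- s)].
  by rewrite horner_coef sumr_ge0 // => i _; rewrite mulr_ge0 ?tr_ge0 ?exprn_ge0 ?expR_ge0.
apply: le_trans (expR_pow_le n h0 (ltW rho0) H1) _.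
rewrite [ep / C * _]mulrC -[leRHS]mulrA ler_wpM2l ?exprn_ge0 ?(ltW rho0) //.
apply: le_trans (ler_wpM2r (ltW d0) H2); rewrite -expRD ler_expR.
by rewrite le_eqVlt; apply/orP; left; apply/eqP; field.
Unshelve. all: by end_near. Qed.

Theorem bigjump_condensed : condensed w kap.
Proof.
apply: condensedP w0 _ => de ep de0 de1 ep0.
pose eta := (1 - kap - de) / 2; have eta0 : 0 < eta by rewrite divr_gt0 ?subr_gt0.
have hde : kap + de + eta <= 1 by rewrite /eta; move: de1; lra.
have [c1 c10 hc1] := wcoef_ge de0 eta0 hde.
have epc : 0 < ep * c1 by rewrite mulr_gt0.
near=> n.
have n0 : (0 < n)%N by near: n; exists 1%N.
have H0 : c1 * (n.+1%:R * w n * rho ^+ n) <= wcoef w n by near: n.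
have hw : c * n%:R `^ (- B) <= w n by near: n.
have u0 : 0 < n.+1%:R * w n * rho ^+ n.
  rewrite !mulr_gt0 ?exprn_gt0 //; apply: lt_le_trans hw.
  by rewrite mulr_gt0 // powR_gt0 // ltr0n.
have H1 : ep * c1 * (n.+1%:R * w n * rho ^+ n) <= ep * wcoef w n.
  by rewrite -mulrA ler_wpM2l // ltW.
split; first by apply: lt_le_trans H0; rewrite mulr_gt0.
  by apply: le_trans H1; near: n; exact: wcoef_lower_dev.
by apply: le_trans H1; near: n; exact: wcoef_upper_dev.
Unshelve. all: by end_near. Qed.
End BigJump.

(** * Slowly varying functions *)

Section SlowVariation.
Variable R : realType.
Local Notation mu := (@lebesgue_measure R).

Lemma lebesgue_shift (c : R) (A : set R) : measurable A ->
  mu [set x | A (x + c)] = mu A.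
Proof.
move=> mA; have mf : measurable_fun setT (fun x : R => x + c) by exact: measurable_funD.
pose f : {mfun measurableTypeR R >-> measurableTypeR R} := HB.pack_for
  {mfun measurableTypeR R >-> measurableTypeR R} (fun x : R => x + c)
  (isMeasurableFun.Build _ _ (measurableTypeR R) (measurableTypeR R) (fun x : R => x + c) mf).
apply/esym; apply: (@lebesgue_measure_unique R (pushforward mu f)) => // X [[a b] /= _ <-].
rewrite /pushforward /=.
have -> : (fun x => x + c) @^-1` `]a, b] = `]a - c, b - c]%classic.
  by apply/seteqP; split => x /=; rewrite !in_itv /= ltrBlDr lerBrDr.
rewrite !lebesgue_measure_itv /= !lte_fin ltrD2r; case: ifP => // _.
by rewrite -!EFinB; congr (_%:E); ring.
Qed.

(** The tail unions of the exceptional sets decrease to the empty set inside a set of finite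
    measure, so their measures tend to 0. *)
Lemma conv_in_measure (f : nat -> R -> R) : (forall m, measurable_fun setT (f m)) ->
  (forall u, f m u @[m --> \oo] --> (0 : R)) ->
  \forall m \near \oo, (mu (`[0%R, 2%R] `&` [set u | (2^-1 < `|f m u|)%R]) < (2^-1)%:E)%E.
Proof.
move=> mf cf; pose E m := `[0%R, 2%R]%classic `&` [set u : R | 2^-1 < `|f m u|].
have mE m : measurable (E m).
  apply: measurableI => //; rewrite -[X in measurable X]setTI.
  have -> : [set u : R | 2^-1 < `|f m u|] = (fun u => `|f m u|) @^-1` `]2^-1, +oo[%classic.
    by apply/seteqP; split => x /=; rewrite in_itv /= andbT.
  by apply: (measurableT_comp _ (mf m)) => //; exact: measurable_normr.
pose F n := \bigcup_(m in [set m | (n <= m)%N]) E m.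
have mF n : measurable (F n) by apply: bigcup_measurable => m _.
have F0 : \bigcap_n F n = set0.
  apply/seteqP; split => // u hu.
  have /cvgr0_norm_lt/(_ 2^-1) h := cf u.
  have [N _ hN] := h ltac:(by []).
  have [m /= Nm [_ /=]] := hu N I.
  by rewrite ltNge => /negP; apply; apply/ltW/hN.
have Ffin : (mu (F 0%N) < +oo)%E.
  apply: (@le_lt_trans _ _ (mu (`[0%R, 2%R]%classic : set R))).
    apply: le_measure.
    - by apply/mem_set; exact: mF.
    - by apply/mem_set; exact: (@measurable_itv R).
    - by apply: bigcup_sub => m _ u [].
  by rewrite lebesgue_measure_itv /= lte_fin ltr0n -EFinB ltry.
have dF : {homo F : n m / (n <= m)%N >-> (m <= n)%O}.
  move=> n m nm; apply/subsetPset => u [k /= mk Ek]; exists k => //=; exact: leq_trans mk.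
have := @nonincreasing_cvg_mu _ _ R mu F Ffin mF; rewrite F0 measure0 => /(_ measurable0 dF) cF.
have [N _ hN] : \forall n \near \oo, (mu (F n) < (2^-1)%:E)%E.
  apply: (cF [set x | (x < (2^-1)%:E)%E]); apply: open_nbhs_nbhs; split; first exact: open_ereal_lt_ereal.
  by rewrite /= lte_fin.
exists N => // m Nm; apply: le_lt_trans (hN m Nm).
apply: le_measure.
- by apply/mem_set; exact: mE.
- by apply/mem_set; exact: mF.
- by move=> u Eu; exists m => /=.
Qed.

(* If this failed along t_n, u_n, both {u | |h (t_n + u) - h t_n| <= 1/2} and its analogue at
   t_n + u_n, shifted by u_n, would have almost full measure in [1, 2], hence meet. *)
Lemma slow_unif (h : R -> R) : measurable_fun setT h ->
  (forall u ep : R, 0 < ep -> exists t0, forall t, t0 <= t -> `|h (t + u) - h t| <= ep) ->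
  exists t0, forall t u : R, t0 <= t -> 0 <= u <= 1 -> `|h (t + u) - h t| <= 1.
Proof.
move=> mh hs; apply: contrapT => H.
have {}H (n : nat) : exists p : R * R, [/\ n%:R <= p.1, 0 <= p.2 <= 1 & 1 < `|h (p.1 + p.2) - h p.1|].
  apply: contrapT => Hn; apply: H; exists n%:R => t u nt u01.
  by rewrite leNgt; apply/negP => h1; apply: Hn; exists (t, u).
have /choice[p hp] := H.
have cvg0 (s : nat -> R) : (forall n, n%:R <= s n) ->
    forall u, h (s n + u) - h (s n) @[n --> \oo] --> (0 : R).
  move=> hsn u; apply/cvgr0Pnorm_le => ep ep0; have [t0 ht0] := hs u ep ep0.
  near=> n; apply: ht0; apply: le_trans (hsn n).
  by near: n; exact: nbhs_infty_ger.
have ms (s : nat -> R) m : measurable_fun setT (fun u => h (s m + u) - h (s m)).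
  apply: measurable_funB => //; apply: (measurableT_comp mh); exact: measurable_funD.
have c1 := cvg0 (fun n => (p n).1) (fun n => let: And3 a _ _ := hp n in a).
have h2 n : n%:R <= (p n).1 + (p n).2.
  by have [a /andP[b _] _] := hp n; rewrite (le_trans a) // lerDl.
have c2 := cvg0 (fun n => (p n).1 + (p n).2) h2.
have e1 := conv_in_measure (ms (fun n => (p n).1)) c1.
have e2 := conv_in_measure (ms (fun n => (p n).1 + (p n).2)) c2.
near \oo => n.
have : (mu (`[0%R, 2%R] `&` [set u | (2^-1 < `|h ((p n).1 + u) - h (p n).1|)%R]) < (2^-1)%:E)%E.
  by near: n.
have : (mu (`[0%R, 2%R] `&` [set u | (2^-1 < `|h ((p n).1 + (p n).2 + u) - h ((p n).1 + (p n).2)|)%R]) < (2^-1)%:E)%E.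
  by near: n.
have [_ /andP[] ] := hp n; move: (p n).1 (p n).2 => t v v0 v1 hv.
set E2 := _ `&` _ ; set E1 := _ `&` [set _ | _] => l2 l1.
have mE (s : R) : measurable (`[0%R, 2%R] `&` [set u : R | 2^-1 < `|h (s + u) - h s|]).
  apply: measurableI => //; rewrite -[X in measurable X]setTI.
  have -> : [set u : R | 2^-1 < `|h (s + u) - h s|] = (fun u => `|h (s + u) - h s|) @^-1` `]2^-1, +oo[%classic.
    by apply/seteqP; split => x /=; rewrite in_itv /= andbT.
  by apply: (measurableT_comp _ (ms (fun=> s) 0%N)) => //; exact: measurable_normr.
have mE1 : measurable E1 by exact: mE.
have mE2 : measurable E2 by exact: mE.
have mS : measurable [set x | E2 (x + - v)].
  rewrite -[X in measurable X]setTI; apply: (measurable_funD _ _) => //.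
have cover : `[1%R, 2%R]%classic `<=` E1 `|` [set x | E2 (x + - v)].
  move=> x /=; rewrite in_itv /= => /andP[x1 x2]; apply: contrapT => hx.
  have a1 : `|h (t + x) - h t| <= 2^-1.
    rewrite leNgt; apply/negP => a; apply: hx; left; split => //=; rewrite in_itv /= x2 andbT.
    by apply: le_trans x1.
  have a2 : `|h (t + x) - h (t + v)| <= 2^-1.
    rewrite leNgt; apply/negP => a; apply: hx; right; split => /=.
      by rewrite in_itv /= subr_ge0 (le_trans v1) //= lerBlDr (le_trans x2) // lerDl.
    by rewrite addrAC -addrA addrNK.
  move: hv; rewrite ltNge => /negP; apply.
  have -> : h (t + v) - h t = (h (t + x) - h t) - (h (t + x) - h (t + v)) by ring.
  by apply: le_trans (ler_normB _ _) _; rewrite -[leRHS](_ : 2^-1 + 2^-1 = 1) ?lerD //; field.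
have : (mu (`[1%R, 2%R]%classic : set R) <= mu E1 + mu E2)%E.
  rewrite -(lebesgue_shift (- v) mE2); apply: le_trans (@measureU2 _ (measurableTypeR R) R mu _ _ mE1 mS).
  apply: le_measure.
  - by apply/mem_set; exact: (@measurable_itv R).
  - by apply/mem_set; exact: measurableU.
  - exact: cover.
rewrite lebesgue_measure_itv /= lte_fin ltr1n leNgt => /negP; apply.
apply: lt_le_trans (lteD l1 l2) _; rewrite -EFinD -EFinB lee_fin.
lra.
Unshelve. all: by end_near. Qed.

Variable L : R -> R.
Hypothesis hL : slowly_varying L.

Lemma near_pinftyP (Q : R -> Prop) : (\forall x \near +oo, Q x) ->
  exists2 x0 : R, 0 < x0 & forall x, x0 <= x -> Q x.
Proof.
move=> [M [_ hM]]; exists (Num.max M 0 + 1); first by rewrite ltr_pwDr // le_max lexx orbT.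
by move=> x hx; apply: hM; apply: lt_le_trans hx; rewrite ltr_pwDr // le_max lexx.
Qed.

Lemma slow_ratio (c ep : R) : 0 < c -> 0 < ep -> exists2 x0 : R, 0 < x0 & forall x, x0 <= x ->
  [/\ 0 < L x, 0 < L (c * x), `|ln (L (c * x)) - ln (L x)| <= ep,
    L (c * x) <= expR ep * L x & L x <= expR ep * L (c * x)].
Proof.
move=> c0 ep0; have [mL [posL cL]] := hL.
have cln : ln (L (c * x) / L x) @[x --> +oo] --> (0 : R).
  by rewrite -(@ln1 R); apply: (cvg_comp _ _ (cL c c0)); exact: continuous_ln.
have [x1 x10 h1] := near_pinftyP posL.
have /cvgr0_norm_le/(_ ep ep0)/near_pinftyP[x2 x20 h2] := cln.
exists (Num.max (Num.max x1 x2) (x1 / c)); first by rewrite !lt_max x10.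
move=> x; rewrite !ge_max => /andP[/andP[hx1 hx2] hx3].
have p1 := h1 x hx1; have p2 : 0 < L (c * x) by apply: h1; rewrite mulrC -ler_pdivrMr.
have := h2 x hx2; rewrite ln_div ?posrE // => hl.
split => //.
  rewrite -[leLHS]lnK ?posrE // -[in leRHS](lnK p1) -expRD ler_expR -lerBlDr.
  by apply: le_trans hl; rewrite ler_norm.
rewrite -[leLHS]lnK ?posrE // -[in leRHS](lnK p2) -expRD ler_expR -lerBlDr.
by apply: le_trans hl; rewrite distrC ler_norm.
Qed.

(** In logarithmic variables slow variation says that increments of [ln (L (expR t))] over a fixed
    shift vanish; [slow_unif] bounds them by 1 uniformly over shifts in [[0, 1]], which contains
    [ln la]. *)
Lemma slow_bounded : exists2 x0 : R, 0 < x0 & forall x la, x0 <= x -> 1 <= la <= 2 ->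
  [/\ 0 < L x, L (la * x) <= expR 1 * L x & L x <= expR 1 * L (la * x)].
Proof.
have [mL [posL _]] := hL; have [x1 x10 h1] := near_pinftyP posL.
pose h t := ln (L (expR t)).
have mh : measurable_fun setT h.
  by apply: (measurableT_comp (@measurable_ln R)); apply: (measurableT_comp mL); exact: measurable_expR.
have hs (u ep : R) : 0 < ep -> exists t0, forall t, t0 <= t -> `|h (t + u) - h t| <= ep.
  move=> ep0; have [x0 x00 hx] := slow_ratio (expR_gt0 u) ep0.
  exists x0 => t tx; rewrite /h expRD mulrC.
  have : x0 <= expR t by apply: le_trans tx _; apply: le_trans (expR_ge1Dx t); rewrite lerDr.
  by move=> /hx[].
have [t0 ht0] := slow_unif mh hs.
exists (Num.max x1 (expR t0)); first by rewrite lt_max x10.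
move=> x la; rewrite ge_max => /andP[hx1 hx2] /andP[la1 la2].
have x0 : 0 < x by exact: lt_le_trans hx1.
have la0 : 0 < la by exact: lt_le_trans la1.
have p1 := h1 x hx1; have p2 : 0 < L (la * x).
  by apply: h1; apply: le_trans hx1 _; rewrite ler_peMl // ltW.
have := ht0 (ln x) (ln la); rewrite /h expRD !lnK ?posrE // [x * la]mulrC => hl.
have {}hl : `|ln (L (la * x)) - ln (L x)| <= 1.
  apply: hl; first by rewrite -[t0]expRK ler_ln ?posrE ?expR_gt0.
  rewrite ln_ge0 //=; have -> : la = 1 + (la - 1) by rewrite addrC subrK.
  by apply: (le_trans (le_ln1Dx _)); lra.
split => //.
  rewrite -[leLHS]lnK ?posrE // -[in leRHS](lnK p1) -expRD ler_expR -lerBlDr.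
  by apply: le_trans hl; rewrite ler_norm.
rewrite -[leLHS]lnK ?posrE // -[in leRHS](lnK p2) -expRD ler_expR -lerBlDr.
by apply: le_trans hl; rewrite distrC ler_norm.
Qed.

Lemma slow_bounded_pow : exists2 x0 : R, 0 < x0 & forall k x la, x0 <= x -> 1 <= la <= 2 ^+ k ->
  [/\ 0 < L x, L (la * x) <= expR 1 ^+ k * L x & L x <= expR 1 ^+ k * L (la * x)].
Proof.
have [x0 x00 hx] := slow_bounded; exists x0 => //.
have M1 : 1 <= expR 1 :> R by rewrite -[leLHS]expR0 ler_expR.
elim=> [|k IH] x la xx /andP[la1 la2].
  have -> : la = 1 by apply/eqP; rewrite eq_le la1 andbT -[leRHS](expr0 2).
  by rewrite mul1r expr0 !mul1r; split => //; have [] := hx x 1 xx; rewrite ?lexx ?ler1n.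
have Mk : 1 <= expR 1 ^+ k :> R by rewrite exprn_ege1.
have [l2|l2] := leP la 2.
  have [p1 p2 p3] := hx x la xx ltac:(by rewrite la1).
  have q : 0 < L (la * x) by have := lt_le_trans p1 p3; rewrite pmulr_rgt0 ?expR_gt0.
  split => //; rewrite exprSr -mulrA.
    by apply: le_trans p2 _; rewrite ler_peMl // mulr_ge0 ?expR_ge0 // ltW.
  by apply: le_trans p3 _; rewrite ler_peMl // mulr_ge0 ?expR_ge0 // ltW.
have h1 : 1 <= la / 2 <= 2 ^+ k.
  rewrite ler_pdivlMr // mul1r (ltW l2) /= ler_pdivrMr // -exprSr //.
have [p1 p2 p3] := IH x (la / 2) xx h1.
have xx' : x0 <= la / 2 * x.
  by apply: (le_trans xx); rewrite ler_peMl //; [exact: le_trans (ltW x00) xx|case/andP: h1].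
have [q1 q2 q3] := hx (la / 2 * x) 2 xx' ltac:(by rewrite ler1n lexx).
have e : 2 * (la / 2 * x) = la * x by field.
rewrite e in q2 q3; rewrite exprS -!mulrA; split => //.
  by apply: le_trans q2 _; rewrite ler_wpM2l ?expR_ge0.
by apply: le_trans p3 _; rewrite mulrCA ler_wpM2l ?exprn_ge0 ?expR_ge0.
Qed.

(** Far enough, one doubling of the argument changes [L] by a factor at most [2^ep]; iterated
    halving brings [x] back to the first dyadic block, where [slow_bounded] applies. *)
Lemma slow_potter (ep : R) : 0 < ep -> exists x0 A D : R, [/\ 0 < x0, 0 < A, 0 < D &
  forall x, x0 <= x -> L x <= A * x `^ ep /\ D * x `^ (- ep) <= L x].
Proof.
move=> ep0; have [x1 x10 h1] := slow_bounded.
have e2 : 0 < ep * ln 2 by rewrite mulr_gt0 // ln_gt0 // ltr1n.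
have [x2 x20 h2] := slow_ratio (ltr0n R 2) e2.
pose x0 := Num.max x1 x2; have x00 : 0 < x0 by rewrite lt_max x10.
have x0x1 : x1 <= x0 by rewrite le_max lexx.
have x0x2 : x2 <= x0 by rewrite le_max lexx orbT.
have e2p : expR (ep * ln 2) = 2 `^ ep by rewrite /powR pnatr_eq0.
have Lx0 : 0 < L x0 by have [] := h1 x0 1 x0x1 ltac:(by rewrite lexx ler1n).
pose A := expR 1 * L x0 * x0 `^ (- ep); pose D := L x0 * x0 `^ ep / expR 1.
have A0 : 0 < A by rewrite !mulr_gt0 ?expR_gt0 ?powR_gt0.
have D0 : 0 < D by rewrite !mulr_gt0 ?invr_gt0 ?expR_gt0 ?powR_gt0.
exists x0, A, D; split => // x xx.
have [k hk] : exists k : nat, x <= 2 ^+ k * x0.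
  exists (Num.truncn (x / x0)).+1; rewrite -ler_pdivrMr //.
  apply: le_trans (ltW (truncnS_gt _)) _; rewrite -natrX ler_nat.
  exact: ltnW (ltn_expl _ _).
elim: k x xx hk => [|k IH] x xx hk.
  have -> : x = x0 by apply/eqP; rewrite eq_le xx andbT -[leRHS]mul1r -[in leRHS](expr0 2).
  have M1 : 1 <= expR 1 :> R by rewrite -[leLHS]expR0 ler_expR.
  have x00' := gt_eqF (powR_gt0 ep x00).
  rewrite /A /D powRN -!mulrA mulVf ?x00' // mulr1 mulrCA [_ * (_ `^ _)^-1]mulrC mulrCA mulrA.
  rewrite ler_peMl ?(ltW Lx0) //; split => //.
  by rewrite mulrA mulfK ?x00' // ler_piMr ?(ltW Lx0) // invf_le1 ?expR_gt0.
have x0' : 0 < x by exact: lt_le_trans xx.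
have [h|h] := leP x (2 * x0).
  have hla : 1 <= x / x0 <= 2 by rewrite ler_pdivlMr // mul1r xx ler_pdivrMr.
  have [_] := h1 x0 (x / x0) x0x1 hla; rewrite divfK ?gt_eqF // => p1 p2.
  have hp : 1 <= x `^ ep / x0 `^ ep.
    rewrite ler_pdivlMr ?powR_gt0 // mul1r.
    by apply: ge0_ler_powR; rewrite ?nnegrE ?(ltW ep0) ?(ltW x00) ?(ltW x0').
  split.
    apply: le_trans p1 _; rewrite /A -mulrA powRN [_^-1 * _]mulrC ler_peMr //.
    by rewrite mulr_ge0 ?expR_ge0 // ltW.
  rewrite /D powRN ler_pdivrMr ?powR_gt0 // ler_pdivrMr ?expR_gt0 // [leRHS]mulrAC.
  apply: ler_pM; [exact: ltW|exact: powR_ge0|by rewrite mulrC|].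
  by move: hp; rewrite ler_pdivlMr ?powR_gt0 // mul1r.
have y0 : x0 <= x / 2 by rewrite ler_pdivlMr // mulrC ltW.
have yk : x / 2 <= 2 ^+ k * x0 by rewrite ler_pdivrMr // mulrAC -exprSr.
have [q1 q2] := IH _ y0 yk.
have xh : 2 * (x / 2) = x by field.
have := h2 (x / 2) (le_trans x0x2 y0); rewrite xh e2p => -[_ _ _ p1 p2].
have xe (r : R) : x `^ r = 2 `^ r * (x / 2) `^ r.
  by rewrite -powRM ?divr_ge0 ?(ltW x0') // mulrC divfK.
split.
  by apply: le_trans p1 _; rewrite xe mulrCA ler_wpM2l ?powR_ge0.
rewrite xe mulrCA powRN mulrC ler_pdivrMr ?powR_gt0 // [leRHS]mulrC.
exact: le_trans q2 p2.
Qed.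
End SlowVariation.

Section NonnegSeries.
Variable R : realType.

(** A mean value bound derived from [ln ((a + 1) / a) >= 1 / (a + 1)]; it makes the sums of
    [sum_powR_le] telescope. *)
Lemma powR_step (ga a : R) : 0 < ga -> 0 < a ->
  ga * (a + 1) `^ (- (1 + ga)) <= a `^ (- ga) - (a + 1) `^ (- ga).
Proof.
move=> g0 a0; have b0 : 0 < a + 1 by rewrite addr_gt0.
have b1 : (a + 1) `^ (- (1 + ga)) = (a + 1) `^ (- ga) / (a + 1).
  rewrite opprD powRD; last by rewrite (gt_eqF b0) implybT.
  by rewrite powR_inv1 ?(ltW b0) // mulrC.
have -> : a `^ (- ga) = (a + 1) `^ (- ga) * ((a + 1) / a) `^ ga.
  rewrite powRM ?invr_ge0 ?(ltW a0) ?(ltW b0) // mulrA [(a + 1) `^ (- ga)]powRN mulVf ?gt_eqF ?powR_gt0 // mul1r.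
  by rewrite -powR_inv1 ?(ltW a0) // -powRrM mulN1r.
rewrite b1 -[X in _ - X]mulr1 -mulrBr mulrCA ler_wpM2l ?powR_ge0 //.
have ab : 0 < (a + 1) / a by rewrite divr_gt0.
rewrite lerBrDr addrC /powR (gt_eqF ab); apply: le_trans (expR_ge1Dx _); rewrite lerD2l ler_wpM2l ?(ltW g0) //.
rewrite -[((a + 1) / a)]invrK lnV ?posrE ?invr_gt0 // invf_div lerNr.
have -> : a / (a + 1) = 1 + - (a + 1)^-1 by field; rewrite gt_eqF.
apply: le_ln1Dx; rewrite ltrN2 invf_lt1 // ltrDr //.
Qed.

Lemma sum_powR_le (ga : R) n : 0 < ga -> \sum_(i < n) i.+1%:R `^ (- (1 + ga)) <= 1 + ga^-1.
Proof.
move=> g0; case: n => [|n]; first by rewrite big_ord0 addr_ge0 // invr_ge0 ltW.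
suff : \sum_(i < n.+1) i.+1%:R `^ (- (1 + ga)) <= 1 + (1 - n.+1%:R `^ (- ga)) / ga.
  by move=> /le_trans; apply; rewrite lerD2l ler_pdivrMr // mulVf ?gt_eqF // gerBl powR_ge0.
elim: n => [|n IH]; first by rewrite big_ord1 !powR1 subrr mul0r addr0.
rewrite big_ord_recr /=; apply: le_trans (lerD IH (lexx _)) _.
rewrite -addrA lerD2l -lerBrDl -mulrBl ler_pdivlMr // mulrC.
have := @powR_step ga n.+1%:R g0 (ltr0Sn _ _); rewrite natr1 => /le_trans; apply.
by move: (_ `^ _) (_ `^ _) => x y; lra.
Qed.

Lemma seriesE (a : nat -> R) n : series a n = \sum_(i < n) a i.
Proof. by rewrite /series /= big_mkord. Qed.

Section Bounded.
Variables (a : nat -> R) (M : R).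
Hypotheses (a0 : forall i, 0 <= a i) (aM : forall n, \sum_(i < n) a i <= M).

Lemma nnseries_nd : {homo series a : n m / (n <= m)%N >-> n <= m}.
Proof. by apply/nondecreasing_seqP => n; rewrite !seriesE big_ord_recr /= lerDl. Qed.

Lemma nnseries_cvg : cvgn (series a).
Proof.
apply: nondecreasing_is_cvgn; first exact: nnseries_nd.
by exists M => _ [n _ <-]; rewrite seriesE.
Qed.

Lemma nnseries_le n : \sum_(i < n) a i <= limn (series a).
Proof. by rewrite -seriesE; apply: nondecreasing_cvgn_le; [exact: nnseries_nd|exact: nnseries_cvg]. Qed.

Lemma nnseries_lim_le : limn (series a) <= M.
Proof. by apply: limr_le; [exact: nnseries_cvg|apply: nearW => n; rewrite seriesE]. Qed.

Lemma nnseries_near (ep : R) : 0 < ep -> \forall n \near \oo, limn (series a) - ep <= \sum_(i < n) a i.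
Proof.
move=> e0; have /cvgrPdist_le/(_ ep e0) := nnseries_cvg.
by apply: filterS => n; rewrite seriesE lerBlDr -lerBlDl => /(le_trans (ler_norm _)).
Qed.
End Bounded.

Lemma one_minus_pow (x : R) n : 0 <= x -> x <= 1 -> 1 - n%:R * x <= (1 - x) ^+ n.
Proof.
move=> x0 x1; elim: n => [|n IH]; first by rewrite mul0r subr0.
rewrite exprS; apply: le_trans (ler_wpM2l _ IH); rewrite ?subr_ge0 // -natr1.
have : 0 <= n%:R * x * x by rewrite !mulr_ge0.
by move: (n%:R) => y; clear; nra.
Qed.

(** Finitely many terms carry the sum up to [ep / 2], and on them [t^i >= 1 - N (1 - t)] by
    Bernoulli's inequality. *)
Lemma abel_limit (a : nat -> R) (M : R) : (forall i, 0 <= a i) -> (forall n, \sum_(i < n) a i <= M) ->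
  limn (series (fun i => a i * t ^+ i)) @[t --> (1 : R)^'-] --> limn (series a).
Proof.
move=> a0 aM; set s := limn (series a).
have s0 : 0 <= s by have := nnseries_le a0 aM 0; rewrite big_ord0.
apply/cvgrPdist_le => ep ep0.
have ep2 : 0 < ep / 2 by rewrite divr_gt0.
have [N _ hN] := nnseries_near a0 aM ep2; have {}hN := hN N (leqnn N).
pose de := ep / 2 / (N%:R * s + 1).
have Ns0 : 0 < N%:R * s + 1 by rewrite ltr_wpDl // mulr_ge0.
have de0 : 0 < de by rewrite divr_gt0.
near=> t.
have t1 : t < 1 by near: t; exact: nbhs_left_lt.
have t0 : 0 < t by near: t; exact: nbhs_left_gt.
have td : 1 - de < t by near: t; apply: nbhs_left_gt; rewrite ltrBlDr ltrDl.
have b0 i : 0 <= a i * t ^+ i by rewrite mulr_ge0 // exprn_ge0 // ltW.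
have bs n : \sum_(i < n) a i * t ^+ i <= s.
  apply: le_trans (nnseries_le a0 aM n); apply: ler_sum => i _.
  by rewrite ler_piMr // exprn_ile1 // ltW.
have hi := nnseries_lim_le b0 bs; have lo := nnseries_le b0 bs N.
rewrite ger0_norm ?subr_ge0 // lerBlDr -lerBlDl; apply: le_trans lo.
have x0 : 0 <= 1 - t by rewrite subr_ge0 ltW.
have x1 : 1 - t <= 1 by rewrite gerBl ltW.
apply: (@le_trans _ _ ((1 - N%:R * (1 - t)) * \sum_(i < N) a i)); last first.
  rewrite mulr_sumr; apply: ler_sum => i _; rewrite mulrC ler_wpM2l //.
  apply: (@le_trans _ _ (t ^+ N)); last by rewrite ler_wiXn2l ?(ltW t0) ?(ltW t1) // ltnW.
  by have := one_minus_pow N x0 x1; rewrite subKr.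
have h1 := nnseries_le a0 aM N; rewrite -/s in h1.
have h2 : N%:R * (1 - t) * s <= ep / 2.
  apply: (@le_trans _ _ (N%:R * s * de)).
    rewrite mulrAC ler_wpM2l ?mulr_ge0 //; move: td; lra.
  rewrite /de mulrA ler_pdivrMr // mulrC ler_wpM2l ?(ltW ep2) // lerDl //.
have h3 : N%:R * (1 - t) * \sum_(i < N) a i <= N%:R * (1 - t) * s by rewrite ler_wpM2l ?mulr_ge0.
rewrite mulrBl mul1r; move: hN h1 h2 h3; rewrite -/s.
move: (N%:R * (1 - t) * s) (N%:R * (1 - t) * _) (\sum_(i < N) a i) => x y z; clear; lra.
Unshelve. all: by end_near. Qed.
End NonnegSeries.

(** * Regularly varying weights satisfy the big-jump hypotheses *)

Section RegularWeights.
Variables (R : realType) (w : nat -> R) (k beta : R) (L : R -> R).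
Hypotheses (wge0 : forall i, 0 <= w i) (w0 : w 0%N = 1).
Hypotheses (hk : is_kappa w k) (k1 : k < 1) (b2 : 2 < beta) (hL : slowly_varying L).
Hypothesis wE : forall i, (0 < i)%N -> w i = L i%:R * (i%:R `^ (- beta)).

Lemma regular_ratio (eta : R) : 0 < eta -> exists2 C : R, 0 < C &
  \forall n \near \oo, forall j, eta * n%:R <= j%:R -> (j <= n)%N -> w j <= C * w n /\ w n <= C * w j.
Proof.
move=> eta0; have [x0 x00 hx] := slow_bounded_pow hL.
pose p := (Num.truncn eta^-1).+1; pose E := expR 1 ^+ p : R.
have hp : eta^-1 <= 2 ^+ p.
  apply: le_trans (ltW (truncnS_gt _)) _; rewrite -natrX ler_nat.
  exact: ltnW (ltn_expl _ _).
have E0 : 0 < E by rewrite exprn_gt0 ?expR_gt0.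
exists (E * (eta `^ (- beta) + 1)); first by rewrite mulr_gt0 // ltr_wpDl ?powR_ge0.
near=> n => j hj jn.
have hn : x0 / eta <= n%:R by near: n; exact: nbhs_infty_ger.
have n0 : 0 < n%:R :> R by apply: lt_le_trans hn; rewrite divr_gt0.
have j0 : 0 < j%:R :> R by apply: lt_le_trans hj; rewrite mulr_gt0.
have xj : x0 <= j%:R by apply: le_trans hj; rewrite mulrC -ler_pdivrMr.
have hla : 1 <= (n%:R / j%:R : R) <= 2 ^+ p.
  rewrite ler_pdivlMr // mul1r ler_nat jn /=; apply: le_trans hp.
  by rewrite ler_pdivrMr // mulrC ler_pdivlMr // mulrC.
have [Lj q1 q2] := hx p j%:R _ xj hla; rewrite divfK ?gt_eqF // -/E in q1 q2.
have Ln : 0 < L n%:R by have := lt_le_trans Lj q2; rewrite pmulr_rgt0.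
rewrite !wE -?(ltr0n R) //.
have be0 : 0 <= beta by apply: le_trans (ltW b2).
have pj : n%:R `^ (- beta) <= j%:R `^ (- beta) :> R.
  rewrite !powRN lef_pV2 ?posrE ?powR_gt0 //.
  by apply: ge0_ler_powR; rewrite ?nnegrE ?ler_nat // ltW.
have pn : j%:R `^ (- beta) <= eta `^ (- beta) * n%:R `^ (- beta) :> R.
  rewrite -powRM ?(ltW eta0) ?(ltW n0) // !powRN lef_pV2 ?posrE ?powR_gt0 ?mulr_gt0 //.
  by apply: ge0_ler_powR; rewrite ?nnegrE ?(ltW j0) // mulr_ge0 ?ltW.
split.
  apply: (@le_trans _ _ (E * L n%:R * (eta `^ (- beta) * n%:R `^ (- beta)))).
    by apply: ler_pM; rewrite ?powR_ge0 ?(ltW Lj).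
  rewrite [leRHS]mulrACA ler_wpM2l ?mulr_ge0 ?(ltW E0) ?(ltW Ln) //.
  by rewrite ler_wpM2r ?powR_ge0 // lerDl.
apply: (@le_trans _ _ (E * L j%:R * j%:R `^ (- beta))).
  by apply: ler_pM; rewrite ?powR_ge0 ?(ltW Ln).
rewrite -!mulrA ler_wpM2l ?(ltW E0) // ler_peMl ?mulr_ge0 ?powR_ge0 ?(ltW Lj) //.
by rewrite lerDr powR_ge0.
Unshelve. all: by end_near. Qed.

(** With Potter exponent [g] and moment order at most [1 + g], the terms [i^(1 + e0) * w i] are of
    order at most [i^(-(1 + 2 g))], hence summable. The cap of [e0] at 1 is the one required by
    [expRN_le_mgf]. *)
Let g := (beta - 2) / 4.
Let e0 := Num.min 1 g.

Lemma g_gt0 : 0 < g. Proof. by rewrite divr_gt0 // subr_gt0. Qed.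

Lemma e0_gt0 : 0 < e0. Proof. by rewrite lt_min ltr01 g_gt0. Qed.

Lemma regular_moment : exists2 S : R, 0 < S &
  forall n, \sum_(i < n) i%:R `^ (1 + e0) * w i <= S.
Proof.
have [x0 [A [D [x00 A0 D0 hx]]]] := slow_potter hL g_gt0.
pose N0 := (Num.truncn x0).+1; pose tm i := i%:R `^ (1 + e0) * w i : R.
have tm0 i : 0 <= tm i by rewrite mulr_ge0 ?powR_ge0.
have g2 : 0 < 2 * g by rewrite mulr_gt0 // g_gt0.
exists (\sum_(i < N0) tm i + A * (1 + (2 * g)^-1) + 1).
  rewrite ltr_wpDl ?ltr01 // addr_ge0 ?sumr_ge0 // mulr_ge0 ?addr_ge0 ?invr_ge0 ?(ltW g2) ?(ltW A0) //.
move=> n; pose G i := if (i < N0)%N then tm i else 0.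
have big i : (N0 <= i)%N -> tm i <= A * i%:R `^ (- (1 + 2 * g)).
  move=> Ni; have i0 : (0 < i)%N by exact: leq_trans Ni.
  have iR : 0 < i%:R :> R by rewrite ltr0n.
  have xi : x0 <= i%:R by apply: le_trans (ltW (truncnS_gt _)) _; rewrite ler_nat.
  rewrite /tm wE // mulrCA mulrC; have [h _] := hx _ xi.
  apply: (@le_trans _ _ (A * i%:R `^ g * (i%:R `^ (1 + e0) * i%:R `^ (- beta)))).
    by rewrite mulrC ler_wpM2r ?mulr_ge0 ?powR_ge0.
  rewrite -mulrA ler_wpM2l ?(ltW A0) // -!powRD; try by rewrite (gt_eqF iR) implybT.
  apply: ler_powR; first by rewrite ler1n.
  have : e0 <= g by rewrite ge_min lexx orbT.
  rewrite /g; move: b2; lra.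
apply: (@le_trans _ _ (\sum_(i < n) (G i + A * i%:R `^ (- (1 + 2 * g)) * (0 < i)%N%:R))).
  apply: ler_sum => i _; rewrite -/(tm i) /G; case: ifP => [_|/negbT].
    by rewrite lerDl !mulr_ge0 ?powR_ge0 // ltW.
  rewrite -leqNgt add0r => Ni; rewrite (leq_trans _ Ni) // mulr1; exact: big.
rewrite big_split /= -addrA; apply: lerD.
  have -> : \sum_(i < N0) tm i = \sum_(i < maxn n N0) G i.
    by rewrite (big_ord_widen (maxn n N0) tm) ?leq_maxr // big_mkcond.
  rewrite (big_ord_widen (maxn n N0) G) ?leq_maxl // big_mkcond.
  by apply: ler_sum => i _; case: ifP => // _; rewrite /G; case: ifP.
apply: (@le_trans _ _ (A * (1 + (2 * g)^-1))); last by rewrite lerDl.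
case: n => [|n]; first by rewrite big_ord0 mulr_ge0 ?addr_ge0 ?invr_ge0 ?(ltW g2) ?(ltW A0).
rewrite big_ord_recl mulr0 add0r.
under eq_bigr do rewrite lift0 mulr1.
by rewrite -mulr_sumr ler_wpM2l ?(ltW A0) // sum_powR_le.
Qed.

Lemma regular_lower : exists2 c : R, 0 < c & \forall n \near \oo, c * n%:R `^ (- (g + beta)) <= w n.
Proof.
have [x0 [A [D [x00 A0 D0 hx]]]] := slow_potter hL g_gt0.
exists D => //; near=> n; have xn : x0 <= n%:R by near: n; exact: nbhs_infty_ger.
have n0 : 0 < n%:R :> R by exact: lt_le_trans xn.
rewrite wE -?(ltr0n R) // opprD powRD; last by rewrite (gt_eqF n0) implybT.
by rewrite mulrA ler_wpM2r ?powR_ge0 //; have [] := hx _ xn.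
Unshelve. all: by end_near. Qed.

Lemma mass_bound : exists M, forall n, \sum_(i < n) w i <= M.
Proof.
have [S S0 hS] := regular_moment; exists (1 + S) => n; case: n => [|n].
  by rewrite big_ord0 addr_ge0 // ltW.
rewrite big_ord_recl w0 lerD2l; apply: le_trans (hS n.+1); rewrite big_ord_recl.
rewrite ler_wpDl ?mulr_ge0 ?powR_ge0 //; apply: ler_sum => i _.
by rewrite lift0 ler_peMl // powR_ge1 ?ler1n // addr_ge0 // ltW // e0_gt0.
Qed.

Lemma mean_bound : exists M, forall n, \sum_(i < n) i%:R * w i <= M.
Proof.
have [S S0 hS] := regular_moment; exists S => n; apply: le_trans (hS n); apply: ler_sum => i _.
case: (posnP i) => [->|i0]; first by rewrite mul0r mulr_ge0 ?powR_ge0.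
rewrite ler_wpM2r // -[leLHS]powRr1 //; apply: ler_powR; first by rewrite ler1n.
by rewrite lerDl ltW // e0_gt0.
Qed.

Let rho := limn (series w).
Let mean := limn (series (fun i => i%:R * w i)).

(** The weights are summable but decay only polynomially. The limit defining [kappa] is therefore
    taken at 1, where the series still converges. *)
Lemma regular_radius : radius w = 1%E.
Proof.
have [M hM] := mass_bound; apply/eqP; rewrite eq_le; apply/andP; split; last first.
  apply: ereal_sup_ubound; exists 1 => //; split; first exact: ler01.
  by under eq_fun do rewrite expr1n mulr1; exact: nnseries_cvg wge0 hM.
apply: ge_ereal_sup => _ [x [x0 cx] <-]; rewrite lee_fin leNgt; apply/negP => x1.
have xp : 0 < x by exact: lt_trans x1.
have lx : 0 < ln x by rewrite ln_gt0.
have [c c0 hc] := regular_lower; set B := g + beta in hc.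
have B0 : 0 < B by rewrite addr_gt0 ?g_gt0 // (lt_trans _ b2).
have /cvgr0_norm_lt /(_ 1 ltr01) h := cvg_series_cvg_0 cx.
have h2 : 0 < 2^-1 :> R by rewrite invr_gt0.
near \oo => n.
have : `|w n * x ^+ n| < 1 by near: n.
have hw : c * n%:R `^ (- B) <= w n by near: n.
have n0 : (0 < n)%N by near: n; exists 1%N.
have nR : 0 < n%:R :> R by rewrite ltr0n.
have e1 : n%:R `^ (- 2^-1) <= ln x / (4 * B).
  by near: n; apply: near_powRN => //; rewrite divr_gt0 // mulr_gt0.
have e2 : - ln c <= n%:R * (ln x / 2).
  by rewrite -ler_pdivrMr ?divr_gt0 //; near: n; exact: nbhs_infty_ger.
rewrite ger0_norm ?mulr_ge0 ?exprn_ge0 ?(ltW xp) // ltNge => /negP; apply.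
apply: le_trans (ler_wpM2r (exprn_ge0 _ (ltW xp)) hw).
have -> : x ^+ n = expR (n%:R * ln x) by rewrite expRM_natl lnK.
rewrite /powR (gt_eqF nR) -[c]lnK ?posrE // -!expRD -[leLHS]expR0 ler_expR.
have l1 : ln n%:R <= 2 * n%:R `^ 2^-1 :> R.
  by have := ln_le_powR h2 nR; rewrite invrK mulrC.
have l2 : n%:R `^ 2^-1 <= n%:R * (ln x / (4 * B)).
  rewrite -ler_pdivrMl // mulrC -[X in _ / X]powRr1 // -powRN -powRD; last by rewrite (gt_eqF nR) implybT.
  by rewrite (_ : 2^-1 + - 1 = - 2^-1) //; field.
have l3 : B * ln n%:R <= n%:R * (ln x / 2).
  apply: (@le_trans _ _ (B * (2 * (n%:R * (ln x / (4 * B)))))).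
    rewrite ler_wpM2l ?(ltW B0) //; apply: le_trans l1 _; by rewrite ler_wpM2l.
  by rewrite le_eqVlt; apply/orP; left; apply/eqP; field; rewrite gt_eqF.
have -> : n%:R * ln x = n%:R * (ln x / 2) + n%:R * (ln x / 2) by field.
by move: l3 e2; rewrite mulNr; move: (B * _) (n%:R * (_ / 2)) (ln c) => y1 y2 y3; lra.
Unshelve. all: by end_near. Qed.

Lemma rho_gt0 : 0 < rho.
Proof.
have [M hM] := mass_bound; have := nnseries_le wge0 hM 1; rewrite big_ord1 w0.
exact: lt_le_trans.
Qed.

(** Abel's theorem for [g] and for its derivative identifies [kappa] with the mean of the law
    proportional to the weights. *)
Lemma regular_kappa : mean = k * rho.
Proof.
have [M hM] := mass_bound; have [M' hM'] := mean_bound.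
have iw0 i : 0 <= i%:R * w i by rewrite mulr_ge0.
have sw0 i : 0 <= i.+1%:R * w i.+1 by rewrite mulr_ge0.
have shift n : \sum_(i < n.+1) i%:R * w i = \sum_(i < n) i.+1%:R * w i.+1.
  by rewrite big_ord_recl mul0r add0r; apply: eq_bigr => i _; rewrite lift0.
have hS n : \sum_(i < n) i.+1%:R * w i.+1 <= M' by rewrite -shift.
have mE : limn (series (fun i => i.+1%:R * w i.+1)) = mean.
  apply/cvg_lim => //; have := nnseries_cvg iw0 hM'; rewrite -/mean -cvg_shiftS.
  by under eq_fun do rewrite seriesE shift -(seriesE (fun i => i.+1%:R * w i.+1)).
have c1 := abel_limit wge0 hM; have c2 := abel_limit sw0 hS; rewrite mE in c2.
have c3 : t * gen_fun' w t / gen_fun w t @[t --> (1 : R)^'-] --> mean / rho.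
  rewrite -[mean]mul1r; apply: cvgM; last first.
    by apply: cvgV => //; rewrite gt_eqF // rho_gt0.
  by apply: cvgM => //; apply: cvg_at_left_filter; exact: cvg_id.
have kE : k = mean / rho.
  case: hk => [[e _]|[[r [e [_ hr]]]|[e _]]].
  - by move: e; rewrite regular_radius => -[] /eqP; rewrite oner_eq0.
  - move: e; rewrite regular_radius => -[] e; rewrite -e in hr.
    exact: cvg_unique hr c3.
  - by move: e; rewrite regular_radius.
by rewrite kE divfK // gt_eqF // rho_gt0.
Qed.

Lemma regular_condensed : 0 <= k /\ condensed w k.
Proof.
have [M hM] := mass_bound; have [M' hM'] := mean_bound.
have iw0 i : 0 <= i%:R * w i by rewrite mulr_ge0.
have k0 : 0 <= k.
  have := nnseries_le iw0 hM' 0; rewrite big_ord0 -/mean regular_kappa pmulr_lge0 //.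
  exact: rho_gt0.
split => //; have [S S0 hS] := regular_moment; have [c c0 hc] := regular_lower.
have B0 : 0 < g + beta by rewrite addr_gt0 ?g_gt0 // (lt_trans _ b2).
apply: (@bigjump_condensed R w rho k e0 S (g + beta) c) => //.
- exact: e0_gt0.
- by rewrite ge_min lexx.
- exact: rho_gt0.
- exact: nnseries_le wge0 hM.
- exact: nnseries_near wge0 hM.
- by move=> n; rewrite -regular_kappa; exact: nnseries_le iw0 hM' n.
- by move=> ep; rewrite -regular_kappa; exact: nnseries_near iw0 hM' ep.
- exact: regular_ratio.
Qed.
End RegularWeights.

Lemma weights_condensed (R : realType) (w : nat -> R) (k : R) :
  (forall i, 0 <= w i) -> w 0%N = 1 -> is_kappa w k -> condA1 w k \/ condA2 w ->
  [/\ 0 <= k, k < 1 & condensed w k].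
Proof.
move=> wge0 w0 hk [[[beta [L [b2 [hL wE]]]] k1]|[al [al0 hw]]].
  by have [] := regular_condensed wge0 w0 hk k1 b2 hL wE.
by rewrite (factw_kappa al0 hw hk); split => //; exact: factw_condensed al0 hw.
Qed.

(** * The trimmed mobile *)

Section ShiftInvariance.
Variable R : realType.

Lemma bdg_succ_shift (a : int) L i : (i < size L)%N ->
  bdg_succ [seq x + a | x <- L] i = bdg_succ L i.
Proof.
move=> iL; rewrite /bdg_succ size_map; have m0 : (0 < size L)%N by exact: leq_ltn_trans iL.
set cand := [seq ((i + _) %% _)%N | _ <- _].
have cP j : j \in cand -> (nth 0 [seq x + a | x <- L] j == nth 0 [seq x + a | x <- L] i - 1) =
    (nth 0 L j == nth 0 L i - 1).
  move=> /mapP[k _ ->]; rewrite !(nth_map 0) ?ltn_mod // addrAC.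
  by rewrite (inj_eq (addIr a)).
by rewrite (eq_in_has cP) (eq_in_find cP).
Qed.

Lemma bdg_dist_shift (a : int) L u v : bdg_dist [seq x + a | x <- L] u v = bdg_dist L u v.
Proof.
have adj x y : bdg_adj [seq x + a | x <- L] x y = bdg_adj L x y.
  rewrite /bdg_adj size_map; apply: eq_in_has => i; rewrite mem_iota /= => iL.
  by rewrite bdg_succ_shift.
rewrite /bdg_dist size_map; apply: eq_find => k; elim: k v => // k IH v.
change (has (fun x => bdg_reach [seq x + a | x <- L] k u x && bdg_adj [seq x + a | x <- L] x v)
    (iota 0 (size [seq x + a | x <- L]).+1) =
  has (fun x => bdg_reach L k u x && bdg_adj L x v) (iota 0 (size L).+1)).
by rewrite size_map; apply: eq_has => x; rewrite IH adj.
Qed.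

Lemma bdg_space_shift (c : R) (a : int) L : bdg_space c [seq x + a | x <- L] = bdg_space c L.
Proof.
have h m1 m2 (d1 d2 : nat -> nat -> nat) : m1 = m2 -> (forall u v, d1 u v = d2 u v) ->
    @PMS R 'I_m1.+1 (fun u v => c * (d1 u v)%:R) ord_max =
    @PMS R 'I_m2.+1 (fun u v => c * (d2 u v)%:R) ord_max.
  move=> -> hd; congr (@PMS R _ _ _); apply/funext => u; apply/funext => v.
  by rewrite hd.
by apply: h; [rewrite size_map|exact: bdg_dist_shift].
Qed.
End ShiftInvariance.

Section PointedAverage.
Variables (R : realType) (F : pms R -> R).
Hypothesis cF : bounded_cont_GH F.

(** Applied to the constant functional, the identities for [F] become counts and provide the
    normalizations. *)
Lemma bounded_cont_cst : bounded_cont_GH (fun=> 1 : R).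
Proof.
split; first by exists 1 => A _; rewrite normr1.
by move=> A _ ep ep0; exists 1 => // B _ _; rewrite subrr normr0.
Qed.

Lemma card_pointed_pairs m : (0 < m)%N ->
  \sum_(v : m.*2.-tuple bool | dyck v) \sum_(k < m.*2 | (k == 0%N :> nat) || nth false v k.-1) (1 : R) = 'C(m.*2, m)%:R.
Proof.
move=> m0; rewrite -(@sum_rootpair m m0 R (fun _ _ => 1)).
by rewrite sumr_const card_balanced.
Qed.

Lemma sum_head_false m : (0 < m)%N ->
  2 * \sum_(w in balanced m | ~~ nth true w 0) (1 : R) = 'C(m.*2, m)%:R.
Proof.
move=> m0; rewrite -card_pointed_pairs //.
exact: (sum_bdg_pointed bounded_cont_cst m0 (lexx 0) 0).
Qed.

Lemma pavg_head_false m (c : R) : (0 < m)%N -> 0 <= c ->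
  \sum_(w in balanced m | ~~ nth true w 0) F (bdg_space c (wlabels w)) =
  pavg F m c * \sum_(w in balanced m | ~~ nth true w 0) 1.
Proof.
move=> m0 c0; apply: (@mulfI R 2) => //.
rewrite mulrCA sum_head_false // /pavg divfK; last by rewrite pnatr_eq0 -lt0n bin_gt0 -addnn leq_addr.
rewrite -(sum_bdg_pointed cF m0 c0 0); congr (_ * _); apply: eq_bigr => w _.
by rewrite bdg_space_shift.
Qed.

Lemma pavg_bnd (M : R) m c : (forall A, compact_pms A -> `|F A| <= M) -> `|pavg F m c| <= M.
Proof.
move=> FM; have M0 : 0 <= M.
  have [_ h] := stepf_codes 0 (fun=> 0 : R).
  by apply: le_trans (FM _ (h 0)).
have [->|m0] := posnP m.
  by rewrite /pavg big1 ?mul0r ?normr0 // => v _; rewrite big_ord0.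
rewrite /pavg normrM normfV ler_pdivrMr; last by rewrite normr_gt0 pnatr_eq0 -lt0n bin_gt0 -addnn leq_addr.
rewrite normr_nat -card_pointed_pairs // mulr_sumr.
apply: le_trans (ler_norm_sum _ _ _) _; apply: ler_sum => v _; rewrite mulr_sumr.
apply: le_trans (ler_norm_sum _ _ _) _; apply: ler_sum => k _; rewrite mulr1.
by apply: FM; have [_] := stepf_codes m.*2 (fun i => c * (hts v i)%:~R : R); apply.
Qed.
End PointedAverage.

Section LtreeCount.

(** An injection into a countable type: measurability of the point events then yields that of every
    event about the mobile. *)
Fixpoint lcode (t : ltree) : GenTree.tree int :=
  let: LNode l cs := t in
  GenTree.Node 0 (GenTree.Leaf l ::
    (fix F cs := match cs with [::] => [::] | c :: cs' => lcode c :: F cs' end) cs).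

Lemma lcodeE l cs : lcode (LNode l cs) = GenTree.Node 0 (GenTree.Leaf l :: map lcode cs).
Proof. by rewrite /=; congr (GenTree.Node _ (_ :: _)); elim: cs => //= c cs ->. Qed.

Lemma lcode_inj : injective lcode.
Proof.
move=> t; move: t; apply: (@ltree_forest_ind _ (fun cs => forall ds, map lcode cs = map lcode ds -> cs = ds)).
- by move=> l cs IH [l' ds]; rewrite !lcodeE => -[-> /IH ->].
- by case.
- by move=> c cs IHc IHcs [|d ds] //= [/IHc -> /IHcs ->].
Qed.

Lemma measurable_preimage_ltree (R : realType) (d : measure_display) (T : measurableType d)
  (X : T -> ltree) (A : set ltree) :
  (forall t, measurable [set om | X om = t]) -> measurable (X @^-1` A).
Proof.
move=> mX; pose E n := [set om | A (X om) /\ pickle (lcode (X om)) = n].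
have -> : X @^-1` A = \bigcup_n E n.
  by apply/seteqP; split => [om Aom|om [n _ []]//]; exists (pickle (lcode (X om))).
apply: bigcupT_measurable => n.
have [[t [At tn]]|nt] := pselect (exists t, A t /\ pickle (lcode t) = n).
  rewrite (_ : E n = [set om | X om = t]) //; apply/seteqP; split => om /=.
    by move=> [_ h]; apply: lcode_inj; apply: (pcan_inj pickleK); rewrite h.
  by move=> e; rewrite /E /= e.
rewrite (_ : E n = set0) //; apply/seteqP; split => // om [h1 h2]; apply: nt.
by exists (X om).
Qed.
End LtreeCount.

Section MobileLaw.
Variables (R : realType) (d : measure_display) (T : measurableType d) (P : probability T R).
Variables (w : nat -> R) (n : nat) (X : T -> ltree).
Hypotheses (n0 : (0 < n)%N) (law : random_mobile_law P w n X) (Tpos : 0 < Tcoef w n).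

Let mX : forall t, measurable [set om | X om = t]. Proof. by case: law. Qed.

Let mpre A : measurable (X @^-1` A). Proof. exact: (measurable_preimage_ltree R). Qed.

Let pr x : R := fine (P [set om | X om = x]).

Let prE x : P [set om | X om = x] = (pr x)%:E.
Proof. by rewrite fineK // fin_num_measure. Qed.

Lemma prob_mem S : uniq S -> P [set om | X om \in S] = (\sum_(x <- S) pr x)%:E.
Proof.
elim: S => [_|x S IH /= /andP[xS uS]].
  by rewrite big_nil (_ : [set _ | _] = set0) ?measure0 //; apply/seteqP; split.
rewrite big_cons EFinD -IH // -prE -measureU.
- congr (P _); apply/seteqP; split => om /=; rewrite inE.
    by move=> /orP[/eqP|]; [left|right].
  by move=> [->|->]; rewrite ?eqxx ?orbT.
- exact: mX.
- exact: (mpre [set y | y \in S]).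
- by apply/seteqP; split => // om [/= e h]; rewrite -e h in xS.
Qed.

Let good om := admissible (X om) /\ pnedges (shape (X om)) = n.

Let mgood : measurable [set om | good om].
Proof. exact: (mpre [set x | admissible x /\ pnedges (shape x) = n]). Qed.

Let Pbad : P (~` [set om | good om]) = 0%E.
Proof. by rewrite probability_setC // (proj1 (proj2 law)) subee. Qed.

Lemma prob_good A : measurable A -> P A = P (A `&` [set om | good om]).
Proof.
move=> mA; rewrite (measureDI P mA mgood) -[RHS]add0e; congr (_ + _)%E.
apply/eqP; rewrite eq_le measure_ge0 andbT -Pbad; apply: le_measure.
- by apply/mem_set; exact: measurableD.
- by apply/mem_set; exact: measurableC.
- by move=> om [].
Qed.

Lemma good_labelings t om : pnedges t = n ->
  (X om \in labelings false 0 t) <-> good om /\ shape (X om) = t.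
Proof.
move=> tn; rewrite mem_labelings /= /good /admissible; split.
  by move=> /and3P[/eqP st -> ->]; rewrite st.
by move=> [[/andP[-> ->] _] ->]; rewrite eqxx.
Qed.

Lemma prob_shape t : pnedges t = n ->
  P [set om | shape (X om) = t] = (\sum_(x <- labelings false 0 t) pr x)%:E.
Proof.
move=> tn; rewrite prob_good; last exact: (mpre [set x | shape x = t]).
rewrite -prob_mem ?uniq_labelings //; congr (P _); apply/seteqP; split => om /=.
  by move=> [h1 h2]; apply/good_labelings.
by move=> /(good_labelings _ tn)[].
Qed.

Let S := flatten [seq labelings false 0 t | t <- ptrees n].

Let SP om : (X om \in S) <-> good om.
Proof.
split=> [/flatten_mapP[t]|g]; first by rewrite mem_ptrees => /eqP tn /(good_labelings _ tn)[].
apply/flatten_mapP; exists (shape (X om)); first by rewrite mem_ptrees g.2.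
by apply/good_labelings; case: g.
Qed.

Let uS : uniq S.
Proof.
have hs t x : x \in labelings false 0 t -> shape x = t.
  by rewrite mem_labelings => /andP[/eqP].
rewrite /S; elim: (ptrees n) (uniq_ptrees n) => //= t s IH /andP[ts us].
rewrite cat_uniq uniq_labelings IH // andbT /=; apply/hasPn => x /flatten_mapP[t' t's].
by move=> /hs e'; apply/negP => /hs e; rewrite -e e' t's in ts.
Qed.

(** The unspecified constant of the law is found by summing over all shapes, the total mass being
    1. *)
Lemma prob_shapeE t : pnedges t = n ->
  \sum_(x <- labelings false 0 t) pr x = mobile_weight w t / Tcoef w n.
Proof.
have [_ [_ [[c hc] _]]] := law.
have h t' : pnedges t' = n -> \sum_(x <- labelings false 0 t') pr x = c * mobile_weight w t'.
  by move=> tn; apply: EFin_inj; rewrite -prob_shape // hc.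
suff ce : c = (Tcoef w n)^-1 by move=> tn; rewrite h // ce mulrC.
have tot : \sum_(x <- S) pr x = 1.
  apply: EFin_inj; rewrite -prob_mem // -(proj1 (proj2 law)); congr (P _).
  by apply/seteqP; split => om /= /SP.
move: tot; rewrite /S big_flatten big_map (eq_big_seq (fun t => c * mobile_weight w t)).
  rewrite -mulr_sumr sum_mobile_weight => e.
  by rewrite -[c]mulr1 -(@mulfV _ (Tcoef w n)) ?gt_eqF // mulrA e mul1r.
by move=> t'; rewrite mem_ptrees => /eqP /h.
Qed.

Variables (F : pms R -> R) (c : R).
Hypotheses (cF : bounded_cont_GH F) (c0 : 0 <= c).

Let G x := F (bdg_space c (star_labels x)).

Lemma sum_pr_star t : pnedges t = n ->
  \sum_(x <- labelings false 0 t) G x * pr x =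
  mobile_weight w t / Tcoef w n * pavg F (tdeg t) c.
Proof.
move=> tn; rewrite -prob_shapeE //; have [_ [_ [_ hu]]] := law.
have [x0 hp] : exists p, forall x, x \in labelings false 0 t -> pr x = p.
  case: (labelings false 0 t) (fun x => mem_labelings false 0 t x) => [_|x0 s hm]; first by exists 0.
  exists (pr x0) => x xs; congr (fine _).
  have := hm x; rewrite xs => /esym/and3P[/eqP s1 a1 l1].
  have := hm x0; rewrite mem_head => /esym/and3P[/eqP s2 a2 l2].
  by apply: hu; rewrite /admissible ?a1 ?a2 ?andbT // s1 s2.
have t0 : (0 < pnedges t)%N by rewrite tn.
(* Treating [F] and the constant 1 as one pair gives both sums with the same unknown multiplicity
   [N], which then disappears from the conditional average. *)
pose G2 (L : seq int) : (R * R)%type := (F (bdg_space c L), 1).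
have hG2 a L : G2 [seq x + a | x <- L] = G2 L by rewrite /G2 bdg_space_shift.
have [N hN] := sum_star_labels hG2 t0.
have m0 : (0 < tdeg t)%N by exact: pdegs_gt0 (tdeg_mem t0).
have e1 : \sum_(x <- labelings false 0 t) G x =
    (\sum_(w in balanced (tdeg t) | ~~ nth true w 0) F (bdg_space c (wlabels w))) *+ N.
  by have := congr1 fst hN; rewrite raddfMn !raddf_sum.
have e2 : \sum_(x <- labelings false 0 t) 1 =
    (\sum_(w in balanced (tdeg t) | ~~ nth true w 0) 1 : R) *+ N.
  by have := congr1 snd hN; rewrite raddfMn !raddf_sum.
rewrite (eq_big_seq (fun x => G x * x0)); last by move=> x /hp ->.
rewrite [in RHS](eq_big_seq (fun x => 1 * x0)); last by move=> x /hp ->; rewrite mul1r.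
rewrite -!mulr_suml e1 e2 pavg_head_false // -!mulrnAr.
by rewrite -mulrA mulrC.
Qed.

Lemma mobile_expectation :
  (\int[P]_om (F (bdg_space c (star_labels (X om))))%:E)%E =
  (\sum_(t <- ptrees n) mobile_weight w t / Tcoef w n * pavg F (tdeg t) c)%:E.
Proof.
have mf (f : ltree -> \bar R) : measurable_fun setT (fun om => f (X om)).
  by move=> _ B mB; rewrite setTI; exact: (mpre (f @^-1` B)).
(* Almost surely the mobile belongs to the finite list [S], so the integrand agrees almost
   everywhere with a simple function. *)
transitivity (\int[P]_om (\sum_(x <- S) (G x)%:E * (\1_[set om' | X om' = x] om)%:E))%E.
  apply: (@ae_eq_integral _ T R P setT) => //; first exact: (mf (fun x => (G x)%:E)).
    have -> : (fun om => (\sum_(x <- S) (G x)%:E * (\1_[set om' | X om' = x] om)%:E)%E) =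
       (fun om => (fun y => (\sum_(x <- S) (G x)%:E * (\1_[set y | y = x] y)%:E)%E) (X om)).
      by apply/funext => om; apply: eq_bigr => x _.
    exact: (mf (fun y => (\sum_(x <- S) (G x)%:E * (\1_[set y | y = x] y)%:E)%E)).
  exists (~` [set om | good om]); split => //; first exact: measurableC.
  move=> om /= h g; apply: h => _.
  have Xs : X om \in S by exact/SP.
  rewrite (bigD1_seq _ Xs uS) /= indicE mem_set // mule1 big1 ?adde0 // => x xX.
  rewrite indicE memNset ?mule0 //= => e; by rewrite e eqxx in xX.
have mI x : measurable_fun setT (\1_[set om' | X om' = x] : T -> R) by exact: measurable_indic.
rewrite (eq_integral (fun om => \sum_(x <- S) (G x * \1_[set om' | X om' = x] om)%:E)%E); last first.
  by move=> om _; apply: eq_bigr => x _; rewrite EFinM.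
rewrite integral_sum //; last first.
  move=> x; have PT : (P setT < +oo)%E by rewrite probability_setT ltry.
  apply: (@bounded_integrable _ T R P setT measurableT PT _ `|G x|).
    exact: measurable_funM.
  by move=> om _; rewrite normrM indicE; case: (_ \in _); rewrite ?normr1 ?normr0 ?mulr1 ?mulr0.
rewrite (eq_bigr (fun x => (G x * pr x)%:E)); last first.
  move=> x _; under eq_integral do rewrite EFinM.
  rewrite integralZl //; last first.
    have PT : (P setT < +oo)%E by rewrite probability_setT ltry.
    apply: (@bounded_integrable _ T R P setT measurableT PT _ 1) => //.
    by move=> om _; rewrite indicE; case: (_ \in _); rewrite ?normr1 ?normr0.
  by rewrite EFinM; congr (_ * _)%E; rewrite integral_indic // setIT; exact: prE.
rewrite sumEFin /S big_flatten big_map; congr (_%:E); apply: eq_big_seq => t.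
by rewrite mem_ptrees => /eqP; exact: sum_pr_star.
Qed.
End MobileLaw.

Lemma dist1_le_sqr (R : realType) (s de : R) : 0 <= s -> 0 <= de ->
  1 - de <= s ^+ 2 -> s ^+ 2 <= 1 + de -> `|s - 1| <= de.
Proof.
move=> s0 de0 r1 r2; have [s1|s1] := leP 1 s.
  by rewrite ger0_norm ?subr_ge0 //; nra.
by rewrite ltr0_norm ?subr_lt0 //; nra.
Qed.

Section Assembly.
Variables (R : realType) (w : nat -> R) (k : R).
Hypotheses (wge0 : forall i, 0 <= w i) (k1 : k < 1) (cw : condensed w k).
Variables (F : pms R -> R) (M E : R).
Hypotheses (FM : forall A, compact_pms A -> `|F A| <= M).
Hypothesis cE : forall eps : R, 0 < eps -> exists2 de : R, 0 < de & \forall m \near \oo,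
  forall c : R, 0 <= c -> `|c * Num.sqrt m.*2%:R - 1| <= de -> `|pavg F m c - E| <= eps.

Lemma mobile_weight_ge0 t : 0 <= mobile_weight w t.
Proof. by rewrite /mobile_weight pweight_pdegs prodr_ge0. Qed.

Lemma scale_near (de : R) m n : 0 < de -> (0 < n)%N ->
  (1 - k - de * (1 - k)) * n%:R <= m%:R -> m%:R <= (1 - k + de * (1 - k)) * n%:R ->
  `|(Num.sqrt (2 * (1 - k) * n%:R))^-1 * Num.sqrt m.*2%:R - 1| <= de.
Proof.
move=> de0 n0 h1 h2; have kp : 0 < 1 - k by rewrite subr_gt0.
have nR : 0 < n%:R :> R by rewrite ltr0n.
have kn : 0 < (1 - k) * n%:R by rewrite mulr_gt0.
pose r := m%:R / ((1 - k) * n%:R).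
have -> : (Num.sqrt (2 * (1 - k) * n%:R))^-1 * Num.sqrt m.*2%:R = Num.sqrt r.
  rewrite -sqrtrV; last by rewrite -mulrA mulr_ge0 // ltW.
  rewrite -sqrtrM ?invr_ge0; last by rewrite -mulrA mulr_ge0 // ltW.
  by congr Num.sqrt; rewrite /r -muln2 natrM; field; rewrite !gt_eqF.
have r0 : 0 <= r by rewrite divr_ge0 // ltW.
have r1 : 1 - de <= r by rewrite /r ler_pdivlMr // mulrA mulrBl mul1r.
have r2 : r <= 1 + de by rewrite /r ler_pdivrMr // mulrA mulrDl mul1r.
by apply: dist1_le_sqr; rewrite ?sqrtr_ge0 ?(ltW de0) ?sqr_sqrtr.
Qed.

(** Given the shape, the expectation is [pavg] at the maximal degree. Shapes whose degree is too
    small or too large have small total weight by condensation, and on the others [pavg] is close to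
    [E] uniformly. *)
Lemma mixture_cvg :
  (fun n => \sum_(t <- ptrees n) mobile_weight w t / Tcoef w n *
     pavg F (tdeg t) (Num.sqrt (2 * (1 - k) * n%:R))^-1) @ \oo --> E.
Proof.
have kp : 0 < 1 - k by rewrite subr_gt0.
have M0 : 0 <= M by apply: le_trans (pavg_bnd 0 0 FM).
have ME : 0 < M + `|E| + 1 by rewrite ltr_wpDl // addr_ge0.
apply/cvgrPdist_le => eps eps0.
have e3 : 0 < eps / 3 by rewrite divr_gt0.
have [de de0 [m0 _ hm0]] := cE e3.
(* The cap at one half keeps the degrees of the main range above [(1 - k) n / 2], hence beyond the
   threshold [m0]. *)
pose de1 := Num.min de 2^-1.
have d10 : 0 < de1 by rewrite lt_min de0 /=.
have d1d : de1 <= de by rewrite ge_min lexx.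
have d1h : de1 <= 2^-1 by rewrite ge_min lexx orbT.
pose de2 := de1 * (1 - k); have d20 : 0 < de2 by rewrite mulr_gt0.
have d21 : de2 < 1 - k.
  by rewrite /de2 -[ltRHS]mul1r ltr_pM2r //; apply: le_lt_trans d1h _; rewrite invf_lt1 // ltr1n.
have ep0 : 0 < eps / 3 / (M + `|E| + 1) by rewrite divr_gt0.
near=> n.
have [T0 T1 T2] : [/\ 0 < Tcoef w n,
    Tcoef (wtrunc w (Num.truncn ((1 - k - de2) * n%:R))) n <= eps / 3 / (M + `|E| + 1) * Tcoef w n &
    Tcoef w n - Tcoef (wtrunc w (Num.truncn ((1 - k + de2) * n%:R))) n <= eps / 3 / (M + `|E| + 1) * Tcoef w n].
  by near: n; exact: cw.
have n0 : (0 < n)%N by near: n; exists 1%N.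
have nm0 : m0%:R / ((1 - k) / 2) <= n%:R :> R by near: n; exact: nbhs_infty_ger.
set c := (Num.sqrt _)^-1; have c0 : 0 <= c by rewrite invr_ge0 sqrtr_ge0.
set K1 := Num.truncn _ in T1; set K2 := Num.truncn _ in T2.
pose q t := mobile_weight w t / Tcoef w n.
have q0 t : 0 <= q t by rewrite divr_ge0 ?mobile_weight_ge0 // ltW.
have qT (Q : pred ptree) : \sum_(t <- ptrees n | Q t) q t =
    (\sum_(t <- ptrees n | Q t) mobile_weight w t) / Tcoef w n by rewrite mulr_suml.
have q1 : \sum_(t <- ptrees n) q t = 1 by rewrite qT sum_mobile_weight divff ?gt_eqF.
have qK K : \sum_(t <- ptrees n | (tdeg t <= K)%N) q t = Tcoef (wtrunc w K) n / Tcoef w n.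
  rewrite qT -(sum_mobile_weight (wtrunc w K)); congr (_ / _); rewrite big_mkcond.
  by apply: eq_bigr => t _; rewrite mobile_weight_trunc.
have lowq : \sum_(t <- ptrees n | (tdeg t <= K1)%N) q t <= eps / 3 / (M + `|E| + 1).
  by rewrite qK ler_pdivrMr.
have highq : \sum_(t <- ptrees n | ~~ (tdeg t <= K2)%N) q t <= eps / 3 / (M + `|E| + 1).
  have e : \sum_(t <- ptrees n) q t = \sum_(t <- ptrees n | (tdeg t <= K2)%N) q t +
      \sum_(t <- ptrees n | ~~ (tdeg t <= K2)%N) q t by rewrite (bigID (fun t => (tdeg t <= K2)%N)).
  rewrite q1 qK in e.
  have -> : \sum_(t <- ptrees n | ~~ (tdeg t <= K2)%N) q t = 1 - Tcoef (wtrunc w K2) n / Tcoef w n.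
    by rewrite [in RHS]e addrAC subrr add0r.
  by rewrite -[X in X - _ <= _](@divff _ (Tcoef w n)) ?gt_eqF // -mulrBl ler_pdivrMr.
have dist t : `|E - pavg F (tdeg t) c| <= M + `|E| + 1.
  apply: le_trans (ler_normB _ _) _; rewrite addrC -addrA lerD ?pavg_bnd //.
  by rewrite lerDl.
have mid t : (K1 < tdeg t)%N -> (tdeg t <= K2)%N -> `|E - pavg F (tdeg t) c| <= eps / 3.
  move=> a1 a2; rewrite distrC.
  have b1 : (1 - k - de2) * n%:R <= (tdeg t)%:R.
    by apply: le_trans (ltW (truncnS_gt _)) _; rewrite ler_nat.
  have b2 : (tdeg t)%:R <= (1 - k + de2) * n%:R.
    rewrite -[leRHS]/((1 - k + de2) * n%:R); apply: le_trans (_ : K2%:R <= _); first by rewrite ler_nat.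
    by rewrite truncn_le mulr_ge0 // addr_ge0 // ltW.
  apply: hm0 => //; last by apply: le_trans d1d; apply: scale_near.
  rewrite /= -(ler_nat R); apply: le_trans b1; move: nm0; rewrite ler_pdivrMr ?divr_gt0 // mulrC => /le_trans; apply.
  rewrite ler_wpM2r // /de2; have := ler_wpM2r (ltW kp) d1h; lra.
rewrite -[E]mul1r -q1 mulr_suml -sumrB.
apply: le_trans (ler_norm_sum _ _ _) _.
apply: (@le_trans _ _ (\sum_(t <- ptrees n) ((q t * (M + `|E| + 1)) * (tdeg t <= K1)%N%:R +
   q t * (eps / 3) + (q t * (M + `|E| + 1)) * (~~ (tdeg t <= K2)%N)%:R))).
  apply: ler_sum => t _; rewrite -/(q t) -mulrBr normrM (ger0_norm (q0 t)).
  have qM : 0 <= q t * (M + `|E| + 1) by rewrite mulr_ge0 // ltW.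
  have qe : 0 <= q t * (eps / 3) by rewrite mulr_ge0 // ltW.
  case: (leqP (tdeg t) K1) => a1.
    rewrite mulr1 -addrA; apply: le_trans (ler_wpM2l (q0 t) (dist t)) _.
    by rewrite lerDl addr_ge0 // mulr_ge0.
  case: (leqP (tdeg t) K2) => a2.
    by rewrite !mulr0 add0r addr0 ler_wpM2l // mid.
  rewrite mulr1 mulr0 add0r; apply: le_trans (ler_wpM2l (q0 t) (dist t)) _.
  by rewrite lerDr.
rewrite !big_split /= -mulr_suml q1 mul1r.
have split3 (Q : pred ptree) : \sum_(t <- ptrees n) q t * (M + `|E| + 1) * (Q t)%:R =
    (\sum_(t <- ptrees n | Q t) q t) * (M + `|E| + 1).
  rewrite mulr_suml [RHS]big_mkcond; apply: eq_bigr => t _.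
  by case: (Q t); rewrite ?mulr1 ?mulr0.
have e3E : eps = eps / 3 + eps / 3 + eps / 3 by field.
by rewrite !split3 [leRHS]e3E !lerD // -ler_pdivlMr.
Unshelve. all: by end_near. Qed.
End Assembly.

Theorem mainTheorem13 (R : realType) (w : nat -> R) (kappa : R)
  (d : measure_display) (T : measurableType d) (P : probability T R)
  (theta : nat -> T -> ltree) (e : T -> R -> R) (N0 : nat) :
  (forall i, 0 <= w i) -> w 0%N = 1 ->
  is_kappa w kappa ->
  condA1 w kappa \/ condA2 w ->
  (forall n, (N0 <= n)%N -> random_mobile_law P w n (theta n)) ->
  is_std_excursion P e ->
  forall F : pms R -> R, bounded_cont_GH F ->
  (fun n : nat => (\int[P]_om
      (F (bdg_space (Num.sqrt (2 * (1 - kappa) * n%:R))^-1 (star_labels (theta n om))))%:E)%E)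
    @ \oo -->
  (\int[P]_om \int[@lebesgue_measure R]_(u in `[0%R, 1%R]) (F (tree_space (e om) u))%:E)%E.
Proof.
move=> wge0 w0 hk hA law he F cF.
have [k0 k1 cw] := weights_condensed wge0 w0 hk hA.
have [E -> cE] := pavg_cvg he cF; have [[M FM] _] := cF.
have cv := mixture_cvg wge0 k1 cw FM cE.
(* An arbitrary admissible deviation: condensation is called here only for the eventual positivity
   of [Tcoef w n]. *)
have d0 : 0 < (1 - kappa) / 2 by rewrite divr_gt0 // subr_gt0.
have d1 : (1 - kappa) / 2 < 1 - kappa.
  by rewrite ltr_pdivrMr // ltr_pMr ?subr_gt0 // ltr1n.
apply: cvg_trans (_ : (fun n => (\sum_(t <- ptrees n) mobile_weight w t / Tcoef w n *
     pavg F (tdeg t) (Num.sqrt (2 * (1 - kappa) * n%:R))^-1)%:E) @ \oo --> E%:E).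
  apply: near_eq_cvg; near=> n; apply/esym/mobile_expectation => //.
  - by near: n; exists 1%N.
  - by apply: law; near: n; exists N0.
  - by near: n; have := cw _ _ d0 d1 ltr01; apply: filterS => n [].
apply: cvg_EFin; first by apply: nearW.
exact: cv.
Unshelve. all: by end_near. Qed.
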